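(* Let $u \in \mathscr{S}'(\mathbb{R}^d)$, $m, s \in \mathbb{R}$ and $a \in G^m$. Then $$\mathrm{WF}_{Q^{s}}(u)\subseteq \bigcap_{m'\leq m}\Big(\mathrm{WF}_{Q^{s-m'}}(a^w(x,D)u) \cup \operatorname{char}_{m'}(a)\Big)$$ and $$\mathrm{WF}_{Q^{s}}(u)\subseteq \bigcap_{m'\leq m}\Big(\mathrm{WF}_{Q^{s-m'}}(A_a u) \cup \operatorname{char}_{m'}(a)\Big),$$ where the intersections are over all real $m' \le m$.
   Context: Notation: $\langle z\rangle = \sqrt{1+|z|^2}$; $T^*\mathbb{R}^d$ is identified with $\mathbb{R}^{2d}$, with points $z=(x,\xi)$, and $T^*\mathbb{R}^d\setminus 0 = \mathbb{R}^{2d}\setminus\{0\}$. A set is conic (a cone) if it is invariant under multiplication by positive scalars. $(\cdot,\cdot)$ is the $L^2$ inner product, conjugate linear in the second argument, extended to the pairing of $\mathscr{S}'$ with $\mathscr{S}$. Shubin symbols: for $m \in \mathbb{R}$, $G^m$ is the set of $a \in C^\infty(\mathbb{R}^{2d})$ such that for all $\alpha \in \mathbb{N}^{2d}$ there is $C_\alpha>0$ with $|\partial^\alpha a(z)| \le C_\alpha \langle z\rangle^{m-|\alpha|}$ for all $z \in \mathbb{R}^{2d}$. Hypercharacteristic set: for $a \in G^m$ and $m'\le m$, $\operatorname{char}_{m'}(a)\subseteq T^*\mathbb{R}^d\setminus 0$ is defined by: $z_0\notin\operatorname{char}_{m'}(a)$ iff there are an open conic set $\Gamma\subseteq T^*\mathbb{R}^d\setminus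 0$ containing $z_0$ and constants $C, A>0$, $C_\alpha>0$ ($\alpha\in\mathbb{N}^{2d}$) such that $|a(z)|\ge C\langle z\rangle^{m'}$ and $|\partial^\alpha a(z)|\le C_\alpha|a(z)|\langle z\rangle^{-|\alpha|}$ for all $\alpha$ and all $z\in\Gamma$ with $|z|\ge A$. Weyl quantization: $a^w(x,D)u(x) = (2\pi)^{-d}\int_{\mathbb{R}^{2d}} e^{i(x-y)\cdot\xi}\, a((x+y)/2,\xi)\,u(y)\,dy\,d\xi$ for $u \in \mathscr{S}(\mathbb{R}^d)$ (as an oscillatory integral); for $a \in G^m$ it is continuous on $\mathscr{S}(\mathbb{R}^d)$ and extends by duality to a continuous operator on $\mathscr{S}'(\mathbb{R}^d)$. Short-time Fourier transform: for $u \in \mathscr{S}'(\mathbb{R}^d)$ and $\varphi\in\mathscr{S}(\mathbb{R}^d)\setminus\{0\}$, $V_\varphi u(x,\xi) = (u, M_\xi T_x \varphi)$, where $M_\xi T_x\varphi(y) = e^{iy\cdot\xi}\varphi(y-x)$. Localization operator: with $\psi_0(y) = \pi^{-d/4}e^{-|y|^2/2}$, $A_a$ is defined weakly by $(A_a f,g) = (2\pi)^{-d}(a V_{\psi_0}f, V_{\psi_0}g)$ for $g \in \mathscr{S}(\mathbb{R}^d)$; for $a \in G^m$ it acts on $f\in\mathscr{S}'(\mathbb{R}^d)$. Sobolev–Gabor wave front set: fix any $\varphi \in \mathscr{S}(\mathbb{R}^d)\setminus\{0\}$ (the definition does not depend on this choice). For $u\in\mathscr{S}'(\mathbb{R}^d)$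 and $s\in\mathbb{R}$, $\mathrm{WF}_{Q^s}(u)\subseteq T^*\mathbb{R}^d\setminus 0$ is defined by: $z_0 \in T^*\mathbb{R}^d\setminus 0$ satisfies $z_0\notin \mathrm{WF}_{Q^s}(u)$ iff there is an open cone $\Gamma \subseteq \mathbb{R}^{2d}\setminus 0$ containing $z_0$ with $\int_\Gamma \langle z\rangle^{2s}|V_\varphi u(z)|^2\,dz<\infty$. *)

(* Defs.v *)
From HB Require Import structures.
From mathcomp Require Import all_boot all_order all_algebra.
From mathcomp Require Import all_classical all_reals all_analysis.
From mathcomp.real_closed Require Import complex.

Set Implicit Arguments.
Unset Strict Implicit.
Unset Printing Implicit Defensive.

Import Order.TTheory GRing.Theory Num.Theory.
Import numFieldNormedType.Exports.
Import ComplexField.Normc.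

Local Open Scope classical_set_scope.
Local Open Scope ring_scope.
Local Open Scope complex_scope.

Fact rV_display : measure_display. Proof. exact: default_measure_display. Qed.

Section rV_measurable.
Context (R : realType) (n : nat).

Definition rV_coord (i : 'I_n) (x : 'rV[R]_n) : measurableTypeR R := x ord0 i.

(* The product sigma-algebra; it coincides with the Borel sets of ['rV[R]_n]. *)
Definition rV_measurable : set (set 'rV[R]_n) := g_sigma_preimage rV_coord.

Let rV_measurable0 : rV_measurable set0.
Proof. exact: sigma_algebra0. Qed.

Let rV_measurableC A : rV_measurable A -> rV_measurable (~` A).
Proof. exact: sigma_algebraC. Qed.

Let rV_measurable_bigcup (F : (set 'rV[R]_n)^nat) :
  (forall i, rV_measurable (F i)) -> rV_measurable (\bigcup_i F i).
Proof. exact: sigma_algebra_bigcup. Qed.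

HB.instance Definition _ := @isMeasurable.Build rV_display 'rV[R]_n
  rV_measurable rV_measurable0 rV_measurableC rV_measurable_bigcup.

End rV_measurable.

Lemma measurable_rV_coord (R : realType) n (i : 'I_n) :
  measurable_fun [set: 'rV[R]_n] (@rV_coord R n i).
Proof.
move=> _ Y mY; rewrite setTI; apply: sub_sigma_algebra => /=.
rewrite -bigcup_seq/=; exists i => /=; first by rewrite mem_index_enum.
by exists Y => //; rewrite setTI.
Qed.

Lemma measurable_fun_rVP d (T : measurableType d) (R : realType) n
    (f : T -> 'rV[R]_n) :
  measurable_fun [set: T] f <->
  forall i, measurable_fun [set: T] (@rV_coord R n i \o f).
Proof.
split=> [mf i|mf].
  exact: measurableT_comp (@measurable_rV_coord R n i) mf.
move=> _; apply: smallest_sub => [|].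
  split => [|A mA|F mF] /=.
  - by rewrite preimage_set0 setI0; exact: measurable0.
  - rewrite setTD setTI preimage_setC; apply: measurableC.
    by rewrite -[X in measurable X]setTI.
  - rewrite preimage_bigcup setTI; apply: bigcupT_measurable => k.
    by rewrite -[X in measurable X]setTI; exact: mF.
rewrite -bigcup_seq/=; apply: bigcup_sub => i _ A [B mB <-] /=.
rewrite setTI; exact: mf.
Qed.

Section lebesgue_rV.
Context (R : realType).

Definition rV_cons n (p : measurableTypeR R * 'rV[R]_n) : 'rV[R]_n.+1 :=
  @row_mx R 1 1 n (p.1)%:M p.2.

Definition rV_uncons n (x : 'rV[R]_n.+1) : measurableTypeR R * 'rV[R]_n :=
  (rV_coord ord0 x, @rsubmx R 1 1 n x).

Lemma rV_cons0 n (p : measurableTypeR R * 'rV[R]_n) :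
  rV_coord ord0 (rV_cons p) = p.1.
Proof.
rewrite /rV_coord /rV_cons mxE; case: splitP => // j _.
by rewrite mxE !ord1 eqxx mulr1n.
Qed.

Lemma rV_consS n (p : measurableTypeR R * 'rV[R]_n) (i : 'I_n) :
  rV_coord (lift ord0 i) (rV_cons p) = rV_coord i p.2.
Proof.
rewrite /rV_coord /rV_cons (_ : lift ord0 i = rshift 1 i); last exact/val_inj.
exact: (@row_mxEr _ 1 1 n).
Qed.

Lemma rV_consK n : cancel (@rV_cons n) (@rV_uncons n).
Proof.
by move=> [x y]; rewrite /rV_uncons rV_cons0 /rV_cons /= row_mxKr.
Qed.

Lemma measurable_rV_cons n : measurable_fun setT (@rV_cons n).
Proof.
apply/measurable_fun_rVP => i; case: (unliftP ord0 i) => [j|] ->.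
  rewrite (_ : _ \o _ = @rV_coord R n j \o snd).
    exact: measurableT_comp (@measurable_rV_coord R n j) measurable_snd.
  by apply/funext => p; exact: rV_consS.
rewrite (_ : _ \o _ = (fst : _ -> measurableTypeR R)).
  exact: (@measurable_fst _ _ (measurableTypeR R) 'rV[R]_n).
by apply/funext => p; exact: rV_cons0.
Qed.

Lemma measurable_rV_uncons n : measurable_fun setT (@rV_uncons n).
Proof.
apply/measurable_fun_pairP; split.
  exact: (@measurable_rV_coord R n.+1 ord0).
apply/measurable_fun_rVP => i.
rewrite (_ : _ \o _ = @rV_coord R n.+1 (rshift 1 i)).
  exact: (@measurable_rV_coord R n.+1 (rshift 1 i)).
by apply/funext => x; rewrite /rV_coord /= mxE.
Qed.

Section cons_measure.
Context n (mu : {sigma_finite_measure set 'rV[R]_n -> \bar R}).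

Definition rV_cons_measure : set 'rV[R]_n.+1 -> \bar R :=
  pushforward (@lebesgue_measure R \x mu)%E (@rV_cons n).

Let mcons A : measurable A -> measurable (@rV_cons n @^-1` A).
Proof.
by move=> mA; rewrite -[X in measurable X]setTI; exact: measurable_rV_cons.
Qed.

Let cons_measure0 : rV_cons_measure set0 = 0%E.
Proof. by rewrite /rV_cons_measure /pushforward preimage_set0 measure0. Qed.

Let cons_measure_ge0 A : (0 <= rV_cons_measure A)%E.
Proof. by rewrite /rV_cons_measure /pushforward; apply: measure_ge0. Qed.

Let cons_measure_sigma_additive : semi_sigma_additive rV_cons_measure.
Proof.
move=> F mF tF mUF; rewrite /rV_cons_measure /pushforward preimage_bigcup.
apply: measure_semi_sigma_additive => [k||]; first exact: mcons.
- apply/trivIsetP => /= i j _ _ ij; rewrite -preimage_setI.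
  by move/trivIsetP : tF => /(_ _ _ _ _ ij) ->//; rewrite preimage_set0.
- by rewrite -preimage_bigcup; exact: mcons.
Qed.

HB.instance Definition _ := isMeasure.Build _ _ _ rV_cons_measure
  cons_measure0 cons_measure_ge0 cons_measure_sigma_additive.

Let cons_measure_sigma_finite : sigma_finite setT rV_cons_measure.
Proof.
have /sigma_finiteP[F [TF ndF Foo]] := sigma_finiteT (@lebesgue_measure R).
have /sigma_finiteP[G [TG ndG Goo]] := sigma_finiteT mu.
exists (fun k => @rV_uncons n @^-1` (F k `*` G k)).
  rewrite -preimage_bigcup (_ : \bigcup_k (F k `*` G k) = setT) ?preimage_setT//.
  rewrite -setXTT TF TG predeqE => -[x y]; split.
    by move=> [k _ []/= ? ?]; split; exists k.
  move=> [/= [k _ Fkx] [l _ Gly]]; exists (maxn k l) => //; split.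
  - by move: x Fkx; exact/subsetPset/ndF/leq_maxl.
  - by move: y Gly; exact/subsetPset/ndG/leq_maxr.
move=> k; have [mF Fk] := Foo k; have [mG Gk] := Goo k.
have mFG : measurable (F k `*` G k) by exact: measurableX.
split; first by rewrite -[X in measurable X]setTI; exact: measurable_rV_uncons.
rewrite /rV_cons_measure /pushforward -comp_preimage.
rewrite (_ : @rV_uncons n \o @rV_cons n = id); last exact/funext/rV_consK.
by rewrite preimage_id product_measure1E// lte_mul_pinfty// ge0_fin_numE.
Qed.

HB.instance Definition _ := @Measure_isSigmaFinite.Build _ _ _ rV_cons_measure
  cons_measure_sigma_finite.

End cons_measure.

Fixpoint lebesgue_rV n : {sigma_finite_measure set 'rV[R]_n -> \bar R} :=
  if n is n'.+1 then rV_cons_measure (lebesgue_rV n') else \d_ (0 : 'rV[R]_0).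

Lemma lebesgue_rV_box n (A : 'I_n -> set (measurableTypeR R)) :
  (forall i, measurable (A i)) ->
  lebesgue_rV n [set x : 'rV[R]_n | forall i, A i (rV_coord i x)] =
  (\prod_(i < n) lebesgue_measure (A i))%E.
Proof.
elim: n A => [|n IH] A mA.
  rewrite big_ord0 /= diracE (_ : [set _ | _] = setT) ?in_setT//.
  by apply/seteqP; split=> // x _ [].
rewrite big_ord_recl -(IH (fun i => A (lift ord0 i)))//.
rewrite -product_measure1E//; last first.
  rewrite (_ : [set _ | _] =
      \bigcap_(i in [set: 'I_n]) (@rV_coord R n i @^-1` A (lift ord0 i))).
    apply: fin_bigcap_measurable => // i _.
    by rewrite -[X in measurable X]setTI; exact: measurable_rV_coord.
  by apply/seteqP; split=> x /= h i => [_|]; exact: h.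
rewrite /= /rV_cons_measure /pushforward; congr (product_measure1 _ _ _).
apply/seteqP; split=> -[x y] /=.
  move=> h; split; first by have := h ord0; rewrite rV_cons0.
  by move=> i; have := h (lift ord0 i); rewrite rV_consS.
by move=> [h0 h] i; case: (unliftP ord0 i) => [j|] ->;
  rewrite ?rV_consS ?rV_cons0.
Qed.

End lebesgue_rV.

Section euclidean.
Context (R : realType) (n : nat).
Implicit Types x y z : 'rV[R]_n.

Definition dot x y : R := \sum_(i < n) x ord0 i * y ord0 i.

(* The norm of ['rV[R]_n] in the library is the supremum norm. *)
Definition enorm x : R := Num.sqrt (dot x x).

Definition japanese z : R := Num.sqrt (1 + enorm z ^+ 2).

Definition conic (G : set 'rV[R]_n) : Prop :=
  forall z t, G z -> 0 < t -> G (t *: z).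

Definition open_cone (G : set 'rV[R]_n) : Prop :=
  [/\ open G, conic G & G `<=` [set z | z != 0]].

End euclidean.

Section complex_functions.
Context (R : realType).

Definition expi (t : R) : R[i] := cos t +i* sin t.

Definition cintegral n (f : 'rV[R]_n -> R[i]) : R[i] :=
  (\int[lebesgue_rV R n]_x complex.Re (f x)) +i*
  (\int[lebesgue_rV R n]_x complex.Im (f x)).

Definition fconj n (f : 'rV[R]_n -> R[i]) : 'rV[R]_n -> R[i] :=
  fun x => conjc (f x).

Definition partial n (i : 'I_n) (f : 'rV[R]_n -> R[i]) : 'rV[R]_n -> R[i] :=
  fun x => ('D_(delta_mx 0 i) (fun y => complex.Re (f y) : R^o) x) +i*
           ('D_(delta_mx 0 i) (fun y => complex.Im (f y) : R^o) x).

Definition partials n (l : seq 'I_n) (f : 'rV[R]_n -> R[i]) :=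
  foldr (@partial n) f l.

Definition smooth n (f : 'rV[R]_n -> R[i]) : Prop :=
  forall l : seq 'I_n,
  [/\ continuous (fun x => complex.Re (partials l f x) : R^o),
      continuous (fun x => complex.Im (partials l f x) : R^o) &
      forall (i : 'I_n) x,
        derivable (fun y => complex.Re (partials l f y) : R^o) x (delta_mx 0 i) /\
        derivable (fun y => complex.Im (partials l f y) : R^o) x (delta_mx 0 i)].

(* Multi-indices are functions ['I_n -> nat]; the order in which the partial
   derivatives are taken is immaterial for smooth functions. *)
Definition mlen n (al : 'I_n -> nat) : nat := (\sum_(i < n) al i)%N.

Definition mpartial n (al : 'I_n -> nat) (f : 'rV[R]_n -> R[i]) :=
  partials (flatten [seq nseq (al i) i | i <- enum 'I_n]) f.

Definition monom n (al : 'I_n -> nat) (x : 'rV[R]_n) : R :=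
  \prod_(i < n) x ord0 i ^+ al i.

Definition schwartz n (f : 'rV[R]_n -> R[i]) : Prop :=
  smooth f /\
  forall al be : 'I_n -> nat, exists C : R,
    forall x, `|monom al x| * normc (mpartial be f x) <= C.

(* A base of closed neighbourhoods of 0 for the Frechet topology of S(R^n) *)
Definition schwartz_nbhs0 n (N : nat) (r : R) (f : 'rV[R]_n -> R[i]) : Prop :=
  forall al be : 'I_n -> nat, (mlen al <= N)%N -> (mlen be <= N)%N ->
    forall x, `|monom al x| * normc (mpartial be f x) <= r.

(* A distribution is a functional phi |-> <u, phi>. Only its values on Schwartz
   functions are meaningful. *)
Definition functional n := ('rV[R]_n -> R[i]) -> R[i].

Definition tempered n (u : functional n) : Prop :=
  (forall (c : R[i]) f g, schwartz f -> schwartz g ->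
     u (fun x => c * f x + g x) = c * u f + u g) /\
  (forall f, schwartz f -> forall e : R, 0 < e -> exists N (r : R), 0 < r /\
     forall g, schwartz g -> schwartz_nbhs0 N r (fun x => g x - f x) ->
       normc (u g - u f) < e).

(* The sesquilinear pairing (u, f), conjugate linear in f *)
Definition pairing n (u : functional n) (f : 'rV[R]_n -> R[i]) : R[i] :=
  u (fconj f).

Definition dist_of n (f : 'rV[R]_n -> R[i]) : functional n :=
  fun phi => cintegral (fun x => f x * phi x).

(* l is the limit as e -> 0+ of the integrals of chi (e w) f w, for every
   Schwartz cut-off chi with chi 0 = 1. *)
Definition is_osc_integral n (f : 'rV[R]_n -> R[i]) (l : R[i]) : Prop :=
  forall chi : 'rV[R]_n -> R[i], schwartz chi -> chi 0 = 1 ->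
    (normc (cintegral (fun w => chi (e *: w) * f w) - l) : R^o) @[e --> 0^'+]
      --> (0 : R^o).

Definition osc_integral n (f : 'rV[R]_n -> R[i]) : R[i] :=
  xget 0 [set l | is_osc_integral f l].

End complex_functions.

(* A point z = (x, xi) of T^*R^d is [row_mx x xi : 'rV[R]_(d + d)]. *)

Section phase_space.
Context (R : realType) (d : nat).
Implicit Types (a : 'rV[R]_(d + d) -> R[i]) (u : functional R d).
Implicit Types (f phi : 'rV[R]_d -> R[i]) (m s : R).

Definition shubin m a : Prop :=
  smooth a /\
  forall al : 'I_(d + d) -> nat, exists C : R, 0 < C /\
    forall z, normc (mpartial al a z) <= C * japanese z `^ (m - (mlen al)%:R).

Definition hyperchar m' a : set 'rV[R]_(d + d) :=
  [set z0 | z0 != 0 /\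
    ~ exists G : set 'rV[R]_(d + d), [/\ open_cone G, G z0 &
        exists C A : R, [/\ 0 < C, 0 < A,
          forall z, G z -> A <= enorm z -> C * japanese z `^ m' <= normc (a z) &
          forall al : 'I_(d + d) -> nat, exists Cal : R, 0 < Cal /\
            forall z, G z -> A <= enorm z ->
              normc (mpartial al a z)
                <= Cal * normc (a z) * japanese z `^ (- (mlen al)%:R)]]].

(* Integration variable w = (y, xi) *)
Definition weyl a f : 'rV[R]_d -> R[i] := fun x =>
  (((2 * pi) ^+ d)^-1)%:C *
  osc_integral (fun w : 'rV[R]_(d + d) =>
    expi (dot (x - lsubmx w) (rsubmx w)) *
    a (row_mx (2^-1 *: (x + lsubmx w)) (rsubmx w)) * f (lsubmx w)).

(* Extension to S' by duality: (a^w u, f) = (u, (conj a)^w f), the formal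
   adjoint of a^w being the Weyl quantization of the conjugate symbol. *)
Definition weyl_dist a u : functional R d := fun phi =>
  pairing u (weyl (fconj a) (fconj phi)).

Definition time_freq phi (z : 'rV[R]_(d + d)) : 'rV[R]_d -> R[i] := fun y =>
  expi (dot y (rsubmx z)) * phi (y - lsubmx z).

Definition stft phi u (z : 'rV[R]_(d + d)) : R[i] :=
  pairing u (time_freq phi z).

Definition psi0 : 'rV[R]_d -> R[i] := fun y =>
  (pi `^ (- (d%:R / 4)) * expR (- (enorm y ^+ 2 / 2)))%:C.

(* pairing (locop a u) g is (2 pi)^-d (a V_psi0 u, V_psi0 g). *)
Definition locop a u : functional R d := fun phi =>
  (((2 * pi) ^+ d)^-1)%:C *
  cintegral (fun z : 'rV[R]_(d + d) =>
    a z * stft psi0 u z * conjc (stft psi0 (dist_of (fconj phi)) z)).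

Definition WFQ phi s u : set 'rV[R]_(d + d) :=
  [set z0 | z0 != 0 /\
    ~ exists G : set 'rV[R]_(d + d), [/\ open_cone G, G z0 &
        (\int[lebesgue_rV R (d + d)]_(z in G)
           (japanese z `^ (2 * s) * normc (stft phi u z) ^+ 2)%:E < +oo)%E]].

End phase_space.

(* Main.v *)
(* Let F = V_phi u. Near a point outside char_m'(a) one freezes the symbol: a(z + X) is
   a(z) (1 + <z>^-1 c_z(X)), where all derivatives of c_z are bounded by a fixed power of <X>,
   uniformly in z. Pairing u with time-frequency shifts then gives, on a cone and for large z,
     |F(z)| <= C <z>^-m' |V_phi(B u)(z)| + C <z>^-1 int |F(w)| <w - z>^-M dw
   for both quantizations B of a (for the localization operator, F in the average is replaced by
   V_psi0 u, which is itself dominated by such an average of F). The averages preserve weighted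
   square integrability on slightly smaller cones, so that integrability of <z>^t F on a cone
   improves to t + 1, as long as t + 1 <= s; as F grows polynomially, one can start from a very
   negative t. The representation of u by its short-time Fourier transform that this requires is
   obtained by exchanging u with Riemann sums. *)
From HB Require Import structures.
Require Import Defs.
From mathcomp Require Import all_boot all_order all_algebra.
From mathcomp Require Import all_classical all_reals all_analysis measurable_realfun.
From mathcomp.real_closed Require Import complex.
From mathcomp Require Import ring lra zify.

Set Implicit Arguments.
Unset Strict Implicit.
Unset Printing Implicit Defensive.

Import Order.TTheory GRing.Theory Num.Theory.
Import numFieldNormedType.Exports.
Import ComplexField.Normc.

Local Open Scope classical_set_scope.
Local Open Scope ring_scope.
Local Open Scope complex_scope.

(** * Complex numbers and the Japanese bracket *)

(** The lower bound turns 1/|a(z)| into a multiple of <z>^-m'; the derivative bounds at z make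
    a(z+X) - a(z) smaller than a(z) by one power of <z>, up to a power of <X>. As z+X may leave the
    cone, the symbol estimates, valid everywhere, have to replace the cone condition from an order N
    with m - N <= m' - 1 on. That single power of <z> is the gain of one bootstrap step.

    Two circumstances shape the rest. Constants must be uniform in z, so estimates are stated for
    families over an arbitrary index type with a weight. And [weyl_dist a u] and [locop a u] are
    treated as bare functionals, with no continuity or measurability claimed for their transforms;
    integrals of such nonnegative functions are compared as suprema over simple functions.
    Oscillatory integrals are reduced to iterated ones, in y before xi. *)

Section complex_numbers.
Context (R : realType).
Implicit Types (z w : R[i]) (t : R).

Lemma normc_ge0 z : 0 <= normc z.
Proof. by case: z => a b; exact: sqrtr_ge0. Qed.

Lemma normcR t : normc t%:C = `|t|.
Proof. by rewrite /normc /= expr0n addr0 sqrtr_sqr. Qed.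

Lemma normc_conj z : normc (conjc z) = normc z.
Proof. by case: z => a b /=; rewrite sqrrN. Qed.

Lemma le_Re_normc z : `|complex.Re z| <= normc z.
Proof. by case: z => a b /=; rewrite -sqrtr_sqr ler_sqrt ?lerDl ?sqr_ge0 // addr_ge0 ?sqr_ge0. Qed.

Lemma le_Im_normc z : `|complex.Im z| <= normc z.
Proof. by case: z => a b /=; rewrite -sqrtr_sqr ler_sqrt ?lerDr ?sqr_ge0 // addr_ge0 ?sqr_ge0. Qed.

Lemma normc_le z : normc z <= `|complex.Re z| + `|complex.Im z|.
Proof.
case: z => a b /=; rewrite -[leRHS]ger0_norm ?addr_ge0// -sqrtr_sqr ler_sqrt ?sqr_ge0//.
rewrite sqrrD !real_normK ?num_real// -mulr_natl.
have := mulr_ge0 (normr_ge0 a) (normr_ge0 b); lra.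
Qed.

Lemma normc_expi t : normc (expi t) = 1.
Proof. by rewrite /= cos2Dsin2 sqrtr1. Qed.

Lemma normci : normc ('i : R[i]) = 1.
Proof. by rewrite /= expr0n add0r expr1n sqrtr1. Qed.

Lemma normc_natr n : normc (n%:R : R[i]) = n%:R.
Proof. by rewrite -(rmorph_nat (real_complex R)) normcR normr_nat. Qed.

Lemma expiD t1 t2 : expi (t1 + t2) = expi t1 * expi t2.
Proof. by rewrite /expi cosD sinD; congr Complex; rewrite addrC. Qed.

Lemma expi0 : expi 0 = 1 :> R[i].
Proof. by rewrite /expi cos0 sin0. Qed.

Lemma conjc_expi t : conjc (expi t) = expi (- t).
Proof. by rewrite /expi cosN sinN. Qed.

Lemma le_normcB z w : normc (z - w) <= normc z + normc w.
Proof. by rewrite -(normcN w); exact: le_normcD. Qed.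

Lemma normc_sum (I : Type) (r : seq I) (F : I -> R[i]) :
  normc (\sum_(i <- r) F i) <= \sum_(i <- r) normc (F i).
Proof.
elim/big_ind2 : _ => [|a b c e ab ce|//]; first by rewrite normc0.
by apply: le_trans (le_normcD _ _) _; exact: lerD.
Qed.

Lemma cReD z w : complex.Re (z + w) = complex.Re z + complex.Re w.
Proof. by case: z; case: w. Qed.
Lemma cImD z w : complex.Im (z + w) = complex.Im z + complex.Im w.
Proof. by case: z; case: w. Qed.
Lemma cReM z w : complex.Re (z * w) =
  complex.Re z * complex.Re w - complex.Im z * complex.Im w.
Proof. by case: z; case: w. Qed.
Lemma cImM z w : complex.Im (z * w) =
  complex.Re z * complex.Im w + complex.Im z * complex.Re w.
Proof. by case: z; case: w. Qed.

Lemma cReN z : complex.Re (- z) = - complex.Re z.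
Proof. by case: z. Qed.
Lemma cImN z : complex.Im (- z) = - complex.Im z.
Proof. by case: z. Qed.
Lemma cRe_conj z : complex.Re (conjc z) = complex.Re z.
Proof. by case: z. Qed.
Lemma cIm_conj z : complex.Im (conjc z) = - complex.Im z.
Proof. by case: z. Qed.

Lemma complex_eqP z w :
  complex.Re z = complex.Re w -> complex.Im z = complex.Im w -> z = w.
Proof. by case: z => a b; case: w => c d /= -> ->. Qed.

End complex_numbers.

(** * Inequalities for the Japanese bracket *)

Section japanese_bracket.
Context (R : realType).
Local Notation jp := japanese.

Lemma dotxx_ge0 n (x : 'rV[R]_n) : 0 <= dot x x.
Proof. by apply: sumr_ge0 => i _; rewrite -expr2 sqr_ge0. Qed.

Lemma enorm_sqr n (x : 'rV[R]_n) : enorm x ^+ 2 = dot x x.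
Proof. by rewrite /enorm sqr_sqrtr// dotxx_ge0. Qed.

Lemma jp_sqr n (x : 'rV[R]_n) : jp x ^+ 2 = 1 + dot x x.
Proof. by rewrite /japanese enorm_sqr sqr_sqrtr// addr_ge0// dotxx_ge0. Qed.

Lemma jp_ge1 n (x : 'rV[R]_n) : 1 <= jp x.
Proof.
by rewrite /japanese -[leLHS]sqrtr1 ler_sqrt ?lerDl ?sqr_ge0// addr_ge0 ?sqr_ge0.
Qed.

Lemma jp_gt0 n (x : 'rV[R]_n) : 0 < jp x.
Proof. exact: lt_le_trans ltr01 (jp_ge1 x). Qed.
Hint Resolve jp_gt0 : core.

Lemma jp_ge0 n (x : 'rV[R]_n) : 0 <= jp x. Proof. exact: ltW. Qed.
Hint Resolve jp_ge0 jp_ge1 : core.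

Lemma jpX_gt0 n (x : 'rV[R]_n) N : 0 < jp x ^+ N. Proof. exact: exprn_gt0. Qed.

Lemma jpX_ge1 n (x : 'rV[R]_n) N : 1 <= jp x ^+ N.
Proof. exact: exprn_ege1. Qed.

Lemma ler_jp m n (x : 'rV[R]_m) (y : 'rV[R]_n) (c : R) :
  0 <= c -> 1 + dot x x <= c ^+ 2 * (1 + dot y y) -> jp x <= c * jp y.
Proof.
move=> c0 h; rewrite -(@ler_pXn2r _ 2) ?nnegrE ?mulr_ge0//.
by rewrite exprMn !jp_sqr.
Qed.

Lemma jp_coord n (x : 'rV[R]_n) i : `|x 0 i| <= jp x.
Proof.
rewrite -(@ler_pXn2r _ 2) ?nnegrE// real_normK ?num_real// jp_sqr /dot.
rewrite (bigD1 i)//= -expr2 addrCA lerDl addr_ge0// sumr_ge0// => j _.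
by rewrite -expr2 sqr_ge0.
Qed.

Lemma jp_le_coord m n (x : 'rV[R]_m) (y : 'rV[R]_n) :
  dot x x <= dot y y -> jp x <= jp y.
Proof. by move=> h; rewrite -[leRHS]mul1r ler_jp// expr1n mul1r lerD2l. Qed.

Lemma dot_le_coord n (x y : 'rV[R]_n) :
  (forall i, `|x 0 i| <= `|y 0 i|) -> dot x x <= dot y y.
Proof.
move=> h; apply: ler_sum => i _; rewrite -!expr2 -(real_normK (num_real (x 0 i))).
by rewrite -(real_normK (num_real (y 0 i))) ler_pXn2r ?nnegrE.
Qed.

Lemma jp_le_sum n (x : 'rV[R]_n) : jp x <= 1 + \sum_i `|x 0 i|.
Proof.
have s0 : 0 <= \sum_i `|x 0 i| by exact: sumr_ge0.
rewrite -(@ler_pXn2r _ 2) ?nnegrE ?addr_ge0// jp_sqr sqrrD expr1n -addrA lerD2l.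
rewrite mul1r -[leLHS]add0r lerD ?mulrn_wge0// expr2 mulr_sumr ler_sum// => i _.
rewrite -expr2 -real_normK ?num_real// expr2 ler_wpM2r//.
by rewrite (bigD1 i)//= lerDl sumr_ge0.
Qed.

Lemma jpN n (x : 'rV[R]_n) : jp (- x) = jp x.
Proof.
by apply/eqP; rewrite eq_le !jp_le_coord// dot_le_coord// => i; rewrite mxE normrN.
Qed.

Lemma jpB n (x y : 'rV[R]_n) : jp (x - y) = jp (y - x).
Proof. by rewrite -jpN opprB. Qed.

Lemma jp0 n : jp (0 : 'rV[R]_n) = 1.
Proof.
rewrite /japanese enorm_sqr /dot big1 ?addr0 ?sqrtr1// => i _.
by rewrite mxE mul0r.
Qed.

(** Peetre's inequality, from |x + y|^2 <= 2 |x|^2 + 2 |y|^2. The constant is not optimal but easy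
    to carry through powers. It lies behind the exchanges of a weight at z + X for the same weight
    at z times a power of <X>. *)
Lemma jpD n (x y : 'rV[R]_n) : jp (x + y) <= 2 * (jp x * jp y).
Proof.
rewrite -(@ler_pXn2r _ 2) ?nnegrE ?mulr_ge0// !exprMn !jp_sqr.
have h : dot (x + y) (x + y) <= 2 * dot x x + 2 * dot y y.
  rewrite /dot !mulr_sumr -big_split ler_sum//= => i _; rewrite !mxE.
  have := sqr_ge0 (x 0 i - y 0 i); lra.
have := dotxx_ge0 x; have := dotxx_ge0 y; nra.
Qed.

Lemma jpDl n (x y : 'rV[R]_n) : jp x <= 2 * (jp (x - y) * jp y).
Proof. by rewrite -{1}(subrK y x) jpD. Qed.

Lemma dot_row_mx m n (x x' : 'rV[R]_m) (y y' : 'rV[R]_n) :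
  dot (row_mx x y) (row_mx x' y') = dot x x' + dot y y'.
Proof.
rewrite /dot big_split_ord /=; congr (_ + _); apply: eq_bigr => i _.
  by rewrite !row_mxEl.
by rewrite !row_mxEr.
Qed.

Lemma jp_row_mxl m n (x : 'rV[R]_m) (y : 'rV[R]_n) : jp x <= jp (row_mx x y).
Proof. by rewrite jp_le_coord// dot_row_mx lerDl dotxx_ge0. Qed.

Lemma jp_row_mxr m n (x : 'rV[R]_m) (y : 'rV[R]_n) : jp y <= jp (row_mx x y).
Proof. by rewrite jp_le_coord// dot_row_mx lerDr dotxx_ge0. Qed.

Lemma jp_row_mx m n (x : 'rV[R]_m) (y : 'rV[R]_n) :
  jp (row_mx x y) <= jp x * jp y.
Proof.
rewrite -(@ler_pXn2r _ 2) ?nnegrE ?mulr_ge0// exprMn !jp_sqr dot_row_mx.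
have := dotxx_ge0 x; have := dotxx_ge0 y; nra.
Qed.

Lemma jpZ n (c : R) (x : 'rV[R]_n) : `|c| <= 1 -> jp (c *: x) <= jp x.
Proof.
move=> c1; rewrite jp_le_coord// dot_le_coord// => i.
by rewrite mxE normrM ler_piMl.
Qed.

Lemma jp_leX n (x : 'rV[R]_n) N M : (N <= M)%N -> jp x ^+ N <= jp x ^+ M.
Proof. by move=> NM; rewrite ler_weXn2l. Qed.

End japanese_bracket.
#[global] Hint Extern 0 (is_true (0 < japanese _)) => exact: jp_gt0 : core.
#[global] Hint Extern 0 (is_true (0 <= japanese _)) => exact: jp_ge0 : core.
#[global] Hint Extern 0 (is_true (1 <= japanese _)) => exact: jp_ge1 : core.
#[global] Hint Extern 0 (is_true (0 <= normc _)) => exact: normc_ge0 : core.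
Local Notation jp := japanese.

(** * Lebesgue measure on row vectors *)

Section lebesgue_rV_unique.
Context (R : realType).

Definition rV_box n (A : 'I_n -> set (measurableTypeR R)) : set 'rV[R]_n :=
  [set x | forall i, A i (rV_coord i x)].

Lemma measurable_rV_box n (A : 'I_n -> set (measurableTypeR R)) :
  (forall i, measurable (A i)) -> measurable (rV_box A).
Proof.
move=> mA; rewrite (_ : rV_box A =
    \bigcap_(i in [set: 'I_n]) (@rV_coord R n i @^-1` A i)).
  apply: fin_bigcap_measurable => // i _.
  by rewrite -[X in measurable X]setTI; exact: measurable_rV_coord.
by apply/seteqP; split=> x /= h i => [_|]; exact: h.
Qed.

(** Boxes, unlike preimages under one coordinate, are stable under intersection, and their measure
    is known explicitly; a measure can therefore be identified by its values on them. *)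
Lemma measurable_rVE n : @measurable _ 'rV[R]_n =
  <<s [set rV_box A | A in [set A | forall i, measurable (A i)]] >>.
Proof.
apply/seteqP; split.
  apply: smallest_sub; first exact: smallest_sigma_algebra.
  rewrite -bigcup_seq/=; apply: bigcup_sub => i _ _ [B mB <-] /=.
  apply: sub_sigma_algebra; exists (fun j => if j == i then B else setT).
    by move=> j; case: ifP => // _; exact: measurableT.
  apply/seteqP; split=> [x /(_ i)|x [_ Bx] j]; first by rewrite eqxx.
  by case: eqP => // ->.
apply: smallest_sub; first exact: sigma_algebra_measurable.
by move=> _ [A mA <-]; exact: measurable_rV_box.
Qed.

Lemma lebesgue_rV_boxE n (A : 'I_n -> set (measurableTypeR R)) :
  (forall i, measurable (A i)) ->
  lebesgue_rV R n (rV_box A) = (\prod_(i < n) lebesgue_measure (A i))%E.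
Proof. exact: lebesgue_rV_box. Qed.

Lemma lebesgue_rV_cube n (c r : R) : 0 <= r ->
  lebesgue_rV R n (rV_box (fun=> `]c, c + r]%classic)) = (r ^+ n)%:E.
Proof.
move=> r0; rewrite lebesgue_rV_boxE; last by move=> i; exact: measurable_itv.
rewrite (eq_bigr (fun=> r%:E)) => [|i _]; last first.
  rewrite lebesgue_measure_itv/= lte_fin ltrDl; case: ltP => [_|r0'].
    by rewrite -EFinB addrAC subrr add0r.
  by congr EFin; apply/eqP; rewrite eq_le r0.
by rewrite prodEFin prodr_const card_ord.
Qed.

(** The boxes form a pi-system exhausted by the cubes ]-k, k]^n of finite measure. The recursive
    definition of [lebesgue_rV] singles out the first coordinate; this characterization yields its
    affine behaviour and the splitting of the variables into two blocks. *)
Lemma lebesgue_rV_unique n (m : {measure set 'rV[R]_n -> \bar R}) :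
  (forall A : 'I_n -> set (measurableTypeR R), (forall i, measurable (A i)) ->
     m (rV_box A) = (\prod_(i < n) lebesgue_measure (A i))%E) ->
  forall B, measurable B -> lebesgue_rV R n B = m B.
Proof.
move=> mE B mB.
apply: (measure_unique
  [set rV_box A | A in [set A | forall i, measurable (A i)]]
  (fun k => rV_box (fun=> `](- k%:R), k%:R]%classic))) => //.
- exact: measurable_rVE.
- move=> _ _ [A mA <-] [A' mA' <-]; exists (fun i => A i `&` A' i).
    by move=> i; exact: measurableI.
  by apply/seteqP; split=> x; [move=> h; split=> i; case: (h i)|case=> h h' i].
- by move=> k; exists (fun=> `](- k%:R), k%:R]%classic) => // i; exact: measurable_itv.
- rewrite -subTset => x _; exists (Num.truncn (\sum_i `|x 0 i|)).+1 => // i /=.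
  have : `|x 0 i| < (Num.truncn (\sum_i `|x 0 i|)).+1%:R.
    apply: le_lt_trans (truncnS_gt _).
    by rewrite (bigD1 i)//= lerDl sumr_ge0.
  by rewrite in_itv/= ltr_norml => /andP[-> /ltW ->].
- by move=> _ [A mA <-]; rewrite mE//; exact: lebesgue_rV_boxE.
- move=> k; have kE : k%:R = - k%:R + 2 * k%:R :> R by lra.
  rewrite {2}kE.
  apply: le_lt_trans (ltry ((2 * k%:R : R) ^+ n)).
  by rewrite -(@lebesgue_rV_cube n (- k%:R))// mulr_ge0.
Qed.
End lebesgue_rV_unique.

Section affine.
Context (R : realType).

Let affine1 (c v : R) : measurableTypeR R -> measurableTypeR R := fun t => c * t + v.

Let measurable_affine1 c v : measurable_fun setT (affine1 c v).
Proof.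
apply: measurable_funD; last exact: measurable_cst.
by apply: measurable_funM; [exact: measurable_cst|exact: measurable_id].
Qed.

(** For c > 0 the preimage of a half-open interval is half-open on the same side, so the scaled
    pushforward agrees with Lebesgue measure on the intervals that determine it. *)
Lemma lebesgue_measure_affine (c v : R) (A : set (measurableTypeR R)) : 0 < c ->
  measurable A ->
  lebesgue_measure A = (c%:E * lebesgue_measure ((fun t => c * t + v)%R @^-1` A))%E.
Proof.
move=> c0 mA.
pose cn : {nonneg R} := NngNum (ltW c0).
pose m : {measure set (measurableTypeR R) -> \bar R} :=
  mscale cn (pushforward lebesgue_measure (affine1 c v)).
rewrite (@lebesgue_measure_unique _ (m (measurable_affine1 c v)) _ _ mA)// => _ [[x y] _ <-]/=.
rewrite /m /mscale/= /pushforward/=.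
rewrite (_ : _ @^-1` _ = `](x - v) / c, (y - v) / c]%classic); last first.
  apply/seteqP; split=> t /=; rewrite /affine1 !in_itv/= ltr_pdivrMr// ler_pdivlMr//;
  by rewrite ltrBlDr lerBrDr [t * c]mulrC.
rewrite !lebesgue_measure_itv/= !lte_fin ltr_pM2r ?invr_gt0// ltrD2r.
case: ifP => _; last by rewrite mule0.
rewrite -!EFinB -EFinM; congr EFin; field; exact: lt0r_neq0.
Qed.

Let affine n (c : R) (v : 'rV[R]_n) (x : 'rV[R]_n) := c *: x + v.

Lemma measurable_affine n (c : R) (v : 'rV[R]_n) :
  measurable_fun setT (fun x : 'rV[R]_n => c *: x + v).
Proof.
apply/measurable_fun_rVP => i.
rewrite (_ : _ \o _ = affine1 c (v 0 i) \o @rV_coord R n i).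
  apply: measurableT_comp; first exact: measurable_affine1.
  exact: measurable_rV_coord.
by apply/funext => x; rewrite /= /rV_coord !mxE.
Qed.

Lemma lebesgue_rV_affine n (c : R) (v : 'rV[R]_n) (A : set 'rV[R]_n) : 0 < c ->
  measurable A ->
  lebesgue_rV R n A =
    ((c ^+ n)%:E * lebesgue_rV R n ((fun x => c *: x + v)%R @^-1` A))%E.
Proof.
move=> c0 mA.
pose cn : {nonneg R} := NngNum (exprn_ge0 n (ltW c0)).
pose m : {measure set 'rV[R]_n -> \bar R} :=
  mscale cn (pushforward (lebesgue_rV R n) (affine c v)).
rewrite (@lebesgue_rV_unique _ _ (m (@measurable_affine n c v)) _ _ mA)// => B mB.
have BE : affine c v @^-1` rV_box B = rV_box (fun i t => B i (c * t + v 0 i)).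
  by apply/seteqP; split=> x /= h i; have := h i; rewrite /rV_coord !mxE.
transitivity ((c ^+ n)%:E * lebesgue_rV R n (affine c v @^-1` rV_box B))%E.
  by [].
rewrite BE lebesgue_rV_boxE => [|i]; last first.
  by rewrite -[X in measurable X]setTI; exact: measurable_affine1.
rewrite [RHS](eq_bigr (fun i => c%:E * lebesgue_measure ((fun t => c * t + v 0 i)%R @^-1` B i))%E);
  last by move=> i _; exact: lebesgue_measure_affine.
rewrite big_split/=; congr (_ * _)%E.
by rewrite prodEFin prodr_const card_ord.
Qed.

End affine.

(** * Borel measurability on row vectors *)

Section borel_rV.
Context (R : realType).

Lemma mx_ballP n (x y : 'rV[R]_n) (e : R) : 0 < e ->
  ball x e y <-> forall i, `|x 0 i - y 0 i| < e.
Proof.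
move=> e0; split=> [[_ h] i|h]; first exact: h.
by split=> // i j; rewrite ord1; exact: h.
Qed.

(** The sigma-algebra is a product one, whereas continuity refers to the sup-norm topology. An open
    set is the union of those balls with rational centre and radius 1/(k+1) that it contains; they
    are countably many, and each is an open box. *)
Lemma measurable_rV_open n (U : set 'rV[R]_n) : open U -> measurable U.
Proof.
move=> oU.
pose c (p : 'rV[rat]_n * nat) : 'rV[R]_n := \row_i ratr (p.1 0 i).
pose B (p : 'rV[rat]_n * nat) : set 'rV[R]_n :=
  if `[< ball (c p) p.2.+1%:R^-1 `<=` U >]
  then ball (c p) p.2.+1%:R^-1 else set0.
rewrite (_ : U = \bigcup_p B p); last first.
  apply/seteqP; split=> [x Ux|x [p _]]; last first.
    by rewrite /B; case: ifPn => // /asboolP; exact.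
  have /nbhs_ballP[e /= e0 xU] : nbhs x U by exact: open_nbhs_nbhs.
  have [k ke] : exists k : nat, k.+1%:R^-1 < e / 2.
    exists (Num.truncn (e / 2)^-1).
    rewrite -[ltRHS]invrK ltf_pV2 ?posrE ?invr_gt0 ?divr_gt0//.
    exact: truncnS_gt.
  have [q qx] : exists q : 'I_n -> rat, forall i, `|ratr (q i) - x 0 i| < k.+1%:R^-1.
    suff /choice : forall i, exists q : rat, `|ratr q - x 0 i| < k.+1%:R^-1.
      by case=> q; exists q.
    move=> i.
    have : x 0 i - k.+1%:R^-1 < x 0 i + k.+1%:R^-1.
      by rewrite ltrBlDr -addrA ltrDl addr_gt0 ?invr_gt0.
    move=> /rat_in_itvoo[q]; rewrite in_itv/= => /andP[q1 q2].
    by exists q; rewrite ltr_norml ltrBrDr addrC q1 ltrBlDr addrC.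
  exists (\row_i q i, k) => //; rewrite /B ifT.
    by apply/mx_ballP => [|i]; rewrite ?invr_gt0// !mxE.
  apply/asboolP => y /mx_ballP; rewrite invr_gt0 ltr0Sn => /(_ isT) qy.
  apply/xU/mx_ballP => // i.
  move: (qy i) (qx i); rewrite !mxE.
  move: (ratr _) (x _ _) (y _ _) (k.+1%:R^-1) ke => a b b' t; rewrite !ltr_norml.
  by move=> ? /andP[? ?] /andP[? ?]; apply/andP; split; lra.
apply: countable_bigcupT_measurable; first exact: countableP.
move=> p; rewrite /B; case: ifP => _; last exact: measurable0.
rewrite (_ : ball _ _ = rV_box (fun i =>
  [set` `](ratr (p.1 0 i) - p.2.+1%:R^-1), (ratr (p.1 0 i) + p.2.+1%:R^-1)[])).
  by apply: measurable_rV_box => i; exact: measurable_itv.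
apply/seteqP; split=> [y /mx_ballP|y h].
  rewrite invr_gt0 ltr0Sn => /(_ isT) h i.
  have := h i; rewrite !mxE /rV_coord/= in_itv/= ltr_norml.
  move: (ratr _) (y _ _) (_^-1) => a b t /andP[? ?]; apply/andP; split; lra.
apply/mx_ballP => [|i]; rewrite ?invr_gt0//; have := h i.
rewrite /rV_coord/= in_itv/= !mxE ltr_norml.
move: (ratr _) (y _ _) (_^-1) => a b t /andP[? ?]; apply/andP; split; lra.
Qed.

Lemma measurable_rV_continuous n (f : 'rV[R]_n -> R) :
  continuous (f : 'rV[R]_n -> R^o) ->
  measurable_fun setT (f : _ -> measurableTypeR R).
Proof.
move=> cf mT; apply: (measurability _ (RGenOpens.measurableE R)) => //.
move=> _ [_ [a [b ->]] <-]; rewrite setTI; apply: measurable_rV_open.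
by apply: (@open_comp _ R^o) => [x _|]; [exact: cf|exact: interval_open].
Qed.

End borel_rV.

Section split_rV.
Context (R : realType) (m n : nat).

Definition rV_pair (p : 'rV[R]_m * 'rV[R]_n) : 'rV[R]_(m + n) := row_mx p.1 p.2.

Lemma measurable_rV_pair : measurable_fun setT rV_pair.
Proof.
apply/measurable_fun_rVP => i; rewrite -(fintype.splitK i); case: (fintype.split i) => j /=.
  rewrite (_ : _ \o _ = @rV_coord R m j \o fst).
    exact: measurableT_comp (@measurable_rV_coord R m j) measurable_fst.
  by apply/funext => p; rewrite /= /rV_coord /rV_pair row_mxEl.
rewrite (_ : _ \o _ = @rV_coord R n j \o snd).
  exact: measurableT_comp (@measurable_rV_coord R n j) measurable_snd.
by apply/funext => p; rewrite /= /rV_coord /rV_pair row_mxEr.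
Qed.

Local Notation mu k := (lebesgue_rV R k).
Local Open Scope ereal_scope.

Lemma lebesgue_rV_split (B : set 'rV[R]_(m + n)) : measurable B ->
  mu (m + n) B = pushforward (mu m \x mu n) rV_pair B.
Proof.
move=> mB.
pose p : {measure set 'rV[R]_(m + n) -> \bar R} := pushforward (mu m \x mu n) rV_pair.
rewrite (@lebesgue_rV_unique _ _ (p measurable_rV_pair) _ _ mB)// => A mA.
transitivity ((mu m \x mu n) (rV_box (fun i => A (lshift n i)) `*`
                              rV_box (fun i => A (rshift m i)))).
  congr (product_measure1 _ _ _); apply/seteqP; split=> -[x y] /= h.
    split=> i; first by have := h (lshift n i); rewrite /rV_coord row_mxEl.
    by have := h (rshift m i); rewrite /rV_coord row_mxEr.
  move=> i; rewrite -(fintype.splitK i); case: (fintype.split i) => j /=.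
    by rewrite /rV_coord row_mxEl; exact: h.1.
  by rewrite /rV_coord row_mxEr; exact: h.2.
rewrite product_measure1E; [|exact: measurable_rV_box..].

rewrite [RHS]big_split_ord/=; congr (_ * _); exact: lebesgue_rV_boxE.
Qed.

End split_rV.

Section integral_rV.
Context (R : realType).
Local Notation mu n := (lebesgue_rV R n).
Local Open Scope ereal_scope.

Lemma ge0_integral_rV_affine n (c : R) (v : 'rV[R]_n) (f : 'rV[R]_n -> \bar R) :
  (0 < c)%R -> measurable_fun setT f -> (forall x, 0 <= f x) ->
  \int[mu n]_x f x = (c ^+ n)%:E * \int[mu n]_x f (c *: x + v)%R.
Proof.
move=> c0 mf f0.
pose cn : {nonneg R} := NngNum (exprn_ge0 n (ltW c0)).
pose m : {measure set 'rV[R]_n -> \bar R} :=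
  mscale cn (pushforward (mu n) (fun x : 'rV[R]_n => c *: x + v)%R).
rewrite (@eq_measure_integral _ _ _ _ (m (@measurable_affine R n c v))); last first.
  by move=> A mA _; exact: lebesgue_rV_affine.
rewrite /m ge0_integral_mscale//; congr (_ * _).
rewrite ge0_integral_pushforward// ?preimage_setT//.
exact: measurable_affine.
Qed.

Lemma integrable_rV_affine n (c : R) (v : 'rV[R]_n) (f : 'rV[R]_n -> \bar R) :
  (0 < c)%R -> (mu n).-integrable setT f ->
  (mu n).-integrable setT (fun x => f (c *: x + v)%R).
Proof.
move=> c0 /integrableP[mf foo]; have maff := @measurable_affine R n c v.
apply/integrableP; split; first exact: measurableT_comp.
move: foo; rewrite (@ge0_integral_rV_affine n c v) => [|//||//]; last first.
  exact: measurableT_comp.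
by case: (\int[_]_x _) => [r||]; rewrite ?ltry// gt0_muley// lte_fin exprn_gt0.
Qed.

Lemma integral_rV_affine n (c : R) (v : 'rV[R]_n) (f : 'rV[R]_n -> \bar R) :
  (0 < c)%R -> (mu n).-integrable setT f ->
  \int[mu n]_x f x = (c ^+ n)%:E * \int[mu n]_x f (c *: x + v)%R.
Proof.
move=> c0 fi; have /integrableP[mf _] := fi.
rewrite integralE [in RHS]integralE muleBr//; last first.
  exact/integrable_add_def/integrable_rV_affine.
congr (_ - _); rewrite (@ge0_integral_rV_affine n c v)//;
  solve [by rewrite unlock | exact: measurable_funepos | exact: measurable_funeneg].
Qed.

Lemma ge0_integral_rV_split m n (f : 'rV[R]_(m + n) -> \bar R) :
  measurable_fun setT f -> (forall x, 0 <= f x) ->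
  \int[mu (m + n)]_z f z = \int[mu m \x mu n]_p f (rV_pair p).
Proof.
move=> mf f0.
pose p : {measure set 'rV[R]_(m + n) -> \bar R} :=
  pushforward (mu m \x mu n) (@rV_pair R m n).
rewrite (@eq_measure_integral _ _ _ _ (p (@measurable_rV_pair R m n))); last first.
  by move=> A mA _; exact: lebesgue_rV_split.
rewrite /p ge0_integral_pushforward// ?preimage_setT//.
exact: measurable_rV_pair.
Qed.

Lemma integral_rV_split m n (f : 'rV[R]_(m + n) -> \bar R) :
  (mu (m + n)).-integrable setT f ->
  (mu m \x mu n).-integrable setT (f \o @rV_pair R m n) /\
  \int[mu (m + n)]_z f z = \int[mu m \x mu n]_p f (rV_pair p).
Proof.
move=> /integrableP[mf foo]; have mp := @measurable_rV_pair R m n; split.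
  apply/integrableP; split; first exact: measurableT_comp.
  rewrite -(@ge0_integral_rV_split m n (abse \o f)) => [//||x].
    by apply: measurableT_comp mf; exact: abse_measurable.
  exact: abse_ge0.
rewrite integralE [in RHS]integralE.
congr (_ - _); rewrite ge0_integral_rV_split//;
  solve [by rewrite unlock | exact: measurable_funepos | exact: measurable_funeneg].
Qed.

(** Tonelli's theorem, one coordinate at a time through [rV_cons]. It is applied to 1/(1 + t^2), for
    integrability of powers of the bracket, and to the Gaussian. *)
Lemma ge0_integral_rV_prod n (f : R -> R) (c : R) :
  measurable_fun setT f -> (forall t, 0 <= f t)%R ->
  \int[lebesgue_measure]_t (f t)%:E = c%:E ->
  \int[mu n]_x (\prod_(i < n) f (x 0%R i))%:E = (c ^+ n)%:E.
Proof.
move=> mf f0 fc; elim: n => [|n IH].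
  rewrite (eq_integral (cst 1)) => [|x _]; last by rewrite big_ord0.
  by rewrite integral_cst//= diracT mule1.
have mP k : measurable_fun setT (fun x : 'rV[R]_k => (\prod_(i < k) f (x 0%R i))%:E).
  apply/measurable_EFinP; apply: measurable_prod => i _.
  by apply: measurableT_comp => //; exact: measurable_rV_coord.
have mc := @measurable_rV_cons R n.
rewrite /= (ge0_integral_pushforward mc)//; last 2 first.
- exact: mP.
- by move=> x _; rewrite lee_fin prodr_ge0.
rewrite preimage_setT fubini_tonelli1//=; last 2 first.
- by apply: measurableT_comp => //; exact: mP.
- by move=> x; rewrite lee_fin prodr_ge0.
rewrite /fubini_F/=.
transitivity (\int[lebesgue_measure]_t ((c ^+ n)%:E * (f t)%:E)).
  apply: eq_integral => t _; rewrite -IH muleC -ge0_integralZl//; last 3 first.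
  - exact: mP.
  - by move=> x _; rewrite lee_fin prodr_ge0.
  - by rewrite lee_fin.
  - apply: eq_integral => x _; rewrite -EFinM big_ord_recl; congr EFin.
    congr (f _ * _)%R; first exact: rV_cons0.
    by apply: eq_bigr => i _; congr f; exact: rV_consS.
rewrite ge0_integralZl//= ?fc ?exprSr//.
- exact/measurable_EFinP.
- by move=> t _; rewrite lee_fin.
- rewrite lee_fin exprn_ge0// -lee_fin -fc.
  by apply: integral_ge0 => t _; rewrite lee_fin.
Qed.

End integral_rV.

(** * Integrability of negative powers of the bracket *)

Section japanese_integral.
Context (R : realType).
Local Notation mu n := (lebesgue_rV R n).

Lemma rV_continuousP (T : topologicalType) n (f : T -> 'rV[R]_n) :
  (forall i, continuous (fun x => f x 0 i : R^o)) -> continuous f.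
Proof.
move=> cf x; apply/cvg_ballP => e e0.
have : \forall y \near x, forall i, `|f x 0 i - f y 0 i| < e.
  apply: filter_forall => i.
  by have /cvgrPdist_lt/(_ e e0) := cf i x.
by apply: filterS => y h; apply/mx_ballP.
Qed.

Lemma continuous_rV_coord n (i : 'I_n) : continuous (fun x : 'rV[R]_n => x 0 i : R^o).
Proof. exact: coord_continuous. Qed.

Lemma continuous_comp_fun (T U V : topologicalType) (f : T -> U) (g : U -> V) :
  continuous f -> continuous g -> continuous (fun x => g (f x)).
Proof. by move=> cf cg x; apply: continuous_comp; [exact: cf|exact: cg]. Qed.

Lemma continuous_sum (T : topologicalType) (I : Type) (r : seq I) (f : I -> T -> R^o) :
  (forall i, continuous (f i)) -> continuous (fun x => \sum_(i <- r) f i x).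
Proof.
move=> cf; elim: r => [|i r IH].
  under eq_fun do rewrite big_nil; exact: cst_continuous.
under eq_fun do rewrite big_cons.
by move=> x; apply: (@cvgD _ R^o); [exact: cf|exact: IH].
Qed.

Lemma continuous_mulR (T : topologicalType) (f g : T -> R^o) :
  continuous f -> continuous g -> continuous (fun x => f x * g x : R^o).
Proof. by move=> cf cg x; apply: (@cvgM R); [exact: cf|exact: cg]. Qed.

Lemma continuous_addR (T : topologicalType) (f g : T -> R^o) :
  continuous f -> continuous g -> continuous (fun x => f x + g x : R^o).
Proof. by move=> cf cg x; apply: (@cvgD R R^o); [exact: cf|exact: cg]. Qed.

Lemma continuous_expnR (T : topologicalType) (f : T -> R^o) k :
  continuous f -> continuous (fun x => f x ^+ k : R^o).
Proof.
move=> cf; elim: k => [|k IH]; first exact: cst_continuous.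
by under eq_fun do rewrite exprS; exact: continuous_mulR.
Qed.

Lemma continuous_invR (T : topologicalType) (f : T -> R^o) :
  (forall x, f x != 0) -> continuous f -> continuous (fun x => (f x)^-1 : R^o).
Proof. by move=> f0 cf x; apply: (@cvgV R); [exact: f0|exact: cf]. Qed.

Lemma continuous_dot (T : topologicalType) n (f g : T -> 'rV[R]_n) :
  continuous f -> continuous g -> continuous (fun x => dot (f x) (g x) : R^o).
Proof.
move=> cf cg; apply: continuous_sum => i.
have cc h : continuous h -> continuous (fun x : T => (h x : 'rV[R]_n) 0 i : R^o).
  move=> ch; apply: (@continuous_comp_fun _ _ R^o h (fun v => v 0 i) ch).
  exact: continuous_rV_coord.
by apply: continuous_mulR; exact: cc.
Qed.

Lemma continuous_jp n : continuous (@japanese R n : 'rV[R]_n -> R^o).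
Proof.
have cid : continuous (@id 'rV[R]_n) by move=> y; exact: cvg_id.
have := continuous_addR (@cst_continuous _ R^o (1 : R)) (continuous_dot cid cid).
move=> /continuous_comp_fun /(_ (@sqrt_continuous R)).
by under eq_fun do rewrite -enorm_sqr.
Qed.

Lemma integral_oneDsqr : (\int[lebesgue_measure]_x ((oneDsqr x)^-1 : R)%:E = (pi : R)%:E)%E.
Proof.
rewrite (@ge0_symfun_integralT _ (fun x => (oneDsqr x)^-1))//=.
- rewrite (_ : [set x | _] = `[0, +oo[%classic); last first.
    by apply/seteqP; split => x/=; rewrite in_itv/= andbT.
  by rewrite integral0y_oneDsqr -EFinM mulrCA divff// mulr1.
- exact: continuous_oneDsqrV.
- by move=> x/=; rewrite /oneDsqr sqrrN.
Qed.

(** Since 1 + x_i^2 <= <x>^2 for each i, <x>^(-2n) lies below the product of the functions 1/(1 +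
    x_i^2). This comparison is the origin of the exponent [n.*2] that guarantees integrability
    throughout. *)
Lemma integrable_jp n : (mu n).-integrable setT (fun x => (jp x ^- n.*2)%:E).
Proof.
apply: (le_integrable _ (g := fun x : 'rV[R]_n => (\prod_(i < n) (oneDsqr (x 0 i))^-1)%:E)) => //.
- apply/measurable_EFinP; apply: measurable_rV_continuous.
  apply: continuous_invR (continuous_expnR (@continuous_jp n)) => x.
  by rewrite gt_eqF// jpX_gt0.
- move=> x _; rewrite !gee0_abs ?lee_fin ?invr_ge0 ?exprn_ge0//; last first.
    by apply: prodr_ge0 => i _; rewrite invr_ge0.
  rewrite prodfV lef_pV2 ?posrE ?jpX_gt0//; last by apply: prodr_gt0 => i _.
  have -> : jp x ^+ n.*2 = \prod_(i < n) jp x ^+ 2.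
    by rewrite prodr_const card_ord -exprM mul2n.
  apply: ler_prod => i _; rewrite (le_trans ler01 (oneDsqr_ge1 _))/= jp_sqr /oneDsqr lerD2l.
  by rewrite /dot (bigD1 i)//= -expr2 lerDl sumr_ge0// => j _; rewrite -expr2 sqr_ge0.
- apply/integrableP; split.
    apply/measurable_EFinP; apply: measurable_prod => i _.
    apply: (measurableT_comp (f := fun t : measurableTypeR R => (oneDsqr t)^-1));
      last exact: measurable_rV_coord.
    by apply: continuous_measurable_fun; exact: continuous_oneDsqrV.
  under eq_integral => x _.
    rewrite gee0_abs; last by rewrite lee_fin prodr_ge0// => i _; rewrite invr_ge0.
    over.
  rewrite (ge0_integral_rV_prod n _ _ integral_oneDsqr) ?ltry//.
  by apply: continuous_measurable_fun; exact: continuous_oneDsqrV.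
Qed.

Definition int_jp n : R := \int[mu n]_x (jp x ^- n.*2).

Lemma int_jp_ge0 n : 0 <= int_jp n.
Proof. by apply: Rintegral_ge0 => x _; rewrite invr_ge0 exprn_ge0. Qed.

End japanese_integral.

(** * Complex-valued integrals *)

Section complex_continuity.
Context (R : realType).

(** Componentwise, to match [smooth], [partial] and [cintegral], which treat real and imaginary
    parts separately. *)
Definition ccont (T : topologicalType) (f : T -> R[i]) :=
  continuous (fun x => complex.Re (f x) : R^o) /\
  continuous (fun x => complex.Im (f x) : R^o).

Section ccont_ops.
Context (T : topologicalType).
Implicit Types f g : T -> R[i].

Lemma ccont_cst (c : R[i]) : ccont (fun _ : T => c).
Proof. by split; exact: cst_continuous. Qed.

Lemma continuous_oppR (h : T -> R^o) : continuous h -> continuous (fun x => - h x : R^o).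
Proof. by move=> ch x; apply: (@cvgN R R^o); exact: ch. Qed.

Lemma ccontN f : ccont f -> ccont (fun x => - f x).
Proof.
move=> [cr ci]; split; [under eq_fun do rewrite cReN|under eq_fun do rewrite cImN];
exact: continuous_oppR.
Qed.

Lemma ccontD f g : ccont f -> ccont g -> ccont (fun x => f x + g x).
Proof.
move=> [cr ci] [dr di]; split; [under eq_fun do rewrite cReD|under eq_fun do rewrite cImD];
exact: continuous_addR.
Qed.

Lemma ccontM f g : ccont f -> ccont g -> ccont (fun x => f x * g x).
Proof.
move=> [cr ci] [dr di]; split.
  under eq_fun do rewrite cReM; apply: continuous_addR; first exact: continuous_mulR.
  by apply: continuous_oppR; exact: continuous_mulR.
by under eq_fun do rewrite cImM; apply: continuous_addR; exact: continuous_mulR.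
Qed.

Lemma ccontB f g : ccont f -> ccont g -> ccont (fun x => f x - g x).
Proof. by move=> cf cg; apply: ccontD => //; exact: ccontN. Qed.

Lemma ccontR (h : T -> R^o) : continuous h -> ccont (fun x => (h x)%:C).
Proof. by move=> ch; split=> //=; exact: cst_continuous. Qed.

Lemma ccont_conj f : ccont f -> ccont (fun x => conjc (f x)).
Proof.
move=> [cr ci]; split; [under eq_fun do rewrite cRe_conj|under eq_fun do rewrite cIm_conj] => //.
exact: continuous_oppR.
Qed.

Lemma ccont_expi (h : T -> R^o) : continuous h -> ccont (fun x => expi (h x)).
Proof.
move=> ch; split=> /=; apply: (continuous_comp_fun ch);
  [exact: continuous_cos|exact: continuous_sin].
Qed.

End ccont_ops.

Lemma ccont_comp (S T : topologicalType) (f : S -> T) (g : T -> R[i]) :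
  continuous f -> ccont g -> ccont (fun x => g (f x)).
Proof. by move=> cf [cr ci]; split; [exact: (continuous_comp_fun cf cr)|exact: (continuous_comp_fun cf ci)].
Qed.

Lemma continuous_row_mx (T : topologicalType) m n (f : T -> 'rV[R]_m) (g : T -> 'rV[R]_n) :
  continuous f -> continuous g -> continuous (fun x => row_mx (f x) (g x)).
Proof.
have cc k (h : T -> 'rV[R]_k) i : continuous h -> continuous (fun x : T => h x 0 i : R^o).
  move=> ch; apply: (@continuous_comp_fun _ _ R^o h (fun v => v 0 i) ch).
  exact: continuous_rV_coord.
move=> cf cg; apply: rV_continuousP => i.
rewrite -(fintype.splitK i); case: (fintype.split i) => j /=.
  by under eq_fun do rewrite row_mxEl; exact: cc.
by under eq_fun do rewrite row_mxEr; exact: cc.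
Qed.

Lemma continuous_scaleR n (c : R) : continuous (fun x : 'rV[R]_n => c *: x).
Proof.
apply: rV_continuousP => i; under eq_fun do rewrite mxE.
by apply: continuous_mulR; [exact: cst_continuous|exact: continuous_rV_coord].
Qed.

Lemma continuous_addrV (T : topologicalType) n (f g : T -> 'rV[R]_n) :
  continuous f -> continuous g -> continuous (fun x => f x + g x).
Proof. by move=> cf cg x; apply: cvgD; [exact: cf|exact: cg]. Qed.

Lemma continuous_subrV (T : topologicalType) n (f g : T -> 'rV[R]_n) :
  continuous f -> continuous g -> continuous (fun x => f x - g x).
Proof. by move=> cf cg x; apply: cvgB; [exact: cf|exact: cg]. Qed.

End complex_continuity.

Section complex_integral.
Context (R : realType).
Local Notation mu n := (lebesgue_rV R n).

Definition cintegrable n (f : 'rV[R]_n -> R[i]) :=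
  (mu n).-integrable setT (fun x => (complex.Re (f x))%:E) /\
  (mu n).-integrable setT (fun x => (complex.Im (f x))%:E).

Definition decay n N C (f : 'rV[R]_n -> R[i]) :=
  forall x, jp x ^+ N * normc (f x) <= C.

Section fixed_dimension.
Context (n : nat).
Implicit Types f g : 'rV[R]_n -> R[i].

Lemma decay_ge0 N C f : decay N C f -> 0 <= C.
Proof. by move=> /(_ 0); apply: le_trans; rewrite mulr_ge0// exprn_ge0. Qed.

Lemma decay_leX N M C f : (N <= M)%N -> decay M C f -> decay N C f.
Proof.
by move=> NM h x; apply: le_trans (h x); rewrite ler_wpM2r// jp_leX.
Qed.

Lemma integrable_decay N (h : 'rV[R]_n -> R) (C : R) :
  measurable_fun setT h -> (n.*2 <= N)%N ->
  (forall x, jp x ^+ N * `|h x| <= C) -> (mu n).-integrable setT (EFin \o h).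
Proof.
move=> mh nN hC; apply: (le_integrable _ (g := fun x => (C%:E * (jp x ^- n.*2)%:E)%E)) => //.
- exact/measurable_EFinP.
- move=> x _; rewrite -EFinM !abse_EFin lee_fin; apply: le_trans (ler_norm _).
  rewrite ler_pdivlMr ?jpX_gt0// mulrC; apply: le_trans (hC x).
  by rewrite ler_wpM2r// jp_leX.
- by apply: integrableZl => //; exact: integrable_jp.
Qed.

Lemma cintegrable_decay N f C : ccont f -> (n.*2 <= N)%N -> decay N C f -> cintegrable f.
Proof.
move=> [cr ci] nN fC; split; apply: (@integrable_decay N _ C) => //.
- exact: measurable_rV_continuous.
- by move=> x; apply: le_trans (fC x); rewrite ler_wpM2l ?exprn_ge0// le_Re_normc.
- exact: measurable_rV_continuous.
- by move=> x; apply: le_trans (fC x); rewrite ler_wpM2l ?exprn_ge0// le_Im_normc.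
Qed.

Lemma normr_Rintegral_decay (h : 'rV[R]_n -> R) (C : R) :
  (mu n).-integrable setT (EFin \o h) -> (forall x, jp x ^+ n.*2 * `|h x| <= C) ->
  `|\int[mu n]_x h x| <= C * int_jp R n.
Proof.
move=> ih hC; apply: le_trans (le_normr_Rintegral _ ih) _ => //.
rewrite /int_jp -RintegralZl//; last exact: integrable_jp.
apply: le_Rintegral => //.
- exact: integrable_norm.
- apply: (@eq_integrable _ _ _ _ _ _ _ (fun x => C%:E * (jp x ^- n.*2)%:E)%E) => //.
  by apply: integrableZl => //; exact: integrable_jp.
- by move=> x _; rewrite ler_pdivlMr ?jpX_gt0// mulrC.
Qed.

(** Real and imaginary parts are estimated separately, hence the factor 2. *)
Lemma normc_cintegral_le f C : cintegrable f -> decay n.*2 C f ->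
  normc (cintegral f) <= 2 * C * int_jp R n.
Proof.
move=> [ir ii] fC; apply: le_trans (normc_le _) _; rewrite -mulrA mulr_natl mulr2n.
apply: lerD; apply: normr_Rintegral_decay => // x; apply: le_trans (fC x).
  by rewrite ler_wpM2l ?exprn_ge0// le_Re_normc.
by rewrite ler_wpM2l ?exprn_ge0// le_Im_normc.
Qed.

Lemma cintegrableD f g : cintegrable f -> cintegrable g ->
  cintegrable (fun x => f x + g x).
Proof.
move=> [fr fi] [gr gi]; split.
  have := integrableD measurableT fr gr; apply: eq_integrable => // x _.
  by rewrite /= cReD.
have := integrableD measurableT fi gi; apply: eq_integrable => // x _.
by rewrite /= cImD.
Qed.

Lemma cintegrableZ (c : R[i]) f : cintegrable f -> cintegrable (fun x => c * f x).
Proof.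
move=> [fr fi]; split.
  have := integrableB measurableT (integrableZl measurableT (complex.Re c) fr)
    (integrableZl measurableT (complex.Im c) fi); apply: eq_integrable => // x _.
  by rewrite /= cReM.
have := integrableD measurableT (integrableZl measurableT (complex.Re c) fi)
  (integrableZl measurableT (complex.Im c) fr); apply: eq_integrable => // x _.
by rewrite /= cImM.
Qed.

Lemma cintegralD f g : cintegrable f -> cintegrable g ->
  cintegral (fun x => f x + g x) = cintegral f + cintegral g.
Proof.
move=> [fr fi] [gr gi]; rewrite /cintegral; apply: complex_eqP => /=.
  by under eq_Rintegral do rewrite cReD; rewrite RintegralD.
by under eq_Rintegral do rewrite cImD; rewrite RintegralD.
Qed.

Lemma cintegralZ (c : R[i]) f : cintegrable f ->
  cintegral (fun x => c * f x) = c * cintegral f.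
Proof.
move=> [fr fi]; have zi (k : R) (h : 'rV[R]_n -> R) :
    (mu n).-integrable setT (fun x => (h x)%:E) ->
    (mu n).-integrable setT (EFin \o (fun x => k * h x)).
  by move=> hi; have := integrableZl measurableT k hi; exact: eq_integrable.
apply: complex_eqP; rewrite ?cReM ?cImM /=.
  under eq_Rintegral do rewrite cReM.
  by rewrite RintegralB// ?RintegralZl//; exact: zi.
under eq_Rintegral do rewrite cImM.
by rewrite RintegralD// ?RintegralZl//; exact: zi.
Qed.

Lemma cintegrableB f g : cintegrable f -> cintegrable g ->
  cintegrable (fun x => f x - g x).
Proof.
move=> fi gi; have := cintegrableD fi (cintegrableZ (-1) gi).
by under [X in cintegrable X -> _]eq_fun do rewrite mulN1r.
Qed.

Lemma cintegralB f g : cintegrable f -> cintegrable g ->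
  cintegral (fun x => f x - g x) = cintegral f - cintegral g.
Proof.
move=> fi gi; have := cintegralD fi (cintegrableZ (-1) gi).
rewrite cintegralZ// mulN1r => <-.
by congr cintegral; apply/funext => x; rewrite mulN1r.
Qed.

Lemma Rintegral_rV_affine (c : R) v (h : 'rV[R]_n -> R) : 0 < c ->
  (mu n).-integrable setT (fun x => (h x)%:E) ->
  \int[mu n]_x h x = c ^+ n * \int[mu n]_x h (c *: x + v).
Proof.
move=> c0 hi; rewrite -RintegralZl//; last exact: (integrable_rV_affine v c0 hi).
rewrite /Rintegral (integral_rV_affine v c0 hi) -integralZl//.
exact: (integrable_rV_affine v c0 hi).
Qed.

Lemma cintegral_affine (c : R) v f : 0 < c -> cintegrable f ->
  cintegral f = (c ^+ n)%:C * cintegral (fun x => f (c *: x + v)).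
Proof.
move=> c0 [fr fi]; apply: complex_eqP; rewrite ?cReM ?cImM /= mul0r ?subr0 ?addr0;
exact: Rintegral_rV_affine.
Qed.

Lemma cintegral_shift v f : cintegrable f ->
  cintegral (fun x => f (x + v)) = cintegral f.
Proof.
move=> fi; rewrite [RHS](cintegral_affine v ltr01 fi) expr1n mul1r.
by congr cintegral; apply/funext => x; rewrite scale1r.
Qed.

End fixed_dimension.

Section split.
Context (m n : nat).

(** Fubini's theorem controls almost every slice only. Integrability of all slices makes every inner
    integral finite, so that passing from extended reals to reals by [fine] is harmless at each
    point. *)
Lemma Rintegral_split (h : 'rV[R]_(m + n) -> R) :
  (mu (m + n)).-integrable setT (fun z => (h z)%:E) ->
  (forall x, (mu n).-integrable setT (fun y => (h (row_mx x y))%:E)) ->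
  (forall y, (mu m).-integrable setT (fun x => (h (row_mx x y))%:E)) ->
  \int[mu (m + n)]_z h z = \int[mu m]_x \int[mu n]_y h (row_mx x y) /\
  \int[mu (m + n)]_z h z = \int[mu n]_y \int[mu m]_x h (row_mx x y).
Proof.
move=> hi hx hy; rewrite /Rintegral; have [hp ->] := integral_rV_split hi; split.
  rewrite -integral12_prod_meas1//; congr fine; apply: eq_integral => x _.
  by rewrite fineK//; apply: integrable_fin_num => //; exact: hx.
rewrite -integral21_prod_meas1//; congr fine; apply: eq_integral => y _.
by rewrite fineK//; apply: integrable_fin_num => //; exact: hy.
Qed.

Variables (F : 'rV[R]_(m + n) -> R[i]) (C : R).
Hypotheses (Fc : ccont F) (FC : decay (m + n).*2 C F).

Lemma ccont_row_mxr x : ccont (fun y => F (row_mx x y)).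
Proof.
apply: ccont_comp Fc; apply: continuous_row_mx; first exact: cst_continuous.
by move=> y; exact: cvg_id.
Qed.

Lemma ccont_row_mxl y : ccont (fun x => F (row_mx x y)).
Proof.
apply: ccont_comp Fc; apply: continuous_row_mx; last exact: cst_continuous.
by move=> x; exact: cvg_id.
Qed.

Lemma cintegrable_row_mxr x : cintegrable (fun y => F (row_mx x y)).
Proof.
apply: (@cintegrable_decay _ (m + n).*2 _ C); first exact: ccont_row_mxr.
  by rewrite leq_double leq_addl.
move=> y; apply: le_trans (FC (row_mx x y)); rewrite ler_wpM2r//.
by rewrite lerXn2r ?nnegrE// jp_row_mxr.
Qed.

Lemma cintegrable_row_mxl y : cintegrable (fun x => F (row_mx x y)).
Proof.
apply: (@cintegrable_decay _ (m + n).*2 _ C); first exact: ccont_row_mxl.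
  by rewrite leq_double leq_addr.
move=> x; apply: le_trans (FC (row_mx x y)); rewrite ler_wpM2r//.
by rewrite lerXn2r ?nnegrE// jp_row_mxl.
Qed.

Lemma cintegral_splitl :
  cintegral F = cintegral (fun x => cintegral (fun y => F (row_mx x y))).
Proof.
have [ir ii] : cintegrable F by exact: cintegrable_decay Fc _ FC.
apply: complex_eqP => /=.
  apply: (Rintegral_split ir _ _).1 => [x|y].
    exact: (cintegrable_row_mxr x).1.
  exact: (cintegrable_row_mxl y).1.
apply: (Rintegral_split ii _ _).1 => [x|y].
  exact: (cintegrable_row_mxr x).2.
exact: (cintegrable_row_mxl y).2.
Qed.

Lemma cintegral_splitr :
  cintegral F = cintegral (fun y => cintegral (fun x => F (row_mx x y))).
Proof.
have [ir ii] : cintegrable F by exact: cintegrable_decay Fc _ FC.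
apply: complex_eqP => /=.
  apply: (Rintegral_split ir _ _).2 => [x|y].
    exact: (cintegrable_row_mxr x).1.
  exact: (cintegrable_row_mxl y).1.
apply: (Rintegral_split ii _ _).2 => [x|y].
  exact: (cintegrable_row_mxr x).2.
exact: (cintegrable_row_mxl y).2.
Qed.

End split.
End complex_integral.

(** * Partial derivatives *)

Section partial_derivatives.
Context (R : realType).

(** A directional derivative and the derivative of the restriction to the line have literally the
    same difference quotient. The rules for partial derivatives are proved in one variable and
    transported through this equivalence. *)
Lemma is_derive_line n (f : 'rV[R]_n -> R) (x v : 'rV[R]_n) (t a : R) :
  is_derive (x + t *: v) v (f : _ -> R^o) a <->
  is_derive t 1 (fun s : R => f (x + s *: v)) a.
Proof.
have E : (fun h : R => h^-1 *: (((f : _ -> R^o) \o shift (x + t *: v)) (h *: v)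
             - (f : _ -> R^o) (x + t *: v))) =
         (fun h : R => h^-1 *: (((fun s : R => f (x + s *: v)) \o shift t) (h *: (1 : R))
             - (fun s : R => f (x + s *: v)) t)).
  apply/funext => h; congr (_ *: (f _ - _)).
  by rewrite /shift/= [h *: 1]mulr1 scalerDl addrCA.
by split=> -[d e]; split; move: d e; rewrite /derivable /derive E.
Qed.

Definition is_partial n (i : 'I_n) (f g : 'rV[R]_n -> R[i]) := forall x,
  is_derive x (delta_mx 0 i) (fun y => complex.Re (f y) : R^o) (complex.Re (g x)) /\
  is_derive x (delta_mx 0 i) (fun y => complex.Im (f y) : R^o) (complex.Im (g x)).

Definition is_cderive (f g : R -> R[i]) := forall t : R,
  is_derive t 1 (fun s => complex.Re (f s)) (complex.Re (g t)) /\
  is_derive t 1 (fun s => complex.Im (f s)) (complex.Im (g t)).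

Lemma is_partial_lineP n (i : 'I_n) f g : is_partial i f g <->
  forall x, is_cderive (fun t => f (x + t *: delta_mx 0 i)) (fun t => g (x + t *: delta_mx 0 i)).
Proof.
split=> [h x t|h x].
  by have [h1 h2] := h (x + t *: delta_mx 0 i); split; apply/is_derive_line.
have [h1 h2] := h x 0; rewrite scale0r addr0 in h1 h2.
by split; rewrite -[x]addr0 -(scale0r (delta_mx 0 i)); apply/is_derive_line; rewrite scale0r addr0.
Qed.

Lemma is_cderive_ext f g f' g' : f =1 f' -> g =1 g' -> is_cderive f g -> is_cderive f' g'.
Proof. by move=> /funext -> /funext ->. Qed.

Lemma is_cderive_cst c : is_cderive (fun=> c) (fun=> 0).
Proof. by move=> t; split=> /=; exact: is_derive_cst. Qed.

Lemma is_cderiveD f f' g g' : is_cderive f f' -> is_cderive g g' ->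
  is_cderive (fun t => f t + g t) (fun t => f' t + g' t).
Proof.
move=> df dg t; have [fr fi] := df t; have [gr gi] := dg t; split.
  by under eq_fun do rewrite cReD; rewrite cReD; exact: is_deriveD.
by under eq_fun do rewrite cImD; rewrite cImD; exact: is_deriveD.
Qed.

Lemma is_cderiveM f f' g g' : is_cderive f f' -> is_cderive g g' ->
  is_cderive (fun t => f t * g t) (fun t => f' t * g t + f t * g' t).
Proof.
move=> df dg t; have [fr fi] := df t; have [gr gi] := dg t; split.
  under eq_fun do rewrite cReM.
  apply: (is_derive_eq (is_deriveB (is_deriveM fr gr) (is_deriveM fi gi))).
  by rewrite cReD !cReM /GRing.scale/=; ring.
under eq_fun do rewrite cImM.
apply: (is_derive_eq (is_deriveD (is_deriveM fr gi) (is_deriveM fi gr))).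
by rewrite cImD !cImM /GRing.scale/=; ring.
Qed.

Lemma is_cderive_conj f g : is_cderive f g ->
  is_cderive (fun t => conjc (f t)) (fun t => conjc (g t)).
Proof.
move=> df t; have [fr fi] := df t; split.
  by under eq_fun do rewrite cRe_conj; rewrite cRe_conj.
by under eq_fun do rewrite cIm_conj; rewrite cIm_conj; exact: is_deriveN.
Qed.

Lemma is_cderiveR (q q' : R -> R) : (forall t : R, is_derive t 1 q (q' t)) ->
  is_cderive (fun t => (q t)%:C) (fun t => (q' t)%:C).
Proof. by move=> dq t; split=> //=; exact: is_derive_cst. Qed.

Lemma is_cderive_scale f g (c : R) : is_cderive f g ->
  is_cderive (fun t => f (c * t)) (fun t => c%:C * g (c * t)).
Proof.
move=> df t; have [fr fi] := df (c * t).
have dc : is_derive t 1 (fun s : R => c * s) c.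
  have := is_deriveZ c (is_derive_id t 1); rewrite /GRing.scale/= mulr1; exact.
split; rewrite ?cReM ?cImM /= mul0r ?subr0 ?addr0.
  apply: (is_derive_eq (@is_derive1_comp _ (fun s => complex.Re (f s)) _ _ _ _ fr dc)).
  by rewrite mulrC.
apply: (is_derive_eq (@is_derive1_comp _ (fun s => complex.Im (f s)) _ _ _ _ fi dc)).
by rewrite mulrC.
Qed.

Lemma is_cderive_expi (q q' : R -> R) : (forall t : R, is_derive t 1 q (q' t)) ->
  is_cderive (fun t => expi (q t)) (fun t => 'i * (q' t)%:C * expi (q t)).
Proof.
move=> dq t; split; rewrite /expi /= !(mul0r, mulr0, subr0, mul1r, addr0, add0r, sub0r).
  apply: (is_derive_eq (@is_derive1_comp _ cos _ _ _ _ (is_derive_cos (q t)) (dq t))).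
  by ring.
apply: (is_derive_eq (@is_derive1_comp _ sin _ _ _ _ (is_derive_sin (q t)) (dq t))).
by ring.
Qed.

(** The mean value theorem fails for complex values, so it is applied to the real and imaginary
    parts, which costs the factor 2. The bound is asked for only on the segment from 0 to h. *)
Lemma is_cderive_le f g (h B : R) : is_cderive f g ->
  (forall t, 0 <= t <= 1 -> normc (g (t * h)) <= B) ->
  normc (f h - f 0) <= 2 * `|h| * B.
Proof.
move=> df gB.
have mvt (q q' : R -> R) : (forall t : R, is_derive t 1 q (q' t)) ->
    (forall t, 0 <= t <= 1 -> `|q' (t * h)| <= B) -> `|q h - q 0| <= `|h| * B.
  move=> dq qB; pose r t := q (h * t).
  have dr (t : R) : is_derive t 1 r (h * q' (t * h)).
    have dc : is_derive t 1 (fun s : R => h * s) h.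
      have := is_deriveZ h (is_derive_id t 1); rewrite /GRing.scale/= mulr1; exact.
    by rewrite mulrC [t * h]mulrC; exact: (@is_derive1_comp _ q _ _ _ _ (dq (h * t)) dc).
  have cr : {within `[0, 1]%classic, continuous r}.
    by apply: derivable_within_continuous => t _; have [] := dr t.
  have [c c01] := MVT (@ltr01 R) (fun t _ => dr t) cr.
  rewrite /r mulr1 mulr0 subr0 mulr1 => ->; rewrite normrM ler_wpM2l// qB//.
  by move: c01; rewrite in_itv/= => /andP[/ltW -> /ltW ->].
apply: le_trans (normc_le _) _; rewrite -mulrA mulr_natl mulr2n.
rewrite cReD cReN cImD cImN; apply: lerD.
  apply: (mvt (fun t => complex.Re (f t)) (fun t => complex.Re (g t))) => t.
    by have [] := df t.
  by move=> /gB; exact/le_trans/le_Re_normc.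
apply: (mvt (fun t => complex.Im (f t)) (fun t => complex.Im (g t))) => t.
  by have [] := df t.
by move=> /gB; exact/le_trans/le_Im_normc.
Qed.

(** [is_cderive_le] used twice: on f(t) - t g(0), whose derivative is g(t) - g(0), and then on g.
    Each use contributes a factor 2. *)
Lemma is_cderive_taylor2 f g k (h B : R) : is_cderive f g -> is_cderive g k ->
  (forall t, 0 <= t <= 1 -> normc (k (t * h)) <= B) ->
  normc (f h - f 0 - h%:C * g 0) <= 4 * h ^+ 2 * B.
Proof.
move=> df dg kB.
have B0 : 0 <= B.
  by apply: le_trans (kB 0 _); rewrite ?normc_ge0// lexx ler01.
pose F t := f t - t%:C * g 0.
have dF : is_cderive F (fun t => g t - g 0).
  have did : is_cderive (fun t => t%:C) (fun=> 1).
    by apply: (@is_cderiveR id (fun=> 1)) => t; exact: is_derive_id.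
  apply: (is_cderive_ext _ _ (is_cderiveD df
    (is_cderiveM did (is_cderive_cst (- g 0))))) => t.
    by rewrite /F mulrN.
  by rewrite mul1r mulr0 addr0.
have -> : f h - f 0 - h%:C * g 0 = F h - F 0 by rewrite /F mul0r subr0 addrAC.
apply: le_trans (is_cderive_le (B := 2 * `|h| * B) dF _) _ => [t /andP[t0 t1]|]; last first.
  by rewrite -(real_normK (num_real h)) le_eqVlt; apply/orP; left; apply/eqP; ring.
apply: le_trans (is_cderive_le (B := B) dg _) _ => [s /andP[s0 s1]|].
  by rewrite mulrA; apply: kB; rewrite mulr_ge0// mulr_ile1.
rewrite ler_wpM2r// ler_wpM2l// normrM ler_piMl// ger0_norm//.
Qed.

(** A quadratic remainder at each point already forces differentiability. Together with
    [is_cderive_taylor2] this permits differentiation under an integral sign by bounding a second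
    derivative, with no limit theorem for integrals. *)
Lemma is_cderive_of_taylor2 f g : 
  (forall t, exists C : R, forall h, `|h| <= 1 ->
     normc (f (t + h) - f t - h%:C * g t) <= C * h ^+ 2) -> is_cderive f g.
Proof.
move=> H.
have key (q q' : R -> R) : (forall t, exists C : R, forall h, `|h| <= 1 ->
     `|q (t + h) - q t - h * q' t| <= C * h ^+ 2) -> forall t : R, is_derive t 1 q (q' t).
  move=> {}H t; have [C HC] := H t.
  have cv : (fun h : R => h^-1 *: ((q \o shift t) (h *: 1) - q t)) @ 0^' --> (q' t : R^o).
    apply/cvgrPdist_lt => e e0.
    have C0 : 0 <= C.
      have := HC 1; rewrite normr1 lexx expr1n mulr1 => /(_ isT).
      exact: le_trans.
    near=> h; have h0 : h != 0 by near: h; exact: nbhs_dnbhs_neq.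
    have h1 : `|h| <= 1.
      by near: h; apply: dnbhs0_le; exact: ltr01.
    have he : `|h| < e / (C + 1).
      by near: h; apply: dnbhs0_lt; rewrite divr_gt0// ltr_wpDl.
    rewrite /shift/= /GRing.scale/= mulr1 distrC.
    rewrite (_ : _ - _ = h^-1 * (q (t + h) - q t - h * q' t)); last first.
      by rewrite [h + t]addrC; field.
    rewrite normrM normfV ltr_pdivrMl ?normr_gt0//; apply: le_lt_trans (HC _ h1) _.
    have -> : C * h ^+ 2 = `|h| * (C * `|h|).
      by rewrite -(real_normK (num_real h)); ring.
    rewrite ltr_pM2l ?normr_gt0//.
    rewrite -(ltr_pM2r (_ : 0 < C + 1)) ?ltr_wpDl// in he.
    rewrite divfK in he; last by rewrite gt_eqF// ltr_wpDl.
    apply: le_lt_trans he; rewrite mulrC ler_wpM2l// lerDl//.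
  by split; [apply/cvg_ex; exists (q' t)|exact/cvg_lim].
move=> t; split; [apply: (key _ (fun t => complex.Re (g t)))|
  apply: (key _ (fun t => complex.Im (g t)))] => {}t; have [C HC] := H t;
  exists C => h /HC; apply: le_trans.
  by apply: le_trans (le_Re_normc _); rewrite !(cReD, cReN, cReM)/= mul0r subr0.
by apply: le_trans (le_Im_normc _); rewrite !(cImD, cImN, cImM)/= mul0r addr0.
Unshelve. all: by end_near. Qed.

End partial_derivatives.

(** * Calculus of iterated partial derivatives *)

Section partial_calculus.
Context (R : realType) (n : nat).
Implicit Types (f g : 'rV[R]_n -> R[i]) (i j : 'I_n) (l : seq 'I_n).
Local Notation e i := (delta_mx 0 i : 'rV[R]_n).

Lemma is_partialE i f g : is_partial i f g -> partial i f = g.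
Proof.
move=> h; apply/funext => x; have [hr hi] := h x.
by apply: complex_eqP; rewrite /partial/= derive_val.
Qed.

Lemma is_partial_ext i f g f' g' : is_partial i f g -> f =1 f' -> g =1 g' ->
  is_partial i f' g'.
Proof. by move=> h /funext <- /funext <-. Qed.

Lemma is_partial_cst i c : is_partial i (fun=> c) (fun=> 0 : R[i]).
Proof. by apply/is_partial_lineP => x; exact: is_cderive_cst. Qed.

Lemma is_partialD i f f' g g' : is_partial i f f' -> is_partial i g g' ->
  is_partial i (fun x => f x + g x) (fun x => f' x + g' x).
Proof.
move=> /is_partial_lineP df /is_partial_lineP dg; apply/is_partial_lineP => x.
exact: is_cderiveD (df x) (dg x).
Qed.

Lemma is_partialM i f f' g g' : is_partial i f f' -> is_partial i g g' ->
  is_partial i (fun x => f x * g x) (fun x => f' x * g x + f x * g' x).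
Proof.
move=> /is_partial_lineP df /is_partial_lineP dg; apply/is_partial_lineP => x.
exact: is_cderiveM (df x) (dg x).
Qed.

Lemma is_partialZ i c f f' : is_partial i f f' ->
  is_partial i (fun x => c * f x) (fun x => c * f' x).
Proof.
move=> df; apply: is_partial_ext (is_partialM (is_partial_cst i c) df) _ _ => //= x.
by rewrite mul0r add0r.
Qed.

Lemma is_partialB i f f' g g' : is_partial i f f' -> is_partial i g g' ->
  is_partial i (fun x => f x - g x) (fun x => f' x - g' x).
Proof.
move=> df dg; apply: is_partial_ext (is_partialD df (is_partialZ (-1) dg)) _ _ => x;
by rewrite mulN1r.
Qed.

Lemma is_partial_conj i f g : is_partial i f g -> is_partial i (fconj f) (fconj g).
Proof.
move=> /is_partial_lineP df; apply/is_partial_lineP => x.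
exact: is_cderive_conj (df x).
Qed.

Lemma is_partial_coord i j : is_partial i (fun x => (x 0 j : R)%:C) (fun=> (i == j)%:R).
Proof.
apply/is_partial_lineP => x.
have -> : (i == j)%:R = ((i == j)%:R : R)%:C :> R[i] by rewrite rmorph_nat.
apply: (@is_cderiveR _ (fun t => (x + t *: e i) 0 j) (fun=> (i == j)%:R)) => t.
have -> : (fun t : R => (x + t *: e i) 0 j) = (fun t => x 0 j + (i == j)%:R * t).
  by apply/funext => s; rewrite !mxE eqxx mulrC eq_sym.
have := is_deriveD (is_derive_cst (x 0 j) t 1) (is_deriveZ ((i == j)%:R : R) (is_derive_id t (1 : R))).
by rewrite /GRing.scale/= mulr1 add0r.
Qed.

Lemma is_partial_expi i (q q' : 'rV[R]_n -> R) :
  is_partial i (fun x => (q x)%:C) (fun x => (q' x)%:C) ->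
  is_partial i (fun x => expi (q x)) (fun x => 'i * (q' x)%:C * expi (q x)).
Proof.
move=> /is_partial_lineP dq; apply/is_partial_lineP => x.
apply: (@is_cderive_expi _ (fun t => q (x + t *: e i)) (fun t => q' (x + t *: e i))) => t.
by have [] := dq x t.
Qed.

Definition in_box (x y z : 'rV[R]_n) := forall k, exists2 s : R,
  0 <= s <= 1 & z 0 k = x 0 k + s * (y 0 k - x 0 k).

(** The points are joined by n segments parallel to the axes, because only partial derivatives are
    at hand; this path stays in the box spanned by x and y. *)
Lemma box_mean_value f (g : 'I_n -> 'rV[R]_n -> R[i]) (x y : 'rV[R]_n) (B : R) :
  (forall i, is_partial i f (g i)) ->
  (forall i z, in_box x y z -> normc (g i z) <= B) ->
  normc (f y - f x) <= 2 * B * \sum_i `|y 0 i - x 0 i|.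
Proof.
move=> df gB.
(* Vertices of the path: [p k] has its first k coordinates from y and the others from x. *)
pose p k : 'rV[R]_n := \row_i (if (i < k)%N then y 0 i else x 0 i).
have p0 : p 0%N = x by apply/rowP => i; rewrite mxE.
have pn : p n = y by apply/rowP => i; rewrite mxE ltn_ord.
rewrite -p0 -pn -(telescope_sumr (fun k => f (p k)) (leq0n n)) big_mkord.
apply: le_trans (normc_sum _ _) _; rewrite mulr_sumr; apply: ler_sum => i _.
have pS : p i.+1 = p i + (y 0 i - x 0 i) *: e i.
  apply/rowP => k; rewrite !mxE eqxx/= ltnS leq_eqVlt -val_eqE/=.
  have [/val_inj ->|ki] := eqVneq (k : nat) i; first by rewrite /= ltnn mulr1 addrC subrK.
  by rewrite /= mulr0 addr0.
have /is_partial_lineP/(_ (p i)) di := df i.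
rewrite pS p0 pn -mulrA [B * _]mulrC mulrA.
have := @is_cderive_le _ _ _ (y 0 i - x 0 i) B di.
rewrite scale0r addr0; apply => t t01; apply: gB => k.
have [->|ki] := eqVneq k i.
  by exists t => //; rewrite !mxE ltnn !eqxx mulr1.
exists (if (k < i)%N then 1 else 0); first by case: ifP; rewrite ?lexx ?ler01.
by rewrite !mxE eqxx (negbTE ki) mulr0 addr0; case: ifP => _; rewrite ?mul1r ?mul0r ?addr0// addrC subrK.
Qed.

Lemma ccont_bounded f (x : 'rV[R]_n) : ccont f -> exists r B : R, 0 < r /\
  forall y : 'rV[R]_n, (forall i, `|y 0 i - x 0 i| < r) -> normc (f y) <= B.
Proof.
move=> [cr ci].
have := cr x; move/cvgrPdist_lt/(_ _ ltr01)/nbhs_ballP => [r1 /= r10 h1].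
have := ci x; move/cvgrPdist_lt/(_ _ ltr01)/nbhs_ballP => [r2 /= r20 h2].
exists (Num.min r1 r2), (normc (f x) + 2); split; first by rewrite lt_min r10.
move=> y hy.
have b1 : ball x r1 y.
  by apply/mx_ballP => // i; rewrite distrC; apply: lt_le_trans (hy i) _; rewrite ge_min lexx.
have b2 : ball x r2 y.
  by apply/mx_ballP => // i; rewrite distrC; apply: lt_le_trans (hy i) _; rewrite ge_min lexx orbT.
rewrite -[f y](subrK (f x)) addrC; apply: le_trans (le_normcD _ _) _.
rewrite lerD2l; apply: le_trans (normc_le _) _.
rewrite cReD cReN cImD cImN distrC [X in _ + X]distrC (_ : 2 = 1 + 1 :> R)//.
by apply: lerD; apply/ltW; [exact: h1|exact: h2].
Qed.

Lemma smooth_ccont f l : smooth f -> ccont (partials l f).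
Proof. by move=> /(_ l)[]. Qed.

Lemma smooth_is_partial f i l : smooth f -> is_partial i (partials l f) (partials (i :: l) f).
Proof.
by move=> /(_ l)[_ _ h] x; have [hr hi] := h i x; split; exact: derivableP.
Qed.

Lemma smooth_is_partial0 f i : smooth f -> is_partial i f (partial i f).
Proof. by move=> sf; exact: (@smooth_is_partial f i [::]). Qed.

(** A coinduction principle. As [smooth] speaks of all iterated derivatives at once, it is
    established by exhibiting a class of continuous functions that is stable under partial
    derivatives. *)
Lemma smooth_coind (P : ('rV[R]_n -> R[i]) -> Prop) :
  (forall f, P f -> ccont f /\ forall i, exists2 g, is_partial i f g & P g) ->
  forall f, P f -> smooth f.
Proof.
move=> HP f Pf.
have Pl l : P (partials l f).
  elim: l => [//|i l IH] /=; have [_ /(_ i)[g dg Pg]] := HP _ IH.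
  by rewrite -/(partials l f) (is_partialE dg).
move=> l; have [[cr ci] hl] := HP _ (Pl l); split=> // i x.
by have [g dg _] := hl i; have [[d1 _] [d2 _]] := dg x.
Qed.

Lemma partials_cat l1 l2 f : partials (l1 ++ l2) f = partials l1 (partials l2 f).
Proof. exact: foldr_cat. Qed.

Lemma partials_rcons l i f : partials (rcons l i) f = partials l (partial i f).
Proof. by rewrite -cats1 partials_cat. Qed.

Lemma smooth_partials l f : smooth f -> smooth (partials l f).
Proof. by move=> sf l'; rewrite -partials_cat; exact: sf. Qed.

Lemma smooth_partial i f : smooth f -> smooth (partial i f).
Proof. exact: (@smooth_partials [:: i]). Qed.

(** Schwarz's theorem by second differences. The combination f(x + h e_i + h e_j) - f(x + h e_i) -
    f(x + h e_j) + f(x) is symmetric in i and j, and it differs from h^2 times either mixed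
    derivative by O(h^3), with constants from local bounds of third derivatives. Dividing by h^2 and
    letting h tend to 0 identifies the two. *)
Lemma partialC i j f : smooth f -> partial i (partial j f) = partial j (partial i f).
Proof.
move=> sf; apply/funext => x.
have [->//|ij] := eqVneq i j.
have [r1 [B1 [r10 h1]]] := ccont_bounded x (smooth_ccont [:: j; i; j] sf).
have [r2 [B2 [r20 h2]]] := ccont_bounded x (smooth_ccont [:: i; j; i] sf).
have [r3 [B3 [r30 h3]]] := ccont_bounded x (smooth_ccont [:: i; i; j] sf).
have [r4 [B4 [r40 h4]]] := ccont_bounded x (smooth_ccont [:: j; j; i] sf).
pose r := Num.min (Num.min r1 r2) (Num.min r3 r4).
have r0 : 0 < r by rewrite !lt_min r10 r20 r30.
have key (i' j' : 'I_n) (B C : R) : i' != j' ->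
    (forall y : 'rV[R]_n, (forall k, `|y 0 k - x 0 k| < r) -> normc (partials [:: j'; i'; j'] f y) <= B) ->
    (forall y : 'rV[R]_n, (forall k, `|y 0 k - x 0 k| < r) -> normc (partials [:: i'; i'; j'] f y) <= C) ->
    forall h, 0 < h < r ->
    normc (f (x + h *: e i' + h *: e j') - f (x + h *: e i') - (f (x + h *: e j') - f x)
       - (h ^+ 2)%:C * partial i' (partial j' f) x) <= (8 * C + 4 * B) * h ^+ 3.
  move=> ij' hB hC h /andP[h0 hr].
  have hn : `|h| = h by rewrite gtr0_norm.
  have near_x (s t : R) : 0 <= s <= 1 -> 0 <= t <= 1 -> forall k,
      `|(x + (s * h) *: e i' + (t * h) *: e j') 0 k - x 0 k| < r.
    move=> /andP[s0 s1] /andP[t0 t1] k; rewrite !mxE !eqxx/=.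
    have [->|_] := eqVneq k i'.
      rewrite (negbTE ij') mulr1 mulr0 addr0 addrAC subrr add0r normrM ger0_norm// hn.
      by apply: le_lt_trans hr; rewrite ler_piMl// ltW.
    rewrite mulr0 addr0 addrAC subrr add0r; case: eqP => _; last by rewrite mulr0 normr0.
    rewrite mulr1 normrM ger0_norm// hn.
    by apply: le_lt_trans hr; rewrite ler_piMl// ltW.
  pose c := partial i' (partial j' f) x.
  (* The derivative of [phi] splits into a first-order Taylor remainder of [partial j' f] in
     direction i', which is O(h^2) by the bound C, and h times the variation of the mixed derivative
     along e_j', which is O(h^2) by the bound B. Integrating over a segment of length h gives
     O(h^3). *)
  pose phi (s : R) := f (x + h *: e i' + s *: e j') - f (x + s *: e j') - s%:C * (h%:C * c).
  have dphi : is_cderive phi (fun s => partial j' f (x + h *: e i' + s *: e j')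
       - partial j' f (x + s *: e j') - h%:C * c).
    have /is_partial_lineP dj := smooth_is_partial0 j' sf.
    have did : is_cderive (fun t : R => t%:C) (fun=> 1).
      by apply: (@is_cderiveR _ id (fun=> 1)) => t; exact: is_derive_id.
    have := is_cderiveD (is_cderiveD (dj (x + h *: e i')) (is_cderiveM (is_cderive_cst (-1)) (dj x)))
      (is_cderiveM did (is_cderive_cst (- (h%:C * c)))).
    by apply: is_cderive_ext => s; rewrite /phi ?mulN1r ?mulrN// mul0r add0r mulr0 addr0 mul1r.
  have -> : f (x + h *: e i' + h *: e j') - f (x + h *: e i') - (f (x + h *: e j') - f x)
      - (h ^+ 2)%:C * partial i' (partial j' f) x = phi h - phi 0.
    by rewrite /phi !scale0r !addr0 mul0r subr0 rmorphXn/= -/c; ring.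
  apply: le_trans (is_cderive_le (B := (4 * C + 2 * B) * h ^+ 2) dphi _) _; last first.
    by rewrite hn exprS; rewrite le_eqVlt; apply/orP; left; apply/eqP; ring.
  move=> t t01.
  have /is_partial_lineP di := @smooth_is_partial f i' [:: j'] sf.
  have /is_partial_lineP dii := @smooth_is_partial f i' [:: i'; j'] sf.
  have t2 := is_cderive_taylor2 (h := h) (B := C) (di (x + (t * h) *: e j')) (dii (x + (t * h) *: e j')).
  have /is_partial_lineP dji := @smooth_is_partial f j' [:: i'; j'] sf.
  have t1 := is_cderive_le (h := t * h) (B := B) (dji x).
  rewrite /= -/(partial j' f) in t2 t1.
  have E : partial j' f (x + h *: e i' + (t * h) *: e j') - partial j' f (x + (t * h) *: e j')
      - h%:C * c =
    (partial j' f (x + (t * h) *: e j' + h *: e i') - partial j' f (x + (t * h) *: e j' + 0 *: e i') -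
      h%:C * partial i' (partial j' f) (x + (t * h) *: e j' + 0 *: e i')) +
    h%:C * (partial i' (partial j' f) (x + (t * h) *: e j') - partial i' (partial j' f) (x + 0 *: e j')).
    by rewrite !scale0r !addr0 -/c mulrBr addrA subrK [x + h *: _ + _]addrAC.
  rewrite E; apply: le_trans (le_normcD _ _) _; rewrite mulrDl; apply: lerD.
    apply: le_trans (t2 _) _ => [s s01|]; last by rewrite mulrAC.
    rewrite addrAC; apply: hC => k; have := near_x s t s01 t01 k.
    by rewrite !mxE.
  rewrite normcM normcR hn.
  have th : normc (partial i' (partial j' f) (x + (t * h) *: e j') - partial i' (partial j' f) (x + 0 *: e j')) <= 2 * h * B.
    have B0 : 0 <= B by apply: le_trans (hB x _); rewrite ?normc_ge0// => k; rewrite subrr normr0.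
    apply: le_trans (t1 _) _ => [s s01|].
      apply: hB => k; rewrite mulrA; have := near_x 0 (s * t) _ _ k.
      rewrite mul0r scale0r addr0; apply; first by rewrite lexx ler01.
      case/andP: s01 => s0 s1; case/andP: t01 => t0 t1'.
      by rewrite mulr_ge0//= mulr_ile1.
    rewrite ler_wpM2r// ler_wpM2l// normrM hn; case/andP: t01 => t0 t1'.
    by rewrite ger0_norm// ler_piMl// ltW.
  apply: le_trans (ler_wpM2l (ltW h0) th) _.
  by rewrite le_eqVlt; apply/orP; left; apply/eqP; ring.
have rs : [/\ r <= r1, r <= r2, r <= r3 & r <= r4].
  by rewrite /r !ge_min !lexx ?orbT.
case: rs => rr1 rr2 rr3 rr4.
have near_le r' (y : 'rV[R]_n) : r <= r' -> (forall k, `|y 0 k - x 0 k| < r) ->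
    forall k, `|y 0 k - x 0 k| < r'.
  by move=> rr' h k; exact: lt_le_trans (h k) rr'.
pose M := (8 * B3 + 4 * B1) + (8 * B4 + 4 * B2).
have diff h : 0 < h < r ->
    normc (partial i (partial j f) x - partial j (partial i f) x) <= M * h.
  move=> /andP[h0 hr]; have hh : 0 < h < r by rewrite h0.
  have k1 := key i j B1 B3 ij (fun y hy => h1 y (near_le _ _ rr1 hy))
    (fun y hy => h3 y (near_le _ _ rr3 hy)) h hh.
  rewrite eq_sym in ij.
  have k2 := key j i B2 B4 ij (fun y hy => h2 y (near_le _ _ rr2 hy))
    (fun y hy => h4 y (near_le _ _ rr4 hy)) h hh.
  rewrite -(ler_pM2l (exprn_gt0 2 h0)).
  have -> : h ^+ 2 * (M * h) = M * h ^+ 3 by ring.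
  rewrite {1}/M mulrDl; apply: le_trans (lerD k1 k2).
  rewrite -{1}(ger0_norm (exprn_ge0 2 (ltW h0))) -normcR -normcM.
  apply: le_trans (le_normcB _ _); rewrite [x + h *: e j + _]addrAC le_eqVlt; apply/orP; left.
  have alg (a b c a' k p q : R[i]) :
      - (k * (p - q)) = a - b - (c - a') - k * p - (a - c - (b - a') - k * q) by ring.
  by rewrite -normcN; apply/eqP; congr normc; exact: alg.
have M0 : 0 <= M.
  have := diff (r / 2); rewrite divr_gt0// ltr_pdivrMr// ltr_pMr// ltr1n => /(_ isT) h.
  by have := le_trans (normc_ge0 _) h; rewrite pmulr_lge0// divr_gt0.
apply/subr0_eq/eq0_normc/eqP; rewrite eq_le normc_ge0 andbT.
apply/ler_addgt0Pl => eps eps0; rewrite addr0.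
pose h := Num.min (r / 2) (eps / (M + 1)).
have h0 : 0 < h by rewrite lt_min !divr_gt0// ltr_wpDl.
apply: le_trans (diff h _) _.
  by rewrite h0 gt_min ltr_pdivrMr// ltr_pMr// ltr1n.
apply: (@le_trans _ _ ((M + 1) * h)); first by rewrite ler_wpM2r ?lerDl// ltW.
by rewrite mulrC -ler_pdivlMr ?ltr_wpDl// ge_min lexx orbT.
Qed.

Lemma partial_partials i l f : smooth f -> partial i (partials l f) = partials l (partial i f).
Proof.
move=> sf; elim: l => [//|j l IH] /=.
by rewrite partialC ?IH//; exact: smooth_partials.
Qed.

Lemma perm_partials l1 l2 f : smooth f -> perm_eq l1 l2 -> partials l1 f = partials l2 f.
Proof.
move=> sf; elim: l1 l2 => [|i l1 IH] l2 l12.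
  by rewrite perm_sym in l12; rewrite (perm_nilP l12).
have il2 : i \in l2 by rewrite -(perm_mem l12) mem_head.
case/splitPr: il2 l12 => p1 p2; rewrite perm_sym perm_catC /= perm_cons => l12.
rewrite partials_cat /= -/(partials p2 f) -partial_partials; last exact: smooth_partials.
rewrite -partials_cat -/(partials l1 f); congr partial; apply: IH.
by rewrite perm_sym perm_catC.
Qed.

(** By symmetry of mixed derivatives. Lists suit induction on the order of differentiation,
    multi-indices occur in the definitions of symbols and Schwartz functions; this is the passage
    between them. *)
Lemma partials_mpartial l f : smooth f ->
  partials l f = mpartial (fun i => count_mem i l) f.
Proof.
move=> sf; apply: perm_partials => //; apply/allP => /= i _; apply/eqP.
rewrite count_flatten -map_comp sumnE big_map big_enum/= (bigD1 i)//= count_nseq/= eqxx mul1n.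
by rewrite big1 ?addn0// => j ji; rewrite count_nseq/= (negbTE ji).
Qed.

Lemma size_mlen l : size l = mlen (fun i : 'I_n => count_mem i l).
Proof.
rewrite /mlen; elim: l => [|i l IH]; first by rewrite big1.
transitivity (\sum_(j < n) ((i == j) + count_mem j l))%N; last by [].
rewrite big_split/= -[X in (_ + X)%N]IH (bigD1 i)//= eqxx big1// => j ji.
by rewrite eq_sym (negbTE ji).
Qed.

Lemma size_flatten_mlen (al : 'I_n -> nat) :
  size (flatten [seq nseq (al i) i | i <- enum 'I_n]) = mlen al.
Proof.
rewrite size_flatten /shape -map_comp sumnE big_map big_enum/=.
by apply: eq_bigr => i _; rewrite size_nseq.
Qed.

End partial_calculus.

(** * Closure properties of smooth functions *)

Section smooth_closure.
Context (R : realType).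

(** An affine map sending each coordinate direction to a multiple [c i] of a coordinate direction,
    or to 0 when [sigma i] is [None]. The chain rule then has a single term, and translations,
    dilations, projections and midpoints are all of this kind. *)
Definition axis_affine m n (sigma : 'I_n -> option 'I_m) (c : 'I_n -> R)
    (A : 'rV[R]_n -> 'rV[R]_m) :=
  continuous A /\ forall i x h,
    A (x + h *: delta_mx 0 i) = A x + (c i * h) *: oapp (delta_mx 0) 0 (sigma i).

Lemma is_partial_comp m n sigma c (A : 'rV[R]_n -> 'rV[R]_m) (f : 'rV[R]_m -> R[i]) i :
  axis_affine sigma c A -> smooth f ->
  is_partial i (fun x => f (A x))
    (fun x => oapp (fun j => (c i)%:C * partial j f (A x)) 0 (sigma i)).
Proof.
move=> [_ hA] sf; apply/is_partial_lineP => x.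
case E : (sigma i) => [j|] /=.
  have /is_partial_lineP dj := smooth_is_partial0 j sf.
  apply: is_cderive_ext (is_cderive_scale (c i) (dj (A x))) => t;
  by rewrite hA E.
by apply: is_cderive_ext (@is_cderive_cst R (f (A x))) => t //; rewrite hA E scaler0 addr0.
Qed.

(** The class fed to [smooth_coind]: the derivative of each constructor is expressed by the same
    constructors, so closure of smooth functions under all these operations is proved at one
    stroke. *)
Inductive smooth_alg n : ('rV[R]_n -> R[i]) -> Prop :=
| SA_smooth f of smooth f : smooth_alg f
| SA_add f g of smooth_alg f & smooth_alg g : smooth_alg (fun x => f x + g x)
| SA_mul f g of smooth_alg f & smooth_alg g : smooth_alg (fun x => f x * g x)
| SA_conj f of smooth_alg f : smooth_alg (fconj f)
| SA_comp m sigma c (A : 'rV[R]_n -> 'rV[R]_m) f of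
    axis_affine sigma c A & smooth f : smooth_alg (fun x => f (A x))
| SA_expi q of smooth (fun x => (q x)%:C) : smooth_alg (fun x => expi (q x))
| SA_expR q of smooth (fun x => (q x)%:C) : smooth_alg (fun x => (expR (q x))%:C).

Lemma smooth_cst n (c : R[i]) : smooth (fun _ : 'rV[R]_n => c).
Proof.
apply: (@smooth_coind _ _ (fun f => exists c, f = fun=> c)); last by exists c.
move=> _ [{}c ->]; split; first exact: ccont_cst.
by move=> i; exists (fun=> 0); [exact: is_partial_cst|exists 0].
Qed.

Lemma partial_real n i (q : 'rV[R]_n -> R) x :
  partial i (fun x => (q x)%:C) x = (complex.Re (partial i (fun x => (q x)%:C) x))%:C.
Proof.
apply: complex_eqP => //=.
by have [_ ->] := @is_derive_cst R _ R^o 0 x (delta_mx 0 i).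
Qed.

Lemma is_partial_expR n i (q q' : 'rV[R]_n -> R) :
  is_partial i (fun x => (q x)%:C) (fun x => (q' x)%:C) ->
  is_partial i (fun x => (expR (q x))%:C) (fun x => (q' x)%:C * (expR (q x))%:C).
Proof.
move=> /is_partial_lineP dq; apply/is_partial_lineP => x.
apply: (is_cderive_ext _ _ (@is_cderiveR _ (fun t => expR (q (x + t *: delta_mx 0 i)))
  (fun t => expR (q (x + t *: delta_mx 0 i)) * q' (x + t *: delta_mx 0 i)) _)) => t //.
  by rewrite rmorphM/= mulrC.
have [dt _] := dq x t.
exact: (@is_derive1_comp _ expR _ _ _ _ (is_derive_expR _) dt).
Qed.

Lemma smooth_alg_smooth n (f : 'rV[R]_n -> R[i]) : smooth_alg f -> smooth f.
Proof.
apply: smooth_coind => {}f; elim=> {f}.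
- move=> f sf; split; first exact: (smooth_ccont [::] sf).
  move=> i; exists (partial i f); first exact: smooth_is_partial0.
  by apply: SA_smooth; exact: smooth_partial.
- move=> f g _ [cf df] _ [cg dg]; split; first exact: ccontD.
  move=> i; have [f' f1 f2] := df i; have [g' g1 g2] := dg i.
  by exists (fun x => f' x + g' x); [exact: is_partialD|exact: SA_add].
- move=> f g sf [cf df] sg [cg dg]; split; first exact: ccontM.
  move=> i; have [f' f1 f2] := df i; have [g' g1 g2] := dg i.
  exists (fun x => f' x * g x + f x * g' x); first exact: is_partialM.
  by apply: SA_add; exact: SA_mul.
- move=> f _ [cf df]; split; first exact: ccont_conj.
  move=> i; have [f' f1 f2] := df i.
  by exists (fconj f'); [exact: is_partial_conj|exact: SA_conj].
- move=> m sigma c A f hA sf; split.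
    by apply: ccont_comp (smooth_ccont [::] sf); case: hA.
  move=> i; eexists; first exact: is_partial_comp hA sf.
  case: (sigma i) => [j|] /=; last by apply: SA_smooth; exact: smooth_cst.
  apply: SA_mul; first by apply: SA_smooth; exact: smooth_cst.
  by apply: SA_comp hA _; exact: smooth_partial.
- move=> q sq; split; first by apply: ccont_expi; case: (smooth_ccont [::] sq).
  move=> i; pose dq := partial i (fun x => (q x)%:C).
  exists (fun x => 'i * dq x * expi (q x)).
    have := smooth_is_partial0 i sq; rewrite (funext (partial_real i q)).
    move=> /is_partial_expi dq'; apply: is_partial_ext dq' _ _ => // x.
    by rewrite -partial_real.
  apply: SA_mul; last exact: SA_expi.
  by apply: SA_mul; apply: SA_smooth; [exact: smooth_cst|exact: smooth_partial].
- move=> q sq; split.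
    apply: ccontR; have [cq _] := smooth_ccont [::] sq.
    by apply: (continuous_comp_fun cq); exact: continuous_expR.
  move=> i; pose dq := partial i (fun x => (q x)%:C).
  exists (fun x => dq x * (expR (q x))%:C).
    have := smooth_is_partial0 i sq; rewrite (funext (partial_real i q)).
    move=> /is_partial_expR dq'; apply: is_partial_ext dq' _ _ => // x.
    by rewrite -partial_real.
  by apply: SA_mul; [apply: SA_smooth; exact: smooth_partial|exact: SA_expR].
Qed.

Section fixed.
Context (n : nat).
Implicit Types f g : 'rV[R]_n -> R[i].

Lemma smoothD f g : smooth f -> smooth g -> smooth (fun x => f x + g x).
Proof. by move=> sf sg; apply: smooth_alg_smooth; apply: SA_add; exact: SA_smooth. Qed.

Lemma smoothM f g : smooth f -> smooth g -> smooth (fun x => f x * g x).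
Proof. by move=> sf sg; apply: smooth_alg_smooth; apply: SA_mul; exact: SA_smooth. Qed.

Lemma smoothZ c f : smooth f -> smooth (fun x => c * f x).
Proof. by move=> sf; apply: smoothM => //; exact: smooth_cst. Qed.

Lemma smoothB f g : smooth f -> smooth g -> smooth (fun x => f x - g x).
Proof.
move=> sf sg; have := smoothD sf (smoothZ (-1) sg).
by under [X in smooth X -> _]eq_fun do rewrite mulN1r.
Qed.

Lemma smooth_conj f : smooth f -> smooth (fconj f).
Proof. by move=> sf; apply: smooth_alg_smooth; apply: SA_conj; exact: SA_smooth. Qed.

Lemma smooth_comp m sigma c (A : 'rV[R]_n -> 'rV[R]_m) (f : 'rV[R]_m -> R[i]) :
  axis_affine sigma c A -> smooth f -> smooth (fun x => f (A x)).
Proof. by move=> hA sf; apply: smooth_alg_smooth; exact: SA_comp hA sf. Qed.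

Lemma smooth_expi (q : 'rV[R]_n -> R) : smooth (fun x => (q x)%:C) -> smooth (fun x => expi (q x)).
Proof. by move=> sq; apply: smooth_alg_smooth; exact: SA_expi. Qed.

Lemma smooth_expR (q : 'rV[R]_n -> R) :
  smooth (fun x => (q x)%:C) -> smooth (fun x => (expR (q x))%:C).
Proof. by move=> sq; apply: smooth_alg_smooth; exact: SA_expR. Qed.

Lemma smooth_sum (I : Type) (r : seq I) (F : I -> 'rV[R]_n -> R[i]) :
  (forall k, smooth (F k)) -> smooth (fun x => \sum_(k <- r) F k x).
Proof.
move=> sF; elim: r => [|k r IH].
  by under eq_fun do rewrite big_nil; exact: smooth_cst.
by under eq_fun do rewrite big_cons; exact: smoothD.
Qed.

Lemma smooth_coord j : smooth (fun x : 'rV[R]_n => (x 0 j)%:C).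
Proof.
apply: (@smooth_coind _ _ (fun f => smooth f \/ f = (fun x => (x 0 j)%:C))); last by right.
move=> f [sf|->].
  split; first exact: (smooth_ccont [::] sf).
  move=> i; exists (partial i f); first exact: smooth_is_partial0.
  by left; exact: smooth_partial.
split; first by apply: ccontR; exact: continuous_rV_coord.
move=> i; eexists; first exact: is_partial_coord.
by left; exact: smooth_cst.
Qed.

Lemma partialsD l f g : smooth f -> smooth g ->
  partials l (fun x => f x + g x) = (fun x => partials l f x + partials l g x).
Proof.
move=> sf sg; elim: l => [//|i l IH] /=; rewrite -/(partials l _) IH.
by apply: is_partialE; apply: is_partialD; exact: smooth_is_partial.
Qed.

Lemma partialsZ l c f : smooth f ->
  partials l (fun x => c * f x) = (fun x => c * partials l f x).
Proof.
move=> sf; elim: l => [//|i l IH] /=; rewrite -/(partials l _) IH.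
by apply: is_partialE; apply: is_partialZ; exact: smooth_is_partial.
Qed.

Lemma partialsB l f g : smooth f -> smooth g ->
  partials l (fun x => f x - g x) = (fun x => partials l f x - partials l g x).
Proof.
move=> sf sg; elim: l => [//|i l IH] /=; rewrite -/(partials l _) IH.
by apply: is_partialE; apply: is_partialB; exact: smooth_is_partial.
Qed.

Lemma partials_conj l f : smooth f -> partials l (fconj f) = fconj (partials l f).
Proof.
move=> sf; elim: l => [//|i l IH] /=; rewrite -/(partials l _) IH.
by apply: is_partialE; apply: is_partial_conj; exact: smooth_is_partial.
Qed.

Lemma partials_cst l c : partials l (fun _ : 'rV[R]_n => c) =
  (fun=> if l is [::] then c else 0).
Proof.
elim: l c => [//|i l IH] c /=; rewrite -/(partials l _) IH.
by apply: is_partialE; case: l {IH} => [|? ?]; exact: is_partial_cst.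
Qed.

Lemma partials_sum l (I : Type) (r : seq I) (F : I -> 'rV[R]_n -> R[i]) :
  (forall k, smooth (F k)) ->
  partials l (fun x => \sum_(k <- r) F k x) = (fun x => \sum_(k <- r) partials l (F k) x).
Proof.
move=> sF; elim: r => [|k r IH].
  under eq_fun do rewrite big_nil; rewrite partials_cst.
  by apply/funext => x; rewrite big_nil; case: l.
under eq_fun do rewrite big_cons; rewrite partialsD//; last exact: smooth_sum.
by rewrite IH; apply/funext => x; rewrite big_cons.
Qed.

(** Each derivative brings down a factor [c i] of modulus at most 1, or kills the function when its
    direction is collapsed. In the latter case the left-hand side is 0, while [pmap] merely drops
    the direction on the right. *)
Lemma normc_partials_comp m sigma c (A : 'rV[R]_n -> 'rV[R]_m) (f : 'rV[R]_m -> R[i]) l x :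
  axis_affine sigma c A -> smooth f -> (forall i, `|c i| <= 1) ->
  normc (partials l (fun x => f (A x)) x) <= normc (partials (pmap sigma l) f (A x)).
Proof.
move=> hA sf c1; elim/last_ind: l f sf => [//|l i IH] f sf.
rewrite partials_rcons (is_partialE (is_partial_comp i hA sf)).
rewrite -cats1 pmap_cat /=; case: (sigma i) => [j|] /=; last first.
  by rewrite partials_cst cats0; case: l {IH} => *; rewrite normc0.
rewrite partialsZ; last by apply: smooth_comp hA _; exact: smooth_partial.
rewrite normcM normcR; apply: le_trans (_ : normc (partials l (fun x => partial j f (A x)) x) <= _).
  by rewrite ler_piMl.
by apply: le_trans (IH _ (smooth_partial j sf)) _; rewrite cats1 partials_rcons.
Qed.

End fixed.
End smooth_closure.

(** * Symbols and Schwartz functions *)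

Section uniform_classes.
Context (R : realType).

(* Families bounded in S, resp. in the symbols of growth L, uniformly in the
   parameter up to the weight w. *)
Definition uS Z n (w : Z -> R) (f : Z -> 'rV[R]_n -> R[i]) :=
  (forall z, smooth (f z)) /\ forall l N, exists C, forall z x,
    jp x ^+ N * normc (partials l (f z) x) <= C * w z.

Definition uO Z n (w : Z -> R) (L : nat) (f : Z -> 'rV[R]_n -> R[i]) :=
  (forall z, smooth (f z)) /\ forall l, exists C, forall z x,
    normc (partials l (f z) x) <= C * w z * jp x ^+ L.

Section fixed.
Context (Z : Type) (n : nat).
Implicit Types (w : Z -> R) (f g : Z -> 'rV[R]_n -> R[i]).

Lemma uS_smooth w f z : uS w f -> smooth (f z). Proof. by case. Qed.
Lemma uO_smooth w L f z : uO w L f -> smooth (f z). Proof. by case. Qed.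

Lemma uS_partial w f i : uS w f -> uS w (fun z => partial i (f z)).
Proof.
move=> [sf bf]; split=> [z|l N]; first exact: smooth_partial.
by have [C hC] := bf (rcons l i) N; exists C => z x; rewrite -partials_rcons.
Qed.

Lemma uO_partial w L f i : uO w L f -> uO w L (fun z => partial i (f z)).
Proof.
move=> [sf bf]; split=> [z|l]; first exact: smooth_partial.
by have [C hC] := bf (rcons l i); exists C => z x; rewrite -partials_rcons.
Qed.

Lemma uSD w f g : uS w f -> uS w g -> uS w (fun z x => f z x + g z x).
Proof.
move=> [sf bf] [sg bg]; split=> [z|l N]; first exact: smoothD.
have [C hC] := bf l N; have [D hD] := bg l N; exists (C + D) => z x.
rewrite partialsD// mulrDl; apply: le_trans (lerD (hC z x) (hD z x)).
by rewrite -mulrDr ler_wpM2l ?exprn_ge0// le_normcD.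
Qed.

Lemma uOD w L f g : uO w L f -> uO w L g -> uO w L (fun z x => f z x + g z x).
Proof.
move=> [sf bf] [sg bg]; split=> [z|l]; first exact: smoothD.
have [C hC] := bf l; have [D hD] := bg l; exists (C + D) => z x.
rewrite partialsD// !mulrDl; apply: le_trans (lerD (hC z x) (hD z x)).
exact: le_normcD.
Qed.

Lemma uO_leL w L L' f : (L <= L')%N -> uO w L f -> uO w L' f.
Proof.
move=> LL' [sf bf]; split=> // l; have [C hC] := bf l; exists C => z x.
apply: le_trans (hC z x) _; rewrite ler_wpM2l ?jp_leX//.
have := le_trans (normc_ge0 _) (hC z 0); rewrite jp0 expr1n mulr1; exact.
Qed.

(** The innermost derivative is peeled off and produces two products of the same type, so that
    induction replaces the Leibniz formula. At order 0 the growth L of g is paid for by taking N + L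
    powers of decay of f. *)
Lemma uSM w w' L f g : uS w f -> uO w' L g -> uS (fun z => w z * w' z) (fun z x => f z x * g z x).
Proof.
move=> Sf Og; split=> [z|l]; first by apply: smoothM; [exact: uS_smooth Sf|exact: uO_smooth Og].
elim/last_ind: l f g Sf Og => [|l i IH] f g Sf Og N.
  have [C hC] := Sf.2 [::] (N + L)%N; have [D hD] := Og.2 [::].
  exists (C * D) => z x /=; rewrite normcM mulrA.
  have := ler_pM _ _ (hC z x) (hD z x); rewrite !mulr_ge0 ?exprn_ge0// => /(_ isT (normc_ge0 _)).
  rewrite exprD -!mulrA => h.
  rewrite -(ler_pM2l (jpX_gt0 x L)); apply: le_trans (le_trans h _).
    by rewrite mulrCA.
  by rewrite le_eqVlt; apply/orP; left; apply/eqP; ring.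
have [C hC] := IH _ _ (uS_partial i Sf) Og N.
have [D hD] := IH _ _ Sf (uO_partial i Og) N.
exists (C + D) => z x; rewrite partials_rcons.
have sf := uS_smooth z Sf; have sg := uO_smooth z Og.
rewrite (is_partialE (is_partialM (smooth_is_partial0 i sf) (smooth_is_partial0 i sg))).
rewrite (partialsD _ (smoothM (smooth_partial i sf) sg) (smoothM sf (smooth_partial i sg))).
rewrite mulrDl; apply: le_trans (lerD (hC z x) (hD z x)).
by rewrite -mulrDr ler_wpM2l ?exprn_ge0// le_normcD.
Qed.

Lemma uOM w w' L L' f g : uO w L f -> uO w' L' g ->
  uO (fun z => w z * w' z) (L + L') (fun z x => f z x * g z x).
Proof.
move=> Sf Og; split=> [z|l]; first by apply: smoothM; [exact: uO_smooth Sf|exact: uO_smooth Og].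
elim/last_ind: l f g Sf Og => [|l i IH] f g Sf Og.
  have [C hC] := Sf.2 [::]; have [D hD] := Og.2 [::].
  exists (C * D) => z x /=; rewrite normcM exprD.
  apply: le_trans (ler_pM _ _ (hC z x) (hD z x)) _ => //.
  by rewrite le_eqVlt; apply/orP; left; apply/eqP; ring.
have [C hC] := IH _ _ (uO_partial i Sf) Og.
have [D hD] := IH _ _ Sf (uO_partial i Og).
exists (C + D) => z x; rewrite partials_rcons.
have sf := uO_smooth z Sf; have sg := uO_smooth z Og.
rewrite (is_partialE (is_partialM (smooth_is_partial0 i sf) (smooth_is_partial0 i sg))).
rewrite (partialsD _ (smoothM (smooth_partial i sf) sg) (smoothM sf (smooth_partial i sg))).
rewrite !mulrDl; apply: le_trans (lerD (hC z x) (hD z x)).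
exact: le_normcD.
Qed.

Lemma uO_cst (c : Z -> R[i]) : uO (fun z => normc (c z)) 0 (fun z (_ : 'rV[R]_n) => c z).
Proof.
split=> [z|l]; first exact: smooth_cst.
exists 1 => z x; rewrite mul1r expr0 mulr1 partials_cst; case: l => [|? ?]//.
by rewrite normc0.
Qed.

Lemma uO_coord j : uO (fun=> 1) 1 (fun (_ : Z) (x : 'rV[R]_n) => (x 0 j)%:C).
Proof.
split=> [z|]; first exact: smooth_coord.
elim/last_ind => [|l i _].
  by exists 1 => z x; rewrite !mul1r expr1; have := jp_coord x j; rewrite -normcR.
exists 1 => z x; rewrite partials_rcons (is_partialE (@is_partial_coord _ _ i j)) partials_cst.
rewrite !mul1r; apply: le_trans (jpX_ge1 x 1); case: l => [|? ?]; last by rewrite normc0.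
by rewrite normc_natr; case: eqP.
Qed.

Lemma uS_conj w f : uS w f -> uS w (fun z => fconj (f z)).
Proof.
move=> [sf bf]; split=> [z|l N]; first exact: smooth_conj.
by have [C hC] := bf l N; exists C => z x; rewrite partials_conj// /fconj normc_conj.
Qed.

Lemma uO_conj w L f : uO w L f -> uO w L (fun z => fconj (f z)).
Proof.
move=> [sf bf]; split=> [z|l]; first exact: smooth_conj.
by have [C hC] := bf l; exists C => z x; rewrite partials_conj// /fconj normc_conj.
Qed.

Lemma uS_uO w f : uS w f -> uO w 0 f.
Proof.
move=> [sf bf]; split=> // l; have [C hC] := bf l 0%N; exists C => z x.
by have := hC z x; rewrite !expr0 mul1r mulr1.
Qed.

Lemma uSZ w (c : Z -> R[i]) f : uS w f -> uS (fun z => w z * normc (c z)) (fun z x => c z * f z x).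
Proof.
move=> Sf; have := uSM Sf (uO_cst c).
by under [X in uS _ X]eq_fun do under eq_fun do rewrite mulrC.
Qed.

Lemma uOZ w L (c : Z -> R[i]) f : uO w L f ->
  uO (fun z => w z * normc (c z)) L (fun z x => c z * f z x).
Proof.
move=> Sf; have := uOM Sf (uO_cst c); rewrite addn0.
by under [X in uO _ _ X]eq_fun do under eq_fun do rewrite mulrC.
Qed.

Lemma uS_param (Y : Type) (k : Y -> Z) w f : uS w f -> uS (w \o k) (fun y => f (k y)).
Proof.
move=> [sf bf]; split=> [y|l N]; first exact: sf.
by have [C hC] := bf l N; exists C => y x; exact: hC.
Qed.

Lemma uO_param (Y : Type) (k : Y -> Z) w L f : uO w L f -> uO (w \o k) L (fun y => f (k y)).
Proof.
move=> [sf bf]; split=> [y|l]; first exact: sf.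
by have [C hC] := bf l; exists C => y x; exact: hC.
Qed.

Lemma uS_decay w f N : uS w f -> exists C, forall z, decay N (C * w z) (f z).
Proof. by move=> [_ /(_ [::] N)[C hC]]; exists C => z x; exact: hC. Qed.

End fixed.

Section schwartz.
Context (n : nat).
Implicit Types f g : 'rV[R]_n -> R[i].

Lemma monom_le_jp (al : 'I_n -> nat) (x : 'rV[R]_n) : `|monom al x| <= jp x ^+ mlen al.
Proof.
rewrite /monom /mlen normr_prod (big_morph _ (exprD (jp x)) (expr0 _)).
by apply: ler_prod => i _; rewrite normr_ge0/= normrX lerXn2r ?nnegrE// jp_coord.
Qed.

Lemma monom0 (x : 'rV[R]_n) : monom (fun _ : 'I_n => 0%N) x = 1.
Proof. by rewrite /monom big1// => i _; rewrite expr0. Qed.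

Lemma monomS (al : 'I_n -> nat) i (x : 'rV[R]_n) :
  monom (fun j => ((i == j) + al j)%N) x = x 0 i * monom al x.
Proof.
rewrite /monom; under eq_bigr do rewrite exprD; rewrite big_split/=; congr (_ * _).
by rewrite (bigD1 i)//= eqxx expr1 big1 ?mulr1// => j ji; rewrite eq_sym (negbTE ji).
Qed.

(** From right to left, the powers of the bracket are converted into monomials one at a time by <x>
    <= 1 + sum |x_i|; the statement proved by induction carries an arbitrary monomial along. *)
Lemma uS_schwartz f : uS (fun _ : unit => 1) (fun=> f) <-> schwartz f.
Proof.
split=> [[/(_ tt) sf bf]|[sf bf]].
  split=> // al be; have [C hC] := bf (flatten [seq nseq (be i) i | i <- enum 'I_n]) (mlen al).
  exists C => x; have := hC tt x; rewrite mulr1; apply: le_trans.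
  by rewrite ler_wpM2r// monom_le_jp.
split=> // l N; rewrite (partials_mpartial l sf).
pose be := fun i : 'I_n => count_mem i l; rewrite -/be; pose k := mpartial be f; rewrite -/k.
suff [C hC] : exists C : R, forall x, jp x ^+ N * (`|monom (fun _ : 'I_n => 0%N) x| * normc (k x)) <= C.
  by exists C => _ x; have := hC x; rewrite monom0 normr1 mul1r mulr1.
elim: N (fun _ : 'I_n => 0%N) => [|N IH] al.
  by have [C hC] := bf al be; exists C => x; rewrite expr0 mul1r hC.
have [C0 hC0] := IH al.
have /choice[C hC] : forall i : 'I_n, exists C : R, forall x,
  jp x ^+ N * (`|monom (fun j => ((i == j) + al j)%N) x| * normc (k x)) <= C by move=> i; exact: IH.
exists (C0 + \sum_i C i) => x.
rewrite exprS -mulrA; apply: le_trans (ler_wpM2r _ (jp_le_sum x)) _.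
  by rewrite !mulr_ge0 ?exprn_ge0.
rewrite mulrDl mul1r lerD// mulr_suml ler_sum// => i _.
by apply: le_trans (hC i x); rewrite monomS normrM mulrCA !mulrA.
Qed.

Lemma schwartz_smooth f : schwartz f -> smooth f. Proof. by case. Qed.

Lemma uS_schwartz_at Z (w : Z -> R) (F : Z -> 'rV[R]_n -> R[i]) z : uS w F -> schwartz (F z).
Proof.
move=> [sF bF]; apply/uS_schwartz; split=> // l N.
by have [C hC] := bF l N; exists (C * w z) => _ x; rewrite mulr1.
Qed.

Lemma schwartzD f g : schwartz f -> schwartz g -> schwartz (fun x => f x + g x).
Proof. by move=> /uS_schwartz Sf /uS_schwartz Sg; apply/uS_schwartz; exact: uSD. Qed.

Lemma schwartzZ c f : schwartz f -> schwartz (fun x => c * f x).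
Proof.
move=> /uS_schwartz Sf; apply: (@uS_schwartz_at _ _ (fun (_ : unit) x => c * f x) tt).
exact: (uSZ (fun=> c) Sf).
Qed.

Lemma schwartzB f g : schwartz f -> schwartz g -> schwartz (fun x => f x - g x).
Proof.
move=> Sf Sg; have := schwartzD Sf (schwartzZ (-1) Sg).
by under [X in schwartz X -> _]eq_fun do rewrite mulN1r.
Qed.

Lemma schwartz_conj f : schwartz f -> schwartz (fconj f).
Proof. by move=> /uS_schwartz Sf; apply/uS_schwartz; exact: (uS_conj Sf). Qed.

Lemma schwartz_partial i f : schwartz f -> schwartz (partial i f).
Proof. by move=> /uS_schwartz Sf; apply/uS_schwartz; exact: (uS_partial i Sf). Qed.

Lemma schwartz_sum (I : Type) (r : seq I) (F : I -> 'rV[R]_n -> R[i]) :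
  (forall k, schwartz (F k)) -> schwartz (fun x => \sum_(k <- r) F k x).
Proof.
move=> sF; elim: r => [|k r IH].
  under eq_fun do rewrite big_nil.
  apply/uS_schwartz; split=> [_|l N]; first exact: smooth_cst.
  by exists 0 => _ x; rewrite partials_cst; case: l => *; rewrite normc0 mulr0 mul0r.
by under eq_fun do rewrite big_cons; exact: schwartzD.
Qed.

Lemma schwartz_ccont f : schwartz f -> ccont f.
Proof. by case=> sf _; exact: (smooth_ccont [::] sf). Qed.

Lemma schwartz_decay f N : schwartz f -> exists C, decay N C f.
Proof.
by move=> /uS_schwartz[_ /(_ [::] N)[C hC]]; exists C => x; have := hC tt x; rewrite mulr1.
Qed.

Lemma schwartz_cintegrable f : schwartz f -> cintegrable f.
Proof.
move=> Sf; have [C hC] := schwartz_decay n.*2 Sf.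
exact: cintegrable_decay (schwartz_ccont Sf) (leqnn _) hC.
Qed.

End schwartz.
End uniform_classes.

(** * Fourier transform *)

Lemma schwartz0 (R : realType) n : schwartz (fun _ : 'rV[R]_n => 0).
Proof.
apply/uS_schwartz; split=> [_|l N]; first exact: smooth_cst.
by exists 0 => _ x; rewrite partials_cst; case: l => *; rewrite normc0 mulr0 mul0r.
Qed.

(** * Tempered functionals and seminorm bounds *)

Section tempered_functionals.
Context (R : realType) (n : nat).
Implicit Types (f g : 'rV[R]_n -> R[i]) (u : functional R n).

Definition snorm_le N B f := forall l x, (size l <= N)%N ->
  jp x ^+ N * normc (partials l f x) <= B.

(** [uS] provides a constant for each list of derivatives separately; induction on the length sums
    the constants of the finitely many lists in question. *)
Lemma uS_snorm_le Z (w : Z -> R) (F : Z -> 'rV[R]_n -> R[i]) N : uS w F ->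
  exists C, forall z, snorm_le N (C * w z) (F z).
Proof.
move=> SF; suff : forall k, exists C, forall z l x, (size l <= k)%N ->
    jp x ^+ N * normc (partials l (F z) x) <= C * w z.
  by move=> /(_ N)[C hC]; exists C => z l x; exact: hC.
move=> k; elim: k F SF => [|k IH] F SF; have [C0 hC0] := SF.2 [::] N.
  by exists C0 => z [|//] x _; exact: hC0.
have /choice[C hC] : forall i : 'I_n, exists C, forall z l x, (size l <= k)%N ->
    jp x ^+ N * normc (partials l (partial i (F z)) x) <= C * w z.
  by move=> i; exact: IH (uS_partial i SF).
have Cw i z : 0 <= C i * w z.
  by apply: le_trans (hC i z [::] 0 _) => //; rewrite mulr_ge0 ?exprn_ge0.
have C0w z : 0 <= C0 * w z.
  by apply: le_trans (hC0 z 0) => //; rewrite mulr_ge0 ?exprn_ge0.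
exists (C0 + \sum_i C i) => z l x; rewrite mulrDl mulr_suml.
case/lastP: l => [|l i] sl.
  by apply: le_trans (hC0 z x) _; rewrite lerDl sumr_ge0.
rewrite partials_rcons; apply: le_trans (hC i z l x _) _.
  by move: sl; rewrite size_rcons ltnS.
by apply: ler_wpDl => //; rewrite (bigD1 i)//= lerDl sumr_ge0.
Qed.

Definition linear_on_schwartz u := forall (c : R[i]) f g, schwartz f -> schwartz g ->
  u (fun x => c * f x + g x) = c * u f + u g.

Lemma linear_on_schwartz0 u : linear_on_schwartz u -> u (fun=> 0) = 0.
Proof.
move=> lu; have := lu 1 _ _ (schwartz0 R n) (schwartz0 R n).
under [X in u X = _]eq_fun do rewrite mul1r addr0.
by rewrite mul1r => /(congr1 (fun z => z - u (fun=> 0))); rewrite subrr addrK.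
Qed.

(** Continuity at 0 gives a neighbourhood of radius r on which |u| < 1. Scaling f into it yields, by
    homogeneity, a bound with constant 1/r. *)
Lemma tempered_bound u : tempered u ->
  exists N C, 0 <= C /\ forall f B, schwartz f -> snorm_le N B f -> normc (u f) <= C * B.
Proof.
move=> [lu cu].
have [N [r [r0 hr]]] := cu _ (schwartz0 R n) 1 ltr01.
exists N, r^-1; split; first by rewrite invr_ge0 ltW.
move=> f B Sf hB.
have B0 : 0 <= B by apply: le_trans (hB [::] 0 isT); rewrite mulr_ge0// exprn_ge0.
have u0 := linear_on_schwartz0 lu.
apply/ler_addgt0Pr => eps eps0.
(* The summand [r * eps] keeps the scaling factor r/t defined when B = 0; it contributes eps to the
   bound, and eps is arbitrary. *)
pose t := B + r * eps; have t0 : 0 < t by rewrite ltr_wpDl// mulr_gt0.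
have rt0 : 0 <= r / t by apply: divr_ge0; exact: ltW.
have Sg : schwartz (fun x => (r / t)%:C * f x) by exact: schwartzZ.
have := hr _ Sg; rewrite u0 subr0.
have -> : u (fun x => (r / t)%:C * f x) = (r / t)%:C * u f.
  have := lu (r / t)%:C f _ Sf (schwartz0 R n); rewrite u0 addr0 => <-.
  by congr u; apply/funext => x; rewrite addr0.
have -> : normc ((r / t)%:C * u f) = normc (u f) * (r / t).
  by rewrite normcM normcR (ger0_norm rt0) [LHS]mulrC.
rewrite -ltr_pdivlMr ?divr_gt0//.
rewrite mul1r invf_div => h; apply: ltW; apply: lt_le_trans (h _) _; last first.
  by rewrite /t mulrDl [r * eps]mulrC mulfK ?gt_eqF// mulrC.
move=> al be ala beb x.
under eq_fun do rewrite subr0.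
rewrite /mpartial partialsZ; last exact: schwartz_smooth.
rewrite normcM normcR (ger0_norm rt0) mulrCA.
have := hB (flatten [seq nseq (be i) i | i <- enum 'I_n]) x; rewrite size_flatten_mlen => /(_ beb) hx.
apply: (@le_trans _ _ (r / t * B)).
  rewrite ler_wpM2l//; apply: le_trans hx; rewrite ler_wpM2r//.
  by apply: le_trans (monom_le_jp _ _) _; exact: jp_leX.
by rewrite mulrAC ler_pdivrMr// ler_wpM2l ?(ltW r0)// lerDl mulr_ge0// ltW.
Qed.

End tempered_functionals.

(** * Differentiation under the integral and integration by parts *)

Section parametric_integrals.
Context (R : realType).
Local Notation K n := (int_jp R n).

Lemma jp_shift_axis n (x : 'rV[R]_n) (i : 'I_n) (t : R) : `|t| <= 1 ->
  jp (x + t *: delta_mx 0 i) <= 4 * jp x.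
Proof.
move=> t1; apply: le_trans (jpD _ _) _.
have : jp (t *: delta_mx 0 i : 'rV[R]_n) <= 2.
  apply: le_trans (jp_le_sum _) _; rewrite (bigD1 i)//= big1 => [|k ki].
    by rewrite addr0 !mxE !eqxx mulr1 (_ : 2 = 1 + 1 :> R)// lerD2l.
  by rewrite !mxE (negbTE ki) mulr0 normr0.
have := jp_ge0 x; nra.
Qed.

(** The second derivative [G2] bounds the Taylor remainder of the integrand by an integrable
    multiple of h^2; integrating, the remainder of the integral is O(h^2), and
    [is_cderive_of_taylor2] concludes. The factor (4 <x>)^L covers parameters at distance at most 1
    from x. *)
Lemma is_partial_cintegral p n (i : 'I_p) (G0 G1 G2 : 'rV[R]_p -> 'rV[R]_n -> R[i]) (C : R) L :
  (forall y, is_partial i (G0 ^~ y) (G1 ^~ y)) ->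
  (forall y, is_partial i (G1 ^~ y) (G2 ^~ y)) ->
  (forall x, cintegrable (G0 x)) -> (forall x, cintegrable (G1 x)) ->
  (forall x, decay n.*2 (C * jp x ^+ L) (G2 x)) ->
  is_partial i (fun x => cintegral (G0 x)) (fun x => cintegral (G1 x)).
Proof.
move=> d01 d12 i0 i1 hC; apply/is_partial_lineP => x0.
apply: is_cderive_of_taylor2 => t; pose x := x0 + t *: delta_mx 0 i.
have C0 : 0 <= C.
  by have := decay_ge0 (hC 0); rewrite jp0 expr1n mulr1.
exists (2 * (4 * (C * (4 * jp x) ^+ L)) * K n) => h h1.
have -> : x0 + (t + h) *: delta_mx 0 i = x + h *: delta_mx 0 i.
  by rewrite scalerDl addrA.
rewrite -/x -cintegralB// -cintegralZ// -cintegralB//; last 2 first.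
- exact: cintegrableB.
- exact: cintegrableZ.
apply: le_trans (normc_cintegral_le (C := 4 * h ^+ 2 * (C * (4 * jp x) ^+ L)) _ _) _.
- by apply: cintegrableB; [exact: cintegrableB|exact: cintegrableZ].
- move=> y.
  have /is_partial_lineP e01 := d01 y; have /is_partial_lineP e12 := d12 y.
  rewrite mulrC -ler_pdivlMr ?jpX_gt0//.
  have := is_cderive_taylor2 (h := h) (B := C * (4 * jp x) ^+ L / jp y ^+ n.*2) (e01 x) (e12 x).
  rewrite scale0r addr0 mulrA; apply => s /andP[s0 s1].
  rewrite ler_pdivlMr ?jpX_gt0// mulrC; apply: le_trans (hC _ y) _.
  rewrite ler_wpM2l// lerXn2r ?nnegrE ?mulr_ge0// jp_shift_axis//.
  by rewrite normrM (ger0_norm s0) mulr_ile1.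
by rewrite le_eqVlt; apply/orP; left; apply/eqP; ring.
Qed.

(** By translation invariance f0(x + h e) - f0(x) has integral 0. It equals h f1(x) up to an
    integrable error of size h^2, so the integral of f1 is O(h) for every small h. *)
Lemma cintegral_partial n (i : 'I_n) (f0 f1 f2 : 'rV[R]_n -> R[i]) (C : R) :
  is_partial i f0 f1 -> is_partial i f1 f2 ->
  cintegrable f0 -> cintegrable f1 -> decay n.*2 C f2 -> cintegral f1 = 0.
Proof.
move=> d01 d12 i0 i1 hC; pose e := delta_mx 0 i : 'rV[R]_n.
have C0 := decay_ge0 hC.
pose M := 2 * (4 * (C * 4 ^+ n.*2)) * K n.
have key h : 0 < h <= 1 -> normc (cintegral f1) <= M * h.
  move=> /andP[h0 h1]; rewrite -(ler_pM2l h0) -{1}(gtr0_norm h0) -normcR -normcM.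
  have ish : cintegrable (fun x => f0 (x + h *: e)).
    have [a b] := i0.
    by split; under eq_fun do rewrite -[X in X + _]scale1r;
      [exact: (integrable_rV_affine (h *: e) ltr01 a)|exact: (integrable_rV_affine (h *: e) ltr01 b)].
  rewrite -cintegralZ// -normcN -[X in normc X]add0r -{1}(subrr (cintegral f0)).
  rewrite -{1}(cintegral_shift (h *: e) i0) -cintegralB// -cintegralB//; last 2 first.
  - exact: cintegrableB.
  - exact: cintegrableZ.
  apply: le_trans (normc_cintegral_le (C := 4 * h ^+ 2 * (C * 4 ^+ n.*2)) _ _) _.
  - by apply: cintegrableB; [exact: cintegrableB|exact: cintegrableZ].
  - move=> y; rewrite mulrC -ler_pdivlMr ?jpX_gt0//.
    move: d01 d12 => /is_partial_lineP e01 /is_partial_lineP e12.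
    have := is_cderive_taylor2 (h := h) (B := C * 4 ^+ n.*2 / jp y ^+ n.*2) (e01 y) (e12 y).
    rewrite scale0r addr0 mulrA; apply => s /andP[s0 s1].
    rewrite ler_pdivlMr ?jpX_gt0//.
    set y' := y + _; have yy' : jp y <= 4 * jp y'.
      have -> : y = y' + (- (s * h)) *: e by rewrite /y' scaleNr addrK.
      apply: jp_shift_axis; rewrite normrN normrM (ger0_norm s0) (gtr0_norm h0).
      by rewrite mulr_ile1// ltW.
    rewrite mulrC; apply: le_trans (_ : (4 * jp y') ^+ n.*2 * normc (f2 y') <= _).
      by rewrite ler_wpM2r// lerXn2r ?nnegrE ?mulr_ge0.
    by rewrite exprMn -mulrA mulrC ler_wpM2r ?exprn_ge0.
  by rewrite /M le_eqVlt; apply/orP; left; apply/eqP; ring.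
have M0 : 0 <= M by rewrite /M !mulr_ge0 ?exprn_ge0 ?int_jp_ge0.
apply/eq0_normc/eqP; rewrite eq_le normc_ge0 andbT.
apply/ler_addgt0Pl => eps eps0; rewrite addr0.
pose h := Num.min 1 (eps / (M + 1)).
have h0 : 0 < h by rewrite lt_min ltr01 divr_gt0// ltr_wpDl.
apply: le_trans (key h _) _; first by rewrite h0 ge_min lexx.
apply: (@le_trans _ _ ((M + 1) * h)); first by rewrite ler_wpM2r ?lerDl// ltW.
by rewrite mulrC -ler_pdivlMr ?ltr_wpDl// ge_min lexx orbT.
Qed.

End parametric_integrals.

(** * The Fourier transform and its decay *)

Section fourier_transform.
Context (R : realType) (n : nat).
Implicit Types (x y xi : 'rV[R]_n) (h : 'rV[R]_n -> R[i]).

Lemma dotC x y : dot x y = dot y x.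
Proof. by apply: eq_bigr => i _; rewrite mulrC. Qed.

Lemma dotDl x y xi : dot (x + y) xi = dot x xi + dot y xi.
Proof. by rewrite /dot -big_split; apply: eq_bigr => i _; rewrite mxE mulrDl. Qed.

Lemma dotNl x y : dot (- x) y = - dot x y.
Proof. by rewrite /dot -sumrN; apply: eq_bigr => i _; rewrite mxE mulNr. Qed.

Lemma dotBl x y xi : dot (x - y) xi = dot x xi - dot y xi.
Proof. by rewrite dotDl dotNl. Qed.

Lemma dotDr x y xi : dot xi (x + y) = dot xi x + dot xi y.
Proof. by rewrite dotC dotDl ![dot _ xi]dotC. Qed.

Lemma dotNr x y : dot y (- x) = - dot y x.
Proof. by rewrite dotC dotNl dotC. Qed.

Lemma dotZl c x y : dot (c *: x) y = c * dot x y.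
Proof. by rewrite /dot mulr_sumr; apply: eq_bigr => i _; rewrite mxE mulrA. Qed.

Lemma smooth_dot xi : smooth (fun y : 'rV[R]_n => (dot y xi)%:C).
Proof.
have -> : (fun y => (dot y xi)%:C) = (fun y => \sum_i (xi 0 i)%:C * (y 0 i)%:C).
  by apply/funext => y; rewrite /dot rmorph_sum/=; apply: eq_bigr => i _; rewrite mulrC rmorphM.
by apply: smooth_sum => i; apply: smoothZ; exact: smooth_coord.
Qed.

Lemma is_partial_dot xi (j : 'I_n) : is_partial j (fun y => (dot y xi)%:C) (fun=> (xi 0 j)%:C).
Proof.
apply/is_partial_lineP => x.
apply: is_cderive_ext (is_cderiveD (is_cderive_cst (dot x xi)%:C)
  (@is_cderiveR _ (fun t => t * xi 0 j) (fun=> xi 0 j) _)) => t //=.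
- rewrite -rmorphD dotDl dotZl /=; congr (_ + _ * _)%:C.
  by rewrite /dot (bigD1 j)//= mxE !eqxx mul1r big1 ?addr0// => k kj; rewrite mxE (negbTE kj) andbF mul0r.
- by rewrite add0r.
- have := is_deriveM (is_derive_id t (1:R)) (is_derive_cst (xi 0 j) t 1).
  by rewrite /GRing.scale/= mulr0 add0r mulr1.
Qed.

Lemma is_partial_expi_dot xi (j : 'I_n) :
  is_partial j (fun y => expi (dot y xi)) (fun y => 'i * (xi 0 j)%:C * expi (dot y xi)).
Proof. by apply: is_partial_expi; exact: is_partial_dot. Qed.

Lemma smooth_expi_dot xi : smooth (fun y : 'rV[R]_n => expi (dot y xi)).
Proof. by apply: smooth_expi; exact: smooth_dot. Qed.

Definition ft h xi := cintegral (fun y => expi (- dot y xi) * h y).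

Lemma ccont_expi_dot xi : ccont (fun y : 'rV[R]_n => expi (- dot y xi)).
Proof.
under eq_fun do rewrite -dotNr.
exact: (smooth_ccont [::] (smooth_expi_dot (- xi))).
Qed.

Lemma decay_expi N C h (q : 'rV[R]_n -> R) : decay N C h -> decay N C (fun y => expi (q y) * h y).
Proof. by move=> hC y; rewrite normcM normc_expi mul1r. Qed.

Lemma cintegrable_ft h C xi : ccont h -> decay n.*2 C h ->
  cintegrable (fun y => expi (- dot y xi) * h y).
Proof.
move=> ch hC; apply: cintegrable_decay (leqnn _) (decay_expi _ hC).
by apply: ccontM => //; exact: ccont_expi_dot.
Qed.

(** Integration by parts for e^(-i y.xi) h(y). Derivatives of h up to order two are controlled
    because [cintegral_partial] asks for a bound on the second derivative of the function whose
    derivative is integrated. *)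
Lemma ft_partial h (B : R) (j : 'I_n) xi : smooth h ->
  (forall l, (size l <= 2)%N -> decay n.*2 B (partials l h)) ->
  'i * (xi 0 j)%:C * ft h xi = ft (partial j h) xi.
Proof.
move=> sh hB.
pose e y := expi (- dot y xi); pose c := 'i * ((- xi) 0 j)%:C.
have de : is_partial j e (fun y => c * e y).
  apply: is_partial_ext (is_partial_expi_dot (- xi) j) _ _ => y; by rewrite /e dotNr.
have ih l : (size l <= 2)%N -> cintegrable (fun y => e y * partials l h y).
  by move=> hl; apply: cintegrable_ft (hB l hl); exact: smooth_ccont.
pose f0 y := e y * h y.
pose f1 y := c * e y * h y + e y * partial j h y.
pose f2 y := c * (c * e y) * h y + c * e y * partial j h y +
   (c * e y * partial j h y + e y * partial j (partial j h) y).
have s1 := smooth_partial j sh.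
have d01 : is_partial j f0 f1 by apply: is_partialM => //; exact: smooth_is_partial0.
have d12 : is_partial j f1 f2.
  apply: is_partialD; apply: is_partialM => //; try exact: smooth_is_partial0.
  exact: is_partialZ.
have f1E : f1 = (fun y => c * (e y * partials [::] h y) + e y * partials [:: j] h y).
  by apply/funext => y; rewrite /f1 mulrA.
have i0 : cintegrable f0 by exact: (ih [::]).
have i1 : cintegrable f1.
  rewrite f1E; apply: cintegrableD; last exact: ih.
  by apply: cintegrableZ; exact: ih.
have := cintegral_partial (C := (normc c ^+ 2 + 2 * normc c + 1) * B) d01 d12 i0 i1.
rewrite f1E cintegralD//; [|by apply: cintegrableZ; exact: ih|exact: ih].
rewrite cintegralZ; last exact: ih.
move=> H; apply/eqP; rewrite -subr_eq0 -oppr_eq0 opprB addrC; apply/eqP.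
rewrite -[RHS]H /ft; last first.
  move=> y; have n2 := hB [:: j; j] isT y; have n1 := hB [:: j] isT y; have n0 := hB [::] isT y.
  rewrite /= in n0 n1 n2; have ne : normc (e y) = 1 by exact: normc_expi.
  apply: (@le_trans _ _ (normc c ^+ 2 * (jp y ^+ n.*2 * normc (h y)) +
     2 * normc c * (jp y ^+ n.*2 * normc (partial j h y)) + jp y ^+ n.*2 * normc (partial j (partial j h) y))).
    rewrite (_ : _ + _ = jp y ^+ n.*2 * (normc c ^+ 2 * normc (h y) + 2 * normc c * normc (partial j h y) +
      normc (partial j (partial j h) y))); last by ring.
    rewrite ler_wpM2l ?exprn_ge0//.
    apply: le_trans (le_normcD _ _) _; apply: le_trans (lerD (le_normcD _ _) (le_normcD _ _)) _.
    rewrite !normcM ne !mulr1 mul1r le_eqVlt; apply/orP; left; apply/eqP; ring.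
  rewrite (_ : _ * B = normc c ^+ 2 * B + 2 * normc c * B + B); last by ring.
  apply: lerD n2; apply: lerD; first by rewrite ler_wpM2l ?exprn_ge0.
  by rewrite ler_wpM2l ?mulr_ge0.
by rewrite /c mxE rmorphN/= mulrN mulNr.
Qed.

(** Each power of <xi> is dominated by 1 + sum |xi_j|, and each |xi_j| is traded for a derivative of
    h; hence the factor (1 + n)^N. The derivative beyond order N is there for [ft_partial], which
    needs order two. *)
Lemma ft_decay N h (B : R) : smooth h ->
  (forall l, (size l <= N.+1)%N -> decay n.*2 B (partials l h)) ->
  forall xi, jp xi ^+ N * normc (ft h xi) <= (1 + n%:R) ^+ N * (2 * B * int_jp R n).
Proof.
elim: N h => [|N IH] h sh hB xi.
  rewrite !expr0 !mul1r; apply: normc_cintegral_le.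
    by apply: cintegrable_ft (hB [::] isT); exact: (smooth_ccont [::]).
  exact/decay_expi/(hB [::]).
have IH0 := IH h sh (fun l hl => hB l (leqW hl)) xi.
have IHj j : jp xi ^+ N * normc (ft (partial j h) xi) <= (1 + n%:R) ^+ N * (2 * B * int_jp R n).
  apply: IH => [|l hl]; first exact: smooth_partial.
  by rewrite -partials_rcons; apply: hB; rewrite size_rcons.
set M := (1 + n%:R) ^+ N * _ in IH0 IHj.
rewrite exprSr -mulrA; apply: le_trans (_ : jp xi ^+ N * ((1 + \sum_j `|xi 0 j|) * normc (ft h xi)) <= _).
  by rewrite ler_wpM2l ?exprn_ge0// ler_wpM2r// jp_le_sum.
rewrite mulrDl mul1r mulrDr exprS -mulrA -/M mulrDl mul1r; apply: lerD => //.
rewrite mulr_suml mulr_sumr -[n in n%:R]card_ord mulr_natl -sumr_const; apply: ler_sum => j _.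
apply: le_trans (IHj j); rewrite -(@ft_partial h B)//; last first.
  by move=> l hl; apply: hB; exact: leq_trans hl _.
by rewrite !normcM normci normcR mul1r.
Qed.

Lemma uS_ft_decay Z (w : Z -> R) (H : Z -> 'rV[R]_n -> R[i]) N : uS w H ->
  exists C, forall z xi, jp xi ^+ N * normc (ft (H z) xi) <= C * w z.
Proof.
move=> SH; pose M := maxn n.*2 N.+1.
have [C hC] := uS_snorm_le M SH.
exists ((1 + n%:R) ^+ N * (2 * C * int_jp R n)) => z xi.
apply: le_trans (ft_decay (B := C * w z) (uS_smooth z SH) _ xi) _.
  move=> l hl; apply: (@decay_leX _ _ _ M); first by rewrite leq_maxl.
  by move=> x; apply: hC; apply: leq_trans hl _; rewrite leq_maxr.
by rewrite le_eqVlt; apply/orP; left; apply/eqP; ring.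
Qed.

End fourier_transform.

(** * Gaussians *)

Section gaussian.
Context (R : realType) (n : nat).
Implicit Types (x y xi : 'rV[R]_n) (h : 'rV[R]_n -> R[i]).
Local Notation K := (int_jp R n).

Lemma eq0_normc_small (z : R[i]) (C : R) :
  (forall e : R, 0 < e <= 1 -> normc z <= C * e) -> z = 0.
Proof.
move=> H; have C0 : 0 <= C.
  by have := H 1; rewrite ltr01 lexx mulr1 => /(_ isT); exact/le_trans/normc_ge0.
apply/eq0_normc/eqP; rewrite eq_le normc_ge0 andbT.
apply/ler_addgt0Pl => eps eps0; rewrite addr0.
pose h := Num.min 1 (eps / (C + 1)).
have h0 : 0 < h by rewrite lt_min ltr01 divr_gt0// ltr_wpDl.
apply: le_trans (H h _) _; first by rewrite h0 ge_min lexx.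
apply: (@le_trans _ _ ((C + 1) * h)); first by rewrite ler_wpM2r ?lerDl// ltW.
by rewrite mulrC -ler_pdivlMr ?ltr_wpDl// ge_min lexx orbT.
Qed.

Lemma lipschitz_ccont h (D : 'rV[R]_n -> R) : (forall x, 0 <= D x) ->
  (forall x y, (forall i, `|y 0 i - x 0 i| <= 1) ->
    normc (h y - h x) <= D x * \sum_i `|y 0 i - x 0 i|) ->
  ccont h.
Proof.
move=> D0 key.
have main (q : R[i] -> R) : (forall a b, `|q a - q b| <= normc (a - b)) ->
    continuous (fun x => q (h x) : R^o).
  move=> qle x.
  apply/(@cvg_ballP R R^o _ (nbhs x) (nbhs_filter x) (fun x => q (h x))) => e e0.
  pose M := D x * n%:R; have M0 : 0 <= M by rewrite mulr_ge0.
  pose r := Num.min 1 (e / (M + 1)).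
  have r0 : 0 < r by rewrite lt_min ltr01 divr_gt0// ltr_wpDl.
  apply/nbhs_ballP; exists r => //= y yb; have xy := (mx_ballP x y r0).1 yb.
  rewrite -ball_normE/= distrC; apply: le_lt_trans (qle _ _) _.
  apply: le_lt_trans (key x y _) _.
    by move=> i; rewrite distrC; apply: le_trans (ltW (xy i)) _; rewrite ge_min lexx.
  apply: (@le_lt_trans _ _ (M * r)).
    rewrite /M -[leRHS]mulrA ler_wpM2l// -[n in n%:R]card_ord mulr_natl -sumr_const.
    by apply: ler_sum => i _; rewrite distrC ltW.
  apply: (@lt_le_trans _ _ ((M + 1) * r)); first by rewrite ltr_pM2r// ltrDl.
  by rewrite mulrC -ler_pdivlMr ?ltr_wpDl// ge_min lexx orbT.
split; apply: main => a b.
  by rewrite -cReN -cReD le_Re_normc.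
by rewrite -cImN -cImD le_Im_normc.
Qed.

Lemma jp_in_box x y z : in_box x y z -> (forall i, `|y 0 i - x 0 i| <= 1) ->
  jp z <= 2 * (jp x * (1 + n%:R)).
Proof.
move=> zb xy; rewrite -(subrK x z) addrC; apply: le_trans (jpD _ _) _.
rewrite ler_wpM2l// ler_wpM2l//; apply: le_trans (jp_le_sum _) _; rewrite lerD2l.
rewrite -[n in n%:R]card_ord -sumr_const; apply: ler_sum => k _.
have [s /andP[s0 s1] zk] := zb k; rewrite !mxE zk addrAC subrr add0r normrM ger0_norm//.
by rewrite mulr_ile1.
Qed.

(** Polynomially bounded partial derivatives make h locally Lipschitz along boxes. Functions
    obtained by differentiating an integral get their continuity from here. *)
Lemma is_partial_ccont h (g : 'I_n -> 'rV[R]_n -> R[i]) (C : R) L : 0 <= C ->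
  (forall i, is_partial i h (g i)) -> (forall i x, normc (g i x) <= C * jp x ^+ L) ->
  ccont h.
Proof.
move=> C0 dh gC.
apply: (@lipschitz_ccont _ (fun x => 2 * (C * (2 * (jp x * (1 + n%:R))) ^+ L))) => [x|x y xy].
  by rewrite !mulr_ge0// exprn_ge0// !mulr_ge0// addr_ge0.
apply: (box_mean_value (g := g)) => // i z zb; apply: le_trans (gC i z) _.
by rewrite ler_wpM2l// lerXn2r ?nnegrE ?mulr_ge0 ?addr_ge0// (jp_in_box zb).
Qed.

Definition gaussian (c : R) : 'rV[R]_n -> R[i] := fun x => (expR (- (c * dot x x)))%:C.

Lemma smooth_dotxx (c : R) : smooth (fun x : 'rV[R]_n => (- (c * dot x x))%:C).
Proof.
have -> : (fun x : 'rV[R]_n => (- (c * dot x x))%:C) =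
    (fun x => \sum_i (- c)%:C * ((x 0 i)%:C * (x 0 i)%:C)).
  apply/funext => x; rewrite /dot -mulNr mulr_sumr rmorph_sum/=.
  by apply: eq_bigr => i _; rewrite !rmorphM.
by apply: smooth_sum => i; apply: smoothZ; apply: smoothM; exact: smooth_coord.
Qed.

Lemma is_partial_gaussian c (i : 'I_n) :
  is_partial i (gaussian c) (fun x => (- (2 * c * x 0 i))%:C * gaussian c x).
Proof.
apply: is_partial_expR; apply/is_partial_lineP => x.
have dE (t : R) : - (c * dot (x + t *: delta_mx 0 i) (x + t *: delta_mx 0 i)) =
    - (c * dot x x) + (- (2 * c * x 0 i)) * t + (- c) * (t * t).
  pose e : 'rV[R]_n := delta_mx 0 i; rewrite -/e.
  have de y : dot y e = y 0 i.
    rewrite /dot (bigD1 i)//= mxE !eqxx mulr1 big1 ?addr0// => k ki.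
    by rewrite mxE (negbTE ki) andbF mulr0.
  have ee : dot e e = 1 by rewrite de mxE !eqxx.
  rewrite dotDl !dotDr !dotZl (dotC x (t *: e)) dotZl (dotC e x) (dotC e (t *: e)) dotZl de ee.
  by ring.
apply: (is_cderive_ext _ _ (@is_cderiveR _ (fun t => - (c * dot x x) + (- (2 * c * x 0 i)) * t + (- c) * (t * t))
   (fun t => - (2 * c * x 0 i) + (- c) * (t + t)) _)) => t.
- by rewrite dE.
- by rewrite !mxE !eqxx/= mulr1; congr _%:C; ring.
have did := is_derive_id t (1 : R).
have := is_deriveD (is_deriveD (is_derive_cst (- (c * dot x x)) t (1 : R))
  (is_deriveZ (- (2 * c * x 0 i)) did)) (is_deriveZ (- c) (is_deriveM did did)).
by rewrite /GRing.scale/= !mulr1 add0r.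
Qed.

(** Writing -c|x|^2 = c - c<x>^2 reduces the claim to e^t >= t^M / M! at t = c<x>^2, where M = N + 1
    gives even 2M powers of the bracket. *)
Lemma gaussian_decay c N : 0 < c -> exists C, decay N C (gaussian c).
Proof.
move=> c0; have c0' := ltW c0; pose M := N.+1; exists (expR c * (M`!%:R / c ^+ M)) => x.
rewrite /gaussian normcR ger0_norm ?expR_ge0//.
have -> : - (c * dot x x) = c - c * jp x ^+ 2 by rewrite jp_sqr; ring.
rewrite expRD expRN mulrCA ler_wpM2l ?expR_ge0// ler_pdivrMr ?expR_gt0//.
have := @expR_ge1Dxn _ (c * jp x ^+ 2) N; rewrite mulr_ge0 ?exprn_ge0// => /(_ isT) h.
apply: (@le_trans _ _ (M`!%:R / c ^+ M * ((c * jp x ^+ 2) ^+ M / M`!%:R))); last first.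
  rewrite ler_wpM2l ?divr_ge0 ?exprn_ge0//.
  by apply: le_trans h; rewrite lerDr.
rewrite (_ : _ / _ * _ = (jp x ^+ 2) ^+ M); last first.
  rewrite exprMn; move: (jp x ^+ 2) => t.
  by field; rewrite expf_neq0 ?gt_eqF//= pnatr_eq0 -lt0n fact_gt0.
rewrite -exprM jp_leX//.
by rewrite mul2n -addnn; apply: leq_trans (leq_addr _ _).
Qed.

Lemma uO_unit (w : unit -> R) L (f : unit -> 'rV[R]_n -> R[i]) :
  uO w L f -> uO (fun=> 1) L f.
Proof.
move=> [sf bf]; split=> // l; have [C hC] := bf l; exists (C * w tt) => -[] x.
by rewrite mulr1; exact: hC.
Qed.

Lemma gaussian_schwartz c : 0 < c -> schwartz (gaussian c).
Proof.
move=> c0.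
have sG : smooth (gaussian c) by apply: smooth_expR; exact: smooth_dotxx.
apply/uS_schwartz; split=> // l N.
(* The induction over derivatives needs a prefactor f of polynomial growth: differentiating f times
   the Gaussian replaces f by its derivative minus 2 c x_i f, of growth one degree higher. *)
suff H : forall (f : unit -> 'rV[R]_n -> R[i]) L, uO (fun=> 1) L f ->
    exists C, forall x, jp x ^+ N * normc (partials l (fun x => f tt x * gaussian c x) x) <= C.
  have [C hC] := H _ _ (uO_unit (uO_cst n (fun _ : unit => 1 : R[i]))).
  exists C => _ x; have := hC x; rewrite mulr1.
  by under [X in partials l X]eq_fun do rewrite mul1r.
elim/last_ind: l => [|l i IH] f L Of.
  have [C hC] := Of.2 [::]; have [D hD] := gaussian_decay (N + L)%N c0.
  exists (C * D) => x /=; rewrite normcM.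
  apply: (@le_trans _ _ (jp x ^+ N * (C * 1 * jp x ^+ L * normc (gaussian c x)))).
    by rewrite ler_wpM2l ?exprn_ge0// ler_wpM2r//; exact: hC.
  have C0 : 0 <= C.
    by have := le_trans (normc_ge0 _) (hC tt 0); rewrite jp0 expr1n !mulr1.
  rewrite mulr1 -mulrA mulrCA ler_wpM2l// mulrA -exprD; exact: hD.
pose g z (x : 'rV[R]_n) := partial i (f z) x + (- (2 * c))%:C * (f z x * (x 0 i)%:C).
have O1 := uO_leL (leqnSn L) (uO_partial i Of).
have := uOM Of (@uO_coord R unit n i); rewrite addn1.
move=> /(uOZ (fun=> (- (2 * c))%:C)) /uO_unit O2.
have [C hC] := IH g _ (uOD O1 O2).
exists C => x; rewrite partials_rcons.
have sf := uO_smooth tt Of.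
rewrite (is_partialE (is_partialM (smooth_is_partial0 i sf) (is_partial_gaussian c i))).
have := hC x; congr (_ * normc (partials _ _ _) <= _); apply/funext => y.
by rewrite /g mulrDl; congr (_ + _); rewrite -mulNr !rmorphM/=; ring.
Qed.

Lemma cintegral_gaussian1 : cintegral (gaussian 1) = (Num.sqrt pi ^+ n)%:C.
Proof.
apply: complex_eqP => /=; last by rewrite Rintegral_cst// mul0r.
rewrite /Rintegral (eq_integral (fun x => (\prod_(i < n) gauss_fun (x 0 i))%:E)).
  rewrite (@ge0_integral_rV_prod R n gauss_fun (Num.sqrt pi))//.
  - exact: measurable_gauss_fun.
  - exact: gauss_fun_ge0.
  - exact: integralT_gauss.
move=> x _; congr EFin; rewrite mul1r /dot -sumrN expR_sum.
by apply: eq_bigr => i _; rewrite /gauss_fun expr2.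
Qed.

Lemma cintegral_gaussian4 : cintegral (gaussian 4^-1) = (2 ^+ n * Num.sqrt pi ^+ n)%:C.
Proof.
have c0 : 0 < 4^-1 :> R by rewrite invr_gt0.
rewrite (cintegral_affine 0 (ltr0Sn R 1) (schwartz_cintegrable (gaussian_schwartz c0))).
rewrite rmorphM/= -cintegral_gaussian1; congr (_ * cintegral _); apply/funext => x.
rewrite /gaussian addr0 dotZl dotC dotZl; congr (expR (- _))%:C; by field.
Qed.

End gaussian.

Section swap.
Context (R : realType) (m n : nat).
Variables (F : 'rV[R]_m -> 'rV[R]_n -> R[i]) (C : R).
Hypothesis Fc : ccont (fun z : 'rV[R]_(m + n) => F (lsubmx z) (rsubmx z)).
Hypothesis FC : forall x y,
  jp x ^+ (m + n).*2 * jp y ^+ (m + n).*2 * normc (F x y) <= C.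

Let F' (z : 'rV[R]_(m + n)) := F (lsubmx z) (rsubmx z).

Let decayF' : decay (m + n).*2 C F'.
Proof.
move=> z; apply: le_trans (FC (lsubmx z) (rsubmx z)); rewrite ler_wpM2r//.
by rewrite -exprMn lerXn2r ?nnegrE ?mulr_ge0// -{1}(hsubmxK z) jp_row_mx.
Qed.

Lemma cintegral_pairE :
  cintegral F' = cintegral (fun x => cintegral (F x)).
Proof.
rewrite (cintegral_splitl Fc decayF'); congr cintegral; apply/funext => x.
by congr cintegral; apply/funext => y; rewrite row_mxKl row_mxKr.
Qed.

Lemma cintegral_swap :
  cintegral (fun x => cintegral (F x)) = cintegral (fun y => cintegral (F ^~ y)).
Proof.
rewrite -cintegral_pairE (cintegral_splitr Fc decayF'); congr cintegral; apply/funext => y.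
by congr cintegral; apply/funext => x; rewrite row_mxKl row_mxKr.
Qed.

End swap.

(** * Fourier inversion on Schwartz functions *)

Section fourier_inversion.
Context (R : realType) (n : nat).
Implicit Types (x y xi : 'rV[R]_n) (h : 'rV[R]_n -> R[i]).

Lemma schwartz_ft_decay h N : schwartz h -> exists C, decay N C (ft h).
Proof.
move=> /uS_schwartz Sh; have [C hC] := uS_ft_decay N Sh.
by exists C => xi; have := hC tt xi; rewrite mulr1.
Qed.

Lemma schwartz_cintegrable_ft h xi : schwartz h ->
  cintegrable (fun y => expi (- dot y xi) * h y).
Proof.
move=> Sh; have [C hC] := schwartz_decay n.*2 Sh.
exact: cintegrable_ft (schwartz_ccont Sh) hC.
Qed.

Lemma ftZ c h xi : schwartz h -> ft (fun y => c * h y) xi = c * ft h xi.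
Proof.
move=> Sh; rewrite /ft -cintegralZ; last exact: schwartz_cintegrable_ft.
by congr cintegral; apply/funext => y; rewrite mulrCA.
Qed.

Lemma schwartz_coordM h (j : 'I_n) c : schwartz h -> schwartz (fun y => c * (y 0 j)%:C * h y).
Proof.
move=> /uS_schwartz Sh.
have := uSZ (fun=> c) (uSM Sh (@uO_coord R unit n j)).
move=> /(uS_schwartz_at tt) => /=.
by under [X in schwartz X -> _]eq_fun do rewrite [h _ * _]mulrC mulrA.
Qed.

Lemma is_partial_ft h (j : 'I_n) : schwartz h ->
  is_partial j (ft h) (ft (fun y => - 'i * (y 0 j)%:C * h y)).
Proof.
move=> Sh; pose h1 := fun y : 'rV[R]_n => - 'i * (y 0 j)%:C * h y.
have Sh1 : schwartz h1 := schwartz_coordM j (- 'i) Sh.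
pose h2 := fun y : 'rV[R]_n => - 'i * (y 0 j)%:C * h1 y.
have Sh2 : schwartz h2 := schwartz_coordM j (- 'i) Sh1.
have de (k : 'rV[R]_n -> R[i]) y : is_partial j (fun xi => expi (- dot y xi) * k y)
    (fun xi => expi (- dot y xi) * (- 'i * (y 0 j)%:C * k y)).
  have E : (fun xi => expi (- dot y xi) * k y) = (fun xi => k y * expi (dot xi (- y))).
    by apply/funext => xi; rewrite dotNr dotC mulrC.
  rewrite E; apply: is_partial_ext (is_partialZ (k y) (is_partial_expi_dot (- y) j)) _ _ => // xi.
  by rewrite dotNr dotC mxE rmorphN/=; ring.
have [C hC] := schwartz_decay n.*2 Sh2.
apply: (@is_partial_cintegral _ _ _ _ (fun xi y => expi (- dot y xi) * h y) 
  (fun xi y => expi (- dot y xi) * h1 y) (fun xi y => expi (- dot y xi) * h2 y) C 0).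
- by move=> y; exact: de.
- by move=> y; exact: de.
- by move=> xi; exact: schwartz_cintegrable_ft.
- by move=> xi; exact: schwartz_cintegrable_ft.
- by move=> xi; rewrite expr0 mulr1; exact: decay_expi.
Qed.

Lemma ft_ccont h : schwartz h -> ccont (ft h).
Proof.
move=> Sh.
have /choice[C hC] : forall j : 'I_n, exists C, decay 0 C (ft (fun y => - 'i * (y 0 j)%:C * h y)).
  by move=> j; apply: schwartz_ft_decay; exact: schwartz_coordM.
have C0 j : 0 <= C j := decay_ge0 (hC j).
apply: (@is_partial_ccont _ _ _ (fun j => ft (fun y => - 'i * (y 0 j)%:C * h y)) (\sum_j C j) 0).
- by apply: sumr_ge0.
- by move=> j; exact: is_partial_ft.
- move=> j x; rewrite expr0 mulr1; have := hC j x; rewrite expr0 mul1r => /le_trans; apply.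
  by rewrite (bigD1 j)//= lerDl sumr_ge0.
Qed.

(** Transforming the equation for the derivative of the Gaussian shows that its transform satisfies
    d_j = -(xi_j / 2) times itself. Multiplied by e^(|xi|^2/4) it therefore has vanishing gradient;
    the constant is the Gaussian integral, its value at 0. *)
Lemma ft_gaussian xi : ft (gaussian 1) xi = (Num.sqrt pi ^+ n)%:C * gaussian 4^-1 xi.
Proof.
have SG := gaussian_schwartz n (@ltr01 R).
pose q xi := ft (gaussian 1) xi * (expR (4^-1 * dot xi xi))%:C.
have dE (j : 'I_n) : is_partial j (fun xi => (expR (4^-1 * dot xi xi))%:C)
     (fun xi : 'rV[R]_n => (2^-1 * xi 0 j)%:C * (expR (4^-1 * dot xi xi))%:C).
  apply: is_partial_ext (is_partial_gaussian (- 4^-1) j) _ _ => x; rewrite /gaussian mulNr opprK//.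
  by congr (_%:C * _); field.
have dft (j : 'I_n) : is_partial j (ft (gaussian 1)) (fun xi => - (2^-1 * xi 0 j)%:C * ft (gaussian 1) xi).
  apply: is_partial_ext (is_partial_ft j SG) _ _ => // x.
  have [B hB'] := uS_snorm_le (maxn n.*2 2) ((uS_schwartz _).2 SG).
  have h2 (l : seq 'I_n) : (size l <= 2)%N -> decay n.*2 B (partials l (gaussian 1)).
    move=> sl; apply: (@decay_leX _ _ _ (maxn n.*2 2)); first exact: leq_maxl.
    move=> y; have := hB' tt l y; rewrite mulr1; apply.
    exact: leq_trans sl (leq_maxr _ _).
  have := ft_partial j x (schwartz_smooth SG) h2.
  rewrite (is_partialE (is_partial_gaussian 1 j)) => H.
  have -> : (fun y : 'rV[R]_n => - 'i * (y 0 j)%:C * gaussian 1 y) =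
     (fun y => ('i * (2^-1)%:C) * ((- (2 * 1 * y 0 j))%:C * gaussian 1 y)).
    apply/funext => y; rewrite mulrA; congr (_ * _).
    rewrite -[RHS]mulrA -rmorphM/= (_ : 2^-1 * - (2 * 1 * y 0 j) = - y 0 j); last by field.
    by rewrite rmorphN/= mulrN mulNr.
  rewrite ftZ; last first.
    by rewrite -(is_partialE (is_partial_gaussian 1 j)); exact: schwartz_partial.
  rewrite -H !mulrA; congr (_ * _).
  rewrite -[X in X * _]mulrA [_ * 'i]mulrC mulrA -expr2 sqr_i mulN1r mulNr rmorphM//=.
have dq (j : 'I_n) : is_partial j q (fun=> 0).
  apply: is_partial_ext (is_partialM (dft j) (dE j)) _ _ => // x; by ring.
have qc : q xi = q 0.
  apply/subr0_eq/eq0_normc/eqP; rewrite eq_le normc_ge0 andbT.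
  have := @box_mean_value _ _ q (fun _ _ => 0) 0 xi 0 dq.
  rewrite mulr0 mul0r; apply => *; by rewrite normc0.
have q0 : q 0 = (Num.sqrt pi ^+ n)%:C.
  rewrite -cintegral_gaussian1 /q /ft.
  have d0 y : dot y 0 = 0 by rewrite -(scale0r 0) dotC dotZl mul0r.
  rewrite d0 mulr0 expR0 mulr1; congr cintegral; apply/funext => y.
  by rewrite d0 oppr0 expi0 mul1r.
rewrite -q0 -qc /q /gaussian -mulrA -rmorphM/= -expRD subrr expR0 mulr1//.
Qed.

Lemma axis_affine_shift x :
  axis_affine (@Some 'I_n) (fun=> 1) (fun y => y + x).
Proof.
split=> [|i y t /=]; last by rewrite mul1r addrAC.
by apply: continuous_addrV; [move=> y; exact: cvg_id|exact: cst_continuous].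
Qed.

Lemma schwartz_shift h x : schwartz h -> schwartz (fun y => h (y + x)).
Proof.
move=> /uS_schwartz [/(_ tt) sh bh]; apply/uS_schwartz; split=> [_|l N].
  exact: smooth_comp (axis_affine_shift x) sh.
have [C hC] := bh (pmap (@Some 'I_n) l) N; exists (2 ^+ N * (jp x ^+ N * C)) => _ y.
rewrite mulr1; apply: (@le_trans _ _ ((2 * (jp (y + x) * jp x)) ^+ N *
    normc (partials (pmap (@Some 'I_n) l) h (y + x)))).
  apply: ler_pM; rewrite ?exprn_ge0//.
    rewrite lerXn2r ?nnegrE ?mulr_ge0//.
    by have := jpDl y (- x); rewrite opprK jpN.
  apply: normc_partials_comp (axis_affine_shift x) sh _ => i; by rewrite normr1.
rewrite !exprMn -!mulrA ler_wpM2l ?exprn_ge0// mulrCA ler_wpM2l ?exprn_ge0//.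
by have := hC tt (y + x); rewrite mulr1.
Qed.

Lemma schwartz_lipschitz h : schwartz h -> exists2 C, 0 <= C & forall x y,
  normc (h y - h x) <= C * \sum_i `|y 0 i - x 0 i|.
Proof.
move=> Sh.
have /choice[C hC] : forall j : 'I_n, exists C, decay 0 C (partial j h).
  by move=> j; apply: schwartz_decay; exact: schwartz_partial.
have C0 j : 0 <= C j := decay_ge0 (hC j).
exists (2 * \sum_j C j); first by rewrite mulr_ge0// sumr_ge0.
move=> x y; apply: (@box_mean_value _ _ h (fun j => partial j h)).
  by move=> i; apply: smooth_is_partial0; exact: schwartz_smooth.
move=> j z _; have := hC j z; rewrite expr0 mul1r => /le_trans; apply.
by rewrite (bigD1 j)//= lerDl sumr_ge0.
Qed.

Lemma decay_dilate N (C e : R) h : 0 < e <= 1 -> decay N C h ->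
  decay N (C * e^-1 ^+ N) (fun y => h (e *: y)).
Proof.
move=> /andP[e0 e1] hC z.
have je : jp z <= e^-1 * jp (e *: z).
  apply: ler_jp; first by rewrite invr_ge0 ltW.
  rewrite dotZl dotC dotZl mulrDr mulr1.
  have ei : 1 <= e^-1 by rewrite invf_ge1.
  apply: lerD; first by rewrite exprn_ege1.
  by rewrite le_eqVlt; apply/orP; left; apply/eqP; field; rewrite gt_eqF.
have e'0 : 0 <= e^-1 by rewrite invr_ge0 ltW.
apply: (@le_trans _ _ ((e^-1 * jp (e *: z)) ^+ N * normc (h (e *: z)))).
  by rewrite ler_wpM2r// lerXn2r ?nnegrE ?mulr_ge0.
by rewrite exprMn -mulrA mulrC ler_wpM2r ?exprn_ge0.
Qed.

(** Inversion at the origin by Gaussian regularization: the integral of G(e xi) times the transform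
    of h equals the integral of h(e y) times the transform of G. As e tends to 0 the first tends to
    the left-hand side and the second to h(0) times the integral of the transform of G, which is (2
    pi)^n. *)
Lemma cintegral_ft h : schwartz h -> cintegral (ft h) = ((2 * pi) ^+ n)%:C * h 0.
Proof.
move=> Sh.
have SG := gaussian_schwartz n (@ltr01 R).
have [CG hG] := schwartz_decay (n + n).*2 SG.
have [Ch hh] := schwartz_decay (n + n).*2 Sh.
have i_ft : cintegrable (ft h).
  have [C hC] := schwartz_ft_decay n.*2 Sh.
  exact: cintegrable_decay (ft_ccont Sh) (leqnn _) hC.
pose I e := cintegral (fun xi => gaussian 1 (e *: xi) * ft h xi).
have dil e k : 0 < e <= 1 -> cintegrable k ->
    cintegral k = (e ^+ n)%:C * cintegral (fun y : 'rV[R]_n => k (e *: y)).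
  move=> /andP[e0 e1] ik; rewrite (cintegral_affine 0 e0 ik); congr (_ * cintegral _).
  by apply/funext => y; rewrite addr0.
have IE e : 0 < e <= 1 -> I e = cintegral (fun y => h (e *: y) * ft (gaussian 1) y).
  move=> e01; have /andP[e0 e1] := e01.
  have en0 : (e ^+ n)%:C != 0 :> R[i] by rewrite fmorph_eq0 expf_neq0// gt_eqF.
  (* The kernel after the substitution y -> e y in the transform of h. It decays rapidly in both
     variables, so the order of integration may be exchanged; the inner xi-integral, rescaled, is
     the transform of the Gaussian at y. *)
  pose F y xi := (e ^+ n)%:C * (expi (- dot (e *: y) xi) * h (e *: y)) * gaussian 1 (e *: xi).
  have Fc : ccont (fun z : 'rV[R]_(n + n) => F (lsubmx z) (rsubmx z)).
    have cl := continuous_comp_fun (@continuous_lsubmx R 1 n n) (@continuous_scaleR R n e).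
    have cr' := @continuous_rsubmx R 1 n n.
    have cr := continuous_comp_fun cr' (@continuous_scaleR R n e).
    apply: ccontM; last exact: (ccont_comp cr (schwartz_ccont SG)).
    apply: ccontM; first exact: ccont_cst.
    apply: ccontM; last exact: (ccont_comp cl (schwartz_ccont Sh)).
    by apply: ccont_expi; apply: continuous_oppR; exact: continuous_dot.
  have FC y xi : jp y ^+ (n + n).*2 * jp xi ^+ (n + n).*2 * normc (F y xi) <=
      e ^+ n * ((Ch * e^-1 ^+ (n + n).*2) * (CG * e^-1 ^+ (n + n).*2)).
    have en : normc ((e ^+ n)%:C : R[i]) = e ^+ n.
      by rewrite normcR ger0_norm// exprn_ge0// ltW.
    rewrite /F !normcM normc_expi mul1r en.
    have alg (a b c k g : R) : a * b * (c * k * g) = c * ((a * k) * (b * g)) by ring.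
    rewrite alg.
    apply: ler_wpM2l; first by rewrite exprn_ge0// ltW.
    by apply: ler_pM; rewrite ?mulr_ge0 ?exprn_ge0//; apply: decay_dilate.
  transitivity (cintegral (fun xi => cintegral (F ^~ xi))).
    rewrite /I; congr cintegral; apply/funext => xi.
    rewrite /ft (dil e _ e01 (schwartz_cintegrable_ft xi Sh)) mulrC.
    rewrite mulrAC -cintegralZ.
      by congr cintegral; apply/funext => y; rewrite /F; ring.
    apply: (@cintegrable_decay _ _ (n + n).*2 _ (Ch * e^-1 ^+ (n + n).*2)).
    - apply: ccontM; last exact: (ccont_comp (@continuous_scaleR R n e) (schwartz_ccont Sh)).
      exact: (ccont_comp (@continuous_scaleR R n e) (ccont_expi_dot xi)).
    - by rewrite leq_double leq_addl.
    - by apply: decay_expi; exact: decay_dilate.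
  rewrite -(cintegral_swap Fc FC); congr cintegral; apply/funext => y.
  rewrite /ft (dil e _ e01 (schwartz_cintegrable_ft y SG)) mulrA -cintegralZ; last first.
    apply: (@cintegrable_decay _ _ (n + n).*2 _ (CG * e^-1 ^+ (n + n).*2)).
    - apply: ccontM; last exact: (ccont_comp (@continuous_scaleR R n e) (schwartz_ccont SG)).
      exact: (ccont_comp (@continuous_scaleR R n e) (ccont_expi_dot y)).
    - by rewrite leq_double leq_addl.
    - by apply: decay_expi; exact: decay_dilate.
  congr cintegral; apply/funext => xi.
  by rewrite /F !dotZl (dotC xi y); ring.
have [C1 hC1] := schwartz_ft_decay (n.*2 + 2)%N Sh.
have [Lh Lh0 hLh] := schwartz_lipschitz Sh.
have [C2 hC2] := schwartz_ft_decay (n.*2 + 1)%N SG.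
have i_ftG : cintegrable (ft (gaussian 1 : 'rV[R]_n -> R[i])).
  have [C hC] := schwartz_ft_decay n.*2 SG.
  exact: cintegrable_decay (ft_ccont SG) (leqnn _) hC.
have E0 : cintegral (ft (gaussian 1 : 'rV[R]_n -> R[i])) = ((2 * pi) ^+ n)%:C.
  rewrite (_ : ft _ = (fun xi => (Num.sqrt pi ^+ n)%:C * gaussian 4^-1 xi)); last first.
    by apply/funext => xi; exact: ft_gaussian.
  rewrite cintegralZ ?cintegral_gaussian4.
    have p2 : Num.sqrt pi * Num.sqrt pi = pi :> R by rewrite -expr2 sqr_sqrtr// pi_ge0.
    by rewrite -rmorphM/= -[in RHS]p2 !exprMn mulrCA.
  by apply: schwartz_cintegrable; apply: gaussian_schwartz; rewrite invr_gt0.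
(* Both errors are O(e) with integrable weights: 1 - G(e xi) <= e <xi>^2, and |h(e y) - h(0)| is at
   most a constant times e <y> by the Lipschitz bound. *)
apply/subr0_eq; apply: (@eq0_normc_small _ _ (2 * C1 * int_jp R n + 2 * (Lh * n%:R * C2) * int_jp R n)) => e e01.
have /andP[e0 e1] := e01.
have ccG : ccont (fun xi : 'rV[R]_n => gaussian 1 (e *: xi)).
  exact: (ccont_comp (@continuous_scaleR R n e) (schwartz_ccont SG)).
have cch : ccont (fun xi : 'rV[R]_n => h (e *: xi)).
  exact: (ccont_comp (@continuous_scaleR R n e) (schwartz_ccont Sh)).
have d1 : decay n.*2 (C1 * e) (fun xi => ft h xi - gaussian 1 (e *: xi) * ft h xi).
  move=> xi; rewrite -{1}[ft h xi]mul1r -mulrBl normcM.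
  have : normc (1 - gaussian 1 (e *: xi)) <= e * jp xi ^+ 2.
    rewrite /gaussian mul1r dotZl dotC dotZl mulrA -expr2 -(rmorph1 (real_complex R)) -rmorphB normcR.
    have d0 := dotxx_ge0 xi.
    have g1 : expR (- (e ^+ 2 * dot xi xi)) <= 1.
      by rewrite expR_le1 oppr_le0 mulr_ge0// exprn_ge0// ltW.
    rewrite ger0_norm ?subr_ge0//; have := expR_ge1Dx (- (e ^+ 2 * dot xi xi)).
    rewrite jp_sqr => h1; apply: (@le_trans _ _ (e ^+ 2 * dot xi xi)); first by lra.
    have : e ^+ 2 * dot xi xi <= e * dot xi xi by rewrite ler_wpM2r// expr2 ler_piMl// ltW.
    by move: e0; lra.
  move=> h1; apply: (@le_trans _ _ (jp xi ^+ n.*2 * (e * jp xi ^+ 2 * normc (ft h xi)))).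
    by rewrite ler_wpM2l ?exprn_ge0// ler_wpM2r.
  have alg (a b c k : R) : a * (b * c * k) = b * (a * c * k) by ring.
  by rewrite alg [C1 * e]mulrC ler_wpM2l ?(ltW e0)//; have := hC1 xi; rewrite exprD.
have d2 : decay n.*2 (Lh * n%:R * C2 * e) (fun y => h (e *: y) * ft (gaussian 1) y - h 0 * ft (gaussian 1) y).
  move=> y; rewrite -mulrBl normcM.
  have : normc (h (e *: y) - h 0) <= Lh * n%:R * e * jp y.
    apply: le_trans (hLh _ _) _; rewrite -!mulrA ler_wpM2l//.
    rewrite -[n in n%:R]card_ord mulr_natl -sumr_const; apply: ler_sum => i _.
    by rewrite !mxE subr0 normrM gtr0_norm// ler_wpM2l ?jp_coord// ltW.
  move=> h1; apply: (@le_trans _ _ (jp y ^+ n.*2 * (Lh * n%:R * e * jp y * normc (ft (gaussian 1) y)))).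
    by rewrite ler_wpM2l ?exprn_ge0// ler_wpM2r.
  have := hC2 y; rewrite exprD expr1 => h2.
  have alg (a b c k : R) : a * (b * c * k) = b * (a * c * k) by ring.
  by rewrite alg [_ * C2 * e]mulrAC ler_wpM2l// !mulr_ge0// ltW.
have iI : cintegrable (fun xi => gaussian 1 (e *: xi) * ft h xi).
  have := cintegrableB i_ft (cintegrable_decay (ccontB (ft_ccont Sh) (ccontM ccG (ft_ccont Sh))) (leqnn _) d1).
  by under [X in cintegrable X -> _]eq_fun do rewrite opprB addrC subrK.
have iG0 : cintegrable (fun y => h 0 * ft (gaussian 1) y) by exact: cintegrableZ.
have iG : cintegrable (fun y => h (e *: y) * ft (gaussian 1) y).
  have := cintegrableD iG0 (cintegrable_decay (ccontB (ccontM cch (ft_ccont SG))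
    (ccontM (@ccont_cst R 'rV[R]_n (h 0)) (ft_ccont SG))) (leqnn _) d2).
  by under [X in cintegrable X -> _]eq_fun do rewrite addrC subrK.
have -> : cintegral (ft h) - ((2 * pi) ^+ n)%:C * h 0 =
    cintegral (fun xi => ft h xi - gaussian 1 (e *: xi) * ft h xi) +
    cintegral (fun y => h (e *: y) * ft (gaussian 1) y - h 0 * ft (gaussian 1) y).
  rewrite !cintegralB// -/(I e) IE// addrA subrK cintegralZ// E0; congr (_ - _); exact: mulrC.
apply: le_trans (le_normcD _ _) _.
apply: le_trans (lerD (normc_cintegral_le _ d1) (normc_cintegral_le _ d2)) _.
- exact: cintegrableB.
- exact: cintegrableB.
- by rewrite le_eqVlt; apply/orP; left; apply/eqP; ring.
Qed.

(** The translate of h by x has transform e^(i x.xi) times that of h, so the case of the origin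
    applies to it. *)
Lemma fourier_inversion h x : schwartz h ->
  cintegral (fun xi => expi (dot x xi) * ft h xi) = ((2 * pi) ^+ n)%:C * h x.
Proof.
move=> Sh; pose hx y := h (y + x).
have Shx : schwartz hx by exact: schwartz_shift.
have := cintegral_ft Shx; rewrite {2}/hx add0r => <-; congr cintegral; apply/funext => xi.
have ik : cintegrable (fun y => expi (- dot (y - x) xi) * h y).
  have := cintegrableZ (expi (dot x xi)) (schwartz_cintegrable_ft xi Sh).
  under [X in cintegrable X -> _]eq_fun do rewrite mulrA -expiD.
  by under [X in _ -> cintegrable X]eq_fun do rewrite dotBl opprB.
rewrite /ft -cintegralZ; last exact: schwartz_cintegrable_ft.
have := cintegral_shift x ik.
rewrite /hx; under [X in cintegral X = _ -> _]eq_fun do rewrite addrK.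
move=> ->; congr cintegral; apply/funext => y.
by rewrite mulrA -expiD dotBl opprB.
Qed.

End fourier_inversion.

(** * Short-time Fourier transform *)

Section time_frequency_shifts.
Context (R : realType) (d : nat).
Implicit Types (psi g : 'rV[R]_d -> R[i]) (w z : 'rV[R]_(d + d)) (y : 'rV[R]_d).

Lemma time_freq_smooth psi w : smooth psi -> smooth (time_freq psi w).
Proof.
move=> sp; apply: smoothM; first exact: smooth_expi_dot.
exact: smooth_comp (axis_affine_shift (- lsubmx w)) sp.
Qed.

Lemma is_partial_time_freq psi w (i : 'I_d) : smooth psi ->
  is_partial i (time_freq psi w)
    (fun y => 'i * (rsubmx w 0 i)%:C * time_freq psi w y + time_freq (partial i psi) w y).
Proof.
move=> sp.
have := is_partialM (is_partial_expi_dot (rsubmx w) i)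
  (is_partial_comp i (axis_affine_shift (- lsubmx w)) sp).
move=> h; apply: is_partial_ext h _ _ => // y /=.
by rewrite /time_freq mul1r mulrA.
Qed.

Lemma jp_lsubmx w : jp (lsubmx w) <= jp w.
Proof. by rewrite -{2}(hsubmxK w) jp_row_mxl. Qed.

Lemma jp_rsubmx w : jp (rsubmx w) <= jp w.
Proof. by rewrite -{2}(hsubmxK w) jp_row_mxr. Qed.

Lemma jp_le_subsub w : jp w <= jp (lsubmx w) * jp (rsubmx w).
Proof. by rewrite -{1}(hsubmxK w) jp_row_mx. Qed.

Lemma time_freq_bound0 psi N : schwartz psi -> exists2 C, 0 <= C & forall w y,
  jp y ^+ N * normc (time_freq psi w y) <= C * jp w ^+ N.
Proof.
move=> Sp; have [C hC] := schwartz_decay N Sp; have C0 := decay_ge0 hC.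
exists (2 ^+ N * C) => [|w y]; first by rewrite mulr_ge0// exprn_ge0.
rewrite /time_freq normcM normc_expi mul1r.
apply: (@le_trans _ _ ((2 * (jp (y - lsubmx w) * jp w)) ^+ N * normc (psi (y - lsubmx w)))).
  rewrite ler_wpM2r// lerXn2r ?nnegrE ?mulr_ge0//.
  apply: le_trans (jpDl y (lsubmx w)) _; rewrite ler_wpM2l// ler_wpM2l//.
  exact: jp_lsubmx.
have alg (a b c e : R) : a * (b * c) * e = a * (b * e) * c by ring.
by rewrite !exprMn alg ler_wpM2r ?exprn_ge0// ler_wpM2l ?exprn_ge0.
Qed.

(** A derivative either brings down a frequency coordinate of w, hence at most one power of <w>, or
    falls on the window; by induction the seminorms of the shifted window grow polynomially in w.
    The exponent K just adds up all those that occur. *)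
Lemma time_freq_bound psi N k : schwartz psi -> exists C K, 0 <= C /\
  forall l w y, (size l <= k)%N ->
    jp y ^+ N * normc (partials l (time_freq psi w) y) <= C * jp w ^+ K.
Proof.
move=> Sp; elim: k psi Sp => [|k IH] psi Sp; have [C0 C00 hC0] := time_freq_bound0 N Sp.
  by exists C0, N; split=> // -[|//] w y _; exact: hC0.
have [C1 [K1 [C10 hC1]]] := IH _ Sp.
have /choice[CK hCK] : forall i : 'I_d, exists CK : R * nat, 0 <= CK.1 /\ forall l w y, (size l <= k)%N ->
    jp y ^+ N * normc (partials l (time_freq (partial i psi) w) y) <= CK.1 * jp w ^+ CK.2.
  by move=> i; have [C [K h]] := IH _ (schwartz_partial i Sp); exists (C, K).
pose K := (N + K1.+1 + \sum_i (CK i).2)%N.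
exists (C0 + C1 + \sum_i (CK i).1), K; split.
  by rewrite !addr_ge0// sumr_ge0// => i _; case: (hCK i).
move=> l w y; have sp := schwartz_smooth Sp.
have w0 := jpX_gt0 w K.
have S0 : 0 <= \sum_i (CK i).1 by apply: sumr_ge0 => i _; case: (hCK i).
case/lastP: l => [_|l i sl] /=.
  apply: le_trans (hC0 w y) _; apply: ler_pM => //; rewrite ?exprn_ge0//.
    by rewrite -addrA lerDl addr_ge0.
  by rewrite jp_leX// /K -addnA leq_addr.
rewrite partials_rcons (is_partialE (is_partial_time_freq w i sp)).
have lk : (size l <= k)%N by move: sl; rewrite size_rcons ltnS.
rewrite partialsD; last 2 first.
- by apply: smoothZ; exact: time_freq_smooth.
- by apply: time_freq_smooth; exact: smooth_partial.
rewrite partialsZ; last exact: time_freq_smooth.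
apply: (@le_trans _ _ (jp w * (C1 * jp w ^+ K1) + (CK i).1 * jp w ^+ (CK i).2)).
  apply: (@le_trans _ _ (jp w * (jp y ^+ N * normc (partials l (time_freq psi w) y)) +
    jp y ^+ N * normc (partials l (time_freq (partial i psi) w) y))).
    rewrite mulrCA -mulrDr ler_wpM2l ?exprn_ge0//; apply: le_trans (le_normcD _ _) _.
    rewrite lerD2r !normcM normci mul1r normcR ler_wpM2r//.
    exact: le_trans (jp_coord _ _) (jp_rsubmx w).
  apply: lerD; first by rewrite ler_wpM2l// hC1.
  by have [_ h] := hCK i; exact: h.
have a1 : jp w * (C1 * jp w ^+ K1) <= C1 * jp w ^+ K.
  rewrite mulrCA ler_wpM2l// -exprS jp_leX// /K addnAC; exact: leq_addl.
have a2 : (CK i).1 * jp w ^+ (CK i).2 <= (\sum_i (CK i).1) * jp w ^+ K.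
  apply: ler_pM; rewrite ?exprn_ge0//; first by case: (hCK i).
    by rewrite (bigD1 i)//= lerDl sumr_ge0// => j _; case: (hCK j).
  by rewrite jp_leX// /K (bigD1 i)//= addnCA leq_addr.
have a3 : 0 <= C0 * jp w ^+ K by rewrite mulr_ge0// ltW.
rewrite !mulrDl; lra.
Qed.

(** For the map w -> y - x, with x the position part of w: position directions of w move its value,
    frequency directions do not. [tf_mod_sigma] is the opposite choice, for the frequency part. *)
Definition tf_sub_sigma (i : 'I_(d + d)) : option 'I_d :=
  match fintype.split i with inl j => Some j | inr _ => None end.

Definition tf_mod_sigma (i : 'I_(d + d)) : option 'I_d :=
  match fintype.split i with inl _ => None | inr j => Some j end.

Lemma axis_affine_sub y : axis_affine tf_sub_sigma (fun=> -1) (fun w => y - lsubmx w).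
Proof.
split=> [|i w t].
  by apply: continuous_subrV; [exact: cst_continuous|exact: continuous_lsubmx].
rewrite /tf_sub_sigma linearD linearZ /= -{1}(fintype.splitK i).
case: (fintype.split i) => j /=.
  have -> : lsubmx (delta_mx 0 (lshift d j) : 'rV[R]_(d + d)) = delta_mx 0 j.
    by apply/rowP => k; rewrite !mxE eq_lshift.
  by rewrite opprD addrA mulN1r scaleNr.
have -> : lsubmx (delta_mx 0 (rshift d j) : 'rV[R]_(d + d)) = 0.
  by apply/rowP => k; rewrite !mxE eq_lrshift.
by rewrite !scaler0 !addr0.
Qed.

Lemma axis_affine_rsubmx : axis_affine tf_mod_sigma (fun=> 1) (@rsubmx R 1 d d).
Proof.
split=> [|i w t]; first exact: continuous_rsubmx.
rewrite /tf_mod_sigma linearD linearZ /= -{1}(fintype.splitK i) mul1r.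
case: (fintype.split i) => j /=.
  have -> : rsubmx (delta_mx 0 (lshift d j) : 'rV[R]_(d + d)) = 0.
    by apply/rowP => k; rewrite !mxE eq_rlshift.
  by rewrite scaler0.
congr (_ + _ *: _).
by apply/rowP => k; rewrite !mxE eq_rshift.
Qed.

(** The mean value estimate is applied in the phase space variable w. Differentiating in position
    hits the window, differentiating in frequency brings down a coordinate of y, which is why [N.+1]
    powers of decay enter. *)
Lemma time_freq_lipschitz0 psi N : schwartz psi -> exists C K, 0 <= C /\
  forall w w' y, (forall i, `|w' 0 i - w 0 i| <= 1) ->
    jp y ^+ N * normc (time_freq psi w' y - time_freq psi w y)
      <= C * jp w ^+ K * \sum_i `|w' 0 i - w 0 i|.
Proof.
move=> Sp; have sp := schwartz_smooth Sp.
have [C0 C00 hC0] := time_freq_bound0 N.+1 Sp.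
have /choice[C1 hC1] : forall i : 'I_d, exists C, 0 <= C /\ forall w y,
    jp y ^+ N * normc (time_freq (partial i psi) w y) <= C * jp w ^+ N.
  by move=> i; have [C c0 h] := time_freq_bound0 N (schwartz_partial i Sp); exists C.
have S0 : 0 <= \sum_i C1 i by apply: sumr_ge0 => i _; case: (hC1 i).
pose M := C0 + \sum_i C1 i; have M0 : 0 <= M by rewrite addr_ge0.
exists (2 * (M * (2 * (1 + (d + d)%:R)) ^+ N.+1)), N.+1; split.
  by rewrite !mulr_ge0// exprn_ge0// mulr_ge0// addr_ge0.
move=> w w' y ww'.
pose G (i : 'I_(d + d)) v := oapp (fun j => (1 : R)%:C * ('i * (y 0 j)%:C * expi (dot (rsubmx v) y))) 0
     (tf_mod_sigma i) * psi (y - lsubmx v) +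
   expi (dot (rsubmx v) y) * oapp (fun j => (-1 : R)%:C * partial j psi (y - lsubmx v)) 0 (tf_sub_sigma i).
have dG i : is_partial i (fun v => time_freq psi v y) (G i).
  have h := is_partialM (is_partial_comp i axis_affine_rsubmx (smooth_expi_dot y))
    (is_partial_comp i (axis_affine_sub y) sp).
  apply: is_partial_ext h _ _ => v; first by rewrite /time_freq dotC.
  by rewrite /G; congr (_ * _ + _); case: (tf_mod_sigma i) => //= j;
    rewrite (is_partialE (is_partial_expi_dot y j)).
have Gb i v : jp y ^+ N * normc (G i v) <= M * jp v ^+ N.+1.
  rewrite /G /tf_mod_sigma /tf_sub_sigma; case: (fintype.split i) => j /=.
    rewrite mul0r add0r normcM normc_expi mul1r normcM normcR normrN1 mul1r.
    have [c0 h] := hC1 j; have := h v y; rewrite /time_freq normcM normc_expi mul1r => /le_trans; apply.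
    apply: ler_pM; rewrite ?exprn_ge0 ?jp_leX//.
    apply: ler_wpDl => //; rewrite (bigD1 j)//= lerDl sumr_ge0// => k _; by case: (hC1 k).
  rewrite mulr0 addr0 !normcM normc_expi normci normc1 !mul1r mulr1 normcR.
  have := hC0 v y; rewrite /time_freq normcM normc_expi mul1r => h.
  apply: (@le_trans _ _ (C0 * jp v ^+ N.+1)); last by rewrite ler_wpM2r ?exprn_ge0// lerDl.
  by apply: le_trans h; rewrite exprSr -mulrA ler_wpM2l ?exprn_ge0// ler_wpM2r// jp_coord.
rewrite mulrC -ler_pdivlMr ?jpX_gt0//.
apply: le_trans (box_mean_value (B := M * (2 * (jp w * (1 + (d + d)%:R))) ^+ N.+1 / jp y ^+ N) dG _) _.
  move=> i v vb; rewrite ler_pdivlMr ?jpX_gt0// mulrC; apply: le_trans (Gb i v) _.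
  by rewrite ler_wpM2l// lerXn2r ?nnegrE ?mulr_ge0 ?addr_ge0// (jp_in_box vb).
rewrite le_eqVlt; apply/orP; left; apply/eqP; rewrite !exprMn.
move: (jp w ^+ _) (_ ^-1) (\sum_i _) => a b c.
by ring.
Qed.

Lemma jp_near w w' : (forall i, `|w' 0 i - w 0 i| <= 1) -> jp w' <= 2 * (jp w * (1 + (d + d)%:R)).
Proof.
move=> ww'; apply: (@jp_in_box _ _ w w' w') => // k; exists 1; first by rewrite lexx ler01.
by rewrite mul1r addrC subrK.
Qed.

(** Time-frequency shifts depend on w in a locally Lipschitz way for every Schwartz seminorm. This
    gives continuity of the transforms and convergence of Riemann sums in the topology of S. *)
Lemma time_freq_lipschitz psi N k : schwartz psi -> exists C K, 0 <= C /\
  forall l w w' y, (size l <= k)%N -> (forall i, `|w' 0 i - w 0 i| <= 1) ->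
    jp y ^+ N * normc (partials l (time_freq psi w') y - partials l (time_freq psi w) y)
      <= C * jp w ^+ K * \sum_i `|w' 0 i - w 0 i|.
Proof.
move=> Sp; elim: k psi Sp => [|k IH] psi Sp; have [C0 [K0 [C00 hC0]]] := time_freq_lipschitz0 N Sp.
  by exists C0, K0; split=> // -[|//] w w' y _; exact: hC0.
have [C1 [K1 [C10 hC1]]] := IH _ Sp.
have [C2 [K2 [C20 hC2]]] := time_freq_bound N k Sp.
have /choice[CK hCK] : forall i : 'I_d, exists CK : R * nat, 0 <= CK.1 /\
  forall l w w' y, (size l <= k)%N -> (forall i, `|w' 0 i - w 0 i| <= 1) ->
    jp y ^+ N * normc (partials l (time_freq (partial i psi) w') y - partials l (time_freq (partial i psi) w) y)
      <= CK.1 * jp w ^+ CK.2 * \sum_i `|w' 0 i - w 0 i|.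
  by move=> i; have [C [K h]] := IH _ (schwartz_partial i Sp); exists (C, K).
pose D := (2 * (1 + (d + d)%:R)) ^+ K2 : R.
have D0 : 0 <= D by rewrite exprn_ge0// mulr_ge0// addr_ge0.
pose K := (K0 + K1.+1 + K2 + \sum_i (CK i).2)%N.
have S0 : 0 <= \sum_i (CK i).1 by apply: sumr_ge0 => i _; case: (hCK i).
exists (C0 + C1 + C2 * D + \sum_i (CK i).1), K; split; first by rewrite !addr_ge0// mulr_ge0.
move=> l w w' y sl ww'; have sp := schwartz_smooth Sp.
set s := \sum_i `|w' 0 i - w 0 i|.
have s0 : 0 <= s by exact: sumr_ge0.
have le_w k' c : 0 <= c -> (k' <= K)%N -> c * jp w ^+ k' <= c * jp w ^+ K.
  by move=> c0 kK; rewrite ler_wpM2l// jp_leX.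
have a0 : C0 * jp w ^+ K0 <= C0 * jp w ^+ K by apply: le_w => //; rewrite /K -!addnA leq_addr.
have p1 : 0 <= C1 * jp w ^+ K by rewrite mulr_ge0// exprn_ge0.
have p2 : 0 <= C2 * D * jp w ^+ K by rewrite mulr_ge0 ?exprn_ge0// mulr_ge0.
have p3 : 0 <= (\sum_i (CK i).1) * jp w ^+ K by rewrite mulr_ge0// exprn_ge0.
have p0 : 0 <= C0 * jp w ^+ K by rewrite mulr_ge0// exprn_ge0.
case/lastP: l sl => [_|l i sl].
  apply: le_trans (hC0 w w' y ww') _; rewrite ler_wpM2r// !mulrDl; lra.
rewrite !partials_rcons !(is_partialE (is_partial_time_freq _ i sp)).
have lk : (size l <= k)%N by move: sl; rewrite size_rcons ltnS.
rewrite !(partialsD _ (smoothZ _ (time_freq_smooth _ sp)) (time_freq_smooth _ (smooth_partial i sp))).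
rewrite !(partialsZ _ _ (time_freq_smooth _ sp)).
set P' := partials l (time_freq psi w') y; set P := partials l (time_freq psi w) y.
set Q' := partials l (time_freq (partial i psi) w') y; set Q := partials l (time_freq (partial i psi) w) y.
have E : 'i * (rsubmx w' 0 i)%:C * P' + Q' - ('i * (rsubmx w 0 i)%:C * P + Q) =
   'i * (rsubmx w 0 i)%:C * (P' - P) + 'i * (rsubmx w' 0 i - rsubmx w 0 i)%:C * P' + (Q' - Q).
  by rewrite rmorphB/=; ring.
rewrite E; apply: (@le_trans _ _ (jp y ^+ N * (jp w * normc (P' - P) + s * normc P' + normc (Q' - Q)))).
  rewrite ler_wpM2l ?exprn_ge0//; apply: le_trans (le_normcD _ _) _; rewrite lerD2r.
  apply: le_trans (le_normcD _ _) _; rewrite !normcM normci !mul1r !normcR; apply: lerD.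
    by rewrite ler_wpM2r//; exact: le_trans (jp_coord _ _) (jp_rsubmx w).
  rewrite ler_wpM2r// !mxE /s (bigD1 (rshift d i))//= lerDl; exact: sumr_ge0.
rewrite !mulrDr.
have b1 : jp y ^+ N * (jp w * normc (P' - P)) <= C1 * jp w ^+ K * s.
  rewrite mulrCA; apply: le_trans (ler_wpM2l (jp_ge0 w) (hC1 l w w' y lk ww')) _.
  have alg (a b c e : R) : a * (b * c * e) = b * (a * c) * e by ring.
  rewrite alg -exprS -/s ler_wpM2r//; apply: le_w => //.
  by rewrite /K -!addnA addnCA leq_addr.
have b2 : jp y ^+ N * (s * normc P') <= C2 * D * jp w ^+ K * s.
  rewrite mulrCA mulrC ler_wpM2r//; apply: le_trans (hC2 l w' y lk) _.
  rewrite -mulrA ler_wpM2l//; apply: (@le_trans _ _ ((2 * (jp w * (1 + (d + d)%:R))) ^+ K2)).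
    by rewrite lerXn2r ?nnegrE ?mulr_ge0 ?addr_ge0//; exact: jp_near.
  have -> : (2 * (jp w * (1 + (d + d)%:R))) ^+ K2 = D * jp w ^+ K2.
    by rewrite /D -exprMn mulrCA [jp w * _]mulrC.
  rewrite ler_wpM2l ?exprn_ge0 ?mulr_ge0 ?addr_ge0//.
  by rewrite jp_leX// /K addnAC leq_addl.
have b3 : jp y ^+ N * normc (Q' - Q) <= (\sum_i (CK i).1) * jp w ^+ K * s.
  have [c0 h] := hCK i; apply: le_trans (h l w w' y lk ww') _; rewrite ler_wpM2r//.
  apply: ler_pM; rewrite ?exprn_ge0//.
    by rewrite (bigD1 i)//= lerDl sumr_ge0// => j _; case: (hCK j).
  by rewrite jp_leX// /K (bigD1 i)//= addnCA leq_addr.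
have p0s : 0 <= C0 * jp w ^+ K * s by rewrite mulr_ge0.
rewrite !mulrDl; lra.
Qed.

Lemma time_freq_schwartz psi w : schwartz psi -> schwartz (time_freq psi w).
Proof.
move=> Sp; apply/uS_schwartz; split=> [_|l N]; first exact/time_freq_smooth/schwartz_smooth.
have [C [K [_ hC]]] := time_freq_bound N (size l) Sp.
by exists (C * jp w ^+ K) => _ y; rewrite mulr1; exact: hC.
Qed.

End time_frequency_shifts.

(** * Short-time Fourier transforms of bounded functionals *)

Section bounded_functionals.
Context (R : realType) (d : nat).
Implicit Types (psi g f h : 'rV[R]_d -> R[i]) (w z : 'rV[R]_(d + d)) (u : functional R d).

(** A form of temperedness shared by u and by [dist_of g] for Schwartz g, so that one set of
    estimates serves both. *)
Definition bounded_functional u := linear_on_schwartz u /\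
  exists N C, 0 <= C /\ forall f B, schwartz f -> snorm_le N B f -> normc (u f) <= C * B.

Lemma conjcM (a b : R[i]) : conjc (a * b) = conjc a * conjc b.
Proof. exact: rmorphM. Qed.

Lemma tempered_bounded u : tempered u -> bounded_functional u.
Proof. by move=> tu; split; [case: tu|exact: tempered_bound]. Qed.

Lemma schwartzM f g : schwartz f -> schwartz g -> schwartz (fun y => f y * g y).
Proof.
move=> /uS_schwartz Sf /uS_schwartz Sg.
exact: (uS_schwartz_at tt (uSM Sf (uS_uO Sg))).
Qed.

Lemma dist_of_bounded g : schwartz g -> bounded_functional (dist_of g).
Proof.
move=> Sg; split.
  move=> c f h Sf Sh; rewrite /dist_of.
  have ig k : schwartz k -> cintegrable (fun y => g y * k y).
    by move=> Sk; apply: schwartz_cintegrable; exact: schwartzM.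
  rewrite -cintegralZ; last exact: ig.
  rewrite -cintegralD; [|exact/cintegrableZ/ig|exact: ig].
  by congr cintegral; apply/funext => y; ring.
have [Cg hCg] := schwartz_decay d.*2 Sg; have Cg0 := decay_ge0 hCg.
exists 0%N, (2 * Cg * int_jp R d); split; first by rewrite !mulr_ge0 ?int_jp_ge0.
move=> f B Sf hB.
have hd : decay d.*2 (Cg * B) (fun y => g y * f y).
  move=> y; rewrite normcM mulrA; apply: ler_pM => //.
  - by rewrite mulr_ge0 ?exprn_ge0.
  - by have := hB [::] y isT; rewrite expr0 mul1r.
apply: le_trans (normc_cintegral_le _ hd) _; last by rewrite -subr_ge0 (_ : _ - _ = 0)//; ring.
by apply: schwartz_cintegrable; exact: schwartzM.
Qed.

Lemma pairing_linear u (c : R[i]) f g : linear_on_schwartz u -> schwartz f -> schwartz g ->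
  pairing u (fun x => c * f x + g x) = conjc c * pairing u f + pairing u g.
Proof.
move=> lu Sf Sg; rewrite /pairing -lu; [|exact: schwartz_conj|exact: schwartz_conj].
by congr u; apply/funext => x; rewrite /fconj rmorphD rmorphM.
Qed.

Lemma pairingB u f g : linear_on_schwartz u -> schwartz f -> schwartz g ->
  pairing u (fun x => f x - g x) = pairing u f - pairing u g.
Proof.
move=> lu Sf Sg; have := pairing_linear (-1) lu Sg Sf.
rewrite rmorphN1 mulN1r addrC => <-; congr pairing; apply/funext => x.
by rewrite mulN1r addrC.
Qed.

Lemma pairing_bound u : bounded_functional u -> exists N C, 0 <= C /\
  forall f B, schwartz f -> snorm_le N B f -> normc (pairing u f) <= C * B.
Proof.
move=> [_ [N [C [C0 hC]]]]; exists N, C; split=> // f B Sf hB.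
apply: hC; first exact: schwartz_conj.
move=> l x lN; rewrite (partials_conj _ (schwartz_smooth Sf)) /fconj normc_conj; exact: hB.
Qed.

Lemma stft_bound psi u : schwartz psi -> bounded_functional u ->
  exists C K, 0 <= C /\ forall w, normc (stft psi u w) <= C * jp w ^+ K.
Proof.
move=> Sp /pairing_bound[N [C [C0 hC]]]; have [D [K [D0 hD]]] := time_freq_bound N N Sp.
exists (C * D), K; split=> [|w]; first exact: mulr_ge0.
rewrite -mulrA; apply: hC; first exact: time_freq_schwartz.
by move=> l x; exact: hD.
Qed.

Lemma stft_lipschitz psi u : schwartz psi -> bounded_functional u ->
  exists C K, 0 <= C /\ forall w w', (forall i, `|w' 0 i - w 0 i| <= 1) ->
    normc (stft psi u w' - stft psi u w) <= C * jp w ^+ K * \sum_i `|w' 0 i - w 0 i|.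
Proof.
move=> Sp bu; have /pairing_bound[N [C [C0 hC]]] := bu.
have [D [K [D0 hD]]] := time_freq_lipschitz N N Sp.
exists (C * D), K; split=> [|w w' ww']; first exact: mulr_ge0.
rewrite /stft -pairingB; [|exact: bu.1|exact: time_freq_schwartz|exact: time_freq_schwartz].
rewrite -!mulrA [D * _]mulrA; apply: hC.
  by apply: schwartzB; exact: time_freq_schwartz.
move=> l x lN; have sf v := time_freq_smooth v (schwartz_smooth Sp).
by rewrite (partialsB _ (sf _) (sf _)); exact: hD.
Qed.

Lemma stft_ccont psi u : schwartz psi -> bounded_functional u -> ccont (stft psi u).
Proof.
move=> Sp bu; have [C [K [C0 hC]]] := stft_lipschitz Sp bu.
apply: (@lipschitz_ccont _ _ _ (fun w => C * jp w ^+ K)) => [w|w w']; last exact: hC.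
by rewrite mulr_ge0// exprn_ge0.
Qed.

Lemma stft_dist_of psi g w :
  stft psi (dist_of g) w = ft (fun y => g y * conjc (psi (y - lsubmx w))) (rsubmx w).
Proof.
rewrite /stft /pairing /dist_of /ft; congr cintegral; apply/funext => y.
by rewrite /fconj /time_freq conjcM conjc_expi mulrCA.
Qed.

(** The decay <y - p>^-M of the window and its derivatives becomes <p>^-M <y>^M by Peetre's
    inequality: decay in the translation p, bought with growth in y that a Schwartz factor can
    absorb. *)
Lemma uO_window psi M : schwartz psi ->
  uO (fun p : 'rV[R]_d => jp p ^- M) M (fun p y => conjc (psi (y - p))).
Proof.
move=> Sp; have Sc := schwartz_conj Sp; have sp := schwartz_smooth Sc.
split=> [p|l]; first exact: (smooth_comp (axis_affine_shift (- p)) sp).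
have /uS_schwartz[_ /(_ (pmap (@Some 'I_d) l) M)[C hC]] := Sc.
exists (C * 2 ^+ M) => p y.
apply: le_trans (normc_partials_comp l y (axis_affine_shift (- p)) sp _) _.
  by move=> _; rewrite normr1.
have {hC} := hC tt (y - p); rewrite mulr1; set Q := normc _ => hC.
have h : jp p ^+ M <= (2 * (jp (y - p) * jp y)) ^+ M.
  by rewrite lerXn2r ?nnegrE ?mulr_ge0// jpB; exact: jpDl.
rewrite -(ler_pM2l (jpX_gt0 p M)).
apply: le_trans (ler_wpM2r (normc_ge0 _) h) _; rewrite -/Q !exprMn.
have alg (a b c e f : R) : f != 0 -> f * (a * b * f^-1 * c) = a * (b * c) by move=> f0; field.
rewrite alg ?gt_eqF ?jpX_gt0//.
have alg2 (a b c e : R) : a * (b * c) * e = b * e * (a * c) by ring.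
by rewrite alg2 ler_wpM2r ?mulr_ge0 ?exprn_ge0.
Qed.

(** At position p the transform is the Fourier transform of [h k] times the translated window, a
    Schwartz family of weight [v k] <p>^-M. Its frequency decay combined with this weight gives
    decay in both halves of w. *)
Lemma uS_stft_decay Z (v : Z -> R) (h : Z -> 'rV[R]_d -> R[i]) psi M : schwartz psi ->
  (forall k, 0 <= v k) -> uS v h ->
  exists C, 0 <= C /\ forall k w, jp w ^+ M * normc (stft psi (dist_of (h k)) w) <= C * v k.
Proof.
move=> Sp v0 Sh.
have S2 := uSM (uS_param (@fst Z 'rV[R]_d) Sh) (uO_param (@snd Z 'rV[R]_d) (uO_window M Sp)).
have [C hC] := uS_ft_decay M S2; exists `|C|; split=> // k w.
have {}hC : jp (rsubmx w) ^+ M * normc (stft psi (dist_of (h k)) w) <= C * (v k * jp (lsubmx w) ^- M).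
  by rewrite stft_dist_of; exact: hC (k, lsubmx w) (rsubmx w).
have hM : jp w ^+ M <= (jp (lsubmx w) * jp (rsubmx w)) ^+ M.
  by rewrite lerXn2r ?nnegrE ?mulr_ge0//; exact: jp_le_subsub.
apply: le_trans (ler_wpM2r (normc_ge0 _) hM) _.
rewrite exprMn -mulrA; apply: le_trans (ler_wpM2l _ hC) _; first by rewrite exprn_ge0.
have alg (a b c : R) : a != 0 -> a * (b * (c * a^-1)) = b * c by move=> a0; field.
by rewrite alg ?gt_eqF ?jpX_gt0// ler_wpM2r// ler_norm.
Qed.

(** Translating the variable of integration by the position of z leaves only a unimodular phase,
    which the modulus removes. *)
Lemma stft_covariant psi h z w : schwartz psi -> schwartz h ->
  normc (stft psi (dist_of (time_freq h z)) w) = normc (stft psi (dist_of h) (w - z)).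
Proof.
move=> Sp Sh.
pose F y := time_freq h z y * fconj (time_freq psi w) y.
have iF : cintegrable F.
  apply: schwartz_cintegrable; apply: schwartzM; first exact: time_freq_schwartz.
  exact/schwartz_conj/time_freq_schwartz.
have E : stft psi (dist_of (time_freq h z)) w = cintegral F by [].
rewrite E -(cintegral_shift (lsubmx z) iF).
have -> : cintegral (fun y => F (y + lsubmx z)) =
    expi (dot (lsubmx z) (rsubmx z - rsubmx w)) * stft psi (dist_of h) (w - z).
  rewrite /stft /pairing /dist_of -cintegralZ; last first.
    apply: schwartz_cintegrable; apply: schwartzM => //.
    exact/schwartz_conj/time_freq_schwartz.
  congr cintegral; apply/funext => y; rewrite /F /fconj /time_freq !conjcM !conjc_expi.
  rewrite addrK (linearB (@lsubmx R 1 d d)).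
  rewrite (_ : y + lsubmx z - lsubmx w = y - (lsubmx w - lsubmx z)); last by rewrite opprB addrA.
  set c := conjc _; rewrite [LHS](_ : _ = expi (dot (y + lsubmx z) (rsubmx z)) *
    expi (- dot (y + lsubmx z) (rsubmx w)) * (h y * c)); last by ring.
  rewrite [RHS](_ : _ = expi (dot (lsubmx z) (rsubmx z - rsubmx w)) * expi (- dot y (rsubmx w - rsubmx z)) * (h y * c)).
    by rewrite -!expiD !dotDl !dotDr !dotNr; congr (expi _ * _); ring.
  by rewrite linearB/=; ring.
by rewrite normcM normc_expi mul1r.
Qed.

End bounded_functionals.

(** * Gabor inversion for tempered distributions *)

Section riemann_sums.
Context (R : realType) (n : nat).
Implicit Types (F : 'rV[R]_n -> R[i]) (w : 'rV[R]_n).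
Local Notation mu := (lebesgue_rV R n).

Lemma cintegrable_sum (I : Type) (r : seq I) (G : I -> 'rV[R]_n -> R[i]) :
  (forall k, cintegrable (G k)) -> cintegrable (fun x => \sum_(k <- r) G k x).
Proof.
move=> iG; elim: r => [|k r IH].
  under eq_fun do rewrite big_nil.
  by split; apply: integrable0.
by under eq_fun do rewrite big_cons; exact: cintegrableD.
Qed.

Lemma cintegral_sum (I : Type) (r : seq I) (G : I -> 'rV[R]_n -> R[i]) :
  (forall k, cintegrable (G k)) ->
  cintegral (fun x => \sum_(k <- r) G k x) = \sum_(k <- r) cintegral (G k).
Proof.
move=> iG; elim: r => [|k r IH].
  under eq_fun do rewrite big_nil.
  by rewrite big_nil; apply: complex_eqP => /=; rewrite Rintegral_cst// mul0r.
under eq_fun do rewrite big_cons.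
by rewrite cintegralD// ?IH ?big_cons//; exact: cintegrable_sum.
Qed.

Section cubes.
Variables (k m : nat).
Hypothesis m0 : (0 < m)%N.
Local Notation N := (k.*2 * m)%N.
Local Notation h := (m%:R^-1 : R).

Let h0 : 0 < h. Proof. by rewrite invr_gt0 ltr0n. Qed.

(** Lower corners of the half-open cubes of side 1/m that tile ]-k, k]^n, with 2km positions in each
    coordinate. *)
Definition corner (j : {ffun 'I_n -> 'I_N}) : 'rV[R]_n := \row_i (- k%:R + (j i)%:R * h).

Definition cube (j : {ffun 'I_n -> 'I_N}) : set 'rV[R]_n :=
  rV_box (fun i => `](corner j 0 i : R), (corner j 0 i + h)]%classic).

Lemma measurable_cube j : measurable (cube j).
Proof. by apply: measurable_rV_box => i; exact: measurable_itv. Qed.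

Lemma lebesgue_cube j : mu (cube j) = (h ^+ n)%:E.
Proof.
rewrite /cube lebesgue_rV_boxE; last by move=> i; exact: measurable_itv.
rewrite (eq_bigr (fun=> h%:E)) => [|i _].
  by rewrite prodEFin prodr_const card_ord.
by rewrite lebesgue_measure_itv/= lte_fin ltrDl h0 -EFinB addrAC subrr add0r.
Qed.

Lemma nat_part (t : R) (M : nat) : 0 < t -> t <= M%:R -> exists2 j : 'I_M, j%:R < t & t <= j.+1%:R.
Proof.
move=> t0; elim: M => [|M IH] tM; first by move: (lt_le_trans t0 tM); rewrite ltxx.
have [Mt|tM'] := ltP M%:R t; first by exists ord_max.
by have [j j1 j2] := IH tM'; exists (widen_ord (leqnSn M) j).
Qed.

(** A point off the grid has a coordinate of modulus at least k. This is how decay of the integrand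
    controls the part of the integral that the sum misses. *)
Lemma cubeP w : (exists j, cube j w) \/ k%:R <= jp w.
Proof.
have [[i0]|nw] := pselect (exists i, ~~ ((- k%:R < w 0 i) && (w 0 i <= k%:R))).
  rewrite negb_and -!real_leNgt ?num_real// -real_ltNge ?num_real// => wi; right.
  apply: le_trans (jp_coord w i0); case/orP: wi => wi.
    by rewrite -normrN; apply: le_trans (ler_norm _); rewrite lerNr.
  by apply: le_trans (ler_norm _); exact: ltW.
left; have wk i : (- k%:R < w 0 i) && (w 0 i <= k%:R).
  by apply/negP => /negP wi; apply: nw; exists i.
have /choice[j hj] : forall i : 'I_n, exists j : 'I_N, j%:R < (w 0 i + k%:R) * m%:R /\ (w 0 i + k%:R) * m%:R <= j.+1%:R.
  move=> i; have /andP[w1 w2] := wk i.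
  have [||j] := @nat_part ((w 0 i + k%:R) * m%:R) N; last by move=> j1 j2; exists j.
    by rewrite mulr_gt0 ?ltr0n// -ltrBlDr sub0r.
  by rewrite natrM ler_pM2r ?ltr0n// -addnn natrD lerD2r.
exists (finfun j) => i; rewrite /cube /rV_coord /= in_itv/= !mxE ffunE.
have [h1 h2] := hj i; apply/andP; split.
  by rewrite addrC ltrBlDr -[ltLHS]/(_ / _) ltr_pdivrMr// ltr0n.
rewrite -addrA -[X in _ + (_ + X)]mul1r -mulrDl addrC lerBrDr.
by rewrite -[leRHS]/(_ / _) ler_pdivlMr ?ltr0n// natr1.
Qed.

Lemma cube_uniq w j j' : cube j w -> cube j' w -> j = j'.
Proof.
move=> jw jw'; apply/ffunP => i; apply/val_inj => /=.
have key (a b : {ffun 'I_n -> 'I_N}) : cube a w -> cube b w -> (a i <= b i)%N.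
  move=> aw bw; have := aw i; have := bw i; rewrite /rV_coord/= !in_itv/= !mxE.
  move=> /andP[_ b2] /andP[a1 _].
  have := lt_le_trans a1 b2; rewrite -addrA ltrD2l -[X in _ < _ + X]mul1r -mulrDl.
  by rewrite ltr_pM2r// natr1 ltr_nat ltnS.
by apply/eqP; rewrite eqn_leq !key.
Qed.

Lemma cube_near w j i : cube j w -> `|w 0 i - corner j 0 i| <= h.
Proof.
move=> /(_ i); rewrite /rV_coord /= in_itv/= => /andP[w1 w2].
by rewrite ger0_norm ?lerBlDl// subr_ge0 ltW.
Qed.

Definition step F w : R[i] := \sum_j F (corner j) * (\1_(cube j) w)%:C.

Lemma step_cube F w j : cube j w -> step F w = F (corner j).
Proof.
move=> jw; rewrite /step (bigD1 j)//= indicE mem_set// mulr1 big1 ?addr0// => j' jj'.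
rewrite indicE memNset ?mulr0// => jw'.
by rewrite (cube_uniq jw jw') eqxx in jj'.
Qed.

Lemma step_out F w : ~ (exists j, cube j w) -> step F w = 0.
Proof.
move=> nw; rewrite /step big1// => j _; rewrite indicE memNset ?mulr0// => jw.
by apply: nw; exists j.
Qed.

Lemma cintegrable_cube j : cintegrable (fun w => (\1_(cube j) w)%:C).
Proof.
split=> /=; last exact: integrable0.
have mQ := measurable_cube j; apply/integrableP; split; first exact/measurable_EFinP.
under eq_integral do rewrite gee0_abs ?lee_fin//.
by rewrite integral_indic// setIT [X in (X < _)%E](lebesgue_cube j) ltry.
Qed.

Lemma cintegrable_step F : cintegrable (step F).
Proof. by apply: cintegrable_sum => j; apply: cintegrableZ; exact: cintegrable_cube. Qed.

Lemma cintegral_step F : cintegral (step F) = \sum_j (h ^+ n)%:C * F (corner j).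
Proof.
rewrite cintegral_sum; last by move=> j; apply: cintegrableZ; exact: cintegrable_cube.
apply: eq_bigr => j _; rewrite cintegralZ; last exact: cintegrable_cube.
rewrite mulrC; congr (_ * _); apply: complex_eqP => /=; last by rewrite Rintegral_cst// mul0r.
rewrite /Rintegral integral_indic ?setIT//; last exact: (measurable_cube j).
by rewrite [X in fine X](lebesgue_cube j).
Qed.

End cubes.

Definition lip C K F := forall w w', (forall i, `|w' 0 i - w 0 i| <= 1) ->
  normc (F w' - F w) <= C * jp w ^+ K * \sum_i `|w' 0 i - w 0 i|.

(* The nodes and weights do not depend on [F]; a functional bounded by finitely many
   seminorms can therefore be exchanged with an integral, see [pairing_superposition]. *)
Lemma riemann_sum K : exists2 C0, 0 <= C0 & forall k, (0 < k)%N -> exists s : seq (R * 'rV[R]_n),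
  forall F C, ccont F -> decay n.*2.+1 C F -> lip C K F ->
    normc (cintegral F - \sum_(p <- s) p.1%:C * F p.2) <= C0 * C / k%:R.
Proof.
exists (2 * int_jp R n) => [|k k0]; first by rewrite mulr_ge0 ?int_jp_ge0.
(* [b] bounds the bracket on the grid cubes. There the integrand varies by at most C b^K n / m on a
   cube, and the weight <w>^(2n) costs another b^(2n); [m] is chosen so that the product stays below
   C / k. *)
pose b := (1 + n * k.+1)%N; pose L := (K + n.*2)%N.
pose m := (b ^ L * n * k).+1.
exists [seq (m%:R^-1 ^+ n, @corner k m j) | j <- enum {ffun 'I_n -> 'I_(k.*2 * m)}].
move=> F C cF dF lF; have C0 := decay_ge0 dF.
rewrite big_map big_enum/= -(@cintegral_step k m (ltn0Sn _)).
have iF : cintegrable F := cintegrable_decay cF (leqnSn _) dF.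
have iS := @cintegrable_step k m (ltn0Sn _) F.
rewrite -cintegralB//.
have := @normc_cintegral_le R n (fun w => F w - step k m F w) (C / k%:R) (cintegrableB iF iS).
have alg (a e c f : R) : 2 * (c / f) * a = 2 * a * c / f by ring.
rewrite alg //; apply => w.
have kp : 0 < k%:R :> R by rewrite ltr0n.
have [[j jw]|nw] := pselect (exists j, @cube k m j w); last first.
  have [//|wk] := @cubeP k m (ltn0Sn _) w.
  (* The one power of decay beyond [n.*2] pays for the factor k, as k <= <w> off the grid. *)
  rewrite step_out// subr0 ler_pdivlMr//; apply: le_trans (dF w).
  by rewrite exprSr mulrAC ler_wpM2r// ler_wpM2l ?exprn_ge0.
have mp : 0 < m%:R :> R by rewrite ltr0n.
have cj i : `|corner j 0 i| <= k%:R.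
  rewrite mxE ler_norml lerDl divr_ge0//= addrC lerBlDr -natrD addnn ler_pdivrMr//.
  by rewrite -natrM ler_nat ltnW.
have bE : b%:R = 1 + n%:R * (k.+1)%:R :> R by rewrite natrD natrM.
have jb (v : 'rV[R]_n) : (forall i, `|v 0 i| <= k.+1%:R) -> jp v <= b%:R.
  move=> vk; apply: le_trans (jp_le_sum _) _; rewrite bE lerD2l.
  rewrite mulr_natl -[n in _ *+ n]card_ord -sumr_const; apply: ler_sum => i _; exact: vk.
have wj i : `|w 0 i - corner j 0 i| <= m%:R^-1 by exact: cube_near.
have m1 : m%:R^-1 <= 1 :> R by rewrite invf_le1// ler1n.
have jj : jp (corner j) <= b%:R.
  by apply: jb => i; apply: le_trans (cj i) _; rewrite ler_nat.
have jw' : jp w <= b%:R.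
  apply: jb => i; rewrite -natr1 -(subrK (corner j 0 i) (w 0 i)) addrC.
  by apply: le_trans (ler_normD _ _) _; apply: lerD => //; exact: le_trans (wj i) m1.
rewrite (step_cube _ _ jw)//.
have hF := lF (corner j) w (fun i => le_trans (wj i) m1).
have hs : \sum_i `|w 0 i - corner j 0 i| <= n%:R * m%:R^-1.
  by rewrite mulr_natl -[n in _ *+ n]card_ord -sumr_const; apply: ler_sum.
have hF2 : normc (F w - F (corner j)) <= C * b%:R ^+ K * (n%:R * m%:R^-1).
  apply: le_trans hF _; apply: ler_pM => //.
  - by rewrite mulr_ge0// exprn_ge0.
  - exact: sumr_ge0.
  - by rewrite ler_wpM2l// lerXn2r ?nnegrE.
apply: (@le_trans _ _ (b%:R ^+ n.*2 * (C * b%:R ^+ K * (n%:R * m%:R^-1)))).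
  by apply: ler_pM => //; rewrite ?exprn_ge0// lerXn2r ?nnegrE.
have alg2 (a e f g c : R) : a * (c * e * (f * g)) = c * (e * a * f) * g by ring.
rewrite alg2 -exprD -/L ler_pdivrMr// mulrAC ler_pdivlMr// -mulrA ler_wpM2l//.
by rewrite -natrX -!natrM ler_nat leqW.
Qed.

End riemann_sums.

Section lipschitz_products.
Context (R : realType) (n : nat).
Implicit Types f g : 'rV[R]_n -> R[i].

Definition grow (C : R) K f := forall w, normc (f w) <= C * jp w ^+ K.

Lemma lip_le C C' K K' f : 0 <= C -> C <= C' -> (K <= K')%N -> lip C K f -> lip C' K' f.
Proof.
move=> C0 CC KK hf w w' ww'; apply: le_trans (hf _ _ ww') _.
by rewrite ler_wpM2r ?sumr_ge0//; apply: ler_pM; rewrite ?exprn_ge0// jp_leX.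
Qed.

Lemma lip_conj C K f : lip C K f -> lip C K (fconj f).
Proof. by move=> h w w' ww'; rewrite /fconj -rmorphB normc_conj; exact: h. Qed.

Lemma lip_ccont C K f : 0 <= C -> lip C K f -> ccont f.
Proof.
move=> C0 h; apply: (@lipschitz_ccont _ _ _ (fun w => C * jp w ^+ K)) => [w|w w']; last exact: h.
by rewrite mulr_ge0// exprn_ge0.
Qed.

Lemma lipM C1 K1 D1 L1 f C2 K2 D2 L2 g : 0 <= C1 -> 0 <= C2 -> 0 <= D1 -> 0 <= D2 ->
  lip C1 K1 f -> grow D1 L1 f -> lip C2 K2 g -> grow D2 L2 g ->
  lip (C1 * D2 * (2 * (1 + n%:R)) ^+ L2 + D1 * C2) (K1 + L1 + (K2 + L2)) (fun w => f w * g w).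
Proof.
move=> C10 C20 D10 D20 lf gf lg gg w w' ww'.
set S := \sum_i _; have S0 : 0 <= S by exact: sumr_ge0.
have -> : f w' * g w' - f w * g w = (f w' - f w) * g w' + f w * (g w' - g w) by ring.
set E := (2 * (1 + n%:R)) ^+ L2.
have E0 : 0 <= E by rewrite exprn_ge0// mulr_ge0// addr_ge0.
apply: le_trans (le_normcD _ _) _; rewrite !normcM !mulrDl; apply: lerD.
  apply: (@le_trans _ _ (C1 * jp w ^+ K1 * S * (D2 * (E * jp w ^+ L2)))).
    apply: ler_pM => //; first exact: lf.
    apply: le_trans (gg w') _; rewrite ler_wpM2l//.
    rewrite /E -exprMn lerXn2r ?nnegrE ?mulr_ge0 ?addr_ge0//.
    have alg (a b : R) : 2 * a * b = 2 * (b * a) by ring.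
    rewrite alg; apply: (@jp_in_box _ _ w w' w') => // k; exists 1; first by rewrite lexx ler01.
    by rewrite mul1r addrC subrK.
  have alg (a b c e p q : R) : a * b * c * (e * (p * q)) = a * e * p * (b * q) * c by ring.
  rewrite alg -exprD ler_wpM2r// ler_wpM2l ?mulr_ge0// jp_leX//; lia.
apply: (@le_trans _ _ (D1 * jp w ^+ L1 * (C2 * jp w ^+ K2 * S))).
  by apply: ler_pM => //; exact: lg.
have alg (a b c e p : R) : a * b * (c * e * p) = a * c * (b * e) * p by ring.
rewrite alg -exprD ler_wpM2r// ler_wpM2l ?mulr_ge0// jp_leX//; lia.
Qed.

Lemma eq0_normc_nat (z : R[i]) (C : R) :
  (forall k, (0 < k)%N -> normc z <= C / k%:R) -> z = 0.
Proof.
move=> h; have C0 : 0 <= C by have := h 1%N isT; rewrite divr1; exact/le_trans/normc_ge0.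
apply: (@eq0_normc_small _ _ C) => e /andP[e0 e1].
have [k ke] : exists k : nat, e^-1 <= k%:R.
  by exists (Num.bound e^-1); apply: ltW; apply: archi_boundP; rewrite invr_ge0 ltW.
have k0 : (0 < k)%N by rewrite -(ltr0n R); apply: lt_le_trans ke; rewrite invr_gt0.
apply: le_trans (h k k0) _; rewrite ler_wpM2l// -[leRHS]invrK lef_pV2 ?posrE ?ltr0n//.
by rewrite invr_gt0.
Qed.

(** What a coefficient function needs for its superposition of time-frequency shifts to be a
    Schwartz function approximated by Riemann sums; short-time Fourier transforms of Schwartz
    functions are of this kind. *)
Definition rapid f := [/\ ccont f, forall N, exists C, decay N C f &
  exists C K, 0 <= C /\ lip C K f].

Lemma decay_grow C f : decay 0 C f -> grow C 0 f.
Proof. by move=> h w; have := h w; rewrite !expr0 mul1r mulr1. Qed.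

End lipschitz_products.

(** * Superpositions of time-frequency shifts *)

Section superposition.
Context (R : realType) (d : nat).
Variables (psi : 'rV[R]_d -> R[i]) (c : 'rV[R]_(d + d) -> R[i]).
Hypotheses (Sp : schwartz psi) (rc : rapid c).

Let G l (y : 'rV[R]_d) w := c w * partials l (time_freq psi w) y.

Let c_ccont : ccont c. Proof. by case: rc. Qed.

Let ccont_tf l y : ccont (fun w => partials l (time_freq psi w) y).
Proof.
have [C [K [C0 hC]]] := time_freq_lipschitz 0 (size l) Sp.
apply: (@lip_ccont _ _ C K) => // w w' ww'.
by have := hC l w w' y (leqnn _) ww'; rewrite expr0 mul1r.
Qed.

Let ccont_G l y : ccont (G l y). Proof. exact: ccontM. Qed.

Let G_bound k N M : exists2 C, 0 <= C & forall l y, (size l <= k)%N ->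
  decay M C (fun w => (jp y ^+ N)%:C * G l y w).
Proof.
have [C [K [C0 hC]]] := time_freq_bound N k Sp.
have [_ /(_ (M + K)%N)[D hD] _] := rc; have D0 := decay_ge0 hD.
exists (D * C) => [|l y lk w]; first exact: mulr_ge0.
rewrite /G !normcM normcR ger0_norm ?exprn_ge0//.
rewrite -(ler_pM2r (jpX_gt0 w K)).
have alg (a b e p q : R) : a * (p * (e * q)) * b = a * b * e * (p * q) by ring.
rewrite alg -exprD -[leRHS]mulrA; apply: ler_pM; [| |exact: hD|exact: hC];
by rewrite mulr_ge0 ?exprn_ge0.
Qed.

Let cintegrable_G l y : cintegrable (G l y).
Proof.
have [C C0 hC] := G_bound (size l) 0 (d + d).*2.
apply: (cintegrable_decay (ccont_G l y) (leqnn _) (C := C)) => w.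
by have := hC l y (leqnn _) w; rewrite expr0 mul1r.
Qed.

(** The adjoint of the short-time Fourier transform with window [psi], applied to [c]. *)
Definition superposition y := cintegral (fun w => c w * time_freq psi w y).

Let is_partial_G l i : is_partial i (fun y => cintegral (G l y)) (fun y => cintegral (G (i :: l) y)).
Proof.
have [C C0 hC] := G_bound (size l).+2 0 (d + d).*2.
have sp w : smooth (time_freq psi w) by exact/time_freq_smooth/schwartz_smooth.
apply: (@is_partial_cintegral _ _ _ _ _ _ (G [:: i, i & l]) C 0) => //.
- by move=> w; apply: is_partialZ; exact: smooth_is_partial.
- by move=> w; apply: is_partialZ; exact: smooth_is_partial.
- by move=> y w; have := hC [:: i, i & l] y (leqnn _) w; rewrite !expr0 mul1r mulr1.
Qed.

Let normc_G k N : exists2 C, 0 <= C & forall l y, (size l <= k)%N ->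
  jp y ^+ N * normc (cintegral (G l y)) <= C.
Proof.
have [C C0 hC] := G_bound k N (d + d).*2.
exists (2 * C * int_jp R (d + d)) => [|l y lk]; first by rewrite !mulr_ge0 ?int_jp_ge0.
apply: le_trans (normc_cintegral_le (cintegrableZ _ (cintegrable_G l y)) (hC l y lk)).
by rewrite cintegralZ// normcM normcR ger0_norm ?exprn_ge0.
Qed.

Lemma partials_superposition l : partials l superposition = fun y => cintegral (G l y).
Proof. by elim: l => [//|i l IH] /=; rewrite -/(partials l _) IH; exact: is_partialE. Qed.

Lemma superposition_schwartz : schwartz superposition.
Proof.
apply/uS_schwartz; split=> [_|l N]; last first.
  have [C _ hC] := normc_G (size l) N; exists C => _ y.
  by rewrite mulr1 partials_superposition; exact: hC.
apply: (@smooth_coind _ _ (fun f => exists l, f = fun y => cintegral (G l y))); last by exists [::].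
move=> _ [l ->]; split; last by move=> i; exists (fun y => cintegral (G (i :: l) y)) => //; exists (i :: l).
have [C C0 hC] := normc_G (size l).+1 0.
apply: (@is_partial_ccont _ _ _ (fun i y => cintegral (G (i :: l) y)) C 0) => // i y.
by rewrite expr0 mulr1; have := hC (i :: l) y (leqnn _); rewrite expr0 mul1r.
Qed.

(** Linearity settles finite sums. Riemann sums with common nodes approximate, with error O(1/k),
    both the scalar integral on the right and, in the finitely many seminorms that control u, the
    superposition itself. *)
Lemma pairing_superposition u : bounded_functional u ->
  pairing u superposition = cintegral (fun w => conjc (c w) * stft psi u w).
Proof.
move=> bu; have lu := bu.1; have [N [Cu [Cu0 hu]]] := pairing_bound bu.
have [Cg [Kg [Cg0 hg]]] := stft_bound Sp bu.
have [Cl [Kl [Cl0 hl]]] := stft_lipschitz Sp bu.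
have [D1 [L1 [D10 hD1]]] := time_freq_bound N N Sp.
have [E1 [M1 [E10 hE1]]] := time_freq_lipschitz N N Sp.
have [cc dc [Cc [Kc [Cc0 lc]]]] := rc.
have [Dc hDc] := dc 0%N; have gc := decay_grow hDc; have Dc0 := decay_ge0 hDc.
pose Fu w := conjc (c w) * stft psi u w.
have cFu : ccont Fu by apply: ccontM; [exact: ccont_conj|exact: stft_ccont].
have [B1 B10 dFu] : exists2 B, 0 <= B & decay (d + d).*2.+1 B Fu.
  have [D hD] := dc ((d + d).*2.+1 + Kg)%N; exists (D * Cg) => [|w]; first by rewrite mulr_ge0// (decay_ge0 hD).
  rewrite /Fu normcM normc_conj.
  rewrite -(ler_pM2r (jpX_gt0 w Kg)).
  have alg (a b e p : R) : a * (e * p) * b = a * b * e * p by ring.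
  rewrite alg -exprD -[leRHS]mulrA; apply: ler_pM; [| |exact: hD|exact: hg] => //.
  by rewrite mulr_ge0 ?exprn_ge0.
have gconj : grow Dc 0 (fconj c) by move=> w; rewrite /fconj normc_conj; exact: gc.
have lFu := lipM Cc0 Cl0 Dc0 Cg0 (lip_conj lc) gconj hl hg.
have [B2 B20 dG] := G_bound N N (d + d).*2.+1.
have lT l y : (size l <= N)%N -> lip E1 M1 (fun w => (jp y ^+ N)%:C * partials l (time_freq psi w) y).
  by move=> lN w w' ww'; rewrite -mulrBr normcM normcR ger0_norm ?exprn_ge0//; exact: hE1.
have gT l y : (size l <= N)%N -> grow D1 L1 (fun w => (jp y ^+ N)%:C * partials l (time_freq psi w) y).
  by move=> lN w; rewrite normcM normcR ger0_norm ?exprn_ge0//; exact: hD1.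
have lG l y (lN : (size l <= N)%N) := lipM Cc0 E10 Dc0 D10 lc gc (lT l y lN) (gT l y lN).
move: lFu lG; set P1 := _ + Dc * Cl; set P2 := _ + Dc * E1; set K1 := (_ + (Kl + Kg))%N; set K2 := (_ + (M1 + L1))%N.
move=> lFu lG.
have g0 p q : 0 <= (2 * (1 + p%:R)) ^+ q :> R by rewrite exprn_ge0// mulr_ge0// addr_ge0.
have P10 : 0 <= P1 by rewrite addr_ge0 ?mulr_ge0.
have P20 : 0 <= P2 by rewrite addr_ge0 ?mulr_ge0.
(* Common exponent and constant for the scalar integrand [Fu] and for the integrands defining the
   derivatives of order at most N of the superposition, weighted by <y>^N, uniformly in y. One set
   of nodes then serves all of them. *)
pose K := (K1 + K2)%N; pose B := B1 + B2 + P1 + P2.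
have [C0 C00 hC0] := riemann_sum R (d + d) K.
apply/eqP; rewrite -subr_eq0; apply/eqP.
apply: (@eq0_normc_nat _ _ (Cu * (C0 * B) + C0 * B)) => k k0.
have [s hs] := hC0 k k0.
pose S y := \sum_(p <- s) (p.1%:C * c p.2) * time_freq psi p.2 y.
have SS : schwartz S by apply: schwartz_sum => p; apply: schwartzZ; exact: time_freq_schwartz.
have pS : pairing u S = \sum_(p <- s) p.1%:C * Fu p.2.
  rewrite /S; elim: (s) => [|p r IH].
    under eq_fun do rewrite big_nil; rewrite big_nil /pairing /fconj.
    under eq_fun do rewrite conjc0; exact: linear_on_schwartz0.
  under eq_fun do rewrite big_cons; rewrite big_cons pairing_linear//; last 2 first.
  - exact: time_freq_schwartz.
  - by apply: schwartz_sum => q; apply: schwartzZ; exact: time_freq_schwartz.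
  by rewrite IH conjcM /Fu mulrA; congr (_ * _ * _ + _); apply: complex_eqP => //=; rewrite oppr0.
have -> : pairing u superposition - cintegral (fun w => conjc (c w) * stft psi u w) =
    pairing u (fun y => superposition y - S y) - (cintegral Fu - \sum_(p <- s) p.1%:C * Fu p.2).
  by rewrite pairingB// ?pS; [rewrite /Fu; ring|exact: superposition_schwartz].
apply: le_trans (le_normcB _ _) _; rewrite mulrDl; apply: lerD; last first.
  apply: hs => //; first by move=> w; apply: le_trans (dFu w) _; rewrite /B; lra.
  apply: lip_le lFu => //; first by rewrite /B; lra.
  by rewrite /K leq_addr.
rewrite -mulrA; apply: hu; first by apply: schwartzB => //; exact: superposition_schwartz.
move=> l y lN.
have sT p : smooth (time_freq psi p) by exact/time_freq_smooth/schwartz_smooth.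
rewrite (partialsB _ (schwartz_smooth superposition_schwartz) (schwartz_smooth SS)).
rewrite partials_superposition partials_sum; last by move=> p; exact: smoothZ.
have := hs (fun w => (jp y ^+ N)%:C * G l y w) B (ccontM (ccont_cst _ _) (ccont_G l y)).
have h1 : decay (d + d).*2.+1 B (fun w => (jp y ^+ N)%:C * G l y w).
  by move=> w; apply: le_trans (dG l y lN w) _; rewrite /B; lra.
have h2 : lip B K (fun w => (jp y ^+ N)%:C * G l y w).
  have -> : (fun w => (jp y ^+ N)%:C * G l y w) = (fun w => c w * ((jp y ^+ N)%:C * partials l (time_freq psi w) y)).
    by apply/funext => w; rewrite /G mulrCA.
  apply: lip_le (lG l y lN) => //; first by rewrite /B; lra.
  by rewrite /K leq_addl.
move=> /(_ h1 h2); rewrite cintegralZ//; apply: le_trans.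
rewrite -[X in X * _](@ger0_norm R) ?exprn_ge0// -normcR -normcM mulrBr.
rewrite -[X in _ <= normc (_ - X)](_ : (jp y ^+ N)%:C * \sum_(p <- s) partials l (fun x => p.1%:C * c p.2 * time_freq psi p.2 x) y = _)//.
rewrite mulr_sumr; apply: eq_bigr => p _.
by rewrite partialsZ// /G; ring.
Qed.

End superposition.

(** * Gabor inversion *)

Section gabor_inversion.
Context (R : realType) (d : nat).
Implicit Types (psi g h : 'rV[R]_d -> R[i]) (w z : 'rV[R]_(d + d)) (u : functional R d).

Lemma mulr_conjc (a : R[i]) : a * conjc a = (normc a ^+ 2)%:C.
Proof.
case: a => x y; apply: complex_eqP => /=; last by ring.
by rewrite sqr_sqrtr ?addr_ge0 ?sqr_ge0//; ring.
Qed.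

Lemma stft_rapid psi g : schwartz psi -> schwartz g -> rapid (stft psi (dist_of g)).
Proof.
move=> Sp Sg; have bg := dist_of_bounded Sg; split; first exact: stft_ccont.
- move=> N; have /uS_schwartz Sg' := Sg.
  have [C [_ hC]] := uS_stft_decay N Sp (fun _ => ler01) Sg'.
  by exists C => w; have := hC tt w; rewrite mulr1.
- exact: stft_lipschitz.
Qed.

Lemma schwartz_oppV psi : schwartz psi -> schwartz (fun p => psi (- p)).
Proof.
move=> /uS_schwartz[/(_ tt) sp bp]; apply/uS_schwartz.
have hA : axis_affine (@Some 'I_d) (fun=> -1) (fun p : 'rV[R]_d => - p).
  split=> [|i p t].
    have cid : continuous (@id 'rV[R]_d) by move=> y; exact: cvg_id.
    have := continuous_subrV (@cst_continuous 'rV[R]_d _ (0 : 'rV[R]_d)) cid.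
    by under [X in continuous X -> _]eq_fun do rewrite sub0r.
  by rewrite opprD mulN1r scaleNr.
split=> [_|l N]; first exact: smooth_comp hA sp.
have [C hC] := bp (pmap (@Some 'I_d) l) N; exists C => _ p.
apply: le_trans (hC tt (- p)); rewrite jpN ler_wpM2l ?exprn_ge0//.
by apply: normc_partials_comp hA sp _ => i; rewrite normrN1.
Qed.

(** The squared L^2 norm of [psi]. The argument is reflected because the norm arises as an integral
    of |psi(y - p)|^2 over the translation p. *)
Definition l2sq psi : R := \int[lebesgue_rV R d]_p (normc (psi (- p)) ^+ 2).

Lemma cintegral_l2sq psi : schwartz psi ->
  cintegral (fun p => psi (- p) * conjc (psi (- p))) = (l2sq psi)%:C.
Proof.
move=> Sp; apply: complex_eqP => /=; last first.
  by under eq_Rintegral do rewrite mulr_conjc/=; rewrite Rintegral_cst// mul0r.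
by under eq_Rintegral do rewrite mulr_conjc/=.
Qed.

(** By Lipschitz continuity |psi(-p)| stays above half of |psi(x0)| on a small cube with corner -x0,
    and this cube has positive measure. *)
Lemma l2sq_gt0 psi : schwartz psi -> (exists x, psi x != 0) -> 0 < l2sq psi.
Proof.
move=> Sp [x0 px0]; have [C C0 hC] := schwartz_lipschitz Sp.
set e := normc (psi x0); have e0 : 0 < e.
  by rewrite lt_neqAle normc_ge0 eq_sym andbT; apply: contra px0 => /eqP/eq0_normc ->.
(* Side of the cube: the variation C d r is then at most e/2. The summand 1 avoids division by 0. *)
pose r := e / (2 * (C * d%:R + 1)).
have D0 : 0 < C * d%:R + 1 by rewrite ltr_wpDl// mulr_ge0.
have r0 : 0 < r by rewrite divr_gt0// mulr_gt0.
pose B : set 'rV[R]_d := rV_box (fun i => `](- x0) 0 i, (- x0) 0 i + r]%classic).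
have mB : measurable B by apply: measurable_rV_box => i; exact: measurable_itv.
have lB : lebesgue_rV R d B = (r ^+ d)%:E.
  rewrite /B lebesgue_rV_boxE; last by move=> i; exact: measurable_itv.
  rewrite (eq_bigr (fun=> r%:E)) => [|i _]; first by rewrite prodEFin prodr_const card_ord.
  by rewrite lebesgue_measure_itv/= lte_fin ltrDl r0 -EFinB addrAC subrr add0r.
have hB p : B p -> e / 2 <= normc (psi (- p)).
  move=> pB; have := hC x0 (- p).
  have : \sum_i `|(- p) 0 i - x0 0 i| <= d%:R * r.
    rewrite mulr_natl -[X in _ *+ X]card_ord -sumr_const; apply: ler_sum => i _.
    have := pB i; rewrite /rV_coord/= in_itv/= !mxE => /andP[p1 p2].
    by rewrite -normrN ger0_norm; lra.
  move=> /(ler_wpM2l C0) h1 h2; have {h1 h2} := le_trans h2 h1.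
  have : C * (d%:R * r) <= e / 2.
    rewrite /r mulrA mulrA ler_pdivrMr ?mulr_gt0//.
    have -> : e / 2 * (2 * (C * d%:R + 1)) = C * d%:R * e + e by field.
    by rewrite mulrA lerDl ltW.
  have : e <= normc (psi (- p)) + normc (psi (- p) - psi x0).
    rewrite /e -(normcN (psi (-p) - _)); apply: le_trans (le_normcD _ _).
    by rewrite opprB addrC subrK.
  by move=> *; lra.
have Sp' := schwartz_oppV Sp.
have Sq : schwartz (fun p => psi (- p) * conjc (psi (- p))).
  by apply: schwartzM => //; exact: schwartz_conj.
have iq : (lebesgue_rV R d).-integrable setT (EFin \o (fun p => normc (psi (- p)) ^+ 2)).
  have [ir _] := schwartz_cintegrable Sq; move: ir; apply: eq_integrable => // p _.
  by rewrite mulr_conjc.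
have iB : (lebesgue_rV R d).-integrable setT (EFin \o (fun p => (e / 2) ^+ 2 * \1_B p)).
  have i1 : (lebesgue_rV R d).-integrable setT (fun p => (\1_B p)%:E).
    apply/integrableP; split; first exact/measurable_EFinP.
    under eq_integral do rewrite gee0_abs ?lee_fin//.
    by rewrite integral_indic// setIT [X in (X < _)%E]lB ltry.
  by have := integrableZl measurableT ((e / 2) ^+ 2) i1; apply: eq_integrable.
have : \int[lebesgue_rV R d]_p ((e / 2) ^+ 2 * \1_B p) <= l2sq psi.
  apply: le_Rintegral => // p _; rewrite indicE.
  have [/set_mem pB|_] := boolP (p \in B); last by rewrite mulr0 sqr_ge0.
  by rewrite mulr1 lerXn2r ?nnegrE ?divr_ge0 ?(ltW e0) ?normc_ge0//; exact: hB.
apply: lt_le_trans; rewrite RintegralZl//; last first.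
  apply/integrableP; split; first exact/measurable_EFinP.
  under eq_integral do rewrite gee0_abs ?lee_fin//.
  by rewrite integral_indic// setIT [X in (X < _)%E]lB ltry.
rewrite /Rintegral integral_indic// setIT [X in fine X]lB/=.
by apply: mulr_gt0; apply: exprn_gt0 => //; apply: divr_gt0.
Qed.

(** For a fixed position p the frequency integral is Fourier inversion of g times the window
    translated to p, and returns (2 pi)^d g(y) |psi(y - p)|^2. Integration over p leaves the L^2
    norm of the window. *)
Lemma gabor_inversion psi g y : schwartz psi -> schwartz g ->
  superposition psi (stft psi (dist_of g)) y = ((2 * pi) ^+ d * l2sq psi)%:C * g y.
Proof.
move=> Sp Sg; have rc := stft_rapid Sp Sg.
pose F w := stft psi (dist_of g) w * time_freq psi w y.
have cF : ccont F.
  apply: ccontM; first by case: rc.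
  have [C [K [C0 hC]]] := time_freq_lipschitz 0 0 Sp.
  apply: (@lip_ccont _ _ C K) => // w w' ww'.
  by have := hC [::] w w' y (leqnn _) ww'; rewrite expr0 mul1r.
have [C dF] : exists C, decay (d + d).*2 C F.
  have [D _ hD] := time_freq_bound0 0 Sp; have [_ dc _] := rc.
  have [E hE] := dc (d + d).*2; have E0 := decay_ge0 hE.
  exists (E * D) => w; rewrite normcM mulrA; apply: ler_pM => //.
    by rewrite mulr_ge0// exprn_ge0.
  by have := hD w y; rewrite !expr0 mul1r mulr1.
rewrite /superposition -/F (cintegral_splitl cF dF).
pose q p := psi (y - p) * conjc (psi (y - p)).
have -> : (fun x => cintegral (fun xi => F (row_mx x xi))) = (fun p => ((2 * pi) ^+ d)%:C * g y * q p).
  apply/funext => p; pose hp t := g t * conjc (psi (t - p)).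
  have Shp : schwartz hp.
    by apply: schwartzM => //; exact: (schwartz_shift (- p) (schwartz_conj Sp)).
  have -> : (fun xi => F (row_mx p xi)) = (fun xi => psi (y - p) * (expi (dot y xi) * ft hp xi)).
    apply/funext => xi; rewrite /F stft_dist_of row_mxKl row_mxKr /time_freq row_mxKl row_mxKr.
    by rewrite -/hp; ring.
  rewrite cintegralZ.
    by rewrite fourier_inversion// /hp /q; ring.
  have [D hD] := schwartz_ft_decay d.*2 Shp.
  apply: cintegrable_decay (leqnn _) (decay_expi _ hD); apply: ccontM; last exact: ft_ccont.
  apply: ccont_expi; apply: continuous_dot; first exact: cst_continuous.
  by move=> t; exact: cvg_id.
have Sq : schwartz (fun p => psi (- p) * conjc (psi (- p))).
  by apply: schwartzM; [|apply: schwartz_conj]; exact: schwartz_oppV.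
have qE : q = fun p => (fun p => psi (- p) * conjc (psi (- p))) (p + (- y)).
  by apply/funext => p; rewrite /q /= opprB.
have iq : cintegrable q by rewrite qE; apply: schwartz_cintegrable; exact: schwartz_shift Sq.
rewrite cintegralZ// rmorphM/= -cintegral_l2sq// -(cintegral_shift (- y) (schwartz_cintegrable Sq)).
by rewrite qE mulrAC.
Qed.

Lemma pairingZ u c g : linear_on_schwartz u -> schwartz g ->
  pairing u (fun x => c * g x) = conjc c * pairing u g.
Proof.
move=> lu Sg; have := pairing_linear c lu Sg (@schwartz0 R d).
under [X in pairing u X = _ -> _]eq_fun do rewrite addr0.
move=> ->; rewrite [X in _ + X](_ : _ = 0) ?addr0// /pairing /fconj.
by under eq_fun do rewrite conjc0; exact: linear_on_schwartz0.
Qed.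

Lemma conjcR (x : R) : conjc x%:C = x%:C.
Proof. by apply: complex_eqP => //=; rewrite oppr0. Qed.

Definition gabor_const psi : R := ((2 * pi) ^+ d * l2sq psi)^-1.

Lemma gabor_const_gt0 psi : schwartz psi -> (exists x, psi x != 0) -> 0 < gabor_const psi.
Proof.
by move=> Sp p0; rewrite invr_gt0 mulr_gt0 ?l2sq_gt0// exprn_gt0// mulr_gt0// pi_gt0.
Qed.

(** The inversion formula is applied to the test function g, and [pairing_superposition] carries u
    inside the integral. *)
Lemma pairing_gabor psi u g : schwartz psi -> (exists x, psi x != 0) ->
  bounded_functional u -> schwartz g ->
  pairing u g = (gabor_const psi)%:C *
    cintegral (fun w => conjc (stft psi (dist_of g) w) * stft psi u w).
Proof.
move=> Sp p0 bu Sg; have c0 := gabor_const_gt0 Sp p0.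
rewrite -(pairing_superposition Sp (stft_rapid Sp Sg) bu).
rewrite (_ : superposition _ _ = fun y => ((gabor_const psi)^-1)%:C * g y); last first.
  by apply/funext => y; rewrite gabor_inversion// /gabor_const invrK.
rewrite pairingZ//; last exact: bu.1.
by rewrite conjcR mulrA -rmorphM/= divff ?mul1r ?gt_eqF.
Qed.

Lemma psi0E : @psi0 R d = fun y => (pi `^ (- (d%:R / 4)))%:C * gaussian 2^-1 y.
Proof.
apply/funext => y; rewrite /psi0 /gaussian -rmorphM/= enorm_sqr.
by rewrite [dot y y / 2]mulrC.
Qed.

Lemma psi0_schwartz : schwartz (@psi0 R d).
Proof. by rewrite psi0E; apply: schwartzZ; apply: gaussian_schwartz; rewrite invr_gt0. Qed.

Lemma psi0_neq0 : exists x, @psi0 R d x != 0.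
Proof.
exists 0; apply/eqP => /(congr1 (@complex.Re R)) /= /eqP.
by rewrite gt_eqF// mulr_gt0 ?expR_gt0 ?powR_gt0 ?pi_gt0.
Qed.

(** With this normalization the factor (2 pi)^-d in [locop] is the Gabor constant of [psi0], so that
    the symbol 1 is quantized to the identity. *)
Lemma l2sq_psi0 : l2sq (@psi0 R d) = 1.
Proof.
have : ((l2sq (@psi0 R d))%:C = 1 :> R[i]); last by move=> /(congr1 (@complex.Re R)).
rewrite -cintegral_l2sq; last exact: psi0_schwartz.
pose c := (pi `^ (- (d%:R / 2)) : R).
have -> : (fun p => psi0 (- p) * conjc (psi0 (- p))) = (fun p : 'rV[R]_d => c%:C * gaussian 1 p).
  apply/funext => p; rewrite psi0E mulr_conjc normcM !normcR -rmorphM/=.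
  rewrite !ger0_norm ?powR_ge0 ?expR_ge0// exprMn; congr (_ * _)%:C.
    by rewrite -powR_mulrn ?powR_ge0// -powRrM; congr powR; field.
  by rewrite -expRM_natl dotNl dotNr opprK; congr expR; field.
rewrite (cintegralZ _ (schwartz_cintegrable (gaussian_schwartz d (@ltr01 R)))).
rewrite cintegral_gaussian1 -rmorphM/= /c -powR12_sqrt ?pi_ge0// -powR_mulrn ?powR_ge0//.
rewrite -powRrM -powRD; last by apply/implyP => _; rewrite gt_eqF ?pi_gt0.
by have -> : - (d%:R / 2) + 2^-1 * d%:R = 0 :> R; [field|rewrite powRr0].
Qed.

End gabor_inversion.

(** * Domination by polynomially weighted averages *)

Section convolution_bound.
Context (R : realType).

Lemma continuous_normc (T : topologicalType) (f : T -> R[i]) :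
  ccont f -> continuous (fun x => normc (f x) : R^o).
Proof.
move=> [cr ci].
have -> : (fun x => normc (f x) : R^o) = fun x => Num.sqrt (complex.Re (f x) ^+ 2 + complex.Im (f x) ^+ 2).
  by apply/funext => x; case: (f x).
have := continuous_addR (continuous_expnR (k := 2) cr) (continuous_expnR (k := 2) ci).
by move=> /continuous_comp_fun /(_ (@sqrt_continuous R)).
Qed.

Lemma normc_cintegral_le_Rintegral n (f : 'rV[R]_n -> R[i]) (g : 'rV[R]_n -> R) :
  cintegrable f -> (lebesgue_rV R n).-integrable setT (EFin \o g) ->
  (forall x, normc (f x) <= g x) ->
  normc (cintegral f) <= 2 * \int[lebesgue_rV R n]_x g x.
Proof.
move=> [ir ii] ig fg; apply: le_trans (normc_le _) _; rewrite mulr_natl mulr2n /=.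
apply: lerD.
  apply: le_trans (le_normr_Rintegral _ ir) _ => //; apply: le_Rintegral => //.
    exact: (integrable_abse ir).
  by move=> x _; exact: le_trans (le_Re_normc _) (fg x).
apply: le_trans (le_normr_Rintegral _ ii) _ => //; apply: le_Rintegral => //.
  exact: (integrable_abse ii).
by move=> x _; exact: le_trans (le_Im_normc _) (fg x).
Qed.

Section fixed.
Context (n : nat).
Implicit Types (w z : 'rV[R]_n) (F : 'rV[R]_n -> R[i]).

Definition avg F M z : R := \int[lebesgue_rV R n]_w (normc (F w) * jp (w - z) ^- M).

Lemma avg_ge0 F M z : 0 <= avg F M z.
Proof. by apply: Rintegral_ge0 => w _; rewrite mulr_ge0// invr_ge0 exprn_ge0. Qed.

(** The kernel <w - z>^-M pays, by Peetre's inequality, for the growth K of F and for the 2n powers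
    that integrability requires, at the price of powers of <z>. *)
Lemma avg_weight F (C : R) K M z w : 0 <= C -> grow C K F -> (n.*2 + K <= M)%N ->
  jp w ^+ n.*2 * (normc (F w) * jp (w - z) ^- M) <= C * (2 * jp z) ^+ (n.*2 + K).
Proof.
move=> C0 gF KM; rewrite mulrA ler_pdivrMr ?jpX_gt0//.
apply: (@le_trans _ _ (C * jp w ^+ (n.*2 + K))).
  by rewrite exprD mulrCA ler_wpM2l ?exprn_ge0//; exact: gF.
rewrite -mulrA ler_wpM2l//.
apply: (@le_trans _ _ ((2 * jp z) ^+ (n.*2 + K) * jp (w - z) ^+ (n.*2 + K))).
  rewrite -exprMn lerXn2r ?nnegrE ?mulr_ge0//.
  by rewrite -mulrA [jp z * _]mulrC; exact: jpDl.
by rewrite ler_wpM2l ?exprn_ge0 ?mulr_ge0// jp_leX.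
Qed.

Lemma continuous_avg_kernel F M z : ccont F ->
  continuous (fun w => normc (F w) * jp (w - z) ^- M : R^o).
Proof.
move=> cF; apply: continuous_mulR; first exact: continuous_normc.
apply: continuous_invR => [w|]; first by rewrite gt_eqF ?jpX_gt0.
apply: continuous_expnR; apply: (continuous_comp_fun _ (@continuous_jp R n)).
apply: continuous_subrV; last exact: cst_continuous.
by move=> w; exact: cvg_id.
Qed.

Lemma integrable_avg F (C : R) K M z : 0 <= C -> ccont F -> grow C K F -> (n.*2 + K <= M)%N ->
  (lebesgue_rV R n).-integrable setT (EFin \o (fun w => normc (F w) * jp (w - z) ^- M)).
Proof.
move=> C0 cF gF KM; apply: (@integrable_decay _ _ n.*2 _ (C * (2 * jp z) ^+ (n.*2 + K))) => //.
  by apply: measurable_rV_continuous; exact: continuous_avg_kernel.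
move=> w; rewrite ger0_norm; first exact: avg_weight.
by rewrite mulr_ge0// invr_ge0 exprn_ge0.
Qed.

End fixed.

(** After Gabor inversion with window [psi], the transform of [h k] shifted by z is, in modulus, the
    transform of [h k] at w - z, which decays like <w - z>^-M uniformly in k. With h the window
    itself this compares transforms for different windows; with h a Weyl operator applied to the
    window it bounds the freezing error. *)
Lemma pairing_avg (d : nat) (psi : 'rV[R]_d -> R[i]) (u : functional R d) (Z : Type)
    (v : Z -> R) (h : Z -> 'rV[R]_d -> R[i]) (Cu : R) K M :
  schwartz psi -> (exists x, psi x != 0) -> bounded_functional u -> 0 <= Cu ->
  grow Cu K (stft psi u) -> ((d + d).*2 + K <= M)%N -> (forall k, 0 <= v k) -> uS v h ->
  exists C, 0 <= C /\ forall k z,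
    normc (pairing u (time_freq (h k) z)) <= C * v k * avg (stft psi u) M z.
Proof.
move=> Sp p0 bu Cu0 gu KM v0 Sh.
have [C [C0 hC]] := uS_stft_decay M Sp v0 Sh.
have c0 := ltW (gabor_const_gt0 Sp p0).
exists (2 * gabor_const psi * C); split=> [|k z]; first by rewrite !mulr_ge0.
have Shk := uS_schwartz_at k Sh.
have St := time_freq_schwartz z Shk.
rewrite (pairing_gabor Sp p0 bu St) normcM normcR ger0_norm//.
have alg (a b c e : R) : 2 * a * b * c * e = a * (2 * (b * c * e)) by ring.
rewrite alg ler_wpM2l//.
have iA := integrable_avg z Cu0 (stft_ccont Sp bu) gu KM.
rewrite -RintegralZl//; apply: normc_cintegral_le_Rintegral.
- have [cV dV _] := stft_rapid Sp St.
  have [D hD] := dV ((d + d).*2 + K)%N; have D0 := decay_ge0 hD.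
  apply: (@cintegrable_decay _ _ (d + d).*2 _ (D * Cu)) => //.
    by apply: ccontM; [exact: ccont_conj|exact: stft_ccont].
  move=> w; rewrite normcM normc_conj.
  rewrite -(ler_pM2r (jpX_gt0 w K)).
  have alg2 (a b e p : R) : a * (e * p) * b = a * b * e * p by ring.
  rewrite alg2 -exprD -[leRHS]mulrA; apply: ler_pM => //.
  by rewrite mulr_ge0 ?exprn_ge0.
- by have := integrableZl measurableT (C * v k) iA; apply: eq_integrable.
- move=> w; rewrite normcM normc_conj stft_covariant//.
  have alg3 (a b p q : R) : a * b * (p * q) = (a * b * q) * p by ring.
  rewrite alg3 ler_wpM2r// ler_pdivlMr ?jpX_gt0// mulrC; exact: hC.
Qed.

End convolution_bound.

(** * Weyl quantization *)

Section weyl_kernel.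
Context (R : realType) (d : nat).
Implicit Types (b : 'rV[R]_(d + d) -> R[i]) (f : 'rV[R]_d -> R[i]) (x y xi : 'rV[R]_d).

Lemma uO_at Z n (w : Z -> R) L (F : Z -> 'rV[R]_n -> R[i]) z :
  uO w L F -> uO (fun _ : unit => 1) L (fun=> F z).
Proof. by move=> OF; have := uO_unit (uO_param (fun _ : unit => z) OF). Qed.

Lemma uO_ge0 Z n (w : Z -> R) L (F : Z -> 'rV[R]_n -> R[i]) l (C : R) z :
  (forall k (x : 'rV[R]_n), normc (partials l (F k) x) <= C * w k * jp x ^+ L) -> 0 <= C * w z.
Proof. by move=> /(_ z 0); rewrite jp0 expr1n mulr1; exact/le_trans/normc_ge0. Qed.

Definition mid xi x y : 'rV[R]_(d + d) := row_mx (2^-1 *: (x + y)) xi.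

Lemma jp_mid xi x y : jp (mid xi x y) <= 2 * (jp x * jp y) * jp xi.
Proof.
apply: le_trans (jp_row_mx _ _) _; rewrite ler_wpM2r//.
apply: le_trans (jpD x y); apply: jpZ; rewrite ger0_norm ?invr_ge0// invf_le1//.
by rewrite (_ : 1 = 1%:R)// ler_nat.
Qed.

Lemma midC xi x y : mid xi x y = mid xi y x. Proof. by rewrite /mid addrC. Qed.

Lemma axis_affine_mid x xi :
  axis_affine (fun i => Some (lshift d i)) (fun=> 2^-1) (mid xi x).
Proof.
have cid : continuous (@id 'rV[R]_d) by move=> y; exact: cvg_id.
split=> [|i y t].
  apply: continuous_row_mx; last exact: cst_continuous.
  apply: (continuous_comp_fun _ (@continuous_scaleR R d 2^-1)).
  by apply: continuous_addrV; [exact: cst_continuous|exact: cid].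
apply/rowP => k; rewrite -(fintype.splitK k); case: (fintype.split k) => j /=.
  rewrite /mid row_mxEl [RHS]mxE row_mxEl !mxE !eqxx eq_lshift /=; ring.
by rewrite /mid row_mxEr [RHS]mxE row_mxEr !mxE eq_rlshift andbF mulr0 addr0.
Qed.

Lemma axis_affine_row_mxr (p : 'rV[R]_d) :
  axis_affine (fun i => Some (rshift d i)) (fun=> 1) (row_mx p : _ -> 'rV[R]_(d + d)).
Proof.
split=> [|i y t].
  apply: continuous_row_mx; first exact: cst_continuous.
  by move=> y; exact: cvg_id.
apply/rowP => k; rewrite -(fintype.splitK k); case: (fintype.split k) => j /=.
  by rewrite row_mxEl [RHS]mxE row_mxEl !mxE eq_lrshift andbF mulr0 addr0.
by rewrite row_mxEr [RHS]mxE row_mxEr !mxE !eqxx eq_rshift /= mul1r.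
Qed.

(* The symbol of [partial j] composed with the Weyl operator of [b]. *)
Definition wdx (j : 'I_d) b (z : 'rV[R]_(d + d)) := 'i * (z 0 (rshift d j))%:C * b z + 2^-1%:C * partial (lshift d j) b z.

Section family.
Context (Z : Type).

Lemma uO_mid (w : Z -> R) L (b : Z -> 'rV[R]_(d + d) -> R[i]) : uO w L b ->
  uO (fun p : Z * 'rV[R]_d * 'rV[R]_d => w p.1.1 * (jp p.1.2 * jp p.2) ^+ L) L
     (fun p y => b p.1.1 (mid p.2 p.1.2 y)).
Proof.
move=> [sb hb]; split=> [p|l]; first exact: smooth_comp (axis_affine_mid _ _) (sb _).
have [C hC] := hb (pmap (fun i => Some (lshift d i)) l).
have Cw k : 0 <= C * w k := uO_ge0 k hC.
exists (C * 2 ^+ L) => -[[k x] xi] y /=.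
apply: le_trans (normc_partials_comp l y (axis_affine_mid x xi) (sb k) _) _.
  by move=> _; rewrite ger0_norm ?invr_ge0// invf_le1// (_ : 1 = 1%:R)// ler_nat.
apply: le_trans (hC k _) _.
have alg (a p c e q : R) : a * p * (c * e) * q = a * c * (p * (e * q)) by ring.
rewrite alg ler_wpM2l// -!exprMn.
rewrite lerXn2r ?nnegrE ?mulr_ge0//; apply: le_trans (jp_mid _ _ _) _.
by rewrite le_eqVlt; apply/orP; left; apply/eqP; ring.
Qed.

Lemma uS_mid (w v : Z -> R) L (b : Z -> 'rV[R]_(d + d) -> R[i]) (f : Z -> 'rV[R]_d -> R[i]) :
  uO w L b -> uS v f ->
  uS (fun p : Z * 'rV[R]_d * 'rV[R]_d => v p.1.1 * (w p.1.1 * (jp p.1.2 * jp p.2) ^+ L))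
     (fun p y => f p.1.1 y * b p.1.1 (mid p.2 p.1.2 y)).
Proof.
by move=> Ob Sf; exact: uSM (uS_param (fun p : Z * _ * _ => p.1.1) Sf) (uO_mid Ob).
Qed.

End family.

(** The integrand of the Weyl operator. Integrating it in y first, as [wint] does, produces rapid
    decay in xi, so that the remaining integral converges absolutely. *)
Definition wker b f x xi y := expi (dot (x - y) xi) * b (mid xi x y) * f y.

Definition wint b f x xi := cintegral (wker b f x xi).

Lemma wker_ft b f x xi :
  wker b f x xi = fun y => expi (dot x xi) * (expi (- dot y xi) * (f y * b (mid xi x y))).
Proof. by apply/funext => y; rewrite /wker dotBl expiD; ring. Qed.

Section family_bounds.
Context (Z : Type) (w v : Z -> R) (L : nat).
Context (b : Z -> 'rV[R]_(d + d) -> R[i]) (f : Z -> 'rV[R]_d -> R[i]).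
Hypotheses (Ob : uO w L b) (Sf : uS v f).

Lemma wker_ccont k x xi : ccont (wker (b k) (f k) x xi).
Proof.
have S := uS_mid Ob Sf; have cS := smooth_ccont [::] (uS_smooth (k, x, xi) S).
have -> : wker (b k) (f k) x xi = fun y => expi (dot (x - y) xi) * (f k y * b k (mid xi x y)).
  by apply/funext => y; rewrite /wker; ring.
apply: ccontM => //; apply: ccont_expi; apply: continuous_dot; last exact: cst_continuous.
by apply: continuous_subrV; [exact: cst_continuous|move=> y; exact: cvg_id].
Qed.

Lemma wker_decay N : exists C, forall k x xi,
  decay N (C * (v k * (w k * (jp x * jp xi) ^+ L))) (wker (b k) (f k) x xi).
Proof.
have [C hC] := uS_decay N (uS_mid Ob Sf); exists C => k x xi y.
apply: le_trans (hC (k, x, xi) y); rewrite /wker -mulrA normcM normc_expi mul1r.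
by rewrite [b k _ * _]mulrC.
Qed.

Lemma wker_cintegrable k x xi : cintegrable (wker (b k) (f k) x xi).
Proof.
have [C hC] := wker_decay d.*2.
exact: cintegrable_decay (wker_ccont k x xi) (leqnn _) (hC k x xi).
Qed.

(** Up to a phase [wint] is a Fourier transform in xi. The symbol at the midpoint contributes growth
    <x>^L <xi>^L; to compensate the second factor, N + L powers of Fourier decay are used. *)
Lemma wint_bound N : exists2 C, 0 <= C & forall k x xi,
  jp xi ^+ N * normc (wint (b k) (f k) x xi) <= C * (`|v k| * `|w k|) * jp x ^+ L.
Proof.
have [C hC] := uS_ft_decay (N + L) (uS_mid Ob Sf); exists `|C| => // k x xi.
have {}hC : jp xi ^+ (N + L) * normc (ft (fun y => f k y * b k (mid xi x y)) xi) <=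
    C * (v k * (w k * (jp x * jp xi) ^+ L)) by exact: (hC (k, x, xi) xi).
move: hC.
have -> : normc (ft (fun y => f k y * b k (mid xi x y)) xi) = normc (wint (b k) (f k) x xi).
  have : cintegrable (fun y => expi (- dot x xi) * wker (b k) (f k) x xi y).
    exact/cintegrableZ/wker_cintegrable.
  rewrite /wint wker_ft => ic; rewrite cintegralZ; first by rewrite normcM normc_expi mul1r.
  move: ic; under [X in cintegrable X -> _]eq_fun do rewrite mulrA -expiD addNr expi0 mul1r.
  by [].
move=> {}hC; rewrite -(ler_pM2r (jpX_gt0 xi L)).
have alg (a e p : R) : a * e * p = a * p * e by ring.
rewrite alg -exprD; apply: le_trans hC _.
have j0 : 0 <= (jp x * jp xi) ^+ L by rewrite exprn_ge0// mulr_ge0.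
apply: le_trans (ler_norm _) _; rewrite !normrM (ger0_norm j0) exprMn.
by rewrite le_eqVlt; apply/orP; left; apply/eqP; ring.
Qed.

End family_bounds.

Let pg L b := uO (fun _ : unit => 1) L (fun=> b).

Section single.
Context (L : nat).
Variables (b : 'rV[R]_(d + d) -> R[i]) (f : 'rV[R]_d -> R[i]).
Hypotheses (Ob : pg L b) (Sf : schwartz f).

Let Sf' : uS (fun _ : unit => 1) (fun=> f). Proof. exact/uS_schwartz. Qed.
Let sb : smooth b. Proof. exact: (uO_smooth tt Ob). Qed.

Lemma wker_decay1 N : exists2 C, 0 <= C & forall x xi, decay N (C * (jp x * jp xi) ^+ L) (wker b f x xi).
Proof.
have [C hC] := wker_decay Ob Sf' N; exists `|C| => // x xi y.
apply: le_trans (hC tt x xi y) _; rewrite !mul1r ler_wpM2r ?exprn_ge0 ?mulr_ge0//.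
exact: ler_norm.
Qed.

Lemma wker_cintegrable1 x xi : cintegrable (wker b f x xi).
Proof. exact: (wker_cintegrable Ob Sf' tt). Qed.

Lemma wint_bound1 N : exists2 C, 0 <= C & forall x, decay N (C * jp x ^+ L) (wint b f x).
Proof.
have [C C0 hC] := wint_bound Ob Sf' N; exists C => // x xi.
by apply: le_trans (hC tt x xi) _; rewrite normr1 !mulr1.
Qed.

Lemma is_partial_wker_x (j : 'I_d) xi y :
  is_partial j (fun x => wker b f x xi y) (fun x => wker (wdx j b) f x xi y).
Proof.
have h1 := is_partialM (is_partial_comp j (axis_affine_shift (- y)) (smooth_expi_dot xi))
  (is_partial_comp j (axis_affine_mid y xi) sb).
have h2 := is_partialZ (f y) h1.
apply: is_partial_ext h2 _ _ => x /=; rewrite /wker /wdx [mid xi x y]midC; first by ring.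
rewrite (is_partialE (is_partial_expi_dot xi j)) row_mxEr.
by ring.
Qed.

(** The phase contributes i (x_j - y_j): the factor x_j stays outside and y_j is attached to f.
    Integrated over xi, this becomes the commutation rule [iweyl_coord]. *)
Lemma is_partial_wker_xi (j : 'I_d) x y :
  is_partial j (fun xi => wker b f x xi y)
   (fun xi => 'i * (x 0 j)%:C * wker b f x xi y + wker (partial (rshift d j) b) f x xi y
     - 'i * wker b (fun y => (y 0 j)%:C * f y) x xi y).
Proof.
have h0 : is_partial j (fun xi => expi (dot (x - y) xi))
    (fun xi => 'i * ((x - y) 0 j)%:C * expi (dot (x - y) xi)).
  by apply: is_partial_ext (is_partial_expi_dot (x - y) j) _ _ => xi; rewrite [dot xi _]dotC.
have h1 := is_partialM h0 (is_partial_comp j (axis_affine_row_mxr (2^-1 *: (x + y))) sb).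
have h2 := is_partialZ (f y) h1.
apply: is_partial_ext h2 _ _ => xi /=; rewrite /wker -/(mid xi x y); first by ring.
by rewrite !mxE rmorphB /=; ring.
Qed.

End single.

Lemma uO_mulw Z n (w : Z -> R) (c : R) L (F : Z -> 'rV[R]_n -> R[i]) :
  uO (fun k => w k * c) L F -> uO w L F.
Proof.
move=> [sF hF]; split=> // l; have [C hC] := hF l; exists (C * c) => k x.
by have := hC k x; rewrite [w k * c]mulrC mulrA.
Qed.

Lemma uO_wdx Z (w : Z -> R) L (b : Z -> 'rV[R]_(d + d) -> R[i]) j :
  uO w L b -> uO w L.+1 (fun k => wdx j (b k)).
Proof.
move=> Ob; apply: uOD.
  have := uOZ (fun=> 'i) (uOM (@uO_coord R Z (d + d) (rshift d j)) Ob).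
  move=> /uO_mulw; rewrite add1n.
  under [X in uO X]eq_fun do rewrite mul1r.
  by under [X in uO _ _ X]eq_fun do under eq_fun do rewrite mulrA.
apply: uO_leL (leqnSn L) _.
exact: uO_mulw (uOZ (fun=> 2^-1%:C) (uO_partial (lshift d j) Ob)).
Qed.

End weyl_kernel.

(** * The Weyl operator as an iterated integral *)

Section weyl_iterated.
Context (R : realType) (d : nat).
Implicit Types (b : 'rV[R]_(d + d) -> R[i]) (f : 'rV[R]_d -> R[i]) (x y xi : 'rV[R]_d).

Let pg L b := uO (fun _ : unit => 1) L (fun=> b).

Lemma pg_wdx L b j : pg L b -> pg L.+1 (wdx j b).
Proof. exact: (@uO_wdx R d unit _ L (fun=> b) j). Qed.

Lemma pg_partial L b i : pg L b -> pg L (partial i b).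
Proof. exact: (@uO_partial R unit _ _ L (fun=> b) i). Qed.

Lemma schwartz_coordMl f (j : 'I_d) : schwartz f -> schwartz (fun y => (y 0 j)%:C * f y).
Proof.
move=> Sf; have := schwartz_coordM j 1 Sf.
by under [X in schwartz X -> _]eq_fun do rewrite mul1r.
Qed.

Lemma is_partial_wint_x L b f (j : 'I_d) xi : pg L b -> schwartz f ->
  is_partial j (fun x => wint b f x xi) (fun x => wint (wdx j b) f x xi).
Proof.
move=> Ob Sf; have O1 := pg_wdx j Ob; have O2 := pg_wdx j O1.
have [C C0 hC] := wker_decay1 O2 Sf d.*2.
apply: (@is_partial_cintegral _ _ _ _ _ _ (fun x => wker (wdx j (wdx j b)) f x xi)
    (C * jp xi ^+ L.+2) L.+2) => [y|y|x|x|x].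
- exact: is_partial_wker_x Ob j xi y.
- exact: is_partial_wker_x O1 j xi y.
- exact: wker_cintegrable1 Ob Sf x xi.
- exact: wker_cintegrable1 O1 Sf x xi.
- by move=> y; apply: le_trans (hC x xi y) _; rewrite exprMn [jp x ^+ _ * _]mulrC mulrA.
Qed.

Lemma is_partial_wint_xi L b f (j : 'I_d) x : pg L b -> schwartz f ->
  is_partial j (wint b f x)
   (fun xi => 'i * (x 0 j)%:C * wint b f x xi + wint (partial (rshift d j) b) f x xi
     - 'i * wint b (fun y => (y 0 j)%:C * f y) x xi).
Proof.
move=> Ob Sf.
have O1 := pg_partial (rshift d j) Ob; have O2 := pg_partial (rshift d j) O1.
have S1 := schwartz_coordMl j Sf; have S2 := schwartz_coordMl j S1.
set c := 'i * (x 0 j)%:C.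
pose G1 b f xi y := c * wker b f x xi y + wker (partial (rshift d j) b) f x xi y
   - 'i * wker b (fun y => (y 0 j)%:C * f y) x xi y.
pose G2 xi y := c * G1 b f xi y + G1 (partial (rshift d j) b) f xi y - 'i * G1 b (fun y => (y 0 j)%:C * f y) xi y.
have dG1 L' b' f' y : pg L' b' -> is_partial j (fun xi => wker b' f' x xi y) (fun xi => G1 b' f' xi y).
  by move=> Ob'; exact: is_partial_wker_xi Ob' j x y.
have iG1 L' b' f' xi : pg L' b' -> schwartz f' -> cintegrable (G1 b' f' xi).
  move=> Ob' Sf'; apply: cintegrableB; [apply: cintegrableD|]; [apply: cintegrableZ| |apply: cintegrableZ].
  - exact: wker_cintegrable1 Ob' Sf' x xi.
  - exact: wker_cintegrable1 (pg_partial _ Ob') Sf' x xi.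
  - exact: wker_cintegrable1 Ob' (schwartz_coordMl j Sf') x xi.
have bG1 L' b' f' : pg L' b' -> schwartz f' -> exists2 C, 0 <= C & forall xi, decay d.*2 (C * jp xi ^+ L') (G1 b' f' xi).
  move=> Ob' Sf'.
  have [C1 C10 h1] := wker_decay1 Ob' Sf' d.*2.
  have [C2 C20 h2] := wker_decay1 (pg_partial (rshift d j) Ob') Sf' d.*2.
  have [C3 C30 h3] := wker_decay1 Ob' (schwartz_coordMl j Sf') d.*2.
  exists ((normc c * C1 + C2 + C3) * jp x ^+ L').
    by rewrite mulr_ge0 ?exprn_ge0// !addr_ge0// mulr_ge0.
  move=> xi y; rewrite -mulrA -exprMn /G1.
  apply: le_trans (ler_wpM2l _ (le_normcB _ _)) _; first by rewrite exprn_ge0.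
  rewrite mulrDr [leRHS]mulrDl; apply: lerD.
    apply: le_trans (ler_wpM2l _ (le_normcD _ _)) _; first by rewrite exprn_ge0.
    rewrite mulrDr [leRHS]mulrDl; apply: lerD; last exact: h2.
    by rewrite normcM mulrCA -mulrA ler_wpM2l//; exact: h1.
  by rewrite normcM normci mul1r; exact: h3.
have [D1 D10 e1] := bG1 _ _ _ Ob Sf.
have [D2 D20 e2] := bG1 _ _ _ O1 Sf.
have [D3 D30 e3] := bG1 _ _ _ Ob S1.
have := @is_partial_cintegral _ _ _ j (fun xi => wker b f x xi) (G1 b f) G2 (normc c * D1 + D2 + D3) L.
move=> H; apply: is_partial_ext (H _ _ _ _ _) _ _ => //.
- by move=> y; exact: dG1 Ob.
- move=> y; apply: is_partialB; [apply: is_partialD; [apply: is_partialZ|]|apply: is_partialZ].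
  + exact: dG1 Ob.
  + exact: dG1 O1.
  + exact: dG1 Ob.
- by move=> xi; exact: wker_cintegrable1 Ob Sf x xi.
- by move=> xi; exact: iG1 Ob Sf.
- move=> xi y; rewrite /G2.
  apply: le_trans (ler_wpM2l _ (le_normcB _ _)) _; first by rewrite exprn_ge0.
  rewrite mulrDr [leRHS]mulrDl; apply: lerD.
    apply: le_trans (ler_wpM2l _ (le_normcD _ _)) _; first by rewrite exprn_ge0.
    rewrite mulrDr [leRHS]mulrDl; apply: lerD; last exact: e2.
    by rewrite normcM mulrCA -mulrA ler_wpM2l//; exact: e1.
  by rewrite normcM normci mul1r; exact: e3.
- move=> xi /=; rewrite /G1 /wint.
  have i1 := wker_cintegrable1 Ob Sf x xi.
  have i2 := wker_cintegrable1 O1 Sf x xi.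
  have i3 := wker_cintegrable1 Ob S1 x xi.
  by rewrite cintegralB ?cintegralD ?cintegralZ//;
    [exact: cintegrableZ|apply: cintegrableD => //; exact: cintegrableZ|exact: cintegrableZ].
Qed.

Lemma wint_ccont L b f x : pg L b -> schwartz f -> ccont (wint b f x).
Proof.
move=> Ob Sf.
have [C1 C10 h1] := wint_bound1 Ob Sf 0.
have /choice[C2 h2] : forall j : 'I_d, exists C, 0 <= C /\
    forall x, decay 0 (C * jp x ^+ L) (wint (partial (rshift d j) b) f x).
  by move=> j; have [C C0 hC] := wint_bound1 (pg_partial (rshift d j) Ob) Sf 0; exists C.
have /choice[C3 h3] : forall j : 'I_d, exists C, 0 <= C /\
    forall x, decay 0 (C * jp x ^+ L) (wint b (fun y => (y 0 j)%:C * f y) x).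
  by move=> j; have [C C0 hC] := wint_bound1 Ob (schwartz_coordMl j Sf) 0; exists C.
pose D := \sum_j (`|x 0 j| * C1 + C2 j + C3 j) * jp x ^+ L.
have t0 j : 0 <= (`|x 0 j| * C1 + C2 j + C3 j) * jp x ^+ L.
  by have [? _] := h2 j; have [? _] := h3 j; rewrite mulr_ge0 ?exprn_ge0// !addr_ge0// mulr_ge0.
apply: (is_partial_ccont (C := D) (L := 0) _ (fun j => is_partial_wint_xi j x Ob Sf)) => [|j xi].
  exact: sumr_ge0.
rewrite expr0 mulr1; apply: (@le_trans _ _ ((`|x 0 j| * C1 + C2 j + C3 j) * jp x ^+ L)); last first.
  by rewrite /D (bigD1 j)//= lerDl sumr_ge0.
have := h1 x xi; have := (h2 j).2 x xi; have := (h3 j).2 x xi; rewrite !expr0 !mul1r => b3 b2 b1.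
apply: le_trans (le_normcB _ _) _; rewrite !mulrDl; apply: lerD.
  apply: le_trans (le_normcD _ _) _; apply: lerD => //.
  by rewrite !normcM normci mul1r normcR -mulrA ler_wpM2l.
by rewrite normcM normci mul1r.
Qed.

Lemma wint_cintegrable L b f x : pg L b -> schwartz f -> cintegrable (wint b f x).
Proof.
move=> Ob Sf; have [C _ hC] := wint_bound1 Ob Sf d.*2.
exact: cintegrable_decay (wint_ccont x Ob Sf) (leqnn _) (hC x).
Qed.

(** The working form of the Weyl operator, an absolutely convergent iterated integral. It is
    identified with the oscillatory integral by [weylE]. *)
Definition iweyl b f x := (((2 * pi) ^+ d)^-1)%:C * cintegral (wint b f x).

Lemma is_partial_iweyl L b f (j : 'I_d) : pg L b -> schwartz f ->
  is_partial j (iweyl b f) (iweyl (wdx j b) f).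
Proof.
move=> Ob Sf; have O1 := pg_wdx j Ob; have O2 := pg_wdx j O1.
have [C C0 hC] := wint_bound1 O2 Sf d.*2.
apply: is_partialZ; apply: (@is_partial_cintegral _ _ _ _ _ _ (wint (wdx j (wdx j b)) f) C L.+2).
- by move=> xi; exact: is_partial_wint_x Ob Sf.
- by move=> xi; exact: is_partial_wint_x O1 Sf.
- by move=> x; exact: wint_cintegrable Ob Sf.
- by move=> x; exact: wint_cintegrable O1 Sf.
- exact: hC.
Qed.

(** The xi_j-derivative of [wint] integrates to 0; written out, this says that multiplication by x_j
    passes through the operator up to a term with a differentiated symbol. It is the source of decay
    in x. *)
Lemma iweyl_coord L b f (j : 'I_d) x : pg L b -> schwartz f ->
  (x 0 j)%:C * iweyl b f x =
  iweyl b (fun y => (y 0 j)%:C * f y) x + 'i * iweyl (partial (rshift d j) b) f x.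
Proof.
move=> Ob Sf; have O1 := pg_partial (rshift d j) Ob; have O2 := pg_partial (rshift d j) O1.
have S1 := schwartz_coordMl j Sf; have S2 := schwartz_coordMl j S1.
set c := 'i * (x 0 j)%:C.
pose G b f xi := c * wint b f x xi + wint (partial (rshift d j) b) f x xi
   - 'i * wint b (fun y => (y 0 j)%:C * f y) x xi.
have dG L' b' f' : pg L' b' -> schwartz f' -> is_partial j (wint b' f' x) (G b' f').
  by move=> Ob' Sf'; exact: is_partial_wint_xi Ob' Sf'.
have iG L' b' f' : pg L' b' -> schwartz f' -> cintegrable (G b' f').
  move=> Ob' Sf'; apply: cintegrableB; [apply: cintegrableD|]; [apply: cintegrableZ| |apply: cintegrableZ].
  - exact: wint_cintegrable Ob' Sf'.
  - exact: wint_cintegrable (pg_partial _ Ob') Sf'.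
  - exact: wint_cintegrable Ob' (schwartz_coordMl j Sf').
have bG L' b' f' : pg L' b' -> schwartz f' -> exists C, decay d.*2 C (G b' f').
  move=> Ob' Sf'.
  have [C1 C10 h1] := wint_bound1 Ob' Sf' d.*2.
  have [C2 C20 h2] := wint_bound1 (pg_partial (rshift d j) Ob') Sf' d.*2.
  have [C3 C30 h3] := wint_bound1 Ob' (schwartz_coordMl j Sf') d.*2.
  exists (normc c * (C1 * jp x ^+ L') + C2 * jp x ^+ L' + C3 * jp x ^+ L') => xi.
  apply: le_trans (ler_wpM2l _ (le_normcB _ _)) _; first by rewrite exprn_ge0.
  rewrite mulrDr; apply: lerD; last by rewrite normcM normci mul1r; exact: h3.
  apply: le_trans (ler_wpM2l _ (le_normcD _ _)) _; first by rewrite exprn_ge0.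
  rewrite mulrDr; apply: lerD; last exact: h2.
  by rewrite normcM mulrCA ler_wpM2l//; exact: h1.
have [D1 e1] := bG _ _ _ Ob Sf.
have [D2 e2] := bG _ _ _ O1 Sf.
have [D3 e3] := bG _ _ _ Ob S1.
pose G2 xi := c * G b f xi + G (partial (rshift d j) b) f xi - 'i * G b (fun y => (y 0 j)%:C * f y) xi.
have d2 : is_partial j (G b f) G2.
  apply: is_partialB; [apply: is_partialD; [apply: is_partialZ|]|apply: is_partialZ].
  - exact: dG Ob Sf.
  - exact: dG O1 Sf.
  - exact: dG Ob S1.
have b2 : decay d.*2 (normc c * D1 + D2 + D3) G2.
  move=> xi; apply: le_trans (ler_wpM2l _ (le_normcB _ _)) _; first by rewrite exprn_ge0.
  rewrite mulrDr; apply: lerD; last by rewrite normcM normci mul1r; exact: e3.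
  apply: le_trans (ler_wpM2l _ (le_normcD _ _)) _; first by rewrite exprn_ge0.
  rewrite mulrDr; apply: lerD; last exact: e2.
  by rewrite normcM mulrCA ler_wpM2l//; exact: e1.
have := cintegral_partial (dG _ _ _ Ob Sf) d2 (wint_cintegrable x Ob Sf) (iG _ _ _ Ob Sf) b2.
have i1 := wint_cintegrable x Ob Sf.
have i2 := wint_cintegrable x O1 Sf.
have i3 := wint_cintegrable x Ob S1.
rewrite /G cintegralB ?cintegralD ?cintegralZ//; last 3 first.
- exact: cintegrableZ.
- by apply: cintegrableD => //; exact: cintegrableZ.
- exact: cintegrableZ.
rewrite /iweyl; set I1 := cintegral _; set I2 := cintegral _; set I3 := cintegral _.
set k := (_%:C : R[i]) => E.
have ii : 'i * 'i = -1 :> R[i] by rewrite -expr2 sqr_i.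
have E3 : I3 = (x 0 j)%:C * I1 - 'i * I2.
  have : 'i * (c * I1 + I2 - 'i * I3) = 0 by rewrite E mulr0.
  have -> : 'i * (c * I1 + I2 - 'i * I3) = ('i * 'i) * ((x 0 j)%:C * I1) + 'i * I2 - ('i * 'i) * I3.
    by rewrite /c; ring.
  by rewrite ii => h; apply/eqP; rewrite -subr_eq0 -h; apply/eqP; ring.
by rewrite E3; ring.
Qed.

End weyl_iterated.

(** * Weyl operators on Schwartz families *)

Section weyl_operator.
Context (R : realType) (d : nat).
Implicit Types (b : 'rV[R]_(d + d) -> R[i]) (f phi : 'rV[R]_d -> R[i]) (x y xi : 'rV[R]_d).

Let pg L b := uO (fun _ : unit => 1) L (fun=> b).
Let wc : R := ((2 * pi) ^+ d)^-1.

Section family.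
Context (Z : Type) (v : Z -> R).

Lemma iweyl_bound0 (w : Z -> R) L (b : Z -> 'rV[R]_(d + d) -> R[i])
    (f : Z -> 'rV[R]_d -> R[i]) : uO w L b -> uS v f -> exists2 C, 0 <= C &
  forall k x, normc (iweyl (b k) (f k) x) <= C * (`|v k| * `|w k|) * jp x ^+ L.
Proof.
move=> Ob Sf; have [C C0 hC] := wint_bound Ob Sf d.*2.
exists (`|wc| * (2 * C * int_jp R d)) => [|k x]; first by rewrite !mulr_ge0 ?int_jp_ge0.
rewrite /iweyl normcM normcR -/wc -!mulrA ler_wpM2l// !mulrA.
have := normc_cintegral_le (wint_cintegrable x (uO_at k Ob) (uS_schwartz_at k Sf)) (hC k x).
by move/le_trans; apply; rewrite le_eqVlt; apply/orP; left; apply/eqP; ring.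
Qed.

(** Each power of <x> is dominated by 1 + sum |x_j|, and [iweyl_coord] turns x_j into a change of f
    or of the symbol. Neither raises the growth L of the symbol, so the right-hand side is the same
    for all M. *)
Lemma iweyl_boundM M (w : Z -> R) L (b : Z -> 'rV[R]_(d + d) -> R[i])
    (f : Z -> 'rV[R]_d -> R[i]) : uO w L b -> uS v f -> exists2 C, 0 <= C &
  forall k x, jp x ^+ M * normc (iweyl (b k) (f k) x) <= C * (`|v k| * `|w k|) * jp x ^+ L.
Proof.
elim: M b f => [|M IH] b f Ob Sf; have [C0 C00 h0] := iweyl_bound0 Ob Sf.
  by exists C0 => // k x; rewrite expr0 mul1r; exact: h0.
have [C1 C10 h1] := IH b f Ob Sf.
have hj (j : 'I_d) : exists C, 0 <= C /\ forall k x,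
    jp x ^+ M * normc ((x 0 j)%:C * iweyl (b k) (f k) x) <= C * (`|v k| * `|w k|) * jp x ^+ L.
  have Sj : uS v (fun k y => (y 0 j)%:C * f k y).
    have := uSM Sf (@uO_coord R Z d j).
    under [X in uS X]eq_fun do rewrite mulr1.
    by under [X in uS _ X]eq_fun do under eq_fun do rewrite mulrC.
  have [C2 C20 h2] := IH b _ Ob Sj.
  have [C3 C30 h3] := IH _ f (uO_partial (rshift d j) Ob) Sf.
  exists (C2 + C3); split=> [|k x]; first exact: addr_ge0.
  rewrite (iweyl_coord j x (uO_at k Ob) (uS_schwartz_at k Sf)) !mulrDl.
  apply: le_trans (ler_wpM2l _ (le_normcD _ _)) _; first by rewrite exprn_ge0.
  by rewrite mulrDr; apply: lerD; [exact: h2|rewrite normcM normci mul1r; exact: h3].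
have /choice[C2 h2] := hj.
exists (C1 + \sum_j C2 j) => [|k x].
  by rewrite addr_ge0// sumr_ge0// => j _; case: (h2 j).
rewrite exprSr -mulrA; apply: (@le_trans _ _ (jp x ^+ M * ((1 + \sum_j `|x 0 j|) * normc (iweyl (b k) (f k) x)))).
  by rewrite ler_wpM2l ?exprn_ge0// ler_wpM2r// jp_le_sum.
rewrite mulrDl mul1r mulrDr -!mulrA mulrDl; apply: lerD; first by rewrite mulrA; have := h1 k x; rewrite -!mulrA.
rewrite mulr_suml mulr_sumr mulr_suml; apply: ler_sum => j _.
by rewrite -(normcR (x 0 j)) -normcM; have [_ /(_ k x)] := h2 j; rewrite -!mulrA.
Qed.

Lemma partials_iweyl l L b f : pg L b -> schwartz f ->
  partials l (iweyl b f) = iweyl (foldr (@wdx R d) b l) f /\ pg (size l + L) (foldr (@wdx R d) b l).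
Proof.
move=> Ob Sf; elim: l => [//|i l [IH1 IH2]] /=; split; last exact: pg_wdx.
by rewrite -/(partials l _) IH1; exact: is_partialE (is_partial_iweyl i IH2 Sf).
Qed.

Lemma uO_foldr_wdx (w : Z -> R) L (b : Z -> 'rV[R]_(d + d) -> R[i]) l :
  uO w L b -> uO w (size l + L) (fun k => foldr (@wdx R d) (b k) l).
Proof. by move=> Ob; elim: l => [//|i l IH] /=; exact: uO_wdx. Qed.

(** Uniform continuity on S of Weyl operators with symbols of polynomial growth. Differentiation in
    x is absorbed into the symbol by [wdx], and multiplication by powers of x is handled by
    [iweyl_boundM]. *)
Lemma iweyl_uS (w : Z -> R) L (b : Z -> 'rV[R]_(d + d) -> R[i]) (f : Z -> 'rV[R]_d -> R[i]) : uO w L b -> uS v f ->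
  uS (fun k => `|v k| * `|w k|) (fun k => iweyl (b k) (f k)).
Proof.
move=> Ob Sf; split=> [k|l N].
  have Sk := uS_schwartz_at k Sf.
  apply: (@smooth_coind _ _ (fun F => exists L b, pg L b /\ F = iweyl b (f k))); last first.
    by exists L, (b k); split=> //; exact: uO_at Ob.
  move=> _ [L' [b' [Ob' ->]]]; split; last first.
    move=> i; exists (iweyl (wdx i b') (f k)); first exact: is_partial_iweyl Ob' Sk.
    by exists L'.+1, (wdx i b'); split=> //; exact: pg_wdx.
  have : forall i, exists C, 0 <= C /\ forall x, normc (iweyl (wdx i b') (f k) x) <= C * jp x ^+ L'.+1.
    move=> i; have [C C0 hC] := iweyl_bound0 (uO_param (fun _ : Z => tt) (pg_wdx i Ob')) Sf.
    exists (C * (`|v k| * 1)); split=> [|x]; first by rewrite !mulr_ge0.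
    by have := hC k x; rewrite /= normr1.
  move=> /choice[C hC].
  apply: (is_partial_ccont (C := \sum_i C i) (L := L'.+1) _ (fun i => is_partial_iweyl i Ob' Sk)) => [|i x].
    by apply: sumr_ge0 => i _; case: (hC i).
  apply: le_trans ((hC i).2 x) _; rewrite ler_wpM2r ?exprn_ge0//.
  by rewrite (bigD1 i)//= lerDl sumr_ge0// => j _; case: (hC j).
(* After the derivatives in l the symbol grows with exponent [size l + L]; that many additional
   powers of <x> cancel this growth on the right. *)
have [C C0 hC] := iweyl_boundM (N + (size l + L)) (uO_foldr_wdx l Ob) Sf.
exists C => k x; have [-> _] := partials_iweyl l (uO_at k Ob) (uS_schwartz_at k Sf).
rewrite -(ler_pM2r (jpX_gt0 x (size l + L))) mulrAC -exprD; exact: hC.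
Qed.

End family.

Lemma iweyl1 f x : schwartz f -> iweyl (fun=> 1) f x = f x.
Proof.
move=> Sf; rewrite /iweyl (_ : wint _ f x = fun xi => expi (dot x xi) * ft f xi); last first.
  apply/funext => xi; rewrite /wint wker_ft -cintegralZ; last exact: schwartz_cintegrable_ft.
  by congr cintegral; apply/funext => y; rewrite mulr1.
rewrite fourier_inversion// mulrA -rmorphM/= mulVf ?mul1r//.
by rewrite gt_eqF// exprn_gt0// mulr_gt0// pi_gt0.
Qed.

Lemma wintD L b1 b2 f x xi : pg L b1 -> pg L b2 -> schwartz f ->
  wint (fun X => b1 X + b2 X) f x xi = wint b1 f x xi + wint b2 f x xi.
Proof.
move=> O1 O2 Sf; rewrite /wint -cintegralD; [|exact: wker_cintegrable1 O1 Sf x xi|exact: wker_cintegrable1 O2 Sf x xi].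
by congr cintegral; apply/funext => y; rewrite /wker; ring.
Qed.

Lemma iweylD L b1 b2 f x : pg L b1 -> pg L b2 -> schwartz f ->
  iweyl (fun X => b1 X + b2 X) f x = iweyl b1 f x + iweyl b2 f x.
Proof.
move=> O1 O2 Sf; rewrite /iweyl -mulrDr -cintegralD; [|exact: wint_cintegrable O1 Sf|exact: wint_cintegrable O2 Sf].
by congr (_ * cintegral _); apply/funext => xi; exact: wintD O1 O2 Sf.
Qed.

Lemma iweylZ L c b f x : pg L b -> schwartz f -> iweyl (fun X => c * b X) f x = c * iweyl b f x.
Proof.
move=> Ob Sf; rewrite /iweyl mulrCA -(cintegralZ c (wint_cintegrable x Ob Sf)).
congr (_ * cintegral _); apply/funext => xi.
rewrite /wint -cintegralZ; last exact: wker_cintegrable1 Ob Sf x xi.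
by congr cintegral; apply/funext => y; rewrite /wker; ring.
Qed.

Lemma pg_shift L b (z : 'rV[R]_(d + d)) : pg L b -> pg L (fun X => b (z + X)).
Proof.
move=> [/(_ tt) sb hb].
have hA : axis_affine (@Some 'I_(d + d)) (fun=> 1) (fun X => z + X).
  have [c h] := axis_affine_shift z; split=> [|i X t]; last by rewrite mul1r addrA.
  by under eq_fun do rewrite addrC.
split=> [_|l]; first exact: smooth_comp hA sb.
have [C hC] := hb (pmap (@Some 'I_(d + d)) l).
have C0 : 0 <= C by have := uO_ge0 tt hC; rewrite mulr1.
exists (C * (2 * jp z) ^+ L) => _ X; apply: le_trans (normc_partials_comp l X hA sb _) _.
  by move=> _; rewrite normr1.
apply: le_trans (hC tt _) _; rewrite !mulr1 -mulrA ler_wpM2l// -exprMn.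
by rewrite lerXn2r ?nnegrE ?mulr_ge0// -mulrA jpD.
Qed.

(** Shifting xi by the frequency and y by the position of z moves the midpoint argument of the
    symbol by z; the phases recombine into the outer time-frequency shift. *)
Lemma iweyl_covariant L b phi z : pg L b -> schwartz phi ->
  iweyl b (time_freq phi z) = time_freq (iweyl (fun X => b (z + X)) phi) z.
Proof.
move=> Ob Sp; have St := time_freq_schwartz z Sp; have Oz := pg_shift z Ob.
apply/funext => x; rewrite /time_freq /iweyl mulrCA; congr (_ * _).
rewrite -(cintegral_shift (rsubmx z) (wint_cintegrable x Ob St)).
rewrite -cintegralZ; last exact: wint_cintegrable Oz Sp.
congr cintegral; apply/funext => xi; rewrite /wint.
rewrite -(cintegral_shift (lsubmx z) (wker_cintegrable1 Ob St x (xi + rsubmx z))).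
rewrite -cintegralZ; last exact: wker_cintegrable1 Oz Sp _ _.
congr cintegral; apply/funext => y; rewrite /wker /time_freq addrK.
have -> : mid (xi + rsubmx z) x (y + lsubmx z) = z + mid xi (x - lsubmx z) y.
  rewrite -{3}(hsubmxK z) /mid add_row_mx [rsubmx z + xi]addrC; congr row_mx.
  by apply/rowP => j; rewrite !mxE; field.
set c := b (z + mid xi (x - lsubmx z) y).
have E1 (p q s : R[i]) : p * c * (q * s) = p * q * (c * s) by ring.
have E2 (p q s : R[i]) : q * (p * c * s) = q * p * (c * s) by ring.
rewrite E1 E2.
by rewrite -!expiD; congr (expi _ * _); rewrite !dotBl !dotDl !dotDr; ring.
Qed.

End weyl_operator.

(** * Agreement with the oscillatory integral *)

Section oscillatory_integral.
Context (R : realType) (d : nat).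
Implicit Types (b : 'rV[R]_(d + d) -> R[i]) (f : 'rV[R]_d -> R[i]) (x y xi : 'rV[R]_d).

Let pg L b := uO (fun _ : unit => 1) L (fun=> b).
(** The bound 1/2 keeps the coefficients e and 2 e of [unmid] at most 1, as [normc_partials_comp]
    requires. *)
Let Z := {e : R | 0 < e <= 2^-1}.

(* Since [unmid e x (mid xi x y)] is [e *: row_mx y xi], a cut-off in the integration variables
   of the oscillatory integral can be absorbed into the symbol. *)
Definition unmid (e : R) x (X : 'rV[R]_(d + d)) : 'rV[R]_(d + d) :=
  e *: row_mx (2 *: lsubmx X - x) (rsubmx X).

Lemma unmidK e x xi y : unmid e x (mid xi x y) = e *: row_mx y xi.
Proof.
rewrite /unmid /mid row_mxKl row_mxKr scalerA divff ?scale1r ?pnatr_eq0//.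
by rewrite addrC addKr.
Qed.

Lemma axis_affine_unmid e x : axis_affine (@Some 'I_(d + d))
  (fun i => match fintype.split i with inl _ => 2 * e | inr _ => e end) (unmid e x).
Proof.
split=> [|i X t].
  apply: (continuous_comp_fun _ (@continuous_scaleR R (d + d) e)).
  apply: continuous_row_mx; last exact: continuous_rsubmx.
  apply: continuous_subrV; last exact: cst_continuous.
  exact: (continuous_comp_fun (@continuous_lsubmx R 1 d d) (@continuous_scaleR R d 2)).
rewrite /unmid; case: (fintype.split_ordP i) => j ->{i} /=;
  apply/rowP => k; rewrite -(fintype.splitK k); case: (fintype.split k) => m /=;
  rewrite [LHS]mxE [RHS]mxE [X in _ = X + _]mxE;
  [rewrite !row_mxEl|rewrite !row_mxEr|rewrite !row_mxEl|rewrite !row_mxEr];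
  rewrite !mxE ?eq_lshift ?eq_rshift ?eq_lrshift ?eq_rlshift ?andbF /=; ring.
Qed.

(** The cut-off differs from 1 by O(e) as a symbol of growth 1. At order 0 this is the Lipschitz
    bound with [chi 0 = 1]; at positive order the chain rule brings down a factor e or 2 e. *)
Lemma uO_cutoff chi x : schwartz chi -> chi 0 = 1 ->
  uO (fun e : Z => sval e) 1 (fun e X => chi (unmid (sval e) x X) - 1).
Proof.
move=> Sc c0; have sc := schwartz_smooth Sc.
have [C C0 hC] := schwartz_lipschitz Sc.
have sA (e : Z) : smooth (fun X => chi (unmid (sval e) x X)).
  exact: smooth_comp (axis_affine_unmid _ _) sc.
split=> [e|l]; first by apply: smoothB => //; exact: smooth_cst.
case/lastP: l => [|l i].
  exists (C * (d + d)%:R * (4 * jp x)) => e X /=.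
  have e0 : 0 <= sval e by case: e => /= e /andP[/ltW].
  have := hC 0 (unmid (sval e) x X); rewrite c0 => /le_trans; apply.
  rewrite expr1 -!mulrA ler_wpM2l//.
  have hk k : `|unmid (sval e) x X 0 k - (0 : 'rV[R]_(d + d)) 0 k| <= 4 * (jp x * (sval e * jp X)).
    rewrite [X in _ - X]mxE subr0 [X in `|X|]mxE normrM (ger0_norm e0).
    have alg (a p q : R) : 4 * (a * (p * q)) = p * (4 * (a * q)) by ring.
    rewrite alg ler_wpM2l//; have jX : jp X <= jp x * jp X by rewrite ler_peMl.
    have jx : jp x <= jp x * jp X by rewrite ler_peMr.
    rewrite -(fintype.splitK k); case: fintype.split => m /=.
      rewrite row_mxEl !mxE; apply: le_trans (ler_normB _ _) _; rewrite normrM.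
      have := jp_coord x m; have := jp_coord X (lshift d m); rewrite normr_nat.
      have gen (a b p q s : R) : a <= p -> b <= q -> p <= s -> q <= s -> 0 <= s -> 2 * a + b <= 4 * s by lra.
      by move=> h1 h2; apply: gen h1 h2 _ _ _ => //; rewrite mulr_ge0.
    rewrite row_mxEr !mxE; apply: le_trans (jp_coord X (rshift d m)) _; apply: le_trans jX _.
    by rewrite ler_peMl ?mulr_ge0// (_ : 1 = 1%:R)// ler_nat.
  apply: le_trans (ler_sum _ (fun k _ => hk k)) _.
  by rewrite sumr_const card_ord -[leLHS]mulr_natl.
have Sci := schwartz_partial i Sc.
have /uS_schwartz[_ /(_ (pmap (@Some 'I_(d + d)) l) 0%N)[D hD]] := Sci.
exists (2 * D) => e X; rewrite expr1.
have /andP[e0 e1] : 0 < sval e <= 2^-1 by case: e.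
have ew := ltW e0.
rewrite (partialsB _ (sA e) (@smooth_cst R (d + d) 1)) partials_cst.
rewrite (_ : (if _ is [::] then _ else _) = 0) ?subr0; last by case: (l).
rewrite partials_rcons (is_partialE (is_partial_comp i (axis_affine_unmid (sval e) x) sc)) /=.
set c := (match _ with inl _ => _ | inr _ => _ end).
have cb : 0 <= c <= 2 * sval e by rewrite /c; case: fintype.split => _; lra.
rewrite partialsZ; last exact: smooth_comp (axis_affine_unmid _ _) (smooth_partial i sc).
have := hD tt (unmid (sval e) x X); rewrite expr0 mul1r mulr1 => h.
have D0 := le_trans (normc_ge0 _) h.
rewrite normcM normcR; case/andP: cb => c00 c1; rewrite ger0_norm//.
apply: (@le_trans _ _ (2 * sval e * D)); last first.
  by rewrite -!mulrA ler_wpM2l// mulrCA ler_wpM2l// ler_peMr.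
apply: ler_pM => //; apply: le_trans h.
apply: (normc_partials_comp l X (axis_affine_unmid _ _) (smooth_partial i sc)) => k.
by rewrite ger0_norm; case: fintype.split => _; lra.
Qed.

Lemma is_osc_integral_unique n (f : 'rV[R]_n -> R[i]) l l' :
  is_osc_integral f l -> is_osc_integral f l' -> l = l'.
Proof.
move=> h h'.
have G0 : gaussian 1 (0 : 'rV[R]_n) = 1.
  by rewrite /gaussian (_ : dot _ _ = 0) ?mulr0 ?oppr0 ?expR0// /dot big1// => i _; rewrite mxE mul0r.
have := h _ (gaussian_schwartz n (@ltr01 R)) G0; have := h' _ (gaussian_schwartz n (@ltr01 R)) G0.
move=> c2 c1; apply/eqP; rewrite -subr_eq0; apply/eqP.
apply: (@eq0_normc_small _ _ 2) => e /andP[e0 _].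
have /cvgr0Pnorm_lt/(_ _ e0) n1 := c1; have /cvgr0Pnorm_lt/(_ _ e0) n2 := c2.
have [t [/= t1 t2]] := @filter_ex _ _ _ _ (filterI n1 n2).
move: t1 t2; rewrite !ger0_norm ?normc_ge0//; set I := cintegral _ => t1 t2.
have -> : l - l' = (I - l') - (I - l) by ring.
by apply: le_trans (le_normcB _ _) _; rewrite mulr_natl mulr2n; apply: lerD; exact: ltW.
Qed.

(** Absorbed into the symbol, the cut-off changes b into b + (chi - 1) b. The regularized integral
    converges absolutely and may be iterated in either order, and by [uO_cutoff] the term with chi -
    1 contributes O(e). *)
Lemma is_osc_integral_weyl L b f x : pg L b -> schwartz f ->
  is_osc_integral (fun w : 'rV[R]_(d + d) =>
    expi (dot (x - lsubmx w) (rsubmx w)) *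
    b (row_mx (2^-1 *: (x + lsubmx w)) (rsubmx w)) * f (lsubmx w)) (cintegral (wint b f x)).
Proof.
move=> Ob Sf chi Sc c0.
have Sf' : uS (fun _ : Z => 1) (fun=> f) by exact: (uS_param (fun _ : Z => tt) ((uS_schwartz f).2 Sf)).
have Oc := uO_cutoff x Sc c0.
have Od := uOM Oc (uO_param (fun _ : Z => tt) Ob).
have [C C0 hC] := wint_bound Od Sf' d.*2.
pose F (w : 'rV[R]_(d + d)) := wker b f x (rsubmx w) (lsubmx w).
have key (e : R) : 0 < e <= 2^-1 -> normc (cintegral (fun w => chi (e *: w) * F w) - cintegral (wint b f x)) <=
    2 * (C * jp x ^+ (1 + L)) * int_jp R d * e.
  move=> he; pose E : Z := exist _ e he; have /andP[e0 e1] := he.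
  set bt := (fun X => (chi (unmid e x X) - 1) * b X) in hC Od *.
  have Ot : pg (1 + L) (fun X => (chi (unmid e x X) - 1) * b X) by exact: (uO_at E Od).
  have ObL : pg (1 + L) b by exact: uO_leL (leq_addl _ _) Ob.
  pose H y xi := wker (fun X => (chi (unmid e x X) - 1) * b X + b X) f x xi y.
  have HE : (fun w => chi (e *: w) * F w) = fun w => H (lsubmx w) (rsubmx w).
    apply/funext => w; rewrite /H /F /wker unmidK hsubmxK.
    have alg (p q r s : R[i]) : p * (q * r * s) = q * ((p - 1) * r + r) * s by ring.
    exact: alg.
  have Hc : ccont (fun w : 'rV[R]_(d + d) => H (lsubmx w) (rsubmx w)).
    have cl := @continuous_lsubmx R 1 d d; have cr := @continuous_rsubmx R 1 d d.
    have cx : continuous (fun _ : 'rV[R]_(d + d) => x) by exact: cst_continuous.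
    rewrite -HE; apply: ccontM.
      by apply: ccont_comp (schwartz_ccont Sc); exact: continuous_scaleR.
    apply: ccontM; last exact: ccont_comp cl (schwartz_ccont Sf).
    apply: ccontM.
      apply: (@ccont_expi R _ (fun w : 'rV[R]_(d + d) => dot (x - lsubmx w) (rsubmx w))).
      exact: (continuous_dot (continuous_subrV cx cl) cr).
    apply: ccont_comp (smooth_ccont [::] (uO_smooth tt Ob)).
    apply: (continuous_row_mx _ cr).
    exact: (continuous_comp_fun (continuous_addrV cx cl) (@continuous_scaleR R d 2^-1)).
  (* Powers of decay asked of the cut-off: P for y and P for xi to allow the exchange of integrals,
     and 2L for the growth of the symbol at the midpoint. The resulting constant may depend on e,
     since it serves only that exchange. *)
  pose P := (d + d).*2; pose Q := (P + P + (L + L))%N.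
  have [D0 /(decay_dilate (e := e)) hD] := schwartz_decay Q Sc.
  have {}hD := hD ltac:(by rewrite e0 (le_trans e1)// invf_le1// (_ : 1 = 1%:R)// ler_nat).
  set D := D0 * _ in hD; have D00 := decay_ge0 hD.
  have [B hB] := Ob.2 [::]; have B0 : 0 <= B by have := uO_ge0 tt hB; rewrite mulr1.
  have [A hA] := schwartz_decay 0 Sf; have A0 := decay_ge0 hA.
  have HC y xi : jp y ^+ P * jp xi ^+ P * normc (H y xi) <= D * (B * (2 * jp x) ^+ L) * A.
    have -> : H y xi = chi (e *: row_mx y xi) * (expi (dot (x - y) xi) * b (mid xi x y) * f y).
      have := congr1 (fun G => G (row_mx y xi)) HE; rewrite /F /wker /= row_mxKl row_mxKr => <-.
      by [].
    set W := jp (row_mx y xi); have W0 : 0 <= W := jp_ge0 _.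
    have hy : jp y <= W := jp_row_mxl y xi; have hxi : jp xi <= W := jp_row_mxr y xi.
    have b1 : normc (b (mid xi x y)) <= B * (2 * jp x) ^+ L * W ^+ (L + L).
      have := hB tt (mid xi x y); rewrite mulr1 => /le_trans; apply.
      rewrite -mulrA ler_wpM2l// exprD mulrA -!exprMn lerXn2r ?nnegrE ?mulr_ge0//.
      apply: le_trans (jp_mid xi x y) _; apply: ler_pM; rewrite ?mulr_ge0// -mulrA ler_wpM2l// ler_wpM2l//.
    have b2 : normc (f y) <= A by have := hA y; rewrite expr0 mul1r.
    have b3 := hD (row_mx y xi); rewrite -/W in b3.
    have b4 : jp y ^+ P * jp xi ^+ P <= W ^+ (P + P).
      by rewrite exprD; apply: ler_pM; rewrite ?exprn_ge0// lerXn2r ?nnegrE.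
    rewrite !normcM normc_expi mul1r.
    apply: (@le_trans _ _ (W ^+ (P + P) * (normc (chi (e *: row_mx y xi)) * (B * (2 * jp x) ^+ L * W ^+ (L + L) * A)))).
      apply: ler_pM; rewrite ?mulr_ge0 ?exprn_ge0//; apply: ler_wpM2l => //.
      by apply: ler_pM.
    have alg (p q r s t : R) : p * (q * (r * s * t)) = p * s * q * r * t by ring.
    rewrite alg -exprD; apply: ler_wpM2r => //; apply: ler_wpM2r => //.
    by rewrite mulr_ge0 ?exprn_ge0 ?mulr_ge0.
  have iw := wint_cintegrable x ObL Sf.
  have it := wint_cintegrable x Ot Sf.
  have -> : cintegral (fun w => chi (e *: w) * F w) =
      cintegral (wint (fun X => (chi (unmid e x X) - 1) * b X) f x) + cintegral (wint b f x).
    rewrite HE (cintegral_pairE Hc HC) (cintegral_swap Hc HC) -cintegralD//.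
    by congr cintegral; apply/funext => xi; rewrite -(wintD x xi Ot ObL Sf).
  rewrite addrK; apply: le_trans (normc_cintegral_le it _) _.
    by move=> xi; exact: (hC E x xi).
  rewrite /= normr1 mul1r mulr1 (ger0_norm (ltW e0)).
  by rewrite le_eqVlt; apply/orP; left; apply/eqP; ring.

pose K := 2 * (C * jp x ^+ (1 + L)) * int_jp R d.
have K0 : 0 <= K by rewrite !mulr_ge0 ?int_jp_ge0 ?exprn_ge0.
have Kp : 0 < K + 1 by rewrite ltr_wpDl.
apply/cvgr0Pnorm_lt => eps eps0.
have epsK : 0 < eps / (K + 1) by exact: divr_gt0.
near=> e.
have he : 0 < e <= 2^-1.
  apply/andP; split; first by near: e; exact: nbhs_right_gt.
  by near: e; apply: nbhs_right_le; rewrite invr_gt0.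
rewrite ger0_norm ?normc_ge0//; apply: le_lt_trans (key e he) _; rewrite -/K.
have : e < eps / (K + 1) by near: e; exact: nbhs_right_lt.
have /andP[e0 _] := he.
rewrite ltr_pdivlMr// mulrDr mulr1 mulrC => h; lra.
Unshelve. all: by end_near.
Qed.

Lemma weylE L b f : pg L b -> schwartz f -> weyl b f = iweyl b f.
Proof.
move=> Ob Sf; apply/funext => x; rewrite /weyl /iweyl; congr (_ * _).
have h := is_osc_integral_weyl x Ob Sf.
rewrite /osc_integral; case: xgetP => [l _ hl|/(_ _ h)//].
exact: is_osc_integral_unique hl h.
Qed.

End oscillatory_integral.

(** * Freezing the symbol at a noncharacteristic point *)

Section symbol_increment.
Context (R : realType).

Lemma nat_ge (x : R) : exists k : nat, x <= k%:R.
Proof.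
exists (Num.bound `|x|); apply: le_trans (ler_norm x) _.
by apply: ltW; apply: archi_boundP.
Qed.

(** A negative exponent interchanges the roles of u and v, hence the comparison in both
    directions. *)
Lemma powR_comparable (c u v p : R) k : 0 < u -> 0 < v -> 1 <= c -> u <= c * v -> v <= c * u ->
  `|p| <= k%:R -> u `^ p <= c ^+ k * v `^ p.
Proof.
move=> u0 v0 c1 uv vu pk; have c0 : 0 < c := lt_le_trans ltr01 c1.
have key (a b q : R) : 0 <= q -> q <= k%:R -> 0 < a -> 0 < b -> a <= c * b -> a `^ q <= c ^+ k * b `^ q.
  move=> q0 qk a0 b0 ab; have a0' := ltW a0; have cb : 0 <= c * b by rewrite ltW// mulr_gt0.
  apply: (le_trans (ge0_ler_powR q0 a0' cb ab)).
  rewrite powRM ?(ltW c0) ?(ltW b0)//; apply: ler_wpM2r; first exact: powR_ge0.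
  by rewrite -powR_mulrn ?(ltW c0)// ler_powR.
have [p0|p0] := leP 0 p; first by apply: key => //; rewrite -(ger0_norm p0).
have := key v u (- p); rewrite oppr_ge0 (ltW p0) -(ltr0_norm p0) => /(_ isT pk v0 u0 vu).
rewrite ltr0_norm// !powRN => h.
have U0 : 0 < u `^ p by rewrite powR_gt0.
have V0 : 0 < v `^ p by rewrite powR_gt0.
have := ler_wpM2r (ltW (mulr_gt0 U0 V0)) h.
rewrite mulrCA mulVf ?mulr1 ?gt_eqF//.
have -> : c ^+ k / u `^ p * (u `^ p * v `^ p) = c ^+ k * v `^ p by field; rewrite gt_eqF.
by [].
Qed.

Lemma jp_powR n (z X : 'rV[R]_n) (p : R) k : `|p| <= k%:R ->
  jp (z + X) `^ p <= (2 * jp X) ^+ k * jp z `^ p.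
Proof.
move=> pk; apply: powR_comparable => //.
- by have := jp_ge1 X; lra.
- by rewrite -mulrA [jp X * _]mulrC jpD.
- have := jpDl z (- X); rewrite opprK jpN => /le_trans; apply.
  by rewrite -mulrA [jp X * _]mulrC.
Qed.

Lemma jp_powR_le n (z : 'rV[R]_n) (p q : R) : p <= q -> jp z `^ p <= jp z `^ q.
Proof. by move=> pq; rewrite ler_powR. Qed.

Context (n : nat) (m : R) (a : 'rV[R]_n -> R[i]).
Hypothesis sa : smooth a.
Hypothesis ba : forall l, exists2 C, 0 <= C & forall z,
  normc (partials l a z) <= C * jp z `^ (m - (size l)%:R).

Lemma symbol_pg : exists L, uO (fun _ : unit => 1) L (fun=> a).
Proof.
have [L mL] := nat_ge m.
exists L; split=> // l; have [C C0 hC] := ba l; exists C => _ z; rewrite mulr1.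
apply: le_trans (hC z) _; rewrite ler_wpM2l// -powR_mulrn//; apply: jp_powR_le.
by apply: le_trans mL; rewrite gerBl.
Qed.

Context (Z : Type) (pt : Z -> 'rV[R]_n) (m' c0 : R).
Hypotheses (c00 : 0 < c0) (lo : forall k, c0 * jp (pt k) `^ m' <= normc (a (pt k))).
Hypothesis hyp : forall l, exists2 C, 0 <= C & forall k,
  normc (partials l a (pt k)) <= C * normc (a (pt k)) * jp (pt k) `^ (- (size l)%:R).

(* The error made in replacing [a (z + X)] by [a z], relative to [a z] and without its decay
   factor [(jp z)^-1]. *)
Definition incr k (X : 'rV[R]_n) := (jp (pt k))%:C * ((a (pt k + X) - a (pt k)) / a (pt k)).

Let base (l : seq 'I_n) (z : 'rV[R]_n) : R[i] := if l is [::] then a z else 0.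

(* Downward induction on the order of the derivative: above order [N] the symbol estimates
   suffice, below it one integrates the bounds of the next order from [pt k] to [pt k + X]. *)
Lemma incr_bound : exists L, forall l, exists2 C, 0 <= C & forall k X,
  jp (pt k) * normc (partials l a (pt k + X) - base l (pt k)) <= C * normc (a (pt k)) * jp X ^+ L.
Proof.
(* From order N on, the symbol estimates alone give <z>^(m'-1), which is a(z)/<z> up to a constant
   by the lower bound. N > 0 ensures that nothing is subtracted at those orders. *)
have [N [N0 mN]] : exists N : nat, (0 < N)%N /\ m - N%:R <= m' - 1.
  have [N hN] := nat_ge (m - m' + 1); exists N.+1; split=> //; rewrite -natr1; lra.
have [K hK] := nat_ge `|m - N%:R|.
suff H : forall j l, (N <= size l + j)%N -> exists2 C, 0 <= C & forall k X,
    jp (pt k) * normc (partials l a (pt k + X) - base l (pt k)) <= C * normc (a (pt k)) * jp X ^+ (K + j).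
  by exists (K + N)%N => l; apply: H; rewrite leq_addl.
elim=> [|j IH] l lN.
  rewrite addn0 in lN; have [C C0 hC] := ba l.
  exists (C * 2 ^+ K / c0) => [|k X]; first by rewrite divr_ge0 ?mulr_ge0 ?exprn_ge0// ltW.
  have -> : base l (pt k) = 0 by case: l lN {hC} => // /(leq_trans N0).
  rewrite subr0 addn0.
  have h1 : normc (partials l a (pt k + X)) <= C * ((2 * jp X) ^+ K * jp (pt k) `^ (m' - 1)).
    apply: le_trans (hC _) _; rewrite ler_wpM2l//.
    apply: (@le_trans _ _ (jp (pt k + X) `^ (m - N%:R))).
      by apply: jp_powR_le; rewrite lerB// ler_nat.
    apply: le_trans (jp_powR _ _ hK) _; rewrite ler_wpM2l ?exprn_ge0 ?mulr_ge0//.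
    exact: jp_powR_le.
  (* The lower bound on a(z) enters here: <z> <z>^(m'-1) = <z>^m'. *)
  have h2 : jp (pt k) * jp (pt k) `^ (m' - 1) <= normc (a (pt k)) / c0.
    rewrite -{1}[jp (pt k)]powRr1// -powRD; last by apply/implyP => _; rewrite gt_eqF.
    by rewrite addrC subrK ler_pdivlMr// mulrC.
  apply: le_trans (ler_wpM2l _ h1) _ => //.
  have alg (p q r s : R) : p * (q * (r * s)) = q * r * (p * s) by ring.
  rewrite alg; apply: le_trans (ler_wpM2l _ h2) _; first by rewrite mulr_ge0 ?exprn_ge0 ?mulr_ge0.
  by rewrite exprMn le_eqVlt; apply/orP; left; apply/eqP; ring.
have /choice[C hC] : forall i, exists C, 0 <= C /\ forall k X,
    jp (pt k) * normc (partials (i :: l) a (pt k + X)) <= C * normc (a (pt k)) * jp X ^+ (K + j).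
  move=> i; have [|C C0 h] := IH (i :: l); first by rewrite /= addSnnS.
  by exists C; split=> // k X; have := h k X; rewrite /base subr0.
have [D D0 hD] := hyp l.
pose S := \sum_i C i; have S0 : 0 <= S by apply: sumr_ge0 => i _; case: (hC i).
exists (2 * S * n%:R + D) => [|k X]; first by rewrite addr_ge0// !mulr_ge0.
set z := pt k; have az0 : 0 <= normc (a z) by [].
have mv : normc (partials l a (z + X) - partials l a z) <=
    2 * (S * normc (a z) * jp X ^+ (K + j) / jp z) * (n%:R * jp X).
  apply: (@le_trans _ _ (2 * (S * normc (a z) * jp X ^+ (K + j) / jp z) * \sum_i `|(z + X) 0 i - z 0 i|)).
    apply: (box_mean_value (g := fun i => partials (i :: l) a)) => [i|i Y hY].
      exact: smooth_is_partial.
    have {hY} jY : jp (Y - z) <= jp X.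
      apply: jp_le_coord; apply: dot_le_coord => q; have [s /andP[s0 s1] E] := hY q.
      rewrite !mxE E mxE addrAC subrr add0r addrAC subrr add0r normrM ger0_norm//.
      by rewrite ler_piMl.
    rewrite ler_pdivlMr// mulrC -(subrK z Y) addrC.
    apply: le_trans ((hC i).2 k _) _; rewrite -!mulrA; apply: ler_pM.
    - by case: (hC i).
    - by rewrite mulr_ge0 ?exprn_ge0.
    - by rewrite /S (bigD1 i)//= lerDl sumr_ge0// => q _; case: (hC q).
    - by rewrite ler_wpM2l// lerXn2r ?nnegrE.
  rewrite ler_wpM2l//.
    by rewrite mulr_ge0// divr_ge0// !mulr_ge0 ?exprn_ge0.
  rewrite mulr_natl -[X in _ *+ X]card_ord -sumr_const; apply: ler_sum => i _.
  by rewrite mxE addrAC subrr add0r jp_coord.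
(* The value at X = 0. At order 0 the subtraction of [base] leaves nothing; at positive order the
   factor <z>^(-|l|) of the hypercharacteristic condition absorbs the extra <z>. *)
have bz : jp z * normc (partials l a z - base l z) <= D * normc (a z).
  rewrite /base; case: l {IH lN mv C hC S S0} hD => [|i l] hD.
    by rewrite subrr normc0 mulr0 mulr_ge0.
  rewrite subr0; apply: le_trans (ler_wpM2l _ (hD k)) _ => //.
  rewrite mulrCA -[leRHS]mulr1 ler_wpM2l ?mulr_ge0// -{1}[jp _]powRr1// -powRD; last by apply/implyP => _; rewrite gt_eqF.
  apply: (@le_trans _ _ (jp (pt k) `^ 0)); last by rewrite powRr0.
  by apply: jp_powR_le; rewrite subr_le0 ler1n.
apply: (@le_trans _ _ (jp z * (normc (partials l a (z + X) - partials l a z) + normc (partials l a z - base l z)))).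
  rewrite ler_wpM2l//; apply: le_trans (le_normcD _ _).
  by rewrite addrA subrK.
rewrite mulrDr !mulrDl; apply: lerD.
  apply: le_trans (ler_wpM2l _ mv) _ => //; rewrite addnS exprSr.
  rewrite le_eqVlt; apply/orP; left; apply/eqP; field.
  by rewrite gt_eqF.
apply: le_trans bz _; rewrite -[leLHS]mulr1 ler_wpM2l ?mulr_ge0//.
exact: jpX_ge1.
Qed.

Lemma uO_incr : exists L, uO (fun _ : Z => 1) L incr.
Proof.
have [L hL] := incr_bound; exists L.
have sh k : smooth (fun X => a (pt k + X)).
  have [c h] := axis_affine_shift (pt k).
  apply: (@smooth_comp _ _ _ (@Some 'I_n) (fun=> 1) (fun X => pt k + X)) sa.
  split=> [|i X t]; last by rewrite mul1r addrA.
  by under eq_fun do rewrite addrC.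
have pshift k l : partials l (fun X => a (pt k + X)) = fun X => partials l a (pt k + X).
  elim: l => [//|i l IH] /=; rewrite -/(partials l _) IH; apply: is_partialE.
  have hA : axis_affine (@Some 'I_n) (fun=> 1) (fun X => pt k + X).
    have [c h] := axis_affine_shift (pt k).
    split=> [|q X t]; last by rewrite mul1r addrA.
    by under eq_fun do rewrite addrC.
  apply: is_partial_ext (is_partial_comp i hA (smooth_partials l sa)) _ _ => // X /=.
  by rewrite mul1r.
have ap k : 0 < normc (a (pt k)).
  by apply: lt_le_trans (lo k); rewrite mulr_gt0// powR_gt0.
have a0 k : normc (a (pt k)) != 0 by rewrite gt_eqF.
have iE k : incr k = fun X => (jp (pt k))%:C / a (pt k) * (a (pt k + X) - a (pt k)).
  by apply/funext => X; rewrite /incr mulrA mulrAC.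
split=> [k|l]; first by rewrite iE; apply: smoothZ; apply: smoothB => //; exact: smooth_cst.
have [C C0 hC] := hL l; exists C => k X; rewrite mulr1 iE partialsZ; last first.
  by apply: smoothB => //; exact: smooth_cst.
rewrite (partialsB _ (sh k) (@smooth_cst R n (a (pt k)))) pshift partials_cst !normcM normcR ger0_norm//.
have -> : normc (a (pt k))^-1 = (normc (a (pt k)))^-1.
  apply: (mulfI (a0 k)); rewrite divff// -normcM divff ?normc1//.
  by apply: contraNneq (a0 k) => ->; rewrite normc0.
rewrite mulrAC ler_pdivrMr//.
by rewrite mulrAC; exact: hC.
Qed.

End symbol_increment.

(** * Pointwise estimates at noncharacteristic points *)

Section core_estimates.
Context (R : realType) (d : nat).
Variables (phi : 'rV[R]_d -> R[i]) (u : functional R d) (a : 'rV[R]_(d + d) -> R[i]) (m m' : R).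
Hypotheses (Sp : schwartz phi) (p0 : exists x, phi x != 0) (bu : bounded_functional u).
Hypothesis sa : smooth a.
Hypothesis ba : forall l, exists2 C, 0 <= C & forall z,
  normc (partials l a z) <= C * jp z `^ (m - (size l)%:R).
Variables (Z : Type) (pt : Z -> 'rV[R]_(d + d)) (c0 : R).
Hypotheses (c00 : 0 < c0) (lo : forall k, c0 * jp (pt k) `^ m' <= normc (a (pt k))).
Hypothesis hyp : forall l, exists2 C, 0 <= C & forall k,
  normc (partials l a (pt k)) <= C * normc (a (pt k)) * jp (pt k) `^ (- (size l)%:R).

Let ap k : 0 < normc (a (pt k)).
Proof. by apply: lt_le_trans (lo k); rewrite mulr_gt0// powR_gt0. Qed.

Let a_neq0 k : a (pt k) != 0.
Proof. by apply: contraTneq (ap k) => ->; rewrite normc0 ltxx. Qed.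

Let incrE k X : a (pt k + X) = a (pt k) * (1 + ((jp (pt k))^-1)%:C * incr a pt k X).
Proof.
rewrite /incr mulrA -rmorphM/= mulVf ?gt_eqF// mul1r mulrDr mulr1.
have -> : a (pt k) * ((a (pt k + X) - a (pt k)) / a (pt k)) = a (pt k + X) - a (pt k).
  by rewrite mulrC divfK// a_neq0.
by rewrite addrCA subrr addr0.
Qed.

(** Division by |a(z)|. In the term with Y the lower bound turns the quotient into <z>^-m'; in the
    error term |a(z)| cancels. *)
Lemma core_finish (F Y H : R) k (C : R) : 0 <= C -> 0 <= Y ->
  normc (a (pt k)) * F <= Y + C * normc (a (pt k)) * (jp (pt k))^-1 * H ->
  F <= c0^-1 * jp (pt k) `^ (- m') * Y + C * (jp (pt k))^-1 * H.
Proof.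
move=> C0 Y0 h; rewrite -(ler_pM2l (ap k)); apply: le_trans h _; rewrite mulrDr.
apply: lerD; last by rewrite le_eqVlt; apply/orP; left; apply/eqP; ring.
rewrite mulrA -[leLHS]mul1r ler_wpM2r// powRN mulrA -ler_pdivrMr ?invr_gt0 ?powR_gt0//.
by rewrite div1r invrK ler_pdivlMr// mulrC.
Qed.

(** Duality moves the operator onto the shifted window, and covariance moves the shift outside,
    which translates the symbol by z and makes it ready to be frozen. *)
Lemma stft_weyl_dist z : stft phi (weyl_dist a u) z =
  pairing u (time_freq (iweyl (fun X => conjc (a (z + X))) phi) z).
Proof.
have [L Oa] := symbol_pg sa ba.
have Oc : uO (fun _ : unit => 1) L (fun=> fconj a) := uO_conj Oa.
rewrite /stft /pairing /weyl_dist -(iweyl_covariant z Oc Sp) -(weylE Oc (time_freq_schwartz z Sp)).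
congr (u (fconj (weyl _ _))); apply/funext => y; exact: conjcK.
Qed.

Lemma core_weyl (Cu : R) K M : 0 <= Cu -> grow Cu K (stft phi u) -> ((d + d).*2 + K <= M)%N ->
  exists2 C, 0 <= C & forall k, normc (stft phi u (pt k)) <=
    C * jp (pt k) `^ (- m') * normc (stft phi (weyl_dist a u) (pt k)) +
    C * (jp (pt k))^-1 * avg (stft phi u) M (pt k).
Proof.
move=> Cu0 gu KM; have [L Oi] := uO_incr sa ba c00 lo hyp.
have Oc := uO_conj Oi.
have Sphi : uS (fun _ : Z => 1) (fun=> phi) := uS_param (fun _ : Z => tt) ((uS_schwartz phi).2 Sp).
have Sw := iweyl_uS Oc Sphi.
have w0 (k : Z) : 0 <= `|1| * `|1| :> R by rewrite mulr_ge0.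
have [C [C0 hC]] := pairing_avg Sp p0 bu Cu0 gu KM w0 Sw.
exists (c0^-1 + C) => [|k]; first by rewrite addr_ge0// invr_ge0 ltW.
set z := pt k; have Sk := uS_schwartz_at k Sw.
have O1 : uO (fun _ : unit => 1) L (fun _ (_ : 'rV[R]_(d + d)) => 1 : R[i]).
  apply: (@uO_leL _ _ _ _ 0) => //.
  by have := uO_cst (d + d) (fun _ : unit => 1 : R[i]); rewrite normc1.
have Ok := uO_at k Oc.
have E : stft phi (weyl_dist a u) z = a z * (stft phi u z +
    ((jp z)^-1)%:C * pairing u (time_freq (iweyl (fconj (incr a pt k)) phi) z)).
  have Otmp : uO (fun _ : unit => 1) L (fun _ X => ((jp z)^-1)%:C * fconj (incr a pt k) X).
    exact: uO_unit (uOZ (fun=> ((jp z)^-1)%:C) Ok).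
  pose h := iweyl (fconj (incr a pt k)) phi.
  have tfE : time_freq (iweyl (fun X => conjc (a (z + X))) phi) z = fun y =>
      conjc (a z) * (((jp z)^-1)%:C * time_freq h z y + time_freq phi z y).
    have -> : (fun X => conjc (a (z + X))) =
        (fun X => conjc (a z) * (1 + ((jp z)^-1)%:C * fconj (incr a pt k) X)).
      have cD (r : R) (v : R[i]) : conjc (1 + r%:C * v) = 1 + r%:C * conjc v.
        by case: v => v1 v2; apply: complex_eqP => /=; ring.
      by apply/funext => X; rewrite incrE conjcM cD.
    apply/funext => y; rewrite /time_freq.
    rewrite (iweylZ _ _ (uOD O1 Otmp) Sp).
    rewrite (iweylD _ O1 Otmp Sp) iweyl1// (iweylZ _ _ Ok Sp) -/h.
    have alg (p q r s t : R[i]) : p * (q * (r + s * t)) = q * (s * (p * t) + p * r) by ring.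
    exact: alg.
  have Sh : schwartz (time_freq h z) := time_freq_schwartz z Sk.
  have Sq := schwartzD (schwartzZ ((jp z)^-1)%:C Sh) (time_freq_schwartz z Sp).
  have e2 := pairing_linear ((jp z)^-1)%:C bu.1 Sh (time_freq_schwartz z Sp).
  have e1 := pairingZ (conjc (a z)) bu.1 Sq.
  have e0 : stft phi (weyl_dist a u) z =
    pairing u (fun y => conjc (a z) * (((jp z)^-1)%:C * time_freq h z y + time_freq phi z y)).
    by rewrite -tfE; exact: stft_weyl_dist.
  have alg (p q r : R[i]) (t : R) : conjc (conjc p) * (conjc t%:C * q + r) = p * (r + t%:C * q).
    by rewrite conjcK conjcR addrC.
  apply: (etrans e0); apply: (etrans e1); rewrite e2.
  exact: alg.
apply: le_trans (core_finish (C := C) C0 (normc_ge0 (stft phi (weyl_dist a u) z)) _) _.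
- rewrite E normcM.
  have h : normc (stft phi u z) <= normc (stft phi u z +
      ((jp z)^-1)%:C * pairing u (time_freq (iweyl (fconj (incr a pt k)) phi) z)) +
      C * (jp z)^-1 * avg (stft phi u) M z.
    set P := _%:C * _; rewrite -[X in normc X <= _](addrK P).
    apply: le_trans (le_normcB _ _) _; rewrite lerD2l /P normcM normcR ger0_norm ?invr_ge0//.
    rewrite mulrAC [C * _ * _]mulrC ler_wpM2l ?invr_ge0//.
    by have := hC k z; rewrite normr1 !mulr1.
  apply: le_trans (ler_wpM2l (normc_ge0 (a z)) h) _.
  have alg4 (p q r t : R) : p * (q * r * t) = q * p * r * t by ring.
  by rewrite mulrDr lerD2l alg4.
- apply: lerD; last first.
    by rewrite ler_wpM2r ?avg_ge0// ler_wpM2r ?invr_ge0// lerDr invr_ge0 ltW.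
  by rewrite ler_wpM2r// ler_wpM2r ?powR_ge0// lerDl.
Qed.

Lemma core_locop (Cu : R) K M : 0 <= Cu -> grow Cu K (stft (@psi0 R d) u) -> ((d + d).*2 + K <= M)%N ->
  exists2 C, 0 <= C & forall k, normc (stft phi u (pt k)) <=
    C * jp (pt k) `^ (- m') * normc (stft phi (locop a u) (pt k)) +
    C * (jp (pt k))^-1 * avg (stft (@psi0 R d) u) M (pt k).
Proof.
move=> Cu0 gu KM; have [L Oi] := uO_incr sa ba c00 lo hyp.
have S0 := psi0_schwartz R d; have n0 := psi0_neq0 R d.
have [B hB] := Oi.2 [::].
have kp : 0 <= ((2 * pi) ^+ d)^-1 :> R by rewrite invr_ge0 exprn_ge0// mulr_ge0// pi_ge0.
set kap := ((2 * pi) ^+ d)^-1 in kp.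
have Sphi : uS (fun _ : unit => 1) (fun=> phi) := (uS_schwartz phi).2 Sp.
(* Of the L + M powers of decay, L absorb the growth of the increment at w - z and M form the kernel
   of the average. *)
have [D [D0 hD]] := uS_stft_decay (L + M) S0 (fun _ => ler01) Sphi.
exists (c0^-1 + kap * (2 * (`|B| * D))) => [|k].
  by rewrite addr_ge0 ?invr_ge0 ?(ltW c00)// !mulr_ge0.
set z := pt k; have St := time_freq_schwartz z Sp.
pose G w := stft (@psi0 R d) u w * conjc (stft (@psi0 R d) (dist_of (time_freq phi z)) w).
have cV : ccont (stft (@psi0 R d) u) := stft_ccont S0 bu.
have [ctf dtf _] := stft_rapid S0 St.
have cG : ccont G by apply: ccontM => //; exact: ccont_conj.
have [Li Oa] := symbol_pg sa ba.
have iG (g : 'rV[R]_(d + d) -> R[i]) (Cg : R) Kg : 0 <= Cg -> ccont g -> grow Cg Kg g ->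
    cintegrable (fun w => g w * G w).
  move=> Cg0 cg gg; have [E hE] := dtf ((d + d).*2 + (Kg + K))%N; have E0 := decay_ge0 hE.
  apply: (@cintegrable_decay _ _ (d + d).*2 _ (Cg * Cu * E)) => //; first exact: ccontM.
  move=> w; rewrite !normcM normc_conj.
  apply: (@le_trans _ _ (jp w ^+ (d + d).*2 * (Cg * jp w ^+ Kg * (Cu * jp w ^+ K *
      normc (stft (@psi0 R d) (dist_of (time_freq phi z)) w))))).
    rewrite ler_wpM2l ?exprn_ge0//; apply: ler_pM; rewrite ?mulr_ge0//.
    by rewrite ler_wpM2r//; exact: gu.
  have alg (p q r s t v : R) : p * (q * r * (s * t * v)) = q * s * (p * (r * t) * v) by ring.
  rewrite alg ler_wpM2l ?mulr_ge0// -!exprD; exact: hE.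
pose g1 w := incr a pt k (w - z).
have cg1 : ccont g1.
  apply: ccont_comp (smooth_ccont [::] (uO_smooth k Oi)).
  apply: continuous_subrV; last exact: cst_continuous.
  by move=> w; exact: cvg_id.
have gg1 w : normc (g1 w) <= `|B| * jp (w - z) ^+ L.
  by apply: le_trans (hB k (w - z)) _; rewrite mulr1 ler_wpM2r ?exprn_ge0// ler_norm.
have i1 : cintegrable (fun w => g1 w * G w).
  apply: (iG g1 (`|B| * (2 * jp z) ^+ L) L) => //; first by rewrite mulr_ge0// exprn_ge0// mulr_ge0.
  move=> w; apply: le_trans (gg1 w) _; rewrite -mulrA ler_wpM2l// -exprMn.
  rewrite lerXn2r ?nnegrE ?mulr_ge0//; apply: le_trans (jpD _ _) _.
  by rewrite jpN -mulrA [jp w * _]mulrC.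
have iG0 : cintegrable G.
  have -> : G = fun w => (fun=> 1) w * G w by apply/funext => w; rewrite mul1r.
  by apply: (iG _ 1 0%N) => //; [exact: ccont_cst|move=> w; rewrite normc1 mulr1].
have E : stft phi (locop a u) z = a z * (stft phi u z +
    ((jp z)^-1)%:C * (kap%:C * cintegral (fun w => g1 w * G w))).
  have E0 : stft phi u z = kap%:C * cintegral G.
    rewrite {1}/stft (pairing_gabor S0 n0 bu St) /gabor_const l2sq_psi0 mulr1 -/kap.
    by congr (_ * cintegral _); apply/funext => w; rewrite mulrC.
  have -> : stft phi (locop a u) z = kap%:C * cintegral (fun w => a w * G w).
    have ff : fconj (fconj (time_freq phi z)) = time_freq phi z by apply/funext => y; exact: conjcK.
    rewrite {1}/stft /pairing /locop -/kap ff; congr (_ * cintegral _); apply/funext => w.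
    by rewrite /G mulrA.
  have -> : (fun w => a w * G w) = fun w => a z * (G w + ((jp z)^-1)%:C * (g1 w * G w)).
    apply/funext => w; rewrite -{1}(subrK z w) [w - z + z]addrC incrE -/z -/(g1 w).
    have alg (p q r s : R[i]) : p * (1 + q * r) * s = p * (s + q * (r * s)) by ring.
    exact: alg.
  rewrite cintegralZ; last by apply: cintegrableD => //; exact: cintegrableZ.
  rewrite cintegralD// ?cintegralZ//; last exact: cintegrableZ.
  have alg (p q r s t : R[i]) : p * (q * (r + s * t)) = q * (p * r + s * (p * t)) by ring.
  by rewrite E0 alg.
have iA := integrable_avg z Cu0 cV gu KM.
have bnd : normc (cintegral (fun w => g1 w * G w)) <= 2 * (`|B| * D) * avg (stft (@psi0 R d) u) M z.
  rewrite -mulrA /avg -RintegralZl//; apply: normc_cintegral_le_Rintegral => //.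
    by have := integrableZl measurableT (`|B| * D) iA; apply: eq_integrable.
  move=> w; rewrite normcM [normc (G w)]normcM normc_conj stft_covariant//.
  have := hD tt (w - z); rewrite mulr1; set V := normc (stft _ (dist_of phi) _) => hV.
  set N := normc (stft _ u w).
  apply: (@le_trans _ _ (`|B| * jp (w - z) ^+ L * (N * V))).
    by apply: (ler_wpM2r _ (gg1 w)); rewrite mulr_ge0 ?normc_ge0.
  have h5 : jp (w - z) ^+ L * V <= D * jp (w - z) ^- M.
    by rewrite ler_pdivlMr ?jpX_gt0// mulrAC -exprD.
  have N0 : 0 <= N := normc_ge0 _.
  have := ler_wpM2l (mulr_ge0 (normr_ge0 B) N0) h5.
  have alg (p q r s : R) : p * q * (r * s) = p * r * (q * s) by ring.
  by rewrite alg [leRHS]alg.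
apply: le_trans (core_finish (C := kap * (2 * (`|B| * D))) _ (normc_ge0 (stft phi (locop a u) z)) _) _.
- by rewrite !mulr_ge0.
- rewrite E normcM.
  have h : normc (stft phi u z) <= normc (stft phi u z +
      ((jp z)^-1)%:C * (kap%:C * cintegral (fun w => g1 w * G w))) +
      kap * (2 * (`|B| * D)) * (jp z)^-1 * avg (stft (@psi0 R d) u) M z.
    set P := _%:C * _; rewrite -[X in normc X <= _](addrK P).
    apply: le_trans (le_normcB _ _) _; rewrite lerD2l /P !normcM !normcR.
    have j0 : 0 <= (jp z)^-1 by rewrite invr_ge0.
    rewrite (ger0_norm j0) (ger0_norm kp).
    have alg (p q r s : R) : q * p * r * s = r * (q * (p * s)) by ring.
    by rewrite [leRHS]alg; apply: ler_wpM2l => //; apply: ler_wpM2l.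
  apply: le_trans (ler_wpM2l (normc_ge0 (a z)) h) _.
  have alg4 (p q r t : R) : p * (q * r * t) = q * p * r * t by ring.
  by rewrite mulrDr lerD2l alg4.
- apply: lerD; last first.
    by rewrite ler_wpM2r ?avg_ge0// ler_wpM2r ?invr_ge0// lerDr invr_ge0 ltW.
  by rewrite ler_wpM2r// ler_wpM2r ?powR_ge0// lerDl !mulr_ge0.
Qed.

End core_estimates.

(** * Averages over cones *)

Section cone_averages.
Context (R : realType) (n : nat).
Local Notation mu := (lebesgue_rV R n).
Implicit Types (z w : 'rV[R]_n) (F : 'rV[R]_n -> R[i]).

(** No measurability is required: the integral of a nonnegative function is a supremum over the
    simple functions below it, hence monotone. *)
Lemma le_integral_any (D : set 'rV[R]_n) (f g : 'rV[R]_n -> \bar R) :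
  (forall x, D x -> 0 <= f x)%E -> (forall x, D x -> f x <= g x)%E ->
  (\int[mu]_(x in D) f x <= \int[mu]_(x in D) g x)%E.
Proof.
move=> f0 fg; have g0 x : D x -> (0 <= g x)%E by move=> Dx; exact: le_trans (f0 x Dx) (fg x Dx).
rewrite !ge0_integralE //=; apply: ge_ereal_sup => _ [h/= hf] <-.
apply: ereal_sup_ubound; exists h => //= x; apply: le_trans (hf x) _.
by rewrite /patch; case: ifPn => // /set_mem; exact: fg.
Qed.

Lemma measurable_jp_sub M : measurable_fun setT
  (fun p : 'rV[R]_n * 'rV[R]_n => (jp (p.2 - p.1) ^- M : R)).
Proof.
have m1 : measurable_fun setT (fun v : 'rV[R]_n => (jp v ^- M : measurableTypeR R)).
  apply: measurable_rV_continuous; apply: continuous_invR => [v|]; first by rewrite gt_eqF ?jpX_gt0.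
  by apply: continuous_expnR; exact: continuous_jp.
apply: (measurableT_comp m1); apply/measurable_fun_rVP => i.
have -> : @rV_coord R n i \o (fun p : 'rV[R]_n * 'rV[R]_n => p.2 - p.1) =
    fun p => (rV_coord i p.2 : R) - (rV_coord i p.1 : R).
  by apply/funext => p; rewrite /rV_coord /= !mxE.
apply: measurable_funB.
  exact: measurableT_comp (@measurable_rV_coord R n i) measurable_snd.
exact: measurableT_comp (@measurable_rV_coord R n i) measurable_fst.
Qed.

Lemma integrable_poly_jp (p : 'rV[R]_n -> R) (C : R) K M z : measurable_fun setT p ->
  (forall w, `|p w| <= C * jp w ^+ K) -> (n.*2 + K <= M)%N ->
  mu.-integrable setT (EFin \o (fun w => p w * jp (w - z) ^- M)).
Proof.
move=> mp pC KM; have C0 : 0 <= C.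
  by have := pC 0; rewrite jp0 expr1n mulr1; exact: le_trans.
apply: (@integrable_decay _ _ n.*2 _ (C * (2 * jp z) ^+ (n.*2 + K))) => //.
  apply: measurable_funM => //; apply: measurable_rV_continuous.
  have := @continuous_avg_kernel R n (fun=> 1) M z (ccont_cst _ _).
  by under [X in continuous X -> _]eq_fun do rewrite normc1 mul1r.
move=> w; rewrite normrM [X in _ * (_ * X)]ger0_norm ?invr_ge0 ?exprn_ge0//.
have gp : grow C K (fun w : 'rV[R]_n => (p w)%:C) by move=> v; rewrite normcR; exact: pC.
by have := avg_weight z w C0 gp KM; rewrite normcR.
Qed.

(* Cauchy-Schwarz, then Tonelli; [J] replaces the squared integral because its measurability
   comes for free. *)
Lemma young_L2 (p : 'rV[R]_n -> R) (C : R) K M : measurable_fun setT p ->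
  (forall w, 0 <= p w <= C * jp w ^+ K) -> (n.*2 + K.*2 <= M)%N ->
  (\int[mu]_w (p w ^+ 2)%:E < +oo)%E ->
  exists J : 'rV[R]_n -> \bar R, [/\ measurable_fun setT J, forall z, (0 <= J z)%E,
    (\int[mu]_z J z < +oo)%E &
    forall z, (((\int[mu]_w (p w * jp (w - z) ^- M)) ^+ 2)%:E <= J z)%E].
Proof.
move=> mp pC KM p2; have p0 w : 0 <= p w by have /andP[] := pC w.
have pC1 w : `|p w| <= C * jp w ^+ K by rewrite ger0_norm//; have /andP[] := pC w.
have pC2 w : `|p w ^+ 2| <= C ^+ 2 * jp w ^+ K.*2.
  rewrite ger0_norm ?sqr_ge0// -muln2 exprM -exprMn lerXn2r ?nnegrE//; first exact: le_trans (pC1 w).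
  by have /andP[] := pC w.
have c1 w : `|1| <= 1 * jp w ^+ 0 :> R by rewrite normr1 expr0 mulr1.
have mp2 : measurable_fun setT (fun w => p w ^+ 2) by exact: measurable_funX.
have KM1 : (n.*2 + K <= M)%N by apply: leq_trans KM; rewrite leq_add2l -addnn leq_addl.
have KM0 : (n.*2 + 0 <= M)%N by apply: leq_trans KM; rewrite leq_add2l.
have i1 z := integrable_poly_jp z mp pC1 KM1.
have i2 z := integrable_poly_jp z mp2 pC2 KM.
have i0 z : mu.-integrable setT (EFin \o (fun w => jp (w - z) ^- M)).
  have := integrable_poly_jp z (measurable_cst (1 : R)) c1 KM0.
  by apply: eq_integrable => // w _ /=; rewrite mul1r.
have q0 v : 0 <= jp v ^- M :> R by move=> *; rewrite invr_ge0 exprn_ge0.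
(* The total mass of the kernel. One is added in [Q1] so that dividing by it calls for no strict
   positivity of Q. *)
pose Q := \int[mu]_w (jp w ^- M); pose Q1 := Q + 1.
have Q0 : 0 <= Q by apply: Rintegral_ge0.
have QE z : \int[mu]_w (jp (w - z) ^- M) = Q.
  rewrite (Rintegral_rV_affine z ltr01 (i0 z)) expr1n mul1r.
  by apply: eq_Rintegral => w _; rewrite scale1r addrK.
have Q10 : 0 < Q1 by rewrite ltr_wpDl.
pose f (v : 'rV[R]_n * 'rV[R]_n) := (p v.2 ^+ 2 * jp (v.2 - v.1) ^- M)%:E.
have mf : measurable_fun setT f.
  apply/measurable_EFinP; apply: measurable_funM; last exact: measurable_jp_sub.
  exact: measurableT_comp mp2 measurable_snd.
have f0 v : (0 <= f v)%E by rewrite lee_fin mulr_ge0 ?sqr_ge0.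
pose J z := (Q1%:E * \int[mu]_w f (z, w))%E.
have mG := measurable_fun_fubini_tonelli_F (m2 := mu) f mf f0.
exists J; split.
- by apply: measurable_funeM; exact: mG.
- by move=> z; rewrite mule_ge0 ?lee_fin ?(ltW Q10)// integral_ge0.
- rewrite ge0_integralZl//; last 2 first.
    by move=> z _; exact: integral_ge0.
    by rewrite lee_fin ltW.
  rewrite -(fubini_tonelli1 (m1 := mu) (m2 := mu) f mf f0) (fubini_tonelli2 (m1 := mu) (m2 := mu) f mf f0).
  rewrite /fubini_G (eq_integral (fun w => ((p w ^+ 2)%:E * Q%:E)%E)); last first.
    move=> w _; rewrite /f /=; under eq_integral do rewrite EFinM.
    rewrite ge0_integralZl//; last 3 first.
    + apply/measurable_EFinP; apply: measurable_rV_continuous.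
      apply: continuous_invR => [v|]; first by rewrite gt_eqF ?jpX_gt0.
      apply: continuous_expnR; apply: (continuous_comp_fun _ (@continuous_jp R n)).
      by apply: continuous_subrV; [exact: cst_continuous|move=> v; exact: cvg_id].
    + by move=> v _; rewrite lee_fin.
    + by rewrite lee_fin sqr_ge0.
    congr (_ * _)%E; under eq_integral do rewrite jpB.
    rewrite -(QE w) /Rintegral fineK//; exact: integrable_fin_num (i0 w).
  have mp2E : measurable_fun setT (fun w => (p w ^+ 2)%:E) by exact/measurable_EFinP.
  have p2E w : setT w -> (0 <= (p w ^+ 2)%:E)%E by rewrite lee_fin sqr_ge0.
  have QE0 : (0 <= Q%:E)%E by rewrite lee_fin.
  rewrite (@ge0_integralZr _ _ _ mu setT measurableT (fun w => (p w ^+ 2)%:E) mp2E Q%:E p2E QE0).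
  rewrite lte_mul_pinfty ?lee_fin ?(ltW Q10)// muleC.
  by rewrite lte_mul_pinfty.
- move=> z; rewrite /J (_ : \int[mu]_w f (z, w) = (\int[mu]_w (p w ^+ 2 * jp (w - z) ^- M))%:E)%E; last first.
    rewrite /Rintegral fineK//; exact: integrable_fin_num (i2 z).
  rewrite -EFinM lee_fin; set P1 := \int[mu]_w _; set P2 := \int[mu]_w _.
  (* Cauchy-Schwarz from the nonnegative quadratic polynomial t -> integral of (p - t)^2 against the
     kernel, evaluated below at t = P1 / Q1. *)
  have key t : 0 <= P2 - 2 * t * P1 + t ^+ 2 * Q1.
    have h : 0 <= \int[mu]_w ((p w - t) ^+ 2 * jp (w - z) ^- M).
      by apply: Rintegral_ge0 => w _; rewrite mulr_ge0 ?sqr_ge0.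
    apply: le_trans h _.
    rewrite (_ : \int[mu]_w _ = P2 - 2 * t * P1 + t ^+ 2 * Q); last first.
      have iz c (g : 'rV[R]_n -> R) : mu.-integrable setT (EFin \o g) ->
          mu.-integrable setT (EFin \o (fun w => c * g w)).
        by move=> ig; have := integrableZl measurableT c ig; apply: eq_integrable.
      have j1 := iz (2 * t) _ (i1 z); have j0 := iz (t ^+ 2) _ (i0 z).
      have j2 : mu.-integrable setT (EFin \o (fun w => p w ^+ 2 * jp (w - z) ^- M - 2 * t * (p w * jp (w - z) ^- M))).
        by have := integrableB measurableT (i2 z) j1; apply: eq_integrable.
      transitivity (\int[mu]_w (p w ^+ 2 * jp (w - z) ^- M - 2 * t * (p w * jp (w - z) ^- M) + t ^+ 2 * jp (w - z) ^- M)).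
        by apply: eq_Rintegral => w _; ring.
      rewrite RintegralD// RintegralB//.
      have -> : \int[mu]_w (2 * t * (p w * jp (w - z) ^- M)) = 2 * t * P1 by rewrite RintegralZl.
      by have -> : \int[mu]_w (t ^+ 2 * jp (w - z) ^- M) = t ^+ 2 * Q by rewrite RintegralZl// QE.
    by rewrite lerD2l ler_wpM2l ?sqr_ge0// lerDl.
  have := key (P1 / Q1).
  have -> : P2 - 2 * (P1 / Q1) * P1 + (P1 / Q1) ^+ 2 * Q1 = (Q1 * P2 - P1 ^+ 2) / Q1.
    by field; rewrite gt_eqF.
  by rewrite pmulr_lge0 ?invr_gt0// subr_ge0.
Qed.

Definition cone z0 (r : R) : set 'rV[R]_n :=
  [set z | exists2 t, 0 < t & forall i, `|t * z 0 i - z0 0 i| < r].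

Lemma cone_mem z0 r : 0 < r -> cone z0 r z0.
Proof. by move=> r0; exists 1 => // i; rewrite mul1r subrr normr0. Qed.

Lemma cone_conic z0 r : conic (cone z0 r).
Proof.
move=> z s [t t0 h] s0; exists (t / s); first exact: divr_gt0.
by move=> i; rewrite mxE mulrA divfK ?gt_eqF.
Qed.

Lemma cone_open z0 r : 0 < r -> open (cone z0 r).
Proof.
move=> r0; have -> : cone z0 r = \bigcup_(t in [set t | 0 < t]) ((fun z => t *: z) @^-1` ball z0 r).
  apply/seteqP; split=> [z [t t0 h]|z [t /= t0]].
    by exists t => //=; apply/(mx_ballP _ _ r0) => i; rewrite distrC mxE.
  by move=> /(mx_ballP _ _ r0) h; exists t => // i; have := h i; rewrite distrC mxE.
apply: bigcup_open => t _; apply: open_comp; last exact: ball_open.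
by move=> z _; exact: continuous_scaleR.
Qed.

Lemma cone_sub z0 r r' : r <= r' -> cone z0 r `<=` cone z0 r'.
Proof. by move=> rr z [t t0 h]; exists t => // i; exact: lt_le_trans (h i) rr. Qed.

Lemma cone_in (G : set 'rV[R]_n) z0 : open_cone G -> G z0 ->
  exists2 r, 0 < r & cone z0 r `<=` G.
Proof.
move=> [oG cG _] Gz0; have := open_nbhs_nbhs (conj oG Gz0).
move=> /nbhs_ballP[r /= r0 h]; exists r => // z [t t0 hz].
have : G (t *: z) by apply: h; apply/(mx_ballP _ _ r0) => i; rewrite distrC mxE.
move=> /(cG _ t^-1) /(_ _); rewrite scalerA mulVf ?gt_eqF// scale1r; apply.
by rewrite invr_gt0.
Qed.

(** Rescale so that t z lies within r/2 of z0. As t w misses the ball of radius r, some coordinate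
    of t (w - z) is at least r/2, while the coordinates of t z are bounded by S; dividing by t
    compares z with w - z. *)
Lemma cone_separated z0 r : 0 < r -> exists2 B, 1 <= B &
  forall z w, cone z0 (r / 2) z -> ~ cone z0 r w -> jp z <= B * jp (w - z).
Proof.
move=> r0; pose S := \sum_i `|z0 0 i| + r; have S0 : 0 <= S by rewrite addr_ge0 ?sumr_ge0// ltW.
exists (1 + n%:R * (2 * S / r)) => [|z w [t t0 hz] nw].
  by rewrite lerDl mulr_ge0// divr_ge0 ?mulr_ge0// ltW.
have [i hi] : exists i, r <= `|t * w 0 i - z0 0 i|.
  apply: contrapT => ne; apply: nw; exists t => // i.
  by rewrite ltNge; apply/negP => ?; apply: ne; exists i.
have h1 : r / 2 <= t * jp (w - z).
  have : `|t * w 0 i - z0 0 i| <= `|t * (w - z) 0 i| + `|t * z 0 i - z0 0 i|.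
    apply: le_trans (ler_normD _ _); rewrite !mxE le_eqVlt; apply/orP; left; apply/eqP; congr `|_|; ring.
  have := hz i; have : `|t * (w - z) 0 i| <= t * jp (w - z).
    by rewrite normrM gtr0_norm// ler_wpM2l ?jp_coord// ltW.
  move: hi; lra.
have hk k : `|z 0 k| <= 2 * S / r * jp (w - z).
  have b1 : t * `|z 0 k| <= S.
    rewrite -[X in X * _](gtr0_norm t0) -normrM -(subrK (z0 0 k) (t * z 0 k)).
    apply: le_trans (ler_normD _ _) _; rewrite addrC; apply: lerD.
      by rewrite (bigD1 k)//= lerDl sumr_ge0.
    by apply: ltW; apply: lt_le_trans (hz k) _; rewrite ler_pdivrMr// ler_peMr// ?(ltW r0) ?ler1n.
  rewrite -(ler_pM2l t0); apply: le_trans b1 _.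
  rewrite mulrCA -[leLHS]mulr1.
  have -> : 2 * S / r * (t * jp (w - z)) = S * (2 / r * (t * jp (w - z))) by field; rewrite gt_eqF.
  rewrite ler_wpM2l// mulrAC ler_pdivlMr// mul1r.
  by move: h1; rewrite ler_pdivrMr// mulrC.
apply: le_trans (jp_le_sum _) _; rewrite mulrDl mul1r; apply: lerD => //.
rewrite -[leRHS]mulrA [leRHS]mulr_natl -[X in _ *+ X]card_ord -sumr_const.
by apply: ler_sum => k _.
Qed.

End cone_averages.

(** * Averages of functions square integrable on a cone *)

Section bootstrap.
Context (R : realType) (n : nat).
Local Notation mu := (lebesgue_rV R n).
Implicit Types (z w : 'rV[R]_n) (F : 'rV[R]_n -> R[i]).

Definition wint2 (D : set 'rV[R]_n) (s : R) F :=
  (\int[mu]_(z in D) (jp z `^ (2 * s) * normc (F z) ^+ 2)%:E)%E.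

Lemma jp_powR2 z s : jp z `^ (2 * s) = (jp z `^ s) ^+ 2.
Proof. by rewrite -powR_mulrn ?powR_ge0// -powRrM mulrC. Qed.

Lemma measurable_weighted s F : ccont F -> measurable_fun setT (fun z => jp z `^ s * normc (F z) : R).
Proof.
move=> cF; apply: measurable_funM.
  apply: (measurableT_comp (f := fun t : R => t `^ s)); first exact: measurable_powR.
  by apply: measurable_rV_continuous; exact: continuous_jp.
by apply: measurable_rV_continuous; exact: continuous_normc.
Qed.

Lemma integral_jp_lty : (\int[mu]_z (jp z ^- n.*2)%:E < +oo)%E.
Proof.
have /integrableP[_] := integrable_jp R n; apply: le_lt_trans.
apply: le_integral_any => z _; first by rewrite lee_fin invr_ge0 exprn_ge0.
by rewrite /= lee_fin ler_norm.
Qed.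

(** For w in the larger cone the weight moves from z to w by Peetre's inequality and [young_L2]
    applies. For w outside it <z> is at most a multiple of <w - z>, so the kernel absorbs the weight
    and the polynomial growth of F. The majorant J serves because it is measurable by
    construction. *)
Lemma cone_average F (C : R) K k M z0 r tau : 0 <= C -> ccont F -> grow C K F -> `|tau| <= k%:R ->
  0 < r -> (n.*2 + (k + K).*2 + k + (K + n).*2 <= M)%N -> (wint2 (cone z0 r) tau F < +oo)%E ->
  exists J : 'rV[R]_n -> \bar R, [/\ measurable_fun setT J, forall z, (0 <= J z)%E,
    (\int[mu]_z J z < +oo)%E &
    forall z, cone z0 (r / 2) z -> (((jp z `^ tau * avg F M z) ^+ 2)%:E <= J z)%E].
Proof.
move=> C0 cF gF tk r0 KM iF.
pose W w := jp w `^ tau * normc (F w).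
(* One square integrable function for both regions: the second summand is the weighted F on the
   cone, the first is what is left of F outside once its growth has been paid for. *)
pose p w : R := jp w ^- n + \1_(cone z0 r) w * W w.
have mC : measurable (cone z0 r) by apply: measurable_rV_open; exact: cone_open.
have W0 w : 0 <= W w by rewrite mulr_ge0 ?powR_ge0.
have mW : measurable_fun setT W by exact: measurable_weighted.
have mjp : measurable_fun setT (fun w : 'rV[R]_n => jp w ^- n : R).
  apply: measurable_rV_continuous; apply: continuous_invR => [v|]; first by rewrite gt_eqF ?jpX_gt0.
  by apply: continuous_expnR; exact: continuous_jp.
have mIW : measurable_fun setT (fun w => \1_(cone z0 r) w * W w : R).
  by apply: measurable_funM => //; exact: measurable_indic.
have mp : measurable_fun setT p by exact: measurable_funD.
have jn0 w : 0 <= jp w ^- n :> R by rewrite invr_ge0 exprn_ge0.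
have IW0 w : 0 <= \1_(cone z0 r) w * W w by rewrite mulr_ge0.
have p0 w : 0 <= p w by rewrite addr_ge0.
have powk w : jp w `^ tau <= jp w ^+ k.
  by rewrite -powR_mulrn//; apply: jp_powR_le; apply: le_trans tk; exact: ler_norm.
have pC w : 0 <= p w <= (1 + C) * jp w ^+ (k + K).
  rewrite p0 mulrDl mul1r; apply: lerD.
    apply: (@le_trans _ _ 1); last exact: jpX_ge1.
    by rewrite invf_le1 ?jpX_gt0// jpX_ge1.
  apply: (@le_trans _ _ (W w)).
    by rewrite indicE; case: (w \in _); rewrite ?mul1r ?mul0r.
  rewrite exprD mulrCA; apply: ler_pM; rewrite ?powR_ge0//; exact: gF.
have p2 : (\int[mu]_w (p w ^+ 2)%:E < +oo)%E.
  apply: (@le_lt_trans _ _ (\int[mu]_w ((2 * jp w ^- n.*2)%:E + (2 * (\1_(cone z0 r) w * W w ^+ 2))%:E))%E).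
    apply: le_integral_any => w _; first by rewrite lee_fin sqr_ge0.
    rewrite -EFinD lee_fin /p.
    have -> : jp w ^- n.*2 = (jp w ^- n) ^+ 2 by rewrite exprVn -exprM muln2.
    have -> : \1_(cone z0 r) w * W w ^+ 2 = (\1_(cone z0 r) w * W w) ^+ 2.
      by rewrite indicE; case: (w \in _); rewrite /= ?mul1r ?mul0r ?expr0n.
    move: (jp w ^- n) (\1_(cone z0 r) w * W w) => x y; rewrite -subr_ge0.
    have -> : 2 * x ^+ 2 + 2 * y ^+ 2 - (x + y) ^+ 2 = (x - y) ^+ 2 by ring.
    exact: sqr_ge0.
  have m1 : measurable_fun setT (fun w : 'rV[R]_n => (2 * jp w ^- n.*2)%:E).
    apply/measurable_EFinP; apply: measurable_funM => //; apply: measurable_rV_continuous.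
    apply: continuous_invR => [v|]; first by rewrite gt_eqF ?jpX_gt0.
    by apply: continuous_expnR; exact: continuous_jp.
  have m2 : measurable_fun setT (fun w => \1_(cone z0 r) w * W w ^+ 2 : R).
    by apply: measurable_funM; [exact: measurable_indic|exact: measurable_funX].
  rewrite ge0_integralD//; last 3 first.
  - by move=> w _; rewrite lee_fin mulr_ge0// invr_ge0 exprn_ge0.
  - by move=> w _; rewrite lee_fin; apply: mulr_ge0 => //; apply: mulr_ge0 => //; exact: sqr_ge0.
  - by apply/measurable_EFinP; apply: measurable_funM.
  apply: lte_add_pinfty.
    under eq_integral do rewrite EFinM.
    rewrite ge0_integralZl//; last 2 first.
    - apply/measurable_EFinP; move/measurable_EFinP : m1; move=> h.
      have := measurable_funM (measurable_cst (2^-1 : R)) h.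
      by apply: eq_measurable_fun => w _ /=; rewrite mulrA mulVf ?mul1r.
    - by move=> w _; rewrite lee_fin invr_ge0 exprn_ge0.
    by rewrite lte_mul_pinfty// integral_jp_lty.
  under eq_integral do rewrite EFinM.
  rewrite ge0_integralZl//; last 2 first.
  - exact/measurable_EFinP.
  - by move=> w _; rewrite lee_fin mulr_ge0// sqr_ge0.
  rewrite lte_mul_pinfty//; apply: le_lt_trans iF.
  rewrite /wint2 [leRHS]integral_mkcond; apply: le_integral_any => w _; first by rewrite lee_fin mulr_ge0 ?sqr_ge0.
  rewrite /patch indicE; case: (w \in _); last by rewrite mul0r.
  by rewrite mul1r /W exprMn -jp_powR2.
(* The exponent that [young_L2] needs for p, which has growth k + K. The remaining part of M covers
   the weight, with exponent k, and the growth outside the cone, with exponent 2 (K + n). *)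
pose M0 := (n.*2 + (k + K).*2)%N.
have n1 : (k + M0 <= n.*2 + (k + K).*2 + k + (K + n).*2)%N by rewrite /M0; clear; lia.
have n2 : (k + (K + n).*2 + M0 <= n.*2 + (k + K).*2 + k + (K + n).*2)%N by rewrite /M0; clear; lia.
have KM1 : (n.*2 + K <= M)%N by apply: leq_trans KM; clear; lia.
have KM2 : (n.*2 + (k + K) <= M0)%N by rewrite /M0; clear; lia.
have [J [mJ J0 iJ hJ]] := young_L2 mp pC (leqnn M0) p2.
have [B B1 hB] := cone_separated z0 r0; have B0 : 0 <= B := le_trans ler01 B1.
pose E := C * B ^+ k * (2 * B) ^+ (K + n); pose D := 2 ^+ k + E.
have E0 : 0 <= E by rewrite !mulr_ge0 ?exprn_ge0 ?mulr_ge0.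
have D0 : 0 <= D by rewrite addr_ge0.
have pw z w : cone z0 (r / 2) z -> jp z `^ tau * (normc (F w) * jp (w - z) ^- M) <= D * (p w * jp (w - z) ^- M0).
  move=> zc; set q := jp (w - z); have q1 : 1 <= q := jp_ge1 _; have q0 : 0 < q := jp_gt0 _.
  rewrite [leRHS]mulrA ler_pdivlMr ?exprn_gt0// mulrA mulrAC ler_pdivrMr ?exprn_gt0//.
  have [wc|wc] := pselect (cone z0 r w).
    have b1 : jp z `^ tau <= (2 * q) ^+ k * jp w `^ tau.
      by have := jp_powR w (z - w) tk; rewrite addrC subrK jpB.
    have b2 : W w <= p w by rewrite /p indicE mem_set// mul1r lerDr.
    apply: (@le_trans _ _ ((2 * q) ^+ k * W w * q ^+ M0)).
      rewrite ler_wpM2r ?exprn_ge0 ?(ltW q0)// /W mulrA ler_wpM2r//.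
    have -> : (2 * q) ^+ k * W w * q ^+ M0 = 2 ^+ k * W w * q ^+ (k + M0) by rewrite exprMn exprD; ring.
    have w1 : 0 <= 2 ^+ k * W w by apply: mulr_ge0 => //; exact: exprn_ge0.
    apply: (ler_pM w1); first by rewrite exprn_ge0// ltW.
      by apply: ler_pM => //; rewrite /D lerDl.
    by rewrite ler_weXn2l//; exact: leq_trans n1 KM.
  have zB : jp z <= B * q := hB z w zc wc.
  have b1 : jp z `^ tau <= B ^+ k * q ^+ k.
    by apply: le_trans (powk z) _; rewrite -exprMn lerXn2r ?nnegrE ?mulr_ge0 ?(ltW q0).
  (* Outside the cone <w> <= 2 <w - z> <z> <= 2 B <w - z>^2, which is why the exponent doubles; the
     n powers beyond K are converted into the summand <w>^-n of p. *)
  have b2 : jp w ^+ (K + n) <= (2 * B) ^+ (K + n) * q ^+ (K + n).*2.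
    rewrite -muln2 mulnC exprM -exprMn lerXn2r ?nnegrE ?mulr_ge0 ?exprn_ge0 ?(ltW q0)//.
    apply: le_trans (jpDl w z) _; rewrite -/q -mulrA ler_wpM2l//.
    by rewrite expr2 mulrA mulrC ler_wpM2r ?(ltW q0).
  have b3 : C * jp w ^+ K <= C * ((2 * B) ^+ (K + n) * q ^+ (K + n).*2) * jp w ^- n.
    by rewrite ler_pdivlMr ?jpX_gt0// -mulrA ler_wpM2l// -exprD.
  have b4 : jp w ^- n <= p w by rewrite /p lerDl.
  apply: (@le_trans _ _ (B ^+ k * q ^+ k * (C * ((2 * B) ^+ (K + n) * q ^+ (K + n).*2) * jp w ^- n) * q ^+ M0)).
    rewrite ler_wpM2r ?exprn_ge0 ?(ltW q0)//; apply: ler_pM; rewrite ?powR_ge0//.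
    exact: le_trans (gF w) b3.
  have -> : B ^+ k * q ^+ k * (C * ((2 * B) ^+ (K + n) * q ^+ (K + n).*2) * jp w ^- n) * q ^+ M0 =
      E * jp w ^- n * q ^+ (k + (K + n).*2 + M0) by rewrite /E !exprD; ring.
  have w1 : 0 <= E * jp w ^- n := mulr_ge0 E0 (jn0 w).
  apply: (ler_pM w1); first by rewrite exprn_ge0// ltW.
    by apply: ler_pM => //; rewrite /D lerDr exprn_ge0.
  by rewrite ler_weXn2l//; exact: leq_trans n2 KM.
exists (fun z => ((D ^+ 2)%:E * J z)%E); split.
- exact: measurable_funeM.
- by move=> z; rewrite mule_ge0// lee_fin sqr_ge0.
- by rewrite ge0_integralZl ?lee_fin ?sqr_ge0// lte_mul_pinfty ?lee_fin ?sqr_ge0.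
- move=> z zc; apply: (@le_trans _ _ ((D ^+ 2)%:E * ((\int[mu]_w (p w * jp (w - z) ^- M0)) ^+ 2)%:E)%E); last first.
    by rewrite lee_wpmul2l ?lee_fin ?sqr_ge0.
  rewrite -EFinM lee_fin -exprMn.
  have pabs w : `|p w| <= (1 + C) * jp w ^+ (k + K) by rewrite ger0_norm//; have /andP[] := pC w.
  have ia := integrable_avg z C0 cF gF KM1.
  have ip := integrable_poly_jp z mp pabs KM2.
  have I0 : 0 <= \int[mu]_w (p w * jp (w - z) ^- M0).
    by apply: Rintegral_ge0 => w _; rewrite mulr_ge0// invr_ge0 exprn_ge0.
  rewrite lerXn2r ?nnegrE ?mulr_ge0 ?powR_ge0 ?avg_ge0//.
  rewrite /avg -!RintegralZl//; apply: le_Rintegral => //.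
  - by have := integrableZl measurableT (jp z `^ tau) ia; apply: eq_integrable.
  - by have := integrableZl measurableT D ip; apply: eq_integrable.
  - by move=> w _; exact: pw.
Qed.

End bootstrap.

(** * Wave front sets *)

Section iteration.
Context (R : realType) (n : nat).
Local Notation mu := (lebesgue_rV R n).
Implicit Types (z w : 'rV[R]_n) (F H Y : 'rV[R]_n -> R[i]).

Lemma integral_sub_lty (D D' : set 'rV[R]_n) (f g : 'rV[R]_n -> \bar R) : D `<=` D' ->
  (forall z, D z -> 0 <= f z)%E -> (forall z, D z -> f z <= g z)%E -> (forall z, D' z -> 0 <= g z)%E ->
  (\int[mu]_(z in D') g z < +oo)%E -> (\int[mu]_(z in D) f z < +oo)%E.
Proof.
move=> DD f0 fg g0; apply: le_lt_trans.
rewrite [leLHS]integral_mkcond [leRHS]integral_mkcond; apply: le_integral_any => z _.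
  by rewrite /patch; case: ifPn => // /set_mem; exact: f0.
rewrite /patch; case: ifPn => [/set_mem zD|_].
  by rewrite mem_set; [exact: fg|exact: DD].
by case: ifPn => // /set_mem; exact: g0.
Qed.

(* [g] is not assumed measurable, so its integral is only a supremum over the simple functions
   below it and is not additive; we only use it as an upper bound for [f - h]. *)
Lemma integral_lty_split (D : set 'rV[R]_n) (c : R) (f g h : 'rV[R]_n -> \bar R) :
  measurable D -> 0 < c -> measurable_fun setT f -> measurable_fun setT h ->
  (forall z, 0 <= f z)%E -> (forall z, f z \is a fin_num) -> (forall z, 0 <= h z)%E -> (forall z, 0 <= g z)%E ->
  (forall z, D z -> f z <= c%:E * g z + h z)%E ->
  (\int[mu]_(z in D) g z < +oo)%E -> (\int[mu]_(z in D) h z < +oo)%E ->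
  (\int[mu]_(z in D) f z < +oo)%E.
Proof.
move=> mD c0 mf mh f0 ff h0 g0 fgh ig ih.
pose f' := ((f \- h)^\+)%E.
have f'0 z : (0 <= f' z)%E by exact: funepos_ge0.
have mf' : measurable_fun D f'.
  apply: (measurable_funS measurableT) => //.
  by apply: measurable_funepos; exact: emeasurable_funB.
have f'g z : D z -> (f' z <= c%:E * g z)%E.
  move=> Dz; have cg : (0 <= c%:E * g z)%E by rewrite mule_ge0// lee_fin ltW.
  rewrite /f' funeposE ge_max cg andbT; have := fgh z Dz; have := ff z; have := h0 z.
  case: (h z) => [r _ fz|_|//]; last by case: (f z) => //= q _ _; exact: leNye.
  by rewrite leeBlDr.
have if' : (\int[mu]_(z in D) ((c^-1)%:E * f' z) < +oo)%E.
  apply: le_lt_trans ig; apply: le_integral_any => z Dz.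
    by rewrite mule_ge0// lee_fin invr_ge0 ltW.
  apply: le_trans (lee_wpmul2l _ (f'g z Dz)) _; first by rewrite lee_fin invr_ge0 ltW.
  by rewrite muleA -EFinM mulVf ?gt_eqF// mul1e.
have if2 : (\int[mu]_(z in D) f' z < +oo)%E.
  have -> : (\int[mu]_(z in D) f' z = c%:E * \int[mu]_(z in D) ((c^-1)%:E * f' z))%E.
    rewrite ge0_integralZl//; last by rewrite lee_fin invr_ge0 ltW.
    by rewrite muleA -EFinM divff ?gt_eqF// mul1e.
  rewrite lte_mul_pinfty ?lee_fin ?(ltW c0)//.
apply: (@le_lt_trans _ _ (\int[mu]_(z in D) (f' z + h z))%E).
  apply: le_integral_any => z _ //; have := f0 z; have := ff z; have := h0 z.
  rewrite /f' funeposE; case: (h z) => [r r0 fz f0z|_ _ _|//].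
    by rewrite -leeBlDr// le_max lexx.
  by rewrite addey ?leey// gt_eqF// (lt_le_trans (ltNyr 0))// le_max lexx orbT.
rewrite ge0_integralD//; first exact: lte_add_pinfty.
exact: measurable_funS mh.
Qed.

Lemma jp_le_enorm z (A : R) : 0 <= A -> enorm z < A -> jp z <= 1 + A.
Proof.
move=> A0 zA; have A1 : 0 <= 1 + A by rewrite addr_ge0.
rewrite -(@ler_pXn2r _ 2) ?nnegrE// /japanese sqr_sqrtr ?addr_ge0 ?sqr_ge0//.
have e0 : 0 <= enorm z by exact: sqrtr_ge0.
have : enorm z ^+ 2 <= A ^+ 2 by rewrite lerXn2r ?nnegrE// ltW.
rewrite sqrrD expr1n; lra.
Qed.

Lemma measurable_sqr_weighted s F : ccont F ->
  measurable_fun setT (fun z => (jp z `^ (2 * s) * normc (F z) ^+ 2)%:E).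
Proof.
move=> cF; apply/measurable_EFinP; have := measurable_funX 2 (measurable_weighted s cF).
by apply: eq_measurable_fun => z _; rewrite exprMn -jp_powR2.
Qed.

(** F is the transform of u in the given window, H its transform in the window of the quantization,
    Y the transform of the image of u. One step passes from F to H and from H back to F, and the
    factor 1/<z> in front of the average of H raises the exponent by 1. *)
Lemma cone_bootstrap F H Y (G G' : set 'rV[R]_n) z0 (A s m' C : R) K M1 :
  ccont F -> ccont H -> 0 <= C -> grow C K F -> grow C K H ->
  open_cone G -> G z0 -> open_cone G' -> G' z0 -> 0 <= A ->
  (forall M, (M1 <= M)%N -> exists2 D, 0 <= D &
     (forall w, normc (H w) <= D * avg F M w) /\
     (forall z, G z -> A <= enorm z ->
        normc (F z) <= D * jp z `^ (- m') * normc (Y z) + D * (jp z)^-1 * avg H M z)) ->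
  (wint2 G' (s - m') Y < +oo)%E ->
  exists G'', [/\ open_cone G'', G'' z0 & (wint2 G'' s F < +oo)%E].
Proof.
move=> cF cH C0 gF gH oG Gz0 oG' Gz0' A0 core iY.
have [r1 r10 s1] := cone_in oG Gz0; have [r2 r20 s2] := cone_in oG' Gz0'.
(* The starting exponent -k must lie below s and leave <z>^-k |F| bounded by a multiple of <z>^-n;
   hence the summands K and n. *)
have [k1 hk1] := nat_ge `|s|; pose k := (k1 + K + n)%N.
have sk : `|s| <= k%:R by apply: le_trans hk1 _; rewrite ler_nat /k -addnA leq_addr.
pose M := (M1 + (n.*2 + (k + K).*2 + k + (K + n).*2))%N.
have [D D0 [hH hF]] := core M (leq_addr _ _).
have MM : (n.*2 + (k + K).*2 + k + (K + n).*2 <= M)%N by rewrite leq_addl.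
(* The exponents rise by 1 from -k and stop at s, which is reached at the latest after 2k steps. *)
pose tau j : R := Num.min (- k%:R + j%:R) s.
have hs : - k%:R <= s /\ s <= k%:R by move: sk; rewrite ler_norml => /andP[].
have tk j : `|tau j| <= k%:R.
  rewrite ler_norml /tau le_min ge_min; case: hs => -> -> /=; rewrite orbT andbT lerDl.
  by rewrite ler0n.
suff P j : exists r, [/\ 0 < r, r <= r1, r <= r2 & (wint2 (cone z0 r) (tau j) F < +oo)%E].
  have [j hj] : exists j, tau j = s.
    exists k.*2; rewrite /tau min_r// -addnn natrD addKr; by case: hs.
  have [r [r0 rr1 rr2 ir]] := P j; rewrite hj in ir.
  exists (cone z0 r); split=> //; last exact: cone_mem.
  split; [exact: cone_open|exact: cone_conic|move=> z zr].
  by have [_ _] := oG; apply; apply: s1; exact: cone_sub zr.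
elim: j => [|j [r [r0 rr1 rr2 ir]]].
  exists (Num.min r1 r2); split; rewrite ?lt_min ?r10 ?r20 ?ge_min ?lexx ?orbT//.
  have -> : tau 0%N = - k%:R by rewrite /tau addr0 min_l//; case: hs.
  have : (\int[mu]_z ((C ^+ 2)%:E * (jp z ^- n.*2)%:E) < +oo)%E.
    rewrite ge0_integralZl ?lee_fin ?sqr_ge0//.
    - by rewrite lte_mul_pinfty ?lee_fin ?sqr_ge0// integral_jp_lty.
    - apply/measurable_EFinP; apply: measurable_rV_continuous.
      apply: continuous_invR => [v|]; first by rewrite gt_eqF ?jpX_gt0.
      by apply: continuous_expnR; exact: continuous_jp.
    - by move=> z _; rewrite lee_fin invr_ge0 exprn_ge0.
  apply: integral_sub_lty => // z _; first by rewrite lee_fin mulr_ge0 ?powR_ge0 ?sqr_ge0.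
    rewrite -EFinM lee_fin jp_powR2 -exprMn powRN powR_mulrn//.
    have -> : C ^+ 2 * jp z ^- n.*2 = (C * jp z ^- n) ^+ 2 by rewrite exprMn exprVn -exprM muln2.
    rewrite lerXn2r ?nnegrE ?mulr_ge0 ?invr_ge0 ?exprn_ge0//.
    rewrite mulrC ler_pdivrMr ?jpX_gt0//; apply: le_trans (gF z) _.
    rewrite -mulrA ler_wpM2l// mulrC ler_pdivlMr ?jpX_gt0// -exprD jp_leX//.
    by rewrite /k -addnA leq_addl.
  by rewrite mule_ge0 ?lee_fin ?sqr_ge0 ?invr_ge0 ?exprn_ge0.
have tt1 : tau j.+1 <= tau j + 1.
  rewrite /tau -natr1 addrA; case: (leP (- k%:R + j%:R) s) => h; first by rewrite ge_min lexx.
  by rewrite ge_min lerDl ler01 orbT.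
have tts : tau j.+1 <= s by rewrite /tau ge_min lexx orbT.
have [J1 [mJ1 J10 iJ1 hJ1]] := cone_average C0 cF gF (tk j) r0 MM ir.
have r20' : 0 < r / 2 by rewrite divr_gt0.
have iH : (wint2 (cone z0 (r / 2)) (tau j) H < +oo)%E.
  have : (\int[mu]_z ((D ^+ 2)%:E * J1 z) < +oo)%E.
    by rewrite ge0_integralZl ?lee_fin ?sqr_ge0// lte_mul_pinfty ?lee_fin ?sqr_ge0.
  apply: integral_sub_lty => // z zc; first by rewrite lee_fin mulr_ge0 ?powR_ge0 ?sqr_ge0.
    apply: le_trans (lee_wpmul2l _ (hJ1 z zc)); last by rewrite lee_fin sqr_ge0.
    rewrite -EFinM lee_fin jp_powR2 -!exprMn lerXn2r ?nnegrE ?mulr_ge0 ?powR_ge0 ?avg_ge0//.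
    by rewrite mulrCA ler_wpM2l ?powR_ge0.
  by rewrite mule_ge0 ?lee_fin ?sqr_ge0.
have [J2 [mJ2 J20 iJ2 hJ2]] := cone_average C0 cH gH (tk j) r20' MM iH.
(* Each of the two averages, of F and of H, halves the opening of the cone. *)
pose r4 := r / 2 / 2; have r40 : 0 < r4 by rewrite divr_gt0.
have r4r : r4 <= r by rewrite /r4; move: r0; lra.
exists r4; split; [exact: r40|exact: le_trans r4r rr1|exact: le_trans r4r rr2|].
pose E := C ^+ 2 * (1 + A) ^+ (k + K + n).*2.
have A1 : 0 <= 1 + A by rewrite addr_ge0.
have E0 : 0 <= E by rewrite mulr_ge0 ?sqr_ge0 ?exprn_ge0.
pose h z := ((2 * D ^+ 2)%:E * J2 z + E%:E * (jp z ^- n.*2)%:E)%E.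
have mjp : measurable_fun setT (fun z : 'rV[R]_n => (jp z ^- n.*2)%:E).
  apply/measurable_EFinP; apply: measurable_rV_continuous.
  apply: continuous_invR => [v|]; first by rewrite gt_eqF ?jpX_gt0.
  by apply: continuous_expnR; exact: continuous_jp.
have D20 : (0 <= (2 * D ^+ 2)%:E)%E by rewrite lee_fin mulr_ge0 ?sqr_ge0.
have jn0 z : (0 <= (jp z ^- n.*2)%:E)%E by rewrite lee_fin invr_ge0 exprn_ge0.
have h0 z : (0 <= h z)%E by rewrite adde_ge0// mule_ge0.
have mh : measurable_fun setT h by apply: emeasurable_funD; exact: measurable_funeM.
have ih : (\int[mu]_z h z < +oo)%E.
  rewrite ge0_integralD//; last 4 first.
  - by move=> z _; rewrite mule_ge0.
  - exact: measurable_funeM.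
  - by move=> z _; rewrite mule_ge0.
  - exact: measurable_funeM.
  by apply: lte_add_pinfty; rewrite ge0_integralZl// lte_mul_pinfty// integral_jp_lty.
pose c : R := 2 * D ^+ 2 + 1.
have c0 : 0 < c by rewrite ltr_wpDl// mulr_ge0 ?sqr_ge0.
have g0 z : (0 <= (jp z `^ (2 * (s - m')) * normc (Y z) ^+ 2)%:E)%E.
  by rewrite lee_fin mulr_ge0 ?powR_ge0 ?sqr_ge0.
apply: (integral_lty_split (c := c) (h := h) (g := fun z => (jp z `^ (2 * (s - m')) * normc (Y z) ^+ 2)%:E)) => //.
- by apply: measurable_rV_open; exact: cone_open.
- exact: measurable_sqr_weighted.
- by move=> z; rewrite lee_fin mulr_ge0 ?powR_ge0 ?sqr_ge0.
- move=> z zc.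
  have zr : cone z0 r z by exact: cone_sub zc.
  have Gz : G z by apply: s1; exact: cone_sub zr.
  have [zA|zA] := leP A (enorm z); last first.
    apply: (@le_trans _ _ (h z)); last by rewrite leeDr// mule_ge0// lee_fin ltW.
    apply: (@le_trans _ _ (E%:E * (jp z ^- n.*2)%:E)%E); last by rewrite leeDr// mule_ge0.
    rewrite -EFinM lee_fin jp_powR2 -exprMn.
    have jA := jp_le_enorm A0 zA.
    have b1 : jp z `^ tau j.+1 * normc (F z) <= C * (1 + A) ^+ (k + K + n) * jp z ^- n.
      rewrite ler_pdivlMr ?jpX_gt0//.
      apply: (@le_trans _ _ (jp z ^+ k * (C * jp z ^+ K) * jp z ^+ n)).
        rewrite ler_wpM2r ?exprn_ge0//; apply: ler_pM; rewrite ?powR_ge0//.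
        rewrite -powR_mulrn//; apply: jp_powR_le; apply: le_trans (tk j.+1); exact: ler_norm.
      have -> : jp z ^+ k * (C * jp z ^+ K) * jp z ^+ n = C * jp z ^+ (k + K + n) by rewrite !exprD; ring.
      by rewrite ler_wpM2l// lerXn2r ?nnegrE.
    have -> : E * jp z ^- n.*2 = (C * (1 + A) ^+ (k + K + n) * jp z ^- n) ^+ 2.
      by rewrite /E !exprMn exprVn -!exprM !muln2.
    by rewrite lerXn2r ?nnegrE ?mulr_ge0 ?powR_ge0 ?invr_ge0 ?exprn_ge0.
  pose y := jp z `^ (s - m') * normc (Y z); pose b := jp z `^ tau j * avg H M z.
  have y0 : 0 <= y by rewrite mulr_ge0 ?powR_ge0.
  have b0 : 0 <= b by rewrite mulr_ge0 ?powR_ge0 ?avg_ge0.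
  have jne : (jp z == 0) = false by rewrite gt_eqF.
  have key : jp z `^ tau j.+1 * normc (F z) <= D * y + D * b.
    apply: le_trans (ler_wpM2l (powR_ge0 _ _) (hF z Gz zA)) _.
    rewrite mulrDr; apply: lerD.
      rewrite -mulrA mulrCA ler_wpM2l// mulrA ler_wpM2r//.
      by rewrite -powRD ?jne ?implybT//; apply: jp_powR_le; rewrite lerD2r.
    rewrite -mulrA mulrCA ler_wpM2l// mulrA ler_wpM2r ?avg_ge0//.
    rewrite ler_pdivrMr// -{3}[jp z]powRr1// -powRD ?jne ?implybT//.
    exact: jp_powR_le.
  apply: (@le_trans _ _ ((2 * D ^+ 2)%:E * (y ^+ 2)%:E + (2 * D ^+ 2)%:E * J2 z)%E).
    apply: (@le_trans _ _ ((2 * D ^+ 2)%:E * (y ^+ 2)%:E + (2 * D ^+ 2)%:E * (b ^+ 2)%:E)%E).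
      rewrite -!EFinM -EFinD lee_fin jp_powR2 -exprMn.
      apply: (@le_trans _ _ ((D * y + D * b) ^+ 2)).
        have F0 : 0 <= jp z `^ tau j.+1 * normc (F z) := mulr_ge0 (powR_ge0 _ _) (normc_ge0 _).
        have yb0 : 0 <= D * y + D * b := addr_ge0 (mulr_ge0 D0 y0) (mulr_ge0 D0 b0).
        by rewrite lerXn2r ?nnegrE.
      rewrite -subr_ge0.
      have -> : 2 * D ^+ 2 * y ^+ 2 + 2 * D ^+ 2 * b ^+ 2 - (D * y + D * b) ^+ 2 = (D * (y - b)) ^+ 2 by ring.
      exact: sqr_ge0.
    by rewrite leeD2l// lee_wpmul2l//; exact: hJ2.
  apply: leeD; last by rewrite leeDl// mule_ge0.
  rewrite -!EFinM lee_fin jp_powR2 -exprMn -/y ler_wpM2r ?sqr_ge0//.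
  by rewrite /c lerDl.
- by apply: (integral_sub_lty _ _ _ _ iY) => // z zc; apply: s2; apply: cone_sub zc; exact: le_trans r4r rr2.
- by apply: (integral_sub_lty _ _ _ _ ih).
Qed.

End iteration.

(** * The two inclusions *)

Section inclusions.
Context (R : realType) (d : nat).
Variables (phi : 'rV[R]_d -> R[i]) (u : functional R d) (a : 'rV[R]_(d + d) -> R[i]) (m : R).
Hypotheses (Sp : schwartz phi) (p0 : exists x, phi x != 0) (tu : tempered u) (sa : shubin m a).

Let bu : bounded_functional u := tempered_bounded tu.

Let ba l : exists2 C, 0 <= C & forall z,
  normc (partials l a z) <= C * jp z `^ (m - (size l)%:R).
Proof.
have [s h] := sa; have [C [C0 hC]] := h (fun i => count_mem i l).
by exists C; [exact: ltW|move=> z; rewrite (partials_mpartial l s) (size_mlen l); exact: hC].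
Qed.

Let stft_grow psi : schwartz psi ->
  exists C K, [/\ 0 <= C, grow C K (stft phi u) & grow C K (stft psi u)].
Proof.
move=> Sq; have [C1 [K1 [C10 h1]]] := stft_bound Sp bu.
have [C2 [K2 [C20 h2]]] := stft_bound Sq bu.
exists (C1 + C2), (K1 + K2)%N; split=> [|w|w]; first exact: addr_ge0.
  by apply: le_trans (h1 w) _; apply: ler_pM; rewrite ?exprn_ge0// ?lerDl// jp_leX// leq_addr.
by apply: le_trans (h2 w) _; apply: ler_pM; rewrite ?exprn_ge0// ?lerDr// jp_leX// leq_addl.
Qed.

(** Common part of both inclusions; [core] is the freezing estimate of the quantization and [psi]
    the window of the average in it. The argument is by contraposition: cones on which the image of
    u is regular and a is noncharacteristic are fed to [cone_bootstrap]. *)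
Lemma WFQ_subset psi (B : functional R d) (m' s : R) :
  schwartz psi -> (exists x, psi x != 0) ->
  (forall (Z : Type) (pt : Z -> 'rV[R]_(d + d)) (c0 : R), 0 < c0 ->
    (forall k, c0 * jp (pt k) `^ m' <= normc (a (pt k))) ->
    (forall l, exists2 C, 0 <= C & forall k,
      normc (partials l a (pt k)) <= C * normc (a (pt k)) * jp (pt k) `^ (- (size l)%:R)) ->
    forall (Cu : R) K M, 0 <= Cu -> grow Cu K (stft psi u) -> ((d + d).*2 + K <= M)%N ->
    exists2 C, 0 <= C & forall k, normc (stft phi u (pt k)) <=
      C * jp (pt k) `^ (- m') * normc (stft phi B (pt k)) +
      C * (jp (pt k))^-1 * avg (stft psi u) M (pt k)) ->
  WFQ phi s u `<=` WFQ phi (s - m') B `|` hyperchar m' a.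
Proof.
move=> Sq q0 core z0 [z00 nWF]; apply: contrapT => /not_orP[nB nH]; apply: nWF.
have {nB} [G' [oG' Gz0' iY]] : exists G : set 'rV[R]_(d + d), [/\ open_cone G, G z0 &
    (\int[lebesgue_rV R (d + d)]_(z in G)
      (japanese z `^ (2 * (s - m')) * normc (stft phi B z) ^+ 2)%:E < +oo)%E].
  by apply: contrapT => n; apply: nB; split.
have {nH} [G [oG Gz0 [c [A [c0 A0 lo hyp]]]]] : exists G : set 'rV[R]_(d + d),
    [/\ open_cone G, G z0 & exists C A : R, [/\ 0 < C, 0 < A,
      forall z, G z -> A <= enorm z -> C * japanese z `^ m' <= normc (a z) &
      forall al : 'I_(d + d) -> nat, exists Cal : R, 0 < Cal /\
        forall z, G z -> A <= enorm z ->
          normc (mpartial al a z) <= Cal * normc (a z) * japanese z `^ (- (mlen al)%:R)]].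
  by apply: contrapT => n; apply: nH; split.
(* The points at which both hypercharacteristic bounds hold serve as the index set, so that the
   constants supplied by [core] are uniform over the cone outside a ball. *)
pose Z := {z : 'rV[R]_(d + d) | G z /\ A <= enorm z}; pose pt (k : Z) := sval k.
have lo' k : c * jp (pt k) `^ m' <= normc (a (pt k)).
  by case: k => z [Gz zA]; exact: lo.
have hyp' l : exists2 C, 0 <= C & forall k,
    normc (partials l a (pt k)) <= C * normc (a (pt k)) * jp (pt k) `^ (- (size l)%:R).
  have [C [C0 hC]] := hyp (fun i => count_mem i l).
  exists C; first exact: ltW.
  case=> z [Gz zA] /=; have [s' _] := sa.
  by rewrite (partials_mpartial l s') (size_mlen l); exact: hC.
have [C [K [C0 gF gH]]] := stft_grow Sq.
have Sphi : uS (fun _ : unit => 1) (fun=> psi) := (uS_schwartz psi).2 Sq.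
apply: (@cone_bootstrap _ _ _ (stft psi u) (stft phi B) G G' z0 A s m' C K ((d + d).*2 + K)) => //.
- exact: stft_ccont.
- exact: stft_ccont.
- exact: ltW.
move=> M KM.
(* With the fixed window [psi] as the family, this bounds the transform of u in the window [psi] by
   an average of its transform in the window [phi]. *)
have [D1 [D10 h1]] := pairing_avg Sp p0 bu C0 gF KM (fun _ => ler01) Sphi.
have [D2 D20 h2] := core Z pt c c0 lo' hyp' C K M C0 gH KM.
exists (D1 + D2); first exact: addr_ge0.
split=> [w|z Gz zA].
  have := h1 tt w; rewrite mulr1 => /le_trans; apply.
  by rewrite ler_wpM2r ?avg_ge0// lerDl.
have := h2 (exist _ z (conj Gz zA)); rewrite /pt /= => /le_trans; apply.
apply: lerD.
  by rewrite ler_wpM2r// ler_wpM2r ?powR_ge0// lerDr.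
by rewrite ler_wpM2r ?avg_ge0// ler_wpM2r ?invr_ge0// lerDr.
Qed.

Lemma WFQ_weyl_subset (m' s : R) :
  WFQ phi s u `<=` WFQ phi (s - m') (weyl_dist a u) `|` hyperchar m' a.
Proof.
apply: (WFQ_subset (psi := phi)) => // Z pt c0 c00 lo hyp Cu K M.
exact: (core_weyl Sp p0 bu sa.1 ba c00 lo hyp).
Qed.

Lemma WFQ_locop_subset (m' s : R) :
  WFQ phi s u `<=` WFQ phi (s - m') (locop a u) `|` hyperchar m' a.
Proof.
apply: (WFQ_subset (psi := @psi0 R d)).
- exact: psi0_schwartz.
- exact: psi0_neq0.
- move=> Z pt c0 c00 lo hyp Cu K M.
  exact: (core_locop Sp bu sa.1 ba c00 lo hyp).
Qed.

End inclusions.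

Theorem theorem4p2 (R : realType) (d : nat)
    (phi : 'rV[R]_d -> R[i]) (phi_schwartz : schwartz phi)
    (phi_neq0 : exists x, phi x != 0)
    (u : functional R d) (u_tempered : tempered u)
    (m s : R) (a : 'rV[R]_(d + d) -> R[i]) (a_shubin : shubin m a) :
  WFQ phi s u `<=`
    \bigcap_(m' in [set m' : R | m' <= m])
      (WFQ phi (s - m') (weyl_dist a u) `|` hyperchar m' a) /\
  WFQ phi s u `<=`
    \bigcap_(m' in [set m' : R | m' <= m])
      (WFQ phi (s - m') (locop a u) `|` hyperchar m' a).
Proof.
split=> z zu m' _.
  exact: (WFQ_weyl_subset phi_schwartz phi_neq0 u_tempered a_shubin m' zu).
exact: (WFQ_locop_subset phi_schwartz phi_neq0 u_tempered a_shubin m' zu).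
Qed.
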